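(* Let $l\ge 2$, let $\pi$ be the simple supercuspidal representation of the split group $\mathrm{SO}_{2l}(F)$ attached to the data $(\varpi,\gamma,\epsilon,\omega)$, where $\varpi$ is a uniformizer of $F$, $\gamma=-4\alpha$ with $\alpha\in\mathfrak o^\times$, $\epsilon=\chi(g_\chi)\in\{\pm1\}$, and $\omega$ is the central character of $\pi$. Let $\tau$ be a quadratic tamely ramified character of $F^*$. Then $\gamma(s,\pi\times\tau,\psi)$ is holomorphic and nonzero at $s=1$ if and only if $$\tau(\varpi)=-\chi(g_\chi)\,\tau(\gamma).$$
   Context: $F$ is a $p$-adic field of characteristic $0$ with ring of integers $\mathfrak o$, maximal ideal $\mathfrak p$, residue field $\kappa$, $q=|\kappa|$, $|\varpi|=q^{-1}$. $\psi$ is an additive character of $F$ of level $1$ (trivial on $\mathfrak p$, nontrivial on $\mathfrak o$). A character $\tau$ of $F^*$ is quadratic if $\tau^2=1$ (the trivial character is allowed), and tamely ramified if trivial on $1+\mathfrak p$ (unramified characters are included). $J_r$ is the $r\times r$ permutation matrix with ones on the anti-diagonal. $\mathrm{SO}_{2l}=\{g\in\mathrm{SL}_{2l}(F):{}^tgJ_{2l}g=J_{2l}\}$, with center $Z$ and upper triangular unipotent subgroup $U$. Simple supercuspidal representations. Let $I$ be the standard Iwahori subgroup of $\mathrm{SO}_{2l}$ (upper triangular mod $\mathfrak p$; generated by the maximal compact subgroup of the diagonal torus and the positive affine root groups) and $I^+$ its pro-unipotent radical. For a uniformizer $\varpi$ and $\alpha\in\mathfrak o^\times$ (representing a class in $\kappa^\times/(\kappa^\times)^2$),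 let $\chi$ be the character of $I^+$ $$\chi(h)=\psi\Big(\sum_{i=1}^{l-1}h_{i,i+1}+\alpha h_{l-1,l+1}+\varpi^{-1}h_{2l-1,1}\Big).$$ Let $g_\chi\in\mathrm{SO}_{2l}$ be the matrix whose only nonzero entries are: $-\varpi^{-1}$ at $(1,2l)$, $-\varpi$ at $(2l,1)$, $1$ at $(i,i)$ for $2\le i\le l-1$ and $l+2\le i\le 2l-1$, $\alpha^{-1}$ at $(l,l+1)$, $\alpha$ at $(l+1,l)$. Then $g_\chi^2=1$ and $g_\chi$ stabilizes $\chi$. Extend $\chi$ to $Z\langle g_\chi\rangle I^+$ by a character $\omega$ of $Z$ (compatible with $\chi$ on $Z\cap I^+$) and by $\chi(g_\chi)=\epsilon\in\{\pm1\}$. The representation $\pi$ compactly induced from this character of $Z\langle g_\chi\rangle I^+$ to $\mathrm{SO}_{2l}$ is irreducible supercuspidal; it is called simple supercuspidal. Put $\gamma=-4\alpha\in F^*$, so $|\gamma|=|4|$. The $\gamma$-factor. Let $\mathrm{SO}_3=\{g\in\mathrm{SL}_3(F):{}^tgJ_{3,\gamma}g=J_{3,\gamma}\}$, $J_{3,\gamma}=\left(\begin{smallmatrix}&&1\\ &\gamma/2&\\ 1&&\end{smallmatrix}\right)$, $U_{\mathrm{SO}_3}$ its upper triangular unipotent subgroup. $V(\tau,s)$ is the space of smooth functions $f_s$ on $\mathrm{SO}_3\times F^*$ with $f_s(\mathrm{diag}(m,1,m^{-1})ug,a)=|m|^s\tau(am)f_s(g,1)$ for $m,a\in F^*$, $u\in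 U_{\mathrm{SO}_3}$; a section is holomorphic if its restriction to $\mathrm{SO}_3(\mathfrak o)$ is polynomial in $q^{\pm s}$. $\mathrm{SO}_3$ is embedded in $\mathrm{SO}_{2l}$ by $x=(x_{ij})\mapsto\mathrm{diag}(I_{l-2},A\,x^{\sharp}A^{-1},I_{l-2})$, where $$A=\left(\begin{smallmatrix}1&&&\\ &\frac14&\frac14&\\ &-\gamma&\gamma&\\ &&&1\end{smallmatrix}\right),\qquad x^\sharp=\left(\begin{smallmatrix}x_{11}&&x_{12}&x_{13}\\ &1&&\\ x_{21}&&x_{22}&x_{23}\\ x_{31}&&x_{32}&x_{33}\end{smallmatrix}\right).$$ The character of $U$ is $\psi(u)=\psi(\sum_{i=1}^{l-2}u_{i,i+1}+\frac14u_{l-1,l}-\gamma u_{l-1,l+1})$; $\pi$ is generic with respect to its inverse, with Whittaker model $\mathcal W(\pi,\psi^{-1})$. $R^{l,1}$ is the group of elements of $\mathrm{SO}_{2l}$ of the form $\mathrm{diag}\big(\left(\begin{smallmatrix}1&\\ r&I_{l-2}\end{smallmatrix}\right),I_2,\left(\begin{smallmatrix}I_{l-2}&\\ r'&1\end{smallmatrix}\right)\big)$ with $r\in F^{l-2}$ a column ($r'$ determined by $r$), and $w^{l,1}=\mathrm{diag}\big(\left(\begin{smallmatrix}&1\\ I_{l-2}&\end{smallmatrix}\right),I_2,\left(\begin{smallmatrix}&I_{l-2}\\ 1&\end{smallmatrix}\right)\big)$. For $W\in\mathcal W(\pi,\psi^{-1})$ and a holomorphic section $f_s$, $$\Psi(W,f_s)=\int_{U_{\mathrm{SO}_3}\backslash\mathrm{SO}_3}\int_{R^{l,1}}W(rw^{l,1}h)f_s(h,1)\,dr\,dh$$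 ($\mathrm{Re}(s)\gg0$, then by meromorphic continuation to a rational function of $q^{-s}$). The intertwining operator $M(\tau,s):V(\tau,s)\to V(\tau^{-1},1-s)$ is the meromorphic continuation of $M(\tau,s)f_s(h,a)=\int_{U_{\mathrm{SO}_3}}f_s(w_1uh,-a^{-1})\,du$, $w_1=\left(\begin{smallmatrix}&&1\\ &-1&\\ 1&&\end{smallmatrix}\right)$, where $U_{\mathrm{SO}_3}\cong F$ via $u\mapsto u_{1,2}$. $M^*(\tau,s)=C(s,\tau,\psi)M(\tau,s)$, where $C(s,\tau,\psi)$ is defined by $\int f_s(w_1u,1)\psi^{-1}(u_{1,2})du=C(s,\tau,\psi)\int M(\tau,s)f_s(w_1u,1)\psi^{-1}(u_{1,2})du$ (integrals over $U_{\mathrm{SO}_3}$), and $\Psi^*(W,f_s)=\Psi(W,M^*(\tau,s)f_s)$. The factor $\gamma(s,\pi\times\tau,\psi)$ is the rational function of $q^{-s}$ such that for all $W$ and $f_s$ $$\gamma(s,\pi\times\tau,\psi)\Psi(W,f_s)=\pi(-I_{2l})\tau(-1)^l\,\tau^2(2)|2|^{2s-1}\tau^{-2}(\gamma)|\gamma|^{-2s+1}\,\Psi^*(W,f_s),$$ where $\pi(-I_{2l})=\omega(-I_{2l})$. *)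

(* Defs.v *)
From HB Require Import structures.
From mathcomp Require Import all_boot all_order all_algebra.
From mathcomp Require Import complex.
From mathcomp Require Import all_classical all_reals all_analysis.
Set Implicit Arguments.
Unset Strict Implicit.
Unset Printing Implicit Defensive.
Import Order.TTheory GRing.Theory Num.Theory.
Local Open Scope classical_set_scope.
Local Open Scope ring_scope.
Local Open Scope complex_scope.

(* A p-adic field of characteristic 0: a complete discretely valued field of
   characteristic 0 whose residue field has [padic_card] elements, with the absolute
   value normalized so that a uniformizer has absolute value [padic_card^-1].  The
   residue field o/p is described by a system of representatives. *)
Record padicField (R : realType) := PadicField {
  padic_field : fieldType ;
  padic_abs : padic_field -> R ;
  padic_card : nat ;
  padic_abs_ge0 : forall x, 0 <= padic_abs x ;
  padic_abs_eq0 : forall x, padic_abs x = 0 <-> x = 0 ;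
  padic_absM : forall x y, padic_abs (x * y) = padic_abs x * padic_abs y ;
  padic_abs_ultra : forall x y,
    padic_abs (x + y) <= Num.max (padic_abs x) (padic_abs y) ;
  padic_complete : forall u : nat -> padic_field,
    (forall e : R, 0 < e -> exists n0 : nat, forall m n,
       (n0 <= m)%N -> (n0 <= n)%N -> padic_abs (u m - u n) < e) ->
    exists x, forall e : R, 0 < e -> exists n0 : nat, forall n,
       (n0 <= n)%N -> padic_abs (u n - x) < e ;
  padic_uniformizer : exists x, padic_abs x = padic_card%:R^-1 ;
  padic_value_group : forall x, x != 0 ->
    exists n : int, padic_abs x = padic_card%:R ^ n ;
  padic_residue_field : exists rep : 'I_padic_card -> padic_field,
    [/\ forall i, padic_abs (rep i) <= 1,
        forall i j, padic_abs (rep i - rep j) < 1 -> i = j &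
        forall x, padic_abs x <= 1 -> exists i, padic_abs (x - rep i) < 1] ;
  padic_char0 : [pchar padic_field] =i pred0
}.

Definition padic_sort (R : realType) (F : padicField R) : Type :=
  padic_field F.
Coercion padic_sort : padicField >-> Sortclass.

Section PadicTopology.
Context (R : realType) (F : padicField R).

HB.instance Definition _ := GRing.Field.on F.
HB.instance Definition _ := isPointed.Build F 0.

Definition absp (x : F) : R := @padic_abs R F x.
Definition resq : nat := @padic_card R F.
Definition padic_ball (x : F) (e : R) : set F := [set y | absp (x - y) < e].

Lemma absp_ge0 x : 0 <= absp x.
Proof. exact: padic_abs_ge0. Qed.

Lemma abspM x y : absp (x * y) = absp x * absp y.
Proof. exact: padic_absM. Qed.

Lemma absp_ultra x y : absp (x + y) <= Num.max (absp x) (absp y).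
Proof. exact: padic_abs_ultra. Qed.

Lemma absp0 : absp 0 = 0.
Proof. exact/padic_abs_eq0. Qed.

Lemma absp1 : absp 1 = 1.
Proof.
have n0 : absp 1 != 0.
  by apply/eqP => /padic_abs_eq0 /eqP; rewrite oner_eq0.
by apply: (mulfI n0); rewrite -abspM !mulr1.
Qed.

Lemma abspN x : absp (- x) = absp x.
Proof.
have h : absp (-1) = 1.
  apply/eqP; rewrite -sqrp_eq1 ?absp_ge0 //.
  by rewrite expr2 -abspM mulrNN mulr1 absp1.
by rewrite -mulN1r abspM h mul1r.
Qed.

Let ball_center x (e : R) : 0 < e -> padic_ball x e x.
Proof. by move=> e0; rewrite /padic_ball /= subrr absp0. Qed.

Let ball_sym x y (e : R) : padic_ball x e y -> padic_ball y e x.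
Proof. by rewrite /padic_ball /= -abspN opprB. Qed.

Let ball_triangle x y z (e1 e2 : R) :
  padic_ball x e1 y -> padic_ball y e2 z -> padic_ball x (e1 + e2) z.
Proof.
rewrite /padic_ball /= => xy yz; rewrite -(subrK y x) -addrA.
apply: le_lt_trans (absp_ultra _ _) _.
apply: (@le_lt_trans _ _ (absp (x - y) + absp (y - z))); last exact: ltrD.
by rewrite ge_max lerDl lerDr !absp_ge0.
Qed.

HB.instance Definition _ := hasNbhs.Build F (nbhs_ (entourage_ padic_ball)).
HB.instance Definition _ := Nbhs_isPseudoMetric.Build R F
  erefl ball_center ball_sym ball_triangle erefl.

End PadicTopology.

Section Analysis.
Context (R : realType).
Local Notation C := R[i].

Definition cpow (x : R) (s : C) : C :=
  (expR (complex.Re s * ln x))%:C *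
  (cos (complex.Im s * ln x) +i* sin (complex.Im s * ln x)).

Section ComplexIntegral.
Context (d : measure_display) (T : measurableType d).
Variable mu : {measure set T -> \bar R}.

Definition cintegrable (D : set T) (f : T -> C) : Prop :=
  mu.-integrable D (fun x => (complex.Re (f x))%:E) /\
  mu.-integrable D (fun x => (complex.Im (f x))%:E).

Definition cintegral (D : set T) (f : T -> C) : C :=
  (\int[mu]_(x in D) complex.Re (f x)) +i*
  (\int[mu]_(x in D) complex.Im (f x)).

End ComplexIntegral.

(* Rational functions of one variable, which is to be specialized to q^-s.
   [ratval r z v]: r has no pole at z and takes the value v there. *)
Definition ratfun := {fraction {poly C}}.

Definition ratval (r : ratfun) (z v : C) : Prop :=
  exists P Q : {poly C},
    [/\ Q.[z] != 0, r = tofrac P / tofrac Q & v = P.[z] / Q.[z]].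

Definition regular_at (r : ratfun) (z : C) : Prop := exists v, ratval r z v.

Definition rateval (r : ratfun) (z : C) : C := xget 0 [set v | ratval r z v].

End Analysis.

Section PadicGroups.
Context (R : realType) (F : padicField R).
Local Notation C := R[i].

(* q^-s *)
Definition qs (s : C) : C := cpow (resq F)%:R (- s).

(* The function I, given by an integral converging (in the sense of conv) on
   some right, resp. left, half plane, continues to the rational function r of
   q^-s.  Integrals of sections of V(tau^-1, 1 - s) converge for Re(1 - s)
   large, i.e. on a left half plane in s. *)
Definition continues_right (conv : C -> Prop) (I : C -> C) (r : ratfun R) :=
  exists s0 : R, forall s : C, s0 < complex.Re s ->
    conv s /\ ratval r (qs s) (I s).

Definition continues_left (conv : C -> Prop) (I : C -> C) (r : ratfun R) :=
  exists s0 : R, forall s : C, complex.Re s < s0 ->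
    conv s /\ ratval r (qs s) (I s).

Definition uniformizer (x : F) : Prop := absp x = (resq F)%:R^-1.

Definition additive_character_level1 (psi : F -> C) : Prop :=
  [/\ forall x y, psi (x + y) = psi x * psi y,
      forall x, absp x < 1 -> psi x = 1 &
      exists x, absp x <= 1 /\ psi x <> 1].

(* Characters of F^* are functions on F; their value at 0 is irrelevant. *)
Definition mul_character (tau : F -> C) : Prop :=
  (forall x, x != 0 -> tau x != 0) /\
  (forall x y, x != 0 -> y != 0 -> tau (x * y) = tau x * tau y).

Definition quadratic (tau : F -> C) : Prop :=
  forall x, x != 0 -> tau x ^+ 2 = 1.

Definition tamely_ramified (tau : F -> C) : Prop :=
  forall x, absp (x - 1) < 1 -> tau x = 1.

(* Matrices indexed from 1, as in the usual notation. *)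
Definition ent n (M : 'M[F]_n) (i j : nat) : F :=
  if (insub i.-1, insub j.-1) is (Some a, Some b) then M a b else 0.

Definition mx1 n (f : nat -> nat -> F) : 'M[F]_n :=
  \matrix_(i < n, j < n) f i.+1 j.+1.

Definition mx_rows n (rows : seq (seq F)) : 'M[F]_n :=
  \matrix_(i < n, j < n) nth 0 (nth [::] rows i) j.

Definition integral_mx n (M : 'M[F]_n) : Prop := forall i j, absp (M i j) <= 1.

Definition SO n (J : 'M[F]_n) : set 'M[F]_n :=
  [set g | \det g = 1 /\ g^T *m J *m g = J].

Definition unipotent n (J : 'M[F]_n) : set 'M[F]_n :=
  [set u | SO J u /\ forall i j : 'I_n, (j <= i)%N -> u i j = (i == j)%:R].

Definition smooth_on n (G : set 'M[F]_n) (f : 'M[F]_n -> C) : Prop :=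
  \forall k \near (1%:M : 'M[F]_n),
    G k -> forall g, G g -> f (g *m k) = f g.

Definition borel n := g_sigma_algebraType (@open 'M[F]_n).

(* Left Haar measures of a subgroup H of GL_n(F) that is closed in the space of
   matrices, given as Borel measures on that space of which only the values on
   subsets of H matter. *)
Definition is_haar n (H : set 'M[F]_n)
    (mu : {measure set (borel n) -> \bar R}) : Prop :=
  [/\ forall (h : 'M[F]_n) (A : set (borel n)), H h -> measurable A ->
        A `<=` H -> mu [set h *m a | a in A] = mu A,
      forall K : set 'M[F]_n, compact K -> K `<=` H -> (mu K < +oo)%E &
      mu H <> 0%E].

(* The Borel sets of the quotient U\G, seen as U-invariant subsets of G. *)
Definition open_mod n (U G : set 'M[F]_n) : set (set 'M[F]_n) :=
  [set A | (exists2 O : set 'M[F]_n, open O & A = O `&` G) /\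
           forall u a, U u -> A a -> A (u *m a)].

Definition quotient_borel n (U G : set 'M[F]_n) :=
  g_sigma_algebraType (open_mod U G).

(* G-invariant Radon measures on U\G; a compact subset of U\G lies in the image
   of a set {g in G : |g_ij| <= B}. *)
Definition is_quotient_measure n (U G : set 'M[F]_n)
    (mu : {measure set (quotient_borel U G) -> \bar R}) : Prop :=
  [/\ forall (g : 'M[F]_n) (A : set (quotient_borel U G)), G g ->
        measurable A -> A `<=` G -> mu [set a *m g | a in A] = mu A,
      forall B : R, (mu [set u *m g | u in U & g in
        [set g | G g /\ forall i j, (absp (g i j) <= B)%R]] < +oo)%E &
      mu G <> 0%E].

Section EvenOrthogonal.
Variable l : nat.
Local Notation N := (2 * l)%N.

Definition J_anti : 'M[F]_N := \matrix_(i, j) ((i + j).+1 == N)%:R.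

Definition SO2l : set 'M[F]_N := SO J_anti.

Definition U2l : set 'M[F]_N := unipotent J_anti.

Definition center2l : set 'M[F]_N :=
  [set z | SO2l z /\ forall g, SO2l g -> z *m g = g *m z].

Definition iwahori : set 'M[F]_N :=
  [set h | [/\ SO2l h, integral_mx h &
               forall i j : 'I_N, (j < i)%N -> absp (h i j) < 1]].

(* The pro-unipotent radical of the Iwahori subgroup. *)
Definition iwahori_plus : set 'M[F]_N :=
  [set h | iwahori h /\ forall i : 'I_N, absp (h i i - 1) < 1].

Definition affine_character (psi : F -> C) (varpi alpha : F)
    (h : 'M[F]_N) : C :=
  psi (\sum_(1 <= i < l) ent h i i.+1 + alpha * ent h l.-1 l.+1
       + varpi^-1 * ent h N.-1 1).

Definition g_chi (varpi alpha : F) : 'M[F]_N :=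
  mx1 N (fun i j =>
    if ((i == 1) && (j == N))%N then - varpi^-1
    else if ((i == N) && (j == 1))%N then - varpi
    else if ((i == l) && (j == l.+1))%N then alpha^-1
    else if ((i == l.+1) && (j == l))%N then alpha
    else ((i == j) && ((2 <= i <= l.-1) || (l.+2 <= i <= N.-1)))%N%:R).

(* Z <g_chi> I^+ *)
Definition inducing_group (varpi alpha : F) : set 'M[F]_N :=
  [set x | exists z (k : nat) h, [/\ center2l z, iwahori_plus h &
     x = z *m (g_chi varpi alpha ^+ k) *m h]].

Definition compatible_central_character (psi : F -> C) (varpi alpha : F)
    (omega : 'M[F]_N -> C) : Prop :=
  [/\ forall z, center2l z -> omega z != 0,
      forall z z', center2l z -> center2l z' ->
        omega (z *m z') = omega z * omega z' &
      forall z, center2l z -> iwahori_plus z ->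
        omega z = affine_character psi varpi alpha z].

(* chi is the character of Z <g_chi> I^+ determined by the affine generic
   character of I^+, by omega on Z and by the sign eps at g_chi. *)
Definition extended_character (psi : F -> C) (varpi alpha : F) (eps : C)
    (omega chi : 'M[F]_N -> C) : Prop :=
  [/\ forall x y, inducing_group varpi alpha x -> inducing_group varpi alpha y ->
        chi (x *m y) = chi x * chi y,
      forall h, iwahori_plus h -> chi h = affine_character psi varpi alpha h,
      forall z, center2l z -> chi z = omega z &
      chi (g_chi varpi alpha) = eps].

(* The space of the compact induction of chi from H to SO_2l, on which SO_2l
   acts by right translation; functions on SO_2l are extended by 0. *)
Definition compact_induction (H : set 'M[F]_N) (chi : 'M[F]_N -> C) :
    set ('M[F]_N -> C) :=
  [set phi | [/\ forall g, ~ SO2l g -> phi g = 0,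
     forall h g, H h -> SO2l g -> phi (h *m g) = chi h * phi g,
     smooth_on SO2l phi &
     exists K : set 'M[F]_N, [/\ compact K, K `<=` SO2l &
       forall g, phi g != 0 -> exists h k, [/\ H h, K k & g = h *m k]]]].

Definition right_translate (g : 'M[F]_N) (phi : 'M[F]_N -> C) : 'M[F]_N -> C :=
  fun x => phi (x *m g).

Definition psi_U (psi : F -> C) (gam : F) (u : 'M[F]_N) : C :=
  psi (\sum_(1 <= i < l.-1) ent u i i.+1 + 4%:R^-1 * ent u l.-1 l
       - gam * ent u l.-1 l.+1).

Definition whittaker_functional (psi : F -> C) (gam : F)
    (V : set ('M[F]_N -> C)) (Lam : ('M[F]_N -> C) -> C) : Prop :=
  (forall (c : C) phi phi', V phi -> V phi' ->
     Lam (fun x => c * phi x + phi' x) = c * Lam phi + Lam phi') /\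
  (forall u phi, U2l u -> V phi ->
     Lam (right_translate u phi) = (psi_U psi gam u)^-1 * Lam phi).

(* W(pi, psi^-1), for pi acting on V by right translation. *)
Definition whittaker_model (psi : F -> C) (gam : F)
    (V : set ('M[F]_N -> C)) : set ('M[F]_N -> C) :=
  [set W | exists Lam phi, [/\ whittaker_functional psi gam V Lam, V phi &
     forall g, SO2l g -> W g = Lam (right_translate g phi)]].

Definition Rl1 : set 'M[F]_N :=
  [set r | SO2l r /\ forall i j : nat, (1 <= i <= N)%N -> (1 <= j <= N)%N ->
     ~~ ((j == 1) && (2 <= i <= l.-1) || (i == N) && (l.+2 <= j <= N.-1))%N ->
     ent r i j = (i == j)%:R].

Definition wl1 : 'M[F]_N :=
  mx1 N (fun i j =>
    [|| (i == 1) && (j == l.-1),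
        (2 <= i <= l.-1) && (j.+1 == i),
        (l <= i <= l.+1) && (i == j),
        (l.+2 <= i <= N.-1) && (j == i.+1) |
        (i == N) && (j == l.+2)]%N%:R).

End EvenOrthogonal.

Section Rankin.
Variables (l : nat) (psi : F -> C) (gam : F).
Local Notation N := (2 * l)%N.

Definition J3 : 'M[F]_3 :=
  mx_rows 3 [:: [:: 0; 0; 1]; [:: 0; gam / 2%:R; 0]; [:: 1; 0; 0]].

Definition SO3 : set 'M[F]_3 := SO J3.

Definition U3 : set 'M[F]_3 := unipotent J3.

Definition SO3_o : set 'M[F]_3 := [set k | SO3 k /\ integral_mx k].

Definition torus3 (m : F) : 'M[F]_3 :=
  mx_rows 3 [:: [:: m; 0; 0]; [:: 0; 1; 0]; [:: 0; 0; m^-1]].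

Definition w1 : 'M[F]_3 :=
  mx_rows 3 [:: [:: 0; 0; 1]; [:: 0; -1; 0]; [:: 1; 0; 0]].

Definition embA : 'M[F]_4 :=
  mx_rows 4 [:: [:: 1; 0; 0; 0]; [:: 0; 4%:R^-1; 4%:R^-1; 0];
                [:: 0; - gam; gam; 0]; [:: 0; 0; 0; 1]].

Definition sharp (x : 'M[F]_3) : 'M[F]_4 :=
  mx_rows 4 [:: [:: ent x 1 1; 0; ent x 1 2; ent x 1 3];
                [:: 0; 1; 0; 0];
                [:: ent x 2 1; 0; ent x 2 2; ent x 2 3];
                [:: ent x 3 1; 0; ent x 3 2; ent x 3 3]].

(* diag(I_(l-2), A x^# A^-1, I_(l-2)) *)
Definition emb (x : 'M[F]_3) : 'M[F]_N :=
  mx1 N (fun i j =>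
    if (l.-1 <= i <= l.+2)%N && (l.-1 <= j <= l.+2)%N
    then ent (embA *m sharp x *m invmx embA) (i - l.-2) (j - l.-2)
    else (i == j)%:R).

(* V(tau, s) *)
Definition in_V (tau : F -> C) (s : C) (f : 'M[F]_3 -> F -> C) : Prop :=
  (forall m a u g, m != 0 -> a != 0 -> U3 u -> SO3 g ->
     f (torus3 m *m u *m g) a = cpow (absp m) s * tau (a * m) * f g 1) /\
  (forall a, a != 0 -> smooth_on SO3 (f^~ a)).

(* Holomorphic sections: the restriction to SO_3(o) (at a = 1) is an element
   of C[q^s, q^-s] tensored with the locally constant functions. *)
Definition holomorphic_section (tau : F -> C) (f : C -> 'M[F]_3 -> F -> C) :=
  (forall s, in_V tau s (f s)) /\
  exists (n d : nat) (P : 'I_n -> {poly C}) (phi : 'I_n -> 'M[F]_3 -> C),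
    (forall i, smooth_on SO3_o (phi i)) /\
    (forall s k, SO3_o k ->
       f s k 1 = \sum_(i < n) (P i).[qs s] * qs s ^- d * phi i k).

Variable muU : {measure set (borel 3) -> \bar R}.

(* Mf h a is the rational function of q^-s continuing (M(tau, s) f_s)(h, a). *)
Definition intertwined (f : C -> 'M[F]_3 -> F -> C)
    (Mf : 'M[F]_3 -> F -> ratfun R) : Prop :=
  forall h a, SO3 h -> a != 0 ->
    continues_right
      (fun s => cintegrable muU U3 (fun u => f s (w1 *m u *m h) (- a^-1)))
      (fun s => cintegral muU U3 (fun u => f s (w1 *m u *m h) (- a^-1)))
      (Mf h a).

Definition jacquet_integrand (phi : 'M[F]_3 -> F -> C) (u : 'M[F]_3) : C :=
  phi (w1 *m u) 1 * (psi (ent u 1 2))^-1.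

Definition section_eval (Phi : 'M[F]_3 -> F -> ratfun R) (s : C) :
    'M[F]_3 -> F -> C := fun h a => rateval (Phi h a) (qs s).

(* cst = C(s, tau, psi) *)
Definition is_C_factor (tau : F -> C) (cst : ratfun R) : Prop :=
  forall f Mf (A B : ratfun R),
    holomorphic_section tau f -> intertwined f Mf ->
    continues_right
      (fun s => cintegrable muU U3 (jacquet_integrand (f s)))
      (fun s => cintegral muU U3 (jacquet_integrand (f s))) A ->
    continues_left
      (fun s => cintegrable muU U3 (jacquet_integrand (section_eval Mf s)))
      (fun s => cintegral muU U3 (jacquet_integrand (section_eval Mf s))) B ->
    A = cst * B.

Variables (muR : {measure set (borel N) -> \bar R})
          (muQ : {measure set (quotient_borel U3 SO3) -> \bar R}).

Definition zeta_integrand (W : 'M[F]_N -> C) (phi : 'M[F]_3 -> F -> C)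
    (h : 'M[F]_3) (r : 'M[F]_N) : C :=
  W (r *m wl1 l *m emb h) * phi h 1.

Definition zeta_inner (W : 'M[F]_N -> C) (phi : 'M[F]_3 -> F -> C)
    (h : 'M[F]_3) : C :=
  cintegral muR (@Rl1 l) (zeta_integrand W phi h).

Definition zeta_integral (W : 'M[F]_N -> C) (phi : 'M[F]_3 -> F -> C) : C :=
  cintegral muQ SO3 (zeta_inner W phi).

Definition zeta_converges (W : 'M[F]_N -> C) (phi : 'M[F]_3 -> F -> C) : Prop :=
  (forall h, SO3 h -> cintegrable muR (@Rl1 l) (zeta_integrand W phi h)) /\
  cintegrable muQ SO3 (zeta_inner W phi).

(* The defining property of gamma(s, pi x tau, psi), as a rational function of
   q^-s, for pi acting by right translation on V with pi(-I_2l) = pi_m1.  Here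
   P = Psi(W, f_s) and Ps = Psi(W, M^*(tau, s) f_s). *)
Definition is_gamma_factor (tau : F -> C) (V : set ('M[F]_N -> C)) (pi_m1 : C)
    (cst : ratfun R) (g : ratfun R) : Prop :=
  forall W f Mf (P Ps : ratfun R),
    whittaker_model psi gam V W ->
    holomorphic_section tau f -> intertwined f Mf ->
    continues_right (fun s => zeta_converges W (f s))
                    (fun s => zeta_integral W (f s)) P ->
    let Msf := section_eval (fun h a => cst * Mf h a) in
    continues_left (fun s => zeta_converges W (Msf s))
                   (fun s => zeta_integral W (Msf s)) Ps ->
    forall s gv pv psv : C,
      ratval g (qs s) gv -> ratval P (qs s) pv -> ratval Ps (qs s) psv ->
      gv * pv =
      pi_m1 * tau (-1) ^+ l * tau 2%:R ^+ 2 * cpow (absp (2%:R : F)) (2%:R * s - 1)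
      * tau gam ^- 2 * cpow (absp gam) (- 2%:R * s + 1) * psv.

End Rankin.

End PadicGroups.

(* Main.v *)
(* Both sides of the functional equation are computed for one choice of data.
   For l = 2 the hypotheses are contradictory: conjugation by g_chi moves a root
   element on which chi is nontrivial to one on which it is trivial.  For l >= 3,
   let W be the Whittaker function of a translate of the vector supported on the
   inducing group, and f_s a section supported on a big cell.  Then W vanishes on
   the domain of integration outside the product of a neighbourhood of 1 in
   R^{l,1} and two cells of SO_3, exchanged by an antidiagonal element, on which
   it equals 1 and epsilon.  The section f_s is 1 on the first cell and 0 on the
   second, so Psi(W, f_s) is a volume, while the dual integral is read off from
   the values of M(tau, s) f_s on both cells.  The factor C(s, tau, psi) is found
   by applying its defining property to the translate of f_s by w_1.  Altogether
   gamma(s, pi x tau, psi) is, up to a nonzero constant, X (1 - a X) / (a q X - 1)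
   with X = q^-s and a = epsilon tau(varpi) tau(gamma) = +-1, so that it has a pole
   at X = 1/q if a = 1, and is regular and nonzero there if a = -1. *)
Require Import Defs.
From HB Require Import structures.
From mathcomp Require Import all_boot all_order all_algebra.
From mathcomp Require Import complex.
From mathcomp Require Import all_classical all_reals all_analysis.
From mathcomp Require Import measurable_realfun.
From mathcomp Require Import ring lra zify.
Set Implicit Arguments.
Unset Strict Implicit.
Unset Printing Implicit Defensive.
Import Order.TTheory GRing.Theory Num.Theory.
Import numFieldNormedType.Exports.
Local Open Scope classical_set_scope.
Local Open Scope ring_scope.

(** * Rational functions *)

(** The hypotheses say only that [g] satisfies the functional equation, so one choice of data with a
    nonzero zeta integral determines it. It is compared with the explicit function at the integers s
    >= 2, away from the zeros of the denominators that occur; s = 1 is such a zero, so a direct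
    evaluation there is impossible. On SO_3 everything is read off the last row (a, b, c) of h: it
    is unchanged by U_3 on the left and isotropic, b^2 = -gam a c. As |gam| = |2|^2, this bounds b/2
    by the geometric mean of a and c, and residue characteristic 2 needs no separate treatment. The
    translate by w_1 is the right section for C(s, tau, psi) because at w_1 u it is supported where
    psi is trivial, so its Jacquet integral is a volume; for f_s itself the support would be
    unbounded. The powers of |2| and |gam| in the functional equation cancel the radius |2| of the
    balls that occur as supports. The fraction that is left has the factor a q X + 1 in both
    numerator and denominator, which is why only one of the points X = 1/q and X = -1/q is a
    pole. *)

Lemma fraction_numden (D : idomainType) (r : {fraction D}) :
  exists P Q : D, Q != 0 /\ r = tofrac P / tofrac Q.
Proof.
elim/generic_quotient.quotW: r => x; exists (frac x).1, (frac x).2.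
have d0 := denom_ratioP x; split => //.
unlock FracField.tofrac.
rewrite -[X in _ * X]FracField.pi_inv -[RHS]FracField.pi_mul.
rewrite /FracField.mulf /FracField.invf !numden_Ratio ?oner_neq0 //.
by rewrite mulr1 mul1r Ratio_numden.
Qed.

Section RatVal.
Context (R : realType).
Local Notation C := R[i].
Implicit Types (r : ratfun R) (z v : C) (P Q : {poly C}).

Lemma tofrac_neq0_horner Q z : Q.[z] != 0 -> (tofrac Q : ratfun R) != 0.
Proof.
by apply: contra; rewrite tofrac_eq0 => /eqP ->; rewrite horner0.
Qed.

Lemma ratval_frac P Q z : Q.[z] != 0 ->
  ratval (tofrac P / tofrac Q) z (P.[z] / Q.[z]).
Proof. by move=> h; exists P, Q. Qed.

Lemma ratval_unique r z v v' : ratval r z v -> ratval r z v' -> v = v'.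
Proof.
move=> [P [Q [Qz rE ->]]] [P' [Q' [Qz' rE' ->]]].
have Q0 := tofrac_neq0_horner Qz; have Q0' := tofrac_neq0_horner Qz'.
have /eqP : (tofrac P : ratfun R) / tofrac Q = tofrac P' / tofrac Q' by rewrite -rE -rE'.
rewrite (eqr_div _ _ Q0 Q0') -2!tofracM tofrac_eq => /eqP e.
by apply/eqP; rewrite eqr_div // -!hornerM e.
Qed.

Lemma rateval_ratval r z v : ratval r z v -> rateval r z = v.
Proof. move=> h; apply: xget_unique => // y hy; exact: ratval_unique hy h. Qed.

Lemma ratval_poly P z : ratval (tofrac P) z P.[z].
Proof.
exists P, 1%:P; split; first by rewrite hornerC oner_neq0.
  by rewrite polyC1 tofrac1 divr1.
by rewrite hornerC divr1.
Qed.

Lemma ratvalC (c : C) z : ratval (tofrac c%:P) z c.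
Proof. by have := ratval_poly c%:P z; rewrite hornerC. Qed.

Lemma ratvalX z : ratval (tofrac 'X) z z.
Proof. by have := ratval_poly 'X z; rewrite hornerX. Qed.

Lemma ratvalM r r' z v v' :
  ratval r z v -> ratval r' z v' -> ratval (r * r') z (v * v').
Proof.
move=> [P [Q [Qz -> ->]]] [P' [Q' [Qz' -> ->]]].
exists (P * P'), (Q * Q'); rewrite 2!hornerM 2!tofracM !mulf_div.
by split; rewrite ?mulf_neq0.
Qed.

Lemma ratvalD r r' z v v' :
  ratval r z v -> ratval r' z v' -> ratval (r + r') z (v + v').
Proof.
move=> [P [Q [Qz -> ->]]] [P' [Q' [Qz' -> ->]]].
exists (P * Q' + P' * Q), (Q * Q').
split; first by rewrite hornerM mulf_neq0.
  rewrite (addf_div _ _ (tofrac_neq0_horner Qz) (tofrac_neq0_horner Qz')).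
  by rewrite tofracD 3!tofracM.
by rewrite (addf_div _ _ Qz Qz') hornerD !hornerM.
Qed.

Lemma ratvalV r z v : ratval r z v -> v != 0 -> ratval r^-1 z v^-1.
Proof.
move=> [P [Q [Qz -> ->]]]; rewrite mulf_eq0 invr_eq0 negb_or => /andP[Pz _].
by exists Q, P; rewrite !invf_div; split.
Qed.

Lemma ratvalN r z v : ratval r z v -> ratval (- r) z (- v).
Proof.
move=> h; rewrite -mulN1r -[- v]mulN1r; apply: ratvalM => //.
by have := ratvalC (-1) z; rewrite polyCN polyC1 tofracN tofrac1.
Qed.

Lemma ratval_exp r z v (n : int) : ratval r z v -> v != 0 -> ratval (r ^ n) z (v ^ n).
Proof.
move=> h v0.
have pn (k : nat) : ratval (r ^+ k) z (v ^+ k).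
  elim: k => [|k IH]; last by rewrite !exprS; apply: ratvalM.
  by rewrite !expr0; have := ratvalC 1 z; rewrite polyC1 tofrac1.
case: n => n; first exact: pn.
by apply: (ratvalV (pn n.+1)); rewrite expf_neq0.
Qed.

(** The cross difference times both denominators vanishes at every [z n], also where a denominator
    does, so it has too many roots. Agreement is asked only where both functions are regular because
    the poles of the gamma factor are not known beforehand. *)
Lemma ratfun_eq_inf r r' (z : nat -> C) : injective z ->
  (forall n v v', ratval r (z n) v -> ratval r' (z n) v' -> v = v') -> r = r'.
Proof.
move=> zI h.
have [P [Q [Q0 rE]]] := fraction_numden r.
have [P' [Q' [Q0' rE']]] := fraction_numden r'.
have [Q0f Q0f'] : (tofrac Q : ratfun R) != 0 /\ (tofrac Q' : ratfun R) != 0.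
  by rewrite !tofrac_eq0.
rewrite rE rE'; apply/eqP; rewrite (eqr_div _ _ Q0f Q0f') -2!tofracM tofrac_eq -subr_eq0.
have /eqP : (P * Q' - P' * Q) * (Q * Q') = 0.
  apply/eqP/negPn/negP => n0.
  pose D := (P * Q' - P' * Q) * (Q * Q').
  have /(max_poly_roots n0) : all (root D) [seq z i | i <- iota 0 (size D)].
    apply/allP => _ /mapP[i _ ->]; rewrite /root /D !(hornerM, hornerD, hornerN).
    have [Qz|Qz] := eqVneq Q.[z i] 0; first by rewrite Qz !(mul0r, mulr0).
    have [Qz'|Qz'] := eqVneq Q'.[z i] 0; first by rewrite Qz' !(mul0r, mulr0).
    rewrite !mulf_eq0 (negPf Qz) (negPf Qz') !orbF subr_eq0.
    rewrite -(eqr_div _ _ Qz Qz'); apply/eqP.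
    by apply: (h i); rewrite ?rE ?rE'; exact: ratval_frac.
  rewrite map_inj_uniq // iota_uniq size_map size_iota => /(_ isT).
  by rewrite ltnn.
by rewrite mulf_eq0 => /orP[//|]; rewrite mulf_eq0 (negPf Q0) (negPf Q0').
Qed.

End RatVal.

(** * Complex powers and the absolute value *)

Section Cpow.
Context (R : realType).
Local Notation C := R[i].
Implicit Types (x y : R) (s t : C).

Lemma complex_eqP (a b : C) :
  complex.Re a = complex.Re b -> complex.Im a = complex.Im b -> a = b.
Proof. by case: a b => [? ?] [? ?] /= -> ->. Qed.

Lemma cpowM x y s : 0 < x -> 0 < y -> cpow (x * y) s = cpow x s * cpow y s.
Proof.
move=> x0 y0; rewrite /cpow lnM ?posrE // !mulrDr expRD cosD sinD.
by apply: complex_eqP => /=; ring.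
Qed.

Lemma cpowD x s t : cpow x (s + t) = cpow x s * cpow x t.
Proof.
case: s t => [a b] [c d]; rewrite /cpow /= !mulrDl expRD cosD sinD.
by apply: complex_eqP => /=; ring.
Qed.

Lemma cpow_r0 x : cpow x 0 = 1.
Proof. by rewrite /cpow /= !mul0r expR0 cos0 sin0; apply: complex_eqP => /=; ring. Qed.

Lemma cpow_1l s : cpow 1 s = 1.
Proof. by rewrite /cpow /= ln1 !mulr0 expR0 cos0 sin0; apply: complex_eqP => /=; ring. Qed.

Lemma cpow_r1 x : 0 < x -> cpow x 1 = x%:C%C.
Proof.
move=> x0; rewrite /cpow /= !mul0r mul1r lnK ?posrE // cos0 sin0.
by apply: complex_eqP => /=; ring.
Qed.

Lemma cpow_neq0 x s : cpow x s != 0.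
Proof.
apply/eqP => h; have := cpowD x s (- s); rewrite h mul0r subrr cpow_r0.
by move/eqP; rewrite oner_eq0.
Qed.

Lemma cpowN x s : cpow x (- s) = (cpow x s)^-1.
Proof.
by apply: (mulfI (cpow_neq0 x s)); rewrite -cpowD subrr cpow_r0 mulfV ?cpow_neq0.
Qed.

Lemma cpowV x s : 0 < x -> cpow x^-1 s = (cpow x s)^-1.
Proof.
move=> x0; apply: (mulfI (cpow_neq0 x s)).
by rewrite -cpowM ?invr_gt0 // mulfV ?gt_eqF // cpow_1l mulfV ?cpow_neq0.
Qed.

Lemma cpow_exp x s (n : int) : 0 < x -> cpow (x ^ n) s = cpow x s ^ n.
Proof.
move=> x0.
have pn (k : nat) : cpow (x ^+ k) s = cpow x s ^+ k.
  by elim: k => [|k IH]; rewrite ?cpow_1l // !exprS cpowM ?IH // exprn_gt0.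
case: n => n; first exact: pn.
change (cpow (x ^+ n.+1)^-1 s = (cpow x s ^+ n.+1)^-1).
by rewrite cpowV ?exprn_gt0 // pn.
Qed.

Lemma normc_cpow x s : Normc.normc (cpow x s) = expR (complex.Re s * ln x).
Proof.
rewrite /cpow; set a := expR _; set th := _ * ln x.
rewrite [X in Normc.normc X](_ : _ = (a * cos th) +i* (a * sin th))%C; last first.
  by apply: complex_eqP => /=; ring.
rewrite /= !exprMn -mulrDr cos2Dsin2 mulr1 sqrtr_sqr ger0_norm //.
exact: expR_ge0.
Qed.

End Cpow.

(** * The absolute value of F and powers of q *)

Section PadicBasic.
Context (R : realType) (F : padicField R).
Local Notation C := R[i].
Local Notation q := ((resq F)%:R : R).
Implicit Types x y z : F.

Lemma absp_gt0 x : (0 < absp x) = (x != 0).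
Proof.
rewrite lt_def absp_ge0 andbT; congr (~~ _); apply/eqP/eqP => [|->].
  by move/padic_abs_eq0.
exact: absp0.
Qed.

Lemma absp_eq0 x : (absp x == 0) = (x == 0).
Proof. by have := absp_gt0 x; rewrite lt_def absp_ge0 andbT => /negb_inj. Qed.

Lemma abspV x : absp x^-1 = (absp x)^-1.
Proof.
have [->|x0] := eqVneq x 0; first by rewrite invr0 absp0 invr0.
have a0 : absp x != 0 by rewrite absp_eq0.
by apply: (mulfI a0); rewrite -abspM !mulfV // absp1.
Qed.

Lemma abspf x y : absp (x / y) = absp x / absp y.
Proof. by rewrite abspM abspV. Qed.

Lemma abspX x n : absp (x ^+ n) = absp x ^+ n.
Proof. by elim: n => [|n IH]; rewrite ?absp1 // !exprS abspM IH. Qed.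

Lemma abspB x y : absp (x - y) = absp (y - x).
Proof. by rewrite -abspN opprB. Qed.

Lemma absp_lt_add x y e : absp x < e -> absp y < e -> absp (x + y) < e.
Proof. by move=> hx hy; apply: le_lt_trans (absp_ultra x y) _; rewrite gt_max hx. Qed.

Lemma absp_le_add x y e : absp x <= e -> absp y <= e -> absp (x + y) <= e.
Proof. by move=> hx hy; apply: le_trans (absp_ultra x y) _; rewrite ge_max hx. Qed.

Lemma absp_lt_sub x y e : absp x < e -> absp y < e -> absp (x - y) < e.
Proof. by move=> hx hy; apply: absp_lt_add; rewrite ?abspN. Qed.

Lemma absp_le_sub x y e : absp x <= e -> absp y <= e -> absp (x - y) <= e.
Proof. by move=> hx hy; apply: absp_le_add; rewrite ?abspN. Qed.

Lemma absp_addl x y : absp y < absp x -> absp (x + y) = absp x.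
Proof.
move=> h; apply/eqP; rewrite eq_le; apply/andP; split.
  by apply: absp_le_add => //; apply: ltW.
rewrite leNgt; apply/negP => h'.
by have := absp_lt_sub h' h; rewrite addrK ltxx.
Qed.

Lemma absp_addr x y : absp x < absp y -> absp (x + y) = absp y.
Proof. by rewrite addrC; apply: absp_addl. Qed.

Lemma absp_sub_eq x y : absp (x - y) < absp y -> absp x = absp y.
Proof. by move=> h; rewrite -(subrK y x) absp_addr. Qed.

Lemma absp_le_sum I (r : seq I) (P : pred I) (f : I -> F) (e : R) : 0 <= e ->
  (forall i, P i -> absp (f i) <= e) -> absp (\sum_(i <- r | P i) f i) <= e.
Proof.
move=> e0 h; elim/big_rec: _ => [|i x Pi hx]; first by rewrite absp0.
by apply: absp_le_add => //; apply: h.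
Qed.

Lemma absp_lt_sum I (r : seq I) (P : pred I) (f : I -> F) (e : R) : 0 < e ->
  (forall i, P i -> absp (f i) < e) -> absp (\sum_(i <- r | P i) f i) < e.
Proof.
move=> e0 h; elim/big_rec: _ => [|i x Pi hx]; first by rewrite absp0.
by apply: absp_lt_add => //; apply: h.
Qed.

Lemma absp_nat n : absp (n%:R : F) <= 1.
Proof.
elim: n => [|n IH]; first by rewrite absp0.
by rewrite -natr1; apply: absp_le_add => //; rewrite absp1.
Qed.

Lemma padic_natr_neq0 n : (n%:R : F) != 0 <-> (0 < n)%N.
Proof.
have pc : [pchar F] =i pred0 := @padic_char0 R F.
by rewrite ((pcharf0P F).1 pc) lt0n.
Qed.

Lemma residue_rep : exists rep : 'I_(resq F) -> F,
  [/\ forall i, absp (rep i) <= 1,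
      forall i j, absp (rep i - rep j) < 1 -> i = j &
      forall x, absp x <= 1 -> exists i, absp (x - rep i) < 1].
Proof. exact: padic_residue_field. Qed.

Lemma resq_gt1 : (1 < resq F)%N.
Proof.
have [rep [_ repI rep_onto]] := residue_rep.
have [i hi] : exists i, absp (0 - rep i : F) < 1 by apply: rep_onto; rewrite absp0.
have [j hj] : exists i, absp (1 - rep i : F) < 1 by apply: rep_onto; rewrite absp1.
have nij : i != j.
  apply/eqP => eij; move: hj; rewrite -eij => hj.
  by have := absp_lt_sub hj hi; rewrite sub0r opprK subrK absp1 ltxx.
have := ltn_ord i; have := ltn_ord j; move: nij; rewrite -val_eqE /=.
case: (nat_of_ord i) => [|a]; case: (nat_of_ord j) => [|b] //; lia.
Qed.

Lemma q_gt1 : 1 < q. Proof. by rewrite ltr1n resq_gt1. Qed.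
Lemma q_gt0 : 0 < q. Proof. exact: lt_trans ltr01 q_gt1. Qed.
Lemma q_neq0 : q != 0. Proof. by rewrite gt_eqF ?q_gt0. Qed.

Lemma qz_gt0 (n : int) : 0 < q ^ n. Proof. by rewrite exprz_gt0 ?q_gt0. Qed.

Lemma ltr_qz (m n : int) : (q ^ m < q ^ n) = (m < n).
Proof. by rewrite ltr_eXz2l ?q_gt1. Qed.

Lemma ler_qz (m n : int) : (q ^ m <= q ^ n) = (m <= n).
Proof. by rewrite ler_eXz2l ?q_gt1. Qed.

Lemma qz_inj (m n : int) : q ^ m = q ^ n -> m = n.
Proof. by move=> e; apply/eqP; rewrite eq_le -!ler_qz e lexx. Qed.

(* The exponent of absp x as a power of q; lgp 0 is a junk value. *)
Definition lgp (x : F) : int := xget 0 [set n : int | absp x = q ^ n].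

Lemma absp_lgp x : x != 0 -> absp x = q ^ lgp x.
Proof.
move=> x0; have [n hn] := padic_value_group x0.
exact: (@xgetPex _ 0 [set n : int | absp x = q ^ n]) (ex_intro _ n hn).
Qed.

Lemma lgp_eq x (n : int) : absp x = q ^ n -> lgp x = n.
Proof.
move=> h; apply: qz_inj; rewrite -h absp_lgp //.
by rewrite -absp_gt0 h qz_gt0.
Qed.

Lemma uniformizer_exists : exists x : F, uniformizer x.
Proof. exact: padic_uniformizer. Qed.

Lemma uniformizer_neq0 x : uniformizer x -> x != 0.
Proof. by move=> h; rewrite -absp_gt0 h invr_gt0 q_gt0. Qed.

Lemma absp_unif x (n : int) : uniformizer x -> absp (x ^ n) = q ^ (- n).
Proof.
move=> h; have pn k : absp (x ^+ k) = q ^ (- k%:Z) by rewrite abspX h exprVn exprnN.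
by case: n => n; rewrite ?pn // NegzE -exprnN abspV pn -invr_expz opprK invrK.
Qed.

(** The value group is discrete: no absolute value lies strictly between 1/q and 1. *)
Lemma absp_lt1 x y : uniformizer y -> absp x < 1 -> absp x <= absp y.
Proof.
move=> hy; have [->|x0] := eqVneq x 0; first by rewrite absp0 absp_ge0.
have qV : q^-1 = q ^ (-1) by [].
by rewrite hy absp_lgp // qV -(expr0z q) ltr_qz ler_qz; lia.
Qed.

Lemma absp_unit1 x : absp (x - 1) < 1 -> absp x = 1.
Proof. by move=> h; rewrite (@absp_sub_eq x 1) absp1. Qed.

Lemma absp_unit1M x y : absp (x - 1) < 1 -> absp (y - 1) < 1 -> absp (x * y - 1) < 1.
Proof.
move=> hx hy; rewrite (_ : _ - 1 = (x - 1) * y + (y - 1)); last by ring.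
by apply: absp_lt_add; rewrite // abspM (absp_unit1 hy) mulr1.
Qed.

Lemma absp_unit1V x : absp (x - 1) < 1 -> absp (x^-1 - 1) < 1.
Proof.
move=> hx; have x1 := absp_unit1 hx.
have x0 : x != 0 by rewrite -absp_gt0 x1.
by rewrite (_ : _ - 1 = - (x - 1) / x) ?abspf ?abspN ?x1 ?divr1 //; field.
Qed.

(** Pigeonhole: q + 1 integers lie in q residue classes. The integer found stands in for the residue
    characteristic when the values of [psi] are shown to be roots of unity. *)
Lemma natr_lt1 : exists n, (0 < n)%N /\ absp (n%:R : F) < 1.
Proof.
have [rep [_ _ rep_onto]] := residue_rep.
have /choice[f hf] (i : 'I_(resq F).+1) := rep_onto (val i)%:R (absp_nat (val i)).
have : ~~ injectiveb f.
  apply/negP => /injectiveP /leq_card; rewrite !card_ord /resq.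
  by rewrite ltnn.
move=> /injectivePn[i [j nij eij]].
wlog lij : i j nij eij / (i < j)%N.
  move=> w; case: (ltngtP i j) => [||/val_inj e]; first exact: w.
  - by apply: w; rewrite // eq_sym.
  - by rewrite e eqxx in nij.
exists (j - i)%N; rewrite subn_gt0; split => //.
rewrite natrB ?(ltnW lij) //.
have := absp_lt_sub (hf j) (hf i); rewrite eij opprB addrA subrK.
by [].
Qed.

(** Turns bounds by |gam| on squares into bounds by |2|. This is how the estimates on SO_3 stay
    valid in residue characteristic 2. *)
Lemma absp_two_square (gam alpha : F) : absp alpha = 1 -> gam = - 4%:R * alpha ->
  absp gam = absp (2%:R : F) ^+ 2.
Proof.
by move=> h ->; rewrite abspM abspN h mulr1 -abspX -natrX.
Qed.

Lemma qsE (s : C) : qs F s = (cpow q s)^-1.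
Proof. by rewrite /qs cpowN. Qed.

Lemma qs_neq0 s : qs F s != 0.
Proof. exact: cpow_neq0. Qed.

Lemma cpow_absp x s : x != 0 -> cpow (absp x) s = qs F s ^ (- lgp x).
Proof.
move=> x0; rewrite absp_lgp // cpow_exp ?q_gt0 //.
by rewrite qsE exprz_inv opprK.
Qed.

Lemma qs1 : qs F 1 = (q^-1)%:C%C.
Proof. by rewrite qsE cpow_r1 ?q_gt0 // fmorphV. Qed.

Lemma normc_qs s : Normc.normc (qs F s) = expR (- complex.Re s * ln q).
Proof. by rewrite /qs normc_cpow; case: s. Qed.

Lemma qs_nat (n : nat) : qs F n%:R = (q ^- n)%:C%C.
Proof.
elim: n => [|n IH]; first by rewrite qsE cpow_r0 expr0 !invr1.
rewrite qsE -natr1 cpowD invfM -!qsE IH qs1 -rmorphM.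
by rewrite exprSr invfM.
Qed.

Lemma qs_nat_inj : injective (fun n : nat => qs F n%:R).
Proof.
move=> m n; rewrite !qs_nat => -[] /invr_inj /eqP.
by move/eqP/ieexprIn; apply; rewrite ?q_gt0 // gt_eqF ?q_gt1.
Qed.

End PadicBasic.

(** * Topology of matrices *)

Section PadicTop.
Context (R : realType) (F : padicField R).
Local Notation q := ((resq F)%:R : R).

Definition mxnear n (M M' : 'M[F]_n) (e : R) : Prop :=
  forall i j, absp (M' i j - M i j) < e.

Lemma nbhs_mxP n (M : 'M[F]_n) (P : set 'M[F]_n) :
  nbhs M P <-> exists2 e : R, 0 < e & forall M', mxnear M M' e -> P M'.
Proof.
rewrite -nbhs_ballE; split => [[e /= e0 h]|[e e0 h]]; exists e => //.
  move=> M' hM'; apply: h; split => // i j.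
  by have := hM' i j; rewrite abspB.
move=> M' [_ hM']; apply: h => i j; have := hM' i j.
by rewrite abspB.
Qed.

Lemma open_mxP n (A : set 'M[F]_n) :
  (forall M, A M -> exists2 e : R, 0 < e & forall M', mxnear M M' e -> A M') <->
  open A.
Proof.
rewrite openE; split => h M.
  by move=> /h; rewrite -nbhs_mxP.
by move=> /h; rewrite /interior nbhs_mxP.
Qed.

Lemma mxnear_sym n (M M' : 'M[F]_n) e : mxnear M M' e -> mxnear M' M e.
Proof. by move=> h i j; rewrite abspB. Qed.

Lemma mxnear_trans n (M M' M'' : 'M[F]_n) e :
  mxnear M M' e -> mxnear M' M'' e -> mxnear M M'' e.
Proof.
move=> h h' i j; rewrite (_ : _ - _ = (M'' i j - M' i j) + (M' i j - M i j)).
  exact: absp_lt_add.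
by ring.
Qed.

Lemma mxnear_le n (M M' : 'M[F]_n) e e' : e <= e' -> mxnear M M' e -> mxnear M M' e'.
Proof. by move=> le h i j; apply: lt_le_trans le. Qed.

Lemma mxnear_refl n (M : 'M[F]_n) e : 0 < e -> mxnear M M e.
Proof. by move=> e0 i j; rewrite subrr absp0. Qed.

Lemma closed_mx n (A : set 'M[F]_n) :
  (forall M, (forall e : R, 0 < e -> exists M', A M' /\ mxnear M M' e) -> A M) ->
  closed A.
Proof.
move=> h M clM; apply: h => e e0.
have [|M' [AM' hM']] := clM [set M' | mxnear M M' e]; last by exists M'.
by apply/nbhs_mxP; exists e.
Qed.

Lemma qV_small (e : R) : 0 < e -> exists k : nat, q ^- k < e.
Proof.
move=> e0; pose k := Num.bound e^-1; exists k.
rewrite -ltf_pV2 ?posrE ?invr_gt0 ?exprn_gt0 ?q_gt0 // invrK.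
have ei : 0 <= e^-1 by rewrite invr_ge0 ltW.
apply: lt_le_trans (archi_boundP ei) _; rewrite -/k -natrX ler_nat.
exact/ltnW/ltn_expl/resq_gt1.
Qed.

Lemma q_large (x : R) : exists k : nat, x <= q ^+ k.
Proof.
have [|k hk] := @qV_small (Num.max x 1)^-1; first by rewrite invr_gt0 lt_max ltr01 orbT.
exists k; have : x <= Num.max x 1 by rewrite le_max lexx.
move/le_trans; apply; apply: ltW.
by move: hk; rewrite ltf_pV2 ?posrE ?exprn_gt0 ?q_gt0 // lt_max ltr01 orbT.
Qed.

(** * Finite expansions, density and compactness *)

Section Digits.
Variables (rep : 'I_(resq F) -> F) (varpi : F).

Definition digits (s : seq 'I_(resq F)) : F :=
  foldr (fun i v => rep i + varpi * v) 0 s.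

Hypothesis rep_onto : forall x, absp x <= 1 -> exists i, absp (x - rep i) < 1.
Hypothesis hvarpi : uniformizer varpi.

Lemma digits_approx k x : absp x <= 1 ->
  exists s : k.-tuple 'I_(resq F), absp (x - digits s) <= q ^- k.
Proof.
have v0 := uniformizer_neq0 hvarpi.
elim: k x => [|k IH] x hx; first by exists [tuple]; rewrite /= subr0 expr0 invr1.
have [i hi] := rep_onto hx.
have [|s hs] := IH ((x - rep i) / varpi).
  rewrite abspf ler_pdivrMr ?absp_gt0 // mul1r; exact: absp_lt1.
exists [tuple of i :: s] => /=.
rewrite (_ : _ - _ = varpi * ((x - rep i) / varpi - digits s)); last by field.
by rewrite abspM hvarpi exprS invfM ler_pM2l // invr_gt0 q_gt0.
Qed.

End Digits.

(** Scaling by the N-th power of a uniformizer moves the ball into the integers, where N + k digits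
    suffice. *)
Lemma padic_finite_net (N k : nat) : exists (I : finType) (c : I -> F),
  forall x, absp x <= q ^+ N -> exists i, absp (x - c i) <= q ^- k.
Proof.
have [rep [_ _ rep_onto]] := residue_rep F.
have [w hw] := uniformizer_exists F; have w0 := uniformizer_neq0 hw.
exists ((N + k).-tuple 'I_(resq F) : finType).
exists (fun s : (N + k).-tuple 'I_(resq F) => digits rep w s / w ^+ N : F) => x hx.
have wN : absp (w ^+ N) = q ^- N by rewrite abspX hw exprVn.
have [|s hs] := digits_approx rep_onto hw (N + k) (x := x * w ^+ N).
  by rewrite abspM wN ler_pdivrMr ?exprn_gt0 ?q_gt0 // mul1r.
exists s; rewrite (_ : _ - _ = (x * w ^+ N - digits rep w s) / w ^+ N).
  rewrite abspf wN invrK -ler_pdivlMr ?exprn_gt0 ?q_gt0 //.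
  by apply: le_trans hs _; rewrite exprD invfM mulrC.
by rewrite mulrBl mulfK // expf_neq0.
Qed.

Lemma padic_dense : exists D : nat -> F, forall x (e : R), 0 < e ->
  exists n, absp (x - D n) < e.
Proof.
have [rep [_ _ rep_onto]] := residue_rep F.
have [w hw] := uniformizer_exists F; have w0 := uniformizer_neq0 hw.
pose D n : F := if unpickle n is Some (N, s) then
  digits rep w s / w ^+ (N : nat) else 0.
exists D => x e e0.
have [N hN] := q_large (absp x); have [k hk] := qV_small e0.
have wN : absp (w ^+ N) = q ^- N by rewrite abspX hw exprVn.
have [|s hs] := digits_approx rep_onto hw (N + k) (x := x * w ^+ N).
  by rewrite abspM wN ler_pdivrMr ?exprn_gt0 ?q_gt0 // mul1r.
exists (pickle (N, tval s)); rewrite /D pickleK.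
rewrite (_ : _ - _ = (x * w ^+ N - digits rep w s) / w ^+ N).
  rewrite abspf wN invrK -ltr_pdivlMr ?exprn_gt0 ?q_gt0 //.
  apply: le_lt_trans hs _; rewrite exprD invfM mulrC.
  by rewrite ltr_pM2r // invr_gt0 exprn_gt0 // q_gt0.
by rewrite mulrBl mulfK // expf_neq0.
Qed.

Lemma mx_dense n : exists D : nat -> 'M[F]_n, forall M (e : R), 0 < e ->
  exists k, mxnear M (D k) e.
Proof.
have [D hD] := padic_dense.
exists (fun k => if unpickle k is Some A then map_mx D A else 0) => M e e0.
have /choice[f hf] (ij : 'I_n * 'I_n) := hD (M ij.1 ij.2) e e0.
exists (pickle (\matrix_(i, j) f (i, j))) => i j.
by rewrite pickleK !mxE abspB; exact: (hf (i, j)).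
Qed.

(* A subspace of the matrix space is Lindelof. *)
Lemma mx_countable_cover n (G : set 'M[F]_n) (V : 'M[F]_n -> 'M[F]_n -> Prop) :
  G !=set0 ->
  (forall h, G h -> exists2 e : R, 0 < e & forall g, G g -> mxnear h g e -> V g h) ->
  exists g : nat -> 'M[F]_n, (forall k, G (g k)) /\
    forall h, G h -> exists k, V (g k) h.
Proof.
move=> [g0 Gg0] hV; have [D hD] := mx_dense n.
pose P k m := [set g | G g /\ mxnear (D k) g (q ^- m)].
pose g km := if unpickle km is Some (k, m) then xget g0 (P k m) else g0.
exists g; split.
  rewrite /g => km; case: (unpickle km) => [[k m]|] //.
  by case: xgetP => // x _ [].
move=> h Gh; have [e e0 he] := hV h Gh.
have [m hm] := qV_small e0.
have [|k hk] := hD h (q ^- m); first by rewrite invr_gt0 exprn_gt0 // q_gt0.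
exists (pickle (k, m)); rewrite /g pickleK.
have [Gx nx] : P k m (xget g0 (P k m)).
  by apply: (@xgetPex _ g0 (P k m)); exists h; split => //; apply: mxnear_sym.
by apply: he => //; apply: mxnear_le (ltW hm) _; apply: mxnear_trans hk nx.
Qed.

Lemma compact_mx_cover n (K : set 'M[F]_n) (V : 'M[F]_n -> 'M[F]_n -> Prop) :
  compact K ->
  (forall k, K k -> exists2 e : R, 0 < e & forall g, mxnear k g e -> V k g) ->
  exists s : seq 'M[F]_n, (forall x, x \in s -> K x) /\
    forall k, K k -> exists2 x, x \in s & V x k.
Proof.
move=> cK hV.
have hV' k : exists e : R, K k -> 0 < e /\ forall g, mxnear k g e -> V k g.
  have [/hV[e e0 he]|nK] := pselect (K k); first by exists e.
  by exists 0.
have [e he] := choice hV'.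
move: cK; rewrite compact_cover => /(_ _ K (fun k => [set g | mxnear k g (e k)])).
case.
- move=> k Kk; apply/open_mxP => M kM; exists (e k); first by have [] := he k Kk.
  by move=> M'; apply: mxnear_trans.
- move=> k Kk; exists k => //; apply: mxnear_refl; by have [] := he k Kk.
move=> D' hD' cov; exists (finmap.enum_fset D'); split.
  by move=> x /hD'; rewrite inE.
move=> k /cov[x /= xD' hx]; exists x => //.
by apply: (he x _).2 => //; have := hD' x xD'; rewrite inE.
Qed.

Lemma ultra_finite_cover (T : Type) (U : set_system T) (UU : UltraFilter U)
  (I : finType) (A : I -> set T) : U (\bigcup_i A i) -> exists i, U (A i).
Proof.
move=> h; apply: contrapT => /forallNP nA.
have hc i : U (~` A i) by case: (in_ultra_setVsetC (A i) UU) => // /nA.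
have : U [set t | forall i, (~` A i) t] by apply: filter_forall.
by move=> /(filterI h) /filter_ex[t [[i _ At] /(_ i)]].
Qed.

(** The ultrafilter selects one ball from each finite net of radius q^-k. The selected centres form
    a Cauchy sequence, and its limit is the limit of the entry. *)
Lemma ultra_entry_cvg n (N : nat) (U : set_system 'M[F]_n) (UU : UltraFilter U)
  (i j : 'I_n) : U [set M | absp (M i j) <= q ^+ N] ->
  exists x : F, forall e : R, 0 < e -> U [set M | absp (M i j - x) < e].
Proof.
move=> hU.
have /choice[c hc] (k : nat) : exists c : F, U [set M | absp (M i j - c) <= q ^- k].
  have [I [c hc]] := padic_finite_net N k.
  have [|a ha] := @ultra_finite_cover _ U UU I (fun a => [set M | absp (M i j - c a) <= q ^- k]).
    by apply: filterS hU => M /= /hc[a ha]; exists a.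
  by exists (c a).
have cc m k : absp (c m - c k) <= Num.max (q ^- m) (q ^- k).
  have [M [/= hm hk]] := filter_ex (filterI (hc m) (hc k)).
  rewrite (_ : _ - _ = (M i j - c k) - (M i j - c m)); last by ring.
  by apply: absp_le_sub; rewrite le_max ?hm ?hk ?orbT.
have mono (m k : nat) : (m <= k)%N -> q ^- k <= q ^- m.
  by move=> mk; rewrite lef_pV2 ?posrE ?exprn_gt0 ?q_gt0 // ler_weXn2l // ltW ?q_gt1.
have [|x hx] := @padic_complete R F c.
  move=> e e0; have [k hk] := qV_small e0; exists k => m l km kl.
  apply: le_lt_trans (cc m l) _; rewrite gt_max.
  by rewrite !(le_lt_trans _ hk) // mono.
exists x => e e0; have [n0 hn0] := hx e e0; have [k hk] := qV_small e0.
apply: filterS (hc (maxn n0 k)) => M /= hM.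
rewrite -(subrK (c (maxn n0 k)) (M i j)) -addrA; apply: absp_lt_add.
  by apply: le_lt_trans hM _; apply: le_lt_trans hk; apply: mono; rewrite leq_maxr.
by apply: hn0; rewrite leq_maxl.
Qed.

(** Every ultrafilter on the set converges entry by entry. This supplies the compact sets on which a
    Haar measure is known to be finite. *)
Lemma compact_mx_bounded n (N : nat) :
  compact [set M : 'M[F]_n | forall i j, absp (M i j) <= q ^+ N].
Proof.
rewrite compact_ultra => U UU UK.
have /choice[x hx] (ij : 'I_n * 'I_n) : exists x : F, forall e : R, 0 < e ->
    U [set M : 'M[F]_n | absp (M ij.1 ij.2 - x) < e].
  by apply: (@ultra_entry_cvg n N) => //; apply: filterS UK => M /=; apply.
exists (\matrix_(i, j) x (i, j)); split => [i j|] /=.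
  rewrite mxE; have qN : 0 < q ^+ N by rewrite exprn_gt0 ?q_gt0.
  have [M [/= hM /(_ i j) hK]] := filter_ex (filterI (hx (i, j) _ qN) UK).
  rewrite -(subKr (M i j) (x (i, j))); apply: absp_le_sub => //; exact: ltW.
move=> P /nbhs_mxP[e e0 he].
have : U [set M : 'M[F]_n | forall ij : 'I_n * 'I_n, absp (M ij.1 ij.2 - x ij) < e].
  by apply: filter_forall => ij; apply: hx.
by apply: filterS => M hM; apply: he => i j; rewrite mxE; apply: (hM (i, j)).
Qed.

Lemma borel_open n (A : set (borel F n)) : open (A : set 'M[F]_n) -> measurable A.
Proof. by move=> oA; apply: sub_sigma_algebra. Qed.

Lemma borel_closed n (A : set (borel F n)) : closed (A : set 'M[F]_n) -> measurable A.
Proof.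
move=> cA; rewrite -(setCK A); apply: measurableC; apply: borel_open.
by rewrite openC.
Qed.

End PadicTop.

(** * Block embeddings *)

Section Sylvester.
Variable K : fieldType.

(** One block matrix, factored in two ways, has both determinants. *)
Lemma det_sylvester m n (A : 'M[K]_(m, n)) (B : 'M[K]_(n, m)) :
  \det (1%:M + A *m B) = \det (1%:M + B *m A).
Proof.
have e1 : block_mx 1%:M (- A) B 1%:M =
    block_mx 1%:M 0 B 1%:M *m block_mx 1%:M (- A) 0 (1%:M + B *m A).
  by rewrite mulmx_block !mul1mx !mul0mx !mulmx1 !addr0 mulmxN addrC addrK.
have e2 : block_mx 1%:M (- A) B 1%:M =
    block_mx (1%:M + A *m B) (- A) 0 1%:M *m block_mx 1%:M 0 B 1%:M.
  by rewrite mulmx_block !mul1mx !mul0mx !mulmx1 ?mulmx0 !add0r mulNmx addrK.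
have := congr1 determinant e2; rewrite [in LHS]e1 !det_mulmx !det_lblock !det_ublock.
by rewrite !det1 !(mul1r, mulr1).
Qed.

Variables (m n : nat) (f : 'I_m -> 'I_n).
Hypothesis f_inj : injective f.

Definition selmx : 'M[K]_(n, m) := \matrix_(i, k) (i == f k)%:R.

Lemma selmxT_mul : selmx^T *m selmx = 1%:M.
Proof.
apply/matrixP => a b; rewrite !mxE (bigD1 (f a)) //= !mxE eqxx mul1r big1 ?addr0.
  by rewrite (inj_eq f_inj).
by move=> i /negPf ni; rewrite !mxE ni mul0r.
Qed.

(* The block embedding GL_m -> GL_n along f, trivial on the other coordinates. *)
Definition embmx (x : 'M[K]_m) : 'M[K]_n :=
  1%:M + selmx *m (x - 1%:M) *m selmx^T.

Lemma embmxM x y : embmx x *m embmx y = embmx (x *m y).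
Proof.
have key : x *m y - 1%:M = (y - 1%:M) + ((x - 1%:M) + (x - 1%:M) *m (y - 1%:M)).
  rewrite mulmxBl !mulmxBr !mul1mx mulmx1; move: (x *m y) => xy.
  by apply/matrixP => i j; rewrite !mxE; ring.
rewrite /embmx key; move: (x - 1%:M) (y - 1%:M) => dx dy.
rewrite !(mulmxDr selmx) !(mulmxDl _ _ selmx^T) mulmxDl mul1mx mulmxDr mulmx1 -addrA; congr (_ + (_ + (_ + _))).
by rewrite -!mulmxA (mulmxA selmx^T selmx) selmxT_mul mul1mx.
Qed.

Lemma embmx_tr x : (embmx x)^T = embmx x^T.
Proof. have dT : (x - 1%:M)^T = x^T - 1%:M by rewrite linearD linearN /= trmx1.
rewrite /embmx (linearD _ _ _) /= !trmx_mul trmxK dT trmx1.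
by rewrite mulmxA. Qed.

Lemma det_embmx x : \det (embmx x) = \det x.
Proof.
rewrite /embmx -mulmxA det_sylvester -mulmxA selmxT_mul mulmx1.
by rewrite addrC subrK.
Qed.

(** [selmx] intertwines the two forms, so the deviation from [J] lives on the small block, where it
    is the left side of [key]. *)
Lemma embmx_form (J : 'M[K]_n) (J' x : 'M[K]_m) : J^T = J -> J'^T = J' ->
  J *m selmx = selmx *m J' -> x^T *m J' *m x = J' ->
  (embmx x)^T *m J *m embmx x = J.
Proof.
move=> Js Js' JS xJ.
have SJ : selmx^T *m J = J' *m selmx^T by rewrite -{1}Js -trmx_mul JS trmx_mul Js'.
have key : (x^T - 1%:M) *m J' + (J' *m (x - 1%:M) + (x^T - 1%:M) *m J' *m (x - 1%:M)) = 0.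
  rewrite !mulmxBl !mulmxBr !mul1mx !mulmx1 xJ; move: (x^T *m J') (J' *m x) => a b.
  by apply/matrixP => i j; rewrite !mxE; ring.
rewrite embmx_tr /embmx mulmxDl mul1mx mulmxDr mulmx1 mulmxDl.
rewrite -[RHS]addr0 -!addrA; congr (_ + _).
have -> : selmx *m (x^T - 1%:M) *m selmx^T *m J =
  selmx *m ((x^T - 1%:M) *m J') *m selmx^T by rewrite -!mulmxA SJ.
have -> : J *m (selmx *m (x - 1%:M) *m selmx^T) =
  selmx *m (J' *m (x - 1%:M)) *m selmx^T by rewrite !mulmxA JS.
rewrite -(mulmxA _ selmx^T) (mulmxA selmx^T (selmx *m _)) (mulmxA selmx^T).
rewrite selmxT_mul mul1mx [selmx *m _ *m (_ *m _)]mulmxA -(mulmxA selmx _ (x - _)).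
by rewrite -!mulmxDl -!mulmxDr key mulmx0 mul0mx.
Qed.

Lemma embmx_in x a b : embmx x (f a) (f b) = x a b.
Proof.
rewrite !mxE (bigD1 b) //= !mxE eqxx mulr1 (bigD1 a) //= !mxE eqxx mul1r.
rewrite !big1 ?addr0 => [|i ni|i ni]; last 2 first.
- by rewrite (_ : selmx^T i (f b) = 0) ?mulr0 // !mxE (inj_eq f_inj) eq_sym (negPf ni).
- by rewrite !mxE (inj_eq f_inj) eq_sym (negPf ni) mul0r.
by rewrite (inj_eq f_inj) addrC subrK.
Qed.

Lemma embmx_outl x i j : (forall a, i != f a) -> embmx x i j = (i == j)%:R.
Proof.
move=> ni; rewrite !mxE big1 ?addr0 // => b _; rewrite !mxE big1 ?mul0r // => a _.
by rewrite !mxE (negPf (ni a)) mul0r.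
Qed.

Lemma embmx_outr x i j : (forall a, j != f a) -> embmx x i j = (i == j)%:R.
Proof.
move=> ni; rewrite !mxE big1 ?addr0 // => b _; rewrite !mxE.
by rewrite (negPf (ni b)) mulr0.
Qed.

End Sylvester.

Lemma mulmx3E (K : fieldType) (A B : 'M[K]_3) i j : (A *m B) i j =
  A i 0 * B 0 j + (A i 1 * B 1 j + A i 2%:R * B 2%:R j).
Proof.
rewrite mxE !big_ord_recl big_ord0 addr0.
by congr (_ + (_ + _)); congr (A _ _ * B _ _); apply: val_inj.
Qed.

Lemma mulmx4E (K : fieldType) (A B : 'M[K]_4) i j : (A *m B) i j =
  A i 0 * B 0 j + (A i 1 * B 1 j + (A i 2%:R * B 2%:R j + A i 3%:R * B 3%:R j)).
Proof.
rewrite mxE !big_ord_recl big_ord0 addr0.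
by congr (_ + (_ + (_ + _))); congr (A _ _ * B _ _); apply: val_inj.
Qed.

Lemma matrix3P (K : fieldType) (A B : 'M[K]_3) :
  [/\ A 0 0 = B 0 0, A 0 1 = B 0 1 & A 0 2%:R = B 0 2%:R] ->
  [/\ A 1 0 = B 1 0, A 1 1 = B 1 1 & A 1 2%:R = B 1 2%:R] ->
  [/\ A 2%:R 0 = B 2%:R 0, A 2%:R 1 = B 2%:R 1 & A 2%:R 2%:R = B 2%:R 2%:R] -> A = B.
Proof.
move=> [a1 a2 a3] [b1 b2 b3] [c1 c2 c3]; apply/matrixP => i j.
have h (k : 'I_3) : [\/ k = 0, k = 1 | k = 2%:R].
  by case: k => [[|[|[|?]]] ?] //; [constructor 1|constructor 2|constructor 3]; apply: val_inj.
by case: (h i) => ->; case: (h j) => ->.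
Qed.

Lemma matrix4P (K : fieldType) (A B : 'M[K]_4) :
  [/\ A 0 0 = B 0 0, A 0 1 = B 0 1, A 0 2%:R = B 0 2%:R & A 0 3%:R = B 0 3%:R] ->
  [/\ A 1 0 = B 1 0, A 1 1 = B 1 1, A 1 2%:R = B 1 2%:R & A 1 3%:R = B 1 3%:R] ->
  [/\ A 2%:R 0 = B 2%:R 0, A 2%:R 1 = B 2%:R 1, A 2%:R 2%:R = B 2%:R 2%:R &
      A 2%:R 3%:R = B 2%:R 3%:R] ->
  [/\ A 3%:R 0 = B 3%:R 0, A 3%:R 1 = B 3%:R 1, A 3%:R 2%:R = B 3%:R 2%:R &
      A 3%:R 3%:R = B 3%:R 3%:R] -> A = B.
Proof.
move=> [a1 a2 a3 a4] [b1 b2 b3 b4] [c1 c2 c3 c4] [d1 d2 d3 d4]; apply/matrixP => i j.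
have h (k : 'I_4) : [\/ k = 0, k = 1, k = 2%:R | k = 3%:R].
  by case: k => [[|[|[|[|?]]]] ?] //;
    [constructor 1|constructor 2|constructor 3|constructor 4]; apply: val_inj.
by case: (h i) => ->; case: (h j) => ->.
Qed.

(** * Groups preserving an invertible form *)

Section SpecialOrthogonal.
Context (R : realType) (F : padicField R) (n : nat) (J : 'M[F]_n).
Hypothesis J_unit : J \in unitmx.
Implicit Types g h : 'M[F]_n.

Lemma SO_unitmx g : SO J g -> g \in unitmx.
Proof. by move=> [d _]; rewrite unitmxE d unitr1. Qed.

Lemma SO1 : SO J 1%:M.
Proof. by split; rewrite ?det1 // trmx1 mul1mx mulmx1. Qed.

Lemma SO_mul g h : SO J g -> SO J h -> SO J (g *m h).
Proof.
move=> [dg Jg] [dh Jh]; split; first by rewrite det_mulmx dg dh mulr1.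
by rewrite trmx_mul -!mulmxA (mulmxA J) (mulmxA g^T) (mulmxA g^T) Jg mulmxA.
Qed.

Lemma SO_inv g : SO J g -> SO J (invmx g).
Proof.
move=> gS; have gu := SO_unitmx gS; case: gS => dg Jg.
split; first by rewrite det_inv dg invr1.
rewrite -{1}Jg trmx_inv !mulmxA mulVmx ?unitmx_tr // mul1mx.
by rewrite -mulmxA mulmxV // mulmx1.
Qed.

Lemma SO_invE g : SO J g -> invmx g = invmx J *m g^T *m J.
Proof.
move=> gS; have gu := SO_unitmx gS; case: gS => dg Jg.
have h : (invmx J *m g^T *m J) *m g = 1%:M.
  by rewrite -mulmxA -mulmxA (mulmxA g^T) Jg mulVmx.
by rewrite -[RHS]mulmx1 -(mulmxV gu) mulmxA h mul1mx.
Qed.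

Lemma SO_rows g : SO J g -> g *m invmx J *m g^T = invmx J.
Proof.
move=> gS; have gu := SO_unitmx gS.
have h := SO_invE gS.
have : g *m (invmx J *m g^T *m J) = 1%:M by rewrite -h mulmxV.
by rewrite !mulmxA => /(congr1 (fun M => M *m invmx J)); rewrite mulmxK // mul1mx.
Qed.

Lemma SO_mulr g h : SO J g -> SO J (h *m g) -> SO J h.
Proof.
move=> gS hgS; rewrite -(mulmxK (SO_unitmx gS) h).
exact: SO_mul (SO_inv gS).
Qed.

Lemma SO_mull g h : SO J g -> SO J (g *m h) -> SO J h.
Proof.
move=> gS ghS; rewrite -(mulKmx (SO_unitmx gS) h).
exact: SO_mul (SO_inv gS) ghS.
Qed.

End SpecialOrthogonal.

(** * Even orthogonal groups *)

Ltac case_ifs := repeat match goal with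
  |- context [if ?b then _ else _] =>
    lazymatch b with context [if _ then _ else _] => fail | _ => case: (boolP b) => ? end end.

Section EvenSO.
Context (R : realType) (F : padicField R) (l : nat).
Local Notation N := (2 * l)%N.
Local Notation J := (@J_anti R F l).
Implicit Types (i j k : 'I_(2 * l)) (M : 'M[F]_(2 * l)).

Lemma J_antiE i j : J i j = (j == rev_ord i)%:R.
Proof. by rewrite mxE -val_eqE /=; congr (_%:R); have := ltn_ord i; have := ltn_ord j; lia. Qed.

Lemma mulmx_anti M i j : (M *m J) i j = M i (rev_ord j).
Proof.
rewrite mxE (bigD1 (rev_ord j)) //= J_antiE rev_ordK eqxx mulr1 big1 ?addr0 //.
by move=> k nk; rewrite J_antiE -(inj_eq rev_ord_inj) rev_ordK eq_sym (negPf nk) mulr0.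
Qed.

Lemma anti_mulmx M i j : (J *m M) i j = M (rev_ord i) j.
Proof.
rewrite mxE (bigD1 (rev_ord i)) //= J_antiE eqxx mul1r big1 ?addr0 //.
by move=> k nk; rewrite J_antiE (negPf nk) mul0r.
Qed.

Lemma J_anti_sq : J *m J = 1%:M.
Proof.
apply/matrixP => i j; rewrite mulmx_anti J_antiE mxE.
by rewrite (inj_eq rev_ord_inj) eq_sym.
Qed.

Lemma J_anti_tr : J^T = J.
Proof. by apply/matrixP => i j; rewrite !mxE addnC. Qed.

Lemma J_anti_unit : J \in unitmx.
Proof. by have [] := mulmx1_unit J_anti_sq. Qed.

Lemma invmx_anti : invmx J = J.
Proof. by rewrite -[RHS](mulKmx J_anti_unit) J_anti_sq mulmx1. Qed.

Lemma SO2l_invE M i j : SO2l M -> (invmx M) i j = M (rev_ord j) (rev_ord i).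
Proof.
move=> /(SO_invE J_anti_unit) ->.
by rewrite invmx_anti mulmx_anti anti_mulmx mxE.
Qed.

Lemma SO2l_col M i j : SO2l M ->
  \sum_k M k i * M (rev_ord k) j = (j == rev_ord i)%:R.
Proof.
move=> [_ /matrixP/(_ i j)]; rewrite J_antiE => <-.
rewrite -mulmxA mxE; apply: eq_bigr => k _.
by rewrite anti_mulmx mxE.
Qed.

Lemma det_levi_anti M : M \in unitmx -> \det (M *m J *m invmx M *m J) = 1.
Proof.
move=> Mu; rewrite -[M *m _ *m _ *m _]mulmxA -mulmxA !det_mulmx det_inv.
have J2 : \det J * \det J = 1 by rewrite -det_mulmx J_anti_sq det1.
rewrite [\det J * _]mulrCA J2 mulr1 mulfV //.
by rewrite -unitfE -unitmxE.
Qed.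

Lemma SO2l_scaledP (c : F) M : c ^+ 2 = 1 -> SO2l M -> SO2l (c *: M).
Proof.
move=> c2 [d JM]; split; first by rewrite detZ exprM c2 expr1n mul1r.
by rewrite [(c *: M)^T]linearZ /= -scalemxAl -scalemxAl -scalemxAr scalerA JM -expr2 c2 scale1r.
Qed.

Definition monomial_mx (s : 'I_(2 * l) -> 'I_(2 * l)) (c : 'I_(2 * l) -> F) : 'M[F]_(2 * l) :=
  \matrix_(i, j) ((j == s i)%:R * c i).

Lemma monomial_mulmx m s c (M : 'M[F]_(2 * l, m)) i (j : 'I_m) :
  (monomial_mx s c *m M) i j = c i * M (s i) j.
Proof.
rewrite mxE (bigD1 (s i)) //= !mxE eqxx mul1r big1 ?addr0 //.
by move=> k nk; rewrite mxE (negPf nk) !mul0r.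
Qed.

Lemma mulmx_monomial s c M i j : involutive s ->
  (M *m monomial_mx s c) i j = M i (s j) * c (s j).
Proof.
move=> sK; rewrite mxE (bigD1 (s j)) //= !mxE sK eqxx mul1r big1 ?addr0 //.
by move=> k nk; rewrite mxE -(inj_eq (inv_inj sK)) sK eq_sym (negPf nk) mul0r mulr0.
Qed.

Lemma iwahori_plus1 : iwahori_plus (1%:M : 'M[F]_(2 * l)).
Proof.
split; last by move=> i; rewrite mxE eqxx subrr absp0.
split; first exact: SO1.
- by move=> i j; rewrite mxE; case: (i == j); rewrite ?absp0 ?absp1.
- by move=> i j ji; rewrite mxE -val_eqE (gtn_eqF ji) absp0.
Qed.

Lemma iwahori_plusM M M' : iwahori_plus M -> iwahori_plus M' -> iwahori_plus (M *m M').
Proof.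
move=> [[MS Mi Ml] Md] [[MS' Mi' Ml'] Md'].
have le1 i j k : absp (M i k * M' k j) <= 1.
  by rewrite abspM mulr_ile1 ?absp_ge0.
split; first split.
- exact: SO_mul MS MS'.
- by move=> i j; rewrite mxE; apply: absp_le_sum.
- move=> i j ji; rewrite mxE; apply: absp_lt_sum => // k _; rewrite abspM.
  have [ki|ik] := ltnP k i.
    by rewrite (le_lt_trans _ (Ml _ _ ki)) // ler_piMr ?absp_ge0.
  have jk := leq_trans ji ik.
  by rewrite (le_lt_trans _ (Ml' _ _ jk)) // ler_piMl ?absp_ge0.
move=> i; rewrite mxE (bigD1 i) //= addrAC.
apply: absp_lt_add; first exact: absp_unit1M.
apply: absp_lt_sum => // k nk; rewrite abspM.
have [ki|ik|e] := ltngtP k i.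
- by rewrite (le_lt_trans _ (Ml _ _ ki)) // ler_piMr ?absp_ge0.
- by rewrite (le_lt_trans _ (Ml' _ _ ik)) // ler_piMl ?absp_ge0.
- by rewrite (val_inj e) eqxx in nk.
Qed.

Lemma iwahori_plusV M : iwahori_plus M -> iwahori_plus (invmx M).
Proof.
move=> [[MS Mi Ml] Md]; split; first split.
- exact: SO_inv MS.
- by move=> i j; rewrite SO2l_invE.
- move=> i j ji; rewrite SO2l_invE //; apply: Ml => /=.
  by have := ltn_ord i; have := ltn_ord j; lia.
- by move=> i; rewrite SO2l_invE.
Qed.

Lemma iwahori_plus_unit M : iwahori_plus M -> M \in unitmx.
Proof. by move=> [[MS _ _] _]; apply: SO_unitmx MS. Qed.

Lemma iwahori_plus_near : exists2 e : R, 0 < e &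
  forall M, SO2l M -> mxnear 1%:M M e -> iwahori_plus M.
Proof.
exists 1 => // M MS h; split; last by move=> i; have := h i i; rewrite mxE eqxx.
split => // [i j|i j ji]; last first.
  by have := h i j; rewrite mxE -val_eqE (gtn_eqF ji) subr0.
rewrite -(subrK (1%:M i j) (M i j)); apply: absp_le_add; first exact/ltW/h.
by rewrite mxE; case: (i == j); rewrite ?absp0 ?absp1.
Qed.

Hypothesis hl : (2 < l)%N.

Fact pos0_subproof (a : 'I_4) : (l - 2 + a < 2 * l)%N.
Proof. by have := ltn_ord a; lia. Qed.
Definition pos0 a : 'I_(2 * l) := Ordinal (pos0_subproof a).

Fact pos_subproof (a : 'I_4) : (nth 0 [:: 0; l.-1; l; N.-1] a < 2 * l)%N.
Proof. by case: a => [[|[|[|[|?]]]] ?] //=; lia. Qed.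
(** The coordinates 1, l, l + 1, 2l, counted from 0. They are those moved by [g_chi], and
    conjugation by [wl1] takes to them the middle block [pos0], in which SO_3 is embedded. *)
Definition pos a : 'I_(2 * l) := Ordinal (pos_subproof a).

Lemma pos0_inj : injective pos0.
Proof. by move=> a b /(congr1 val) /= /addnI /val_inj. Qed.

Lemma pos_inj : injective pos.
Proof.
move=> a b /(congr1 val) /=; case: a b => [[|[|[|[|?]]]] ?] [[|[|[|[|?]]]] ?] //= e;
  apply: val_inj => //=; lia.
Qed.

Definition J4 : 'M[F]_4 := \matrix_(a, b) ((a + b)%N == 3)%:R.

Lemma J4_tr : J4^T = J4.
Proof. by apply/matrixP => a b; rewrite !mxE addnC. Qed.

Lemma mulmx_rows4 (a00 a01 a02 a03 a10 a11 a12 a13 a20 a21 a22 a23 a30 a31 a32 a33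
  b00 b01 b02 b03 b10 b11 b12 b13 b20 b21 b22 b23 b30 b31 b32 b33 : F) :
  mx_rows 4 [:: [:: a00; a01; a02; a03]; [:: a10; a11; a12; a13]; [:: a20; a21; a22; a23]; [:: a30; a31; a32; a33]] *m
  mx_rows 4 [:: [:: b00; b01; b02; b03]; [:: b10; b11; b12; b13]; [:: b20; b21; b22; b23]; [:: b30; b31; b32; b33]] = mx_rows 4
  [:: [:: a00 * b00 + (a01 * b10 + (a02 * b20 + a03 * b30)); a00 * b01 + (a01 * b11 + (a02 * b21 + a03 * b31)); a00 * b02 + (a01 * b12 + (a02 * b22 + a03 * b32)); a00 * b03 + (a01 * b13 + (a02 * b23 + a03 * b33))];
   [:: a10 * b00 + (a11 * b10 + (a12 * b20 + a13 * b30)); a10 * b01 + (a11 * b11 + (a12 * b21 + a13 * b31)); a10 * b02 + (a11 * b12 + (a12 * b22 + a13 * b32)); a10 * b03 + (a11 * b13 + (a12 * b23 + a13 * b33))];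
   [:: a20 * b00 + (a21 * b10 + (a22 * b20 + a23 * b30)); a20 * b01 + (a21 * b11 + (a22 * b21 + a23 * b31)); a20 * b02 + (a21 * b12 + (a22 * b22 + a23 * b32)); a20 * b03 + (a21 * b13 + (a22 * b23 + a23 * b33))];
   [:: a30 * b00 + (a31 * b10 + (a32 * b20 + a33 * b30)); a30 * b01 + (a31 * b11 + (a32 * b21 + a33 * b31)); a30 * b02 + (a31 * b12 + (a32 * b22 + a33 * b32)); a30 * b03 + (a31 * b13 + (a32 * b23 + a33 * b33))]].
Proof. by apply: matrix4P; split; rewrite mulmx4E !mxE. Qed.

Lemma mulmx_J4 m (M : 'M[F]_(m, 4)) (i : 'I_m) (j : 'I_4) : (M *m J4) i j = M i (rev_ord j).
Proof.
rewrite mxE (bigD1 (rev_ord j)) //= big1 ?addr0 => [|k nk]; rewrite !mxE.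
  by rewrite (_ : (_ == 3)%N) ?mulr1 //; case: j => [[|[|[|[|?]]]] ?].
rewrite (_ : (_ == 3)%N = false) ?mulr0 //; move: nk; rewrite -val_eqE.
by case: j k => [[|[|[|[|?]]]] ?] [[|[|[|[|?]]]] ?].
Qed.

Lemma rev_pos a : rev_ord (pos a) = pos (rev_ord a).
Proof. by apply: val_inj; case: a => [[|[|[|[|?]]]] ?] //=; lia. Qed.

Lemma rev_pos0 a : rev_ord (pos0 a) = pos0 (rev_ord a).
Proof. by apply: val_inj; case: a => [[|[|[|[|?]]]] ?] //=; lia. Qed.

Lemma anti_selmx (f : 'I_4 -> 'I_(2 * l)) : (forall a, rev_ord (f a) = f (rev_ord a)) ->
  J *m selmx F f = selmx F f *m J4.
Proof.
move=> fr; apply/matrixP => i b; rewrite mxE [RHS]mxE (bigD1 (rev_ord i)) //=.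
rewrite J_antiE eqxx mul1r big1 ?addr0; last first.
  by move=> k nk; rewrite J_antiE (negPf nk) mul0r.
rewrite (bigD1 (rev_ord b)) //= !mxE big1 ?addr0.
  rewrite -fr (_ : (_ + _ == 3)%N = true) ?mulr1.
    by rewrite -(inj_eq rev_ord_inj) rev_ordK.
  by case: b => [[|[|[|[|?]]]] ?].
move=> c nc; rewrite !mxE (_ : (_ == 3)%N = false) ?mulr0 //.
by move: nc; rewrite -val_eqE; case: b c => [[|[|[|[|?]]]] ?] [[|[|[|[|?]]]] ?].
Qed.

Lemma SO2l_embmx (f : 'I_4 -> 'I_(2 * l)) (Y : 'M[F]_4) : injective f ->
  (forall a, rev_ord (f a) = f (rev_ord a)) ->
  \det Y = 1 -> Y^T *m J4 *m Y = J4 -> SO2l (embmx f Y).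
Proof.
move=> fI fr dY JY; split; first by rewrite det_embmx.
by apply: (embmx_form fI) JY; [exact: J_anti_tr|exact: J4_tr|exact: anti_selmx].
Qed.

Lemma pos_cases i : (exists a, i = pos a) \/ (forall a, i != pos a).
Proof.
case: (pickP (fun a => i == pos a)) => [a /eqP ->|h]; first by left; exists a.
by right => a; rewrite h.
Qed.

Lemma pos0_cases i : (exists a, i = pos0 a) \/ (forall a, i != pos0 a).
Proof.
case: (pickP (fun a => i == pos0 a)) => [a /eqP ->|h]; first by left; exists a.
by right => a; rewrite h.
Qed.

Lemma emb_embmx (gam : F) (x : 'M[F]_3) :
  emb l gam x = embmx pos0 (embA gam *m sharp x *m invmx (embA gam)).
Proof.
rewrite /emb; move: (embA gam *m sharp x *m _) => X.
apply/matrixP => i j; rewrite mxE.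
have outP k : (forall a, k != pos0 a) -> ~~ (l.-1 <= k.+1 <= l.+2)%N.
  move=> nk; apply/negP => h.
  have lt4 : (k - (l - 2) < 4)%N by lia.
  by have := nk (Ordinal lt4); rewrite -val_eqE /=; lia.
have [[a ->]|ni] := pos0_cases i; last first.
  by rewrite embmx_outl // (negPf (outP _ ni)) eqSS.
have [[b ->]|nj] := pos0_cases j; last first.
  by rewrite embmx_outr // (negPf (outP _ nj)) andbF eqSS.
rewrite (embmx_in pos0_inj) ifT; last by move: (ltn_ord a) (ltn_ord b) => /=; lia.
rewrite /ent (_ : (_ - _).-1 = a); last by move: (ltn_ord a) => /=; lia.
rewrite (_ : ((pos0 b).+1 - _).-1 = b); last by move: (ltn_ord b) => /=; lia.
by rewrite !valK.
Qed.

Lemma ent_ord n (M : 'M[F]_n) (i j : nat) (a b : 'I_n) :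
  i.-1 = a -> j.-1 = b -> ent M i j = M a b.
Proof. by move=> ia jb; rewrite /ent ia jb !valK. Qed.

(* The cyclic shift of the first l - 1 coordinates, 0-indexed. *)
Fact wsigma_subproof i :
  ((if i == 0 :> nat then l - 2 else if i <= l - 2 then i.-1 else i) < 2 * l)%N.
Proof. by have := ltn_ord i; case_ifs; lia. Qed.
Definition wsigma i : 'I_(2 * l) := Ordinal (wsigma_subproof i).

Lemma wsigma_inj : injective wsigma.
Proof.
move=> i j /(congr1 val) /= e; apply: val_inj => /=; move: e.
by case_ifs; lia.
Qed.

(** The cyclic shift acts on the first half of the coordinates and its mirror image on the second.
    The nested conditionals are traded for disjunctions of linear facts, which [lia] can use. *)
Lemma wl1E i j : wl1 F l i j = (j == rev_ord (wsigma (rev_ord (wsigma i))))%:R.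
Proof.
rewrite mxE -val_eqE /=; congr ((_ : bool)%:R).
have := ltn_ord i; have := ltn_ord j; move: (nat_of_ord i) (nat_of_ord j) => a b hb ha.
set c := if a == 0 then _ else _.
have hc : [\/ a = 0 /\ c = l - 2, (0 < a <= l - 2) /\ c = a.-1 | l - 2 < a /\ c = a]%N.
  rewrite /c; case: (posnP a) => [|a0]; first by constructor 1.
  by case: leqP => ?; [constructor 2|constructor 3]; split => //; lia.
move: (c) hc => {}c hc.
set d := if _ == 0 then _ else _.
have hd : [\/ (2 * l - c.+1 = 0 /\ d = l - 2),
   (0 < 2 * l - c.+1 <= l - 2) /\ d = (2 * l - c.+1).-1 |
   l - 2 < 2 * l - c.+1 /\ d = 2 * l - c.+1]%N.
  rewrite /d; case: (posnP (2 * l - c.+1)%N) => [|a0]; first by constructor 1.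
  by case: leqP => ?; [constructor 2|constructor 3]; split => //; lia.
move: (d) hd => {}d hd.
apply/idP/eqP => h.
  case/orP: h => [/andP[/eqP h1 /eqP h2]|]; last
    case/orP=> [/andP[/andP[h1 h3] /eqP h2]|]; last
    case/orP=> [/andP[/andP[h1 h3] /eqP h2]|]; last
    case/orP=> [/andP[/andP[h1 h3] /eqP h2]|/andP[/eqP h1 /eqP h2]];
  by case: hc => -[hc1 hc2]; case: hd => -[hd1 hd2]; lia.
case: hc => -[hc1 hc2]; case: hd => -[hd1 hd2]; try (exfalso; lia).
- by apply/orP; left; lia.
- by apply/orP; right; apply/orP; left; lia.
- by apply/orP; right; apply/orP; right; apply/orP; right; apply/orP; right; lia.
- by apply/orP; right; apply/orP; right; apply/orP; right; apply/orP; left; lia.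
- by apply/orP; right; apply/orP; right; apply/orP; left; lia.
Qed.

End EvenSO.

(** * The Weyl element w^{l,1} and diagonal elements *)

Section WeylTorus.
Context (R : realType) (F : padicField R) (l : nat).
Hypothesis hl : (2 < l)%N.
Local Notation N := (2 * l)%N.
Local Notation J := (@J_anti R F l).
Implicit Types (i j k : 'I_(2 * l)) (M : 'M[F]_(2 * l)).
Local Notation pos := (pos hl).
Local Notation pos0 := (pos0 hl).
Local Notation wsigma := (wsigma hl).

Definition wl1_fun i : 'I_(2 * l) := rev_ord (wsigma (rev_ord (wsigma i))).

Lemma wl1_fun_inj : injective wl1_fun.
Proof. by move=> i j /rev_ord_inj /wsigma_inj /rev_ord_inj /wsigma_inj. Qed.

Lemma wl1_fun_rev i : wl1_fun (rev_ord i) = rev_ord (wl1_fun i).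
Proof.
apply: val_inj => /=; have := ltn_ord i; move: (nat_of_ord i) => a ha.
set c := if a == 0 then _ else _.
have hc : [\/ a = 0 /\ c = l - 2, (0 < a <= l - 2) /\ c = a.-1 | l - 2 < a /\ c = a]%N.
  rewrite /c; case: (posnP a) => [|a0]; first by constructor 1.
  by case: leqP => ?; [constructor 2|constructor 3]; split => //; lia.
move: (c) hc => {}c hc.
set b := (2 * l - a.+1)%N; set d := if b == 0 then _ else _.
have hd : [\/ b = 0 /\ d = l - 2, (0 < b <= l - 2) /\ d = b.-1 | l - 2 < b /\ d = b]%N.
  rewrite /d; case: (posnP b) => [|b0]; first by constructor 1.
  by case: leqP => ?; [constructor 2|constructor 3]; split => //; lia.
move: (d) hd => {}d hd.
have [e|e] := posnP (2 * l - d.+1)%N; have [e'|e'] := posnP (2 * l - c.+1)%N;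
  rewrite /b ?e ?e' ?eqxx ?(gtn_eqF e) ?(gtn_eqF e');
  case: hc => -[hc1 hc2]; case: hd => -[hd1 hd2]; try (exfalso; lia);
  by case_ifs; lia.
Qed.

Lemma wl1_fun_pos a : wl1_fun (pos a) = pos0 a.
Proof. by apply: val_inj; case: a => [[|[|[|[|?]]]] ?] //=; case_ifs; lia. Qed.

Lemma wl1_monomial : wl1 F l = monomial_mx wl1_fun (fun=> 1).
Proof. by apply/matrixP => i j; rewrite (wl1E F hl) mxE mulr1. Qed.

(** Moves [wl1] past the embedded SO_3, so that the block acts on the coordinates of [g_chi]. There
    membership in the inducing group can be read from entries. *)
Lemma wl1_emb (X : 'M[F]_4) : wl1 F l *m embmx pos0 X = embmx pos X *m wl1 F l.
Proof.
have e1 : wl1 F l *m selmx F pos0 = selmx F pos.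
  apply/matrixP => i b; rewrite wl1_monomial monomial_mulmx mul1r !mxE -wl1_fun_pos.
  by rewrite (inj_eq wl1_fun_inj).
have e2 : (selmx F pos)^T *m wl1 F l = (selmx F pos0)^T.
  rewrite wl1_monomial; apply/matrixP => a j; rewrite mxE (bigD1 (pos a)) //=.
  rewrite !mxE eqxx mul1r mulr1 wl1_fun_pos big1 ?addr0 //.
  by move=> i /negPf ni; rewrite !mxE ni mul0r.
by rewrite /embmx mulmxDl mulmxDr mul1mx mulmx1 !mulmxA e1 -!mulmxA e2.
Qed.

Lemma wl1_SO2l : SO2l (wl1 F l).
Proof.
pose A := monomial_mx (F := F) wsigma (fun=> 1).
have AtA : A *m A^T = 1%:M.
  apply/matrixP => i j; rewrite monomial_mulmx mul1r !mxE mulr1.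
  by rewrite (inj_eq (@wsigma_inj _ hl)).
have wA : wl1 F l = A *m (J *m A *m J).
  apply/matrixP => i j; rewrite (wl1E F hl) monomial_mulmx mul1r mulmx_anti anti_mulmx mxE mulr1.
  by rewrite -(inj_eq rev_ord_inj) rev_ordK.
split.
  have A2 : \det A * \det A = 1 by rewrite -[X in _ * X]det_tr -det_mulmx AtA det1.
  have J2 : \det J * \det J = 1 by rewrite -det_mulmx J_anti_sq det1.
  by rewrite wA !det_mulmx [\det J * _ * _]mulrAC J2 mul1r A2.
have wJ : wl1 F l *m J *m (wl1 F l)^T = J.
  apply/matrixP => i j; rewrite wl1_monomial -mulmxA monomial_mulmx mul1r anti_mulmx.
  by rewrite J_antiE !mxE mulr1 -wl1_fun_rev (inj_eq wl1_fun_inj) eq_sym.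
have wu : wl1 F l \in unitmx.
  have := congr1 determinant wJ; rewrite !det_mulmx => e.
  rewrite unitmxE unitfE; apply/eqP => w0.
  have := @J_anti_unit R F l; rewrite unitmxE unitfE -e w0 !mul0r eqxx.
  by [].
have e : invmx (wl1 F l) = J *m (wl1 F l)^T *m J.
  by rewrite -[RHS](mulKmx wu) 2!(mulmxA (wl1 F l)) wJ J_anti_sq mulmx1.
have : (J *m (wl1 F l)^T *m J) *m wl1 F l = 1%:M by rewrite -e mulVmx.
move=> /(congr1 (mulmx J)); rewrite !mulmxA J_anti_sq mul1mx mulmx1.
by [].
Qed.

Lemma diag_SO2l (d : 'I_(2 * l) -> F) : (forall i, d i != 0) ->
  (forall i, d (rev_ord i) = (d i)^-1) -> SO2l (monomial_mx id d).
Proof.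
(* [e] keeps only the first half of [d]. The diagonal matrix is then D J D^-1 J, whose determinant
   is visibly 1. *)
move=> d0 dr; pose e i : F := if (i < l)%N then d i else 1.
have e0 i : e i != 0 by rewrite /e; case: ifP => _; rewrite ?d0 ?oner_eq0.
pose D := monomial_mx (F := F) (l := l) id e.
pose D' := monomial_mx (F := F) (l := l) id (fun i => (e i)^-1).
have DD' : D *m D' = 1%:M.
  apply/matrixP => i j; rewrite monomial_mulmx !mxE eq_sym.
  by case: eqP => [->|_]; rewrite ?mul0r ?mulr0 // mul1r mulfV.
have [Du _] := mulmx1_unit DD'.
have D'E : D' = invmx D by rewrite -[LHS](mulKmx Du) DD' mulmx1.
have tE : monomial_mx id d = D *m J *m invmx D *m J.
  apply/matrixP => i j; rewrite -D'E mulmx_anti -!mulmxA monomial_mulmx anti_mulmx !mxE.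
  rewrite (inj_eq rev_ord_inj); case: eqP => _; rewrite ?mul0r ?mulr0 // !mul1r.
  rewrite /e /=; case: (ltnP i l) => h.
    by rewrite ifF ?invr1 ?mulr1 //; apply/negbTE; rewrite -leqNgt; lia.
  by rewrite ifT ?dr ?invrK ?mul1r //; have := ltn_ord i; lia.
split; first by rewrite tE det_levi_anti.
apply/matrixP => i j; rewrite mulmx_monomial // mulmx_anti J_antiE !mxE.
have -> : (j == rev_ord i) = (i == rev_ord j) by rewrite -(inj_eq rev_ord_inj) rev_ordK eq_sym.
by case: eqP => _; rewrite ?mul0r // mul1r dr mulVf ?d0.
Qed.

(** Neighbouring entries of the first half have ratio -1, which inverts the character. The middle
    entries 4 and 1/4, next to -1, turn the coefficients 1 and alpha of the affine character into
    -1/4 and -4 alpha = gam, the negatives of those in [psi_U]. The second half is forced by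
    orthogonality. *)
Definition tfun i : F :=
  if (i < l.-1)%N then (-1) ^+ (l.-1 - i) else
  if (i == l.-1 :> nat) then 4%:R else
  if (i == l :> nat) then 4%:R^-1 else (-1) ^+ (l.-1 - rev_ord i).

Lemma four_neq0 : 4%:R != 0 :> F.
Proof. by apply/padic_natr_neq0. Qed.

Lemma two_neq0 : 2%:R != 0 :> F.
Proof. by apply/padic_natr_neq0. Qed.

Lemma tfun_neq0 i : tfun i != 0.
Proof.
rewrite /tfun; case: ifP => _; first by rewrite signr_eq0.
case: ifP => _; first exact: four_neq0.
by case: ifP => _; rewrite ?invr_eq0 ?four_neq0 ?signr_eq0.
Qed.

Lemma tfun_rev i : tfun (rev_ord i) = (tfun i)^-1.
Proof.
rewrite /tfun rev_ordK /=; have := ltn_ord i => hi.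
case_ifs; first [exfalso; lia | by [] | by rewrite invrK | by rewrite invr_sign].
Qed.

Lemma tfun_ratio i j : i.+1 = j :> nat -> (j < l.-1)%N -> tfun i / tfun j = -1.
Proof.
move=> ij jl; rewrite /tfun jl ifT; last by lia.
rewrite (_ : (l.-1 - i = (l.-1 - j).+1)%N); last by lia.
by rewrite exprS mulfK // signr_eq0.
Qed.

Lemma tfun_before i : i = (l - 2)%N :> nat -> tfun i = -1.
Proof.
move=> e; rewrite /tfun ifT; last by lia.
by rewrite (_ : (l.-1 - i = 1)%N) ?expr1 //; lia.
Qed.

Lemma tfun_mid1 i : i = l.-1 :> nat -> tfun i = 4%:R.
Proof. by move=> e; rewrite /tfun e ltnn eqxx. Qed.

Lemma tfun_mid2 i : i = l :> nat -> tfun i = 4%:R^-1.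
Proof.
have p : (l.-1 < l)%N by lia.
by move=> e; rewrite /tfun e ltnNge (ltnW p) /= (gtn_eqF p) eqxx.
Qed.

(* Conjugation by this diagonal matrix matches the affine character with the
   inverse of [psi_U]. *)
Definition tmx : 'M[F]_(2 * l) := monomial_mx id tfun.

Lemma tmx_mulmx M i j : (tmx *m M) i j = tfun i * M i j.
Proof. exact: monomial_mulmx. Qed.

Lemma tmx_SO2l : SO2l tmx.
Proof. by apply: diag_SO2l tfun_rev; exact: tfun_neq0. Qed.

Definition tconj M := tmx *m M *m invmx tmx.

Lemma tmx_unit : tmx \in unitmx.
Proof. exact: SO_unitmx tmx_SO2l. Qed.

Lemma tconjE M i j : tconj M i j = tfun i * M i j / tfun j.
Proof.
rewrite /tconj (_ : invmx tmx = monomial_mx id (fun i => (tfun i)^-1)).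
  by rewrite mulmx_monomial // tmx_mulmx.
apply: (can_inj (mulKmx tmx_unit)); rewrite mulmxV ?tmx_unit //.
apply/matrixP => a b; rewrite monomial_mulmx !mxE eq_sym.
by case: eqP => _; rewrite ?mul0r ?mulr0 // mul1r mulfV ?tfun_neq0.
Qed.

Lemma tconjM M M' : tconj (M *m M') = tconj M *m tconj M'.
Proof. by rewrite /tconj !mulmxA mulmxKV ?tmx_unit. Qed.

Lemma tconj_SO2l M : SO2l M -> SO2l (tconj M).
Proof. by move=> h; apply: SO_mul (SO_inv tmx_SO2l); apply: SO_mul h; apply: tmx_SO2l. Qed.

End WeylTorus.

(** * The inducing group *)

Section InducingGroup.
Context (R : realType) (F : padicField R) (l : nat).
Hypothesis hl : (2 < l)%N.
Local Notation N := (2 * l)%N.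
Local Notation q := ((resq F)%:R : R).
Implicit Types (i j k : 'I_(2 * l)) (M : 'M[F]_(2 * l)).
Local Notation pos := (pos hl).

Variables (varpi alpha : F).

Local Notation H := (inducing_group (l := l) varpi alpha).
Local Notation g := (g_chi l varpi alpha).

(* The affine Weyl element g_chi, as a permutation of coordinates up to scalars. *)
Fact gperm_subproof i : ((if i == 0 :> nat then N.-1 else if i == N.-1 :> nat then 0
  else if i == l.-1 :> nat then l else if i == l :> nat then l.-1 else i) < 2 * l)%N.
Proof. by have := ltn_ord i; case_ifs; lia. Qed.
Definition gperm i : 'I_(2 * l) := Ordinal (gperm_subproof i).

Definition gcoef i : F :=
  if i == 0 :> nat then - varpi^-1 else if i == N.-1 :> nat then - varpi
  else if i == l.-1 :> nat then alpha^-1 else if i == l :> nat then alpha else 1.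

(** A case view of [gperm] and [gcoef], which gives linear hypotheses on positions in place of
    nested conditionals. *)
Inductive gperm_spec (i : nat) : nat -> F -> Prop :=
| GpermFirst of i = 0%N : gperm_spec i N.-1 (- varpi^-1)
| GpermLast of i = N.-1 : gperm_spec i 0 (- varpi)
| GpermMid1 of i = l.-1 : gperm_spec i l alpha^-1
| GpermMid2 of i = l : gperm_spec i l.-1 alpha
| GpermOther of i <> 0%N & i <> N.-1 & i <> l.-1 & i <> l : gperm_spec i i 1.

Lemma gpermP i : gperm_spec i (gperm i) (gcoef i).
Proof.
rewrite /gperm /gcoef /=.
case: eqVneq => e0; first by constructor.
case: eqVneq => e1; first by constructor.
case: eqVneq => e2; first by constructor.
case: eqVneq => e3; first by constructor.
by constructor; apply/eqP.
Qed.

Opaque gperm.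

Lemma gpermK : involutive gperm.
Proof.
move=> i; apply: val_inj => /=; case: (gpermP (gperm i)); case: (gpermP i) => *; lia.
Qed.

Lemma g_chi_monomial : g = monomial_mx gperm gcoef.
Proof.
apply/matrixP => i j; rewrite !mxE -val_eqE /=.
have := ltn_ord i; have := ltn_ord j => hj hi.
case: (gpermP i) => [e|e|e|e|e0 e1 e2 e3]; case_ifs; try (exfalso; lia).
all: try by rewrite (_ : (nat_of_ord j == _) = true) ?mul1r //; lia.
all: try by rewrite mulr1; congr ((_ : bool)%:R); lia.
all: rewrite (_ : (i.+1 == j.+1) && _ = false); [|lia].
all: by rewrite (_ : (nat_of_ord j == _) = false) ?mul0r //; lia.
Qed.

Lemma g_chi_mul M i j : (g *m M) i j = gcoef i * M (gperm i) j.
Proof. by rewrite g_chi_monomial monomial_mulmx. Qed.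

Lemma gperm_first i : i = 0%N :> nat -> gperm i = N.-1 :> nat.
Proof. by case: (gpermP i) => *; lia. Qed.

Lemma gperm_last i : i = N.-1 :> nat -> gperm i = 0%N :> nat.
Proof. by case: (gpermP i) => *; lia. Qed.

Lemma gperm_lt_first i j : i = 0%N :> nat -> j != 0%N :> nat -> j != N.-1 :> nat ->
  (gperm j < gperm i)%N.
Proof.
move=> /gperm_first -> /eqP j0 /eqP j1; have := ltn_ord j.
by case: (gpermP j) => *; lia.
Qed.

Lemma gperm_lt_last i j : j = N.-1 :> nat -> i != 0%N :> nat -> i != N.-1 :> nat ->
  (gperm j < gperm i)%N.
Proof.
move=> /gperm_last -> /eqP i0 /eqP i1; have := ltn_ord i.
by case: (gpermP i) => *; lia.
Qed.

(** Away from the first and last coordinates only the transposition of the two middle ones reverses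
    an order. *)
Lemma gperm_lt i j : (j < i)%N -> i != 0%N :> nat -> i != N.-1 :> nat ->
  j != 0%N :> nat -> j != N.-1 :> nat -> ~ (gperm i = l.-1 :> nat /\ gperm j = l :> nat) ->
  (gperm j < gperm i)%N.
Proof.
move=> ji /eqP i0 /eqP i1 /eqP j0 /eqP j1 e; have := ltn_ord i; have := ltn_ord j => hj hi.
case: (gpermP i) e => [?|?|?|?|? ? ? ?]; case: (gpermP j) => [?|?|?|?|? ? ? ?] e;
  try (exfalso; clear e; lia); try (clear e; lia).
by case: e.
Qed.

(* Halving the isotropy relation of a column, so that it also yields a bound in
   residue characteristic 2. *)
Lemma SO2l_isotropic M j : SO2l M ->
  \sum_(k : 'I_(2 * l) | (k < l)%N) M k j * M (rev_ord k) j = 0.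
Proof.
move=> MS; have := SO2l_col j j MS.
rewrite (_ : (j == rev_ord j) = false); last first.
  by apply/eqP => /(congr1 val) /=; have := ltn_ord j; lia.
rewrite (bigID (fun k : 'I_(2 * l) => k < l)%N) /=.
rewrite [X in _ + X](reindex_inj rev_ord_inj) /=.
have -> : \sum_(k : 'I_(2 * l) | ~~ (rev_ord k < l)%N) M (rev_ord k) j * M (rev_ord (rev_ord k)) j =
    \sum_(k : 'I_(2 * l) | (k < l)%N) M k j * M (rev_ord k) j.
  apply: eq_big => [k|k _]; first by have := ltn_ord k; rewrite /=; lia.
  by rewrite rev_ordK mulrC.
move: (\sum_(k < _ | _) _) => S; rewrite (_ : S + S = 2%:R * S); last by ring.
by move/eqP; rewrite mulf_eq0 (negPf (two_neq0 F)) => /eqP.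
Qed.

Hypothesis hvarpi : uniformizer varpi.
Hypothesis halpha : absp alpha = 1.

Let varpi0 : varpi != 0. Proof. exact: uniformizer_neq0. Qed.
Let alpha0 : alpha != 0. Proof. by rewrite -absp_gt0 halpha. Qed.

Lemma gcoef_gperm i : gcoef i * gcoef (gperm i) = 1.
Proof.
case: (gpermP (gperm i)); case: (gpermP i) => *;
  by [exfalso; lia | rewrite mulr1 | field].
Qed.

Lemma g_chi_conjE M i j :
  (g *m M *m g) i j = gcoef i * M (gperm i) (gperm j) / gcoef j.
Proof.
rewrite [in X in _ *m X]g_chi_monomial (mulmx_monomial _ _ _ _ gpermK) g_chi_mul.
congr (_ * _); have c0 : gcoef j != 0.
  by apply: contra_eq_neq (gcoef_gperm j) => ->; rewrite mul0r eq_sym oner_eq0.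
by apply: (mulfI c0); rewrite gcoef_gperm mulfV.
Qed.

Lemma g_chi_sq : g *m g = 1%:M.
Proof.
apply/matrixP => i j; rewrite g_chi_mul [in LHS]g_chi_monomial !mxE gpermK.
case: eqP => [->|ne]; last by rewrite mul0r mulr0 (introF eqP) // => e; case: ne.
by rewrite mul1r gcoef_gperm eqxx.
Qed.

(* SO_4 block matrix of g_chi at the positions 1, l, l+1, 2l. *)
Definition g4 : 'M[F]_4 := mx_rows 4 [:: [:: 0; 0; 0; - varpi^-1];
  [:: 0; 0; alpha^-1; 0]; [:: 0; alpha; 0; 0]; [:: - varpi; 0; 0; 0]].

Lemma g_chi_embmx : g = embmx pos g4.
Proof.
rewrite g_chi_monomial; apply/matrixP => i j; rewrite mxE.
have [[a ->]|ni] := pos_cases hl i; last first.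
  rewrite embmx_outl // -!val_eqE /= eq_sym; move: (ni 0) (ni 1) (ni 2%:R) (ni 3%:R).
  by rewrite -!val_eqE /=; case: (gpermP i) => *; rewrite ?mulr1 //; exfalso; lia.
have [[b ->]|nj] := pos_cases hl j; last first.
  rewrite embmx_outr // // (_ : (pos a == j) = false); last by rewrite eq_sym (negPf (nj a)).
  rewrite (_ : (j == _) = false) ?mul0r //.
  apply/eqP => e; move: (nj 0) (nj 1) (nj 2%:R) (nj 3%:R); rewrite e -!val_eqE /= {nj e}.
  by case: (gpermP (pos a)); case: a => [[|[|[|[|?]]]] ?] /=; lia.
rewrite (embmx_in (@pos_inj _ hl)) !mxE -val_eqE.
case: a b => [[|[|[|[|?]]]] ?] [[|[|[|[|?]]]] ?] //=; case: (gpermP (pos _)) => /= *;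
  try (exfalso; lia).
all: rewrite ?eqxx ?mul1r //.
all: by rewrite (_ : (_ == _ :> nat) = false) ?mul0r //; lia.
Qed.

Lemma absp_gcoef i : absp (gcoef i) =
  if i == 0 :> nat then q else if i == N.-1 :> nat then q^-1 else 1.
Proof.
rewrite /gcoef; case: ifP => _; first by rewrite abspN abspV hvarpi invrK.
case: ifP => _; first by rewrite abspN hvarpi.
case: ifP => _; first by rewrite abspV halpha invr1.
by case: ifP => _; rewrite ?halpha ?absp1.
Qed.

Lemma absp_lt1V (x : F) : absp x < 1 -> absp x <= q^-1.
Proof. by rewrite -hvarpi; apply: absp_lt1. Qed.

Lemma qV_lt1 : q^-1 < 1.
Proof. by rewrite invf_lt1 ?q_gt0 ?q_gt1. Qed.

Lemma qV_gt0 : 0 < q^-1.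
Proof. by rewrite invr_gt0 q_gt0. Qed.

(** Isotropy of the first column expresses the corner, up to a unit, by products of two entries
    below the diagonal. Both powers of q are needed: conjugation by [g_chi] multiplies the absolute
    value of the corner by q^2. *)
Lemma iwahori_corner M (i j : 'I_(2 * l)) : iwahori_plus M ->
  i = N.-1 :> nat -> j = 0%N :> nat -> absp (M i j) <= q^-1 ^+ 2.
Proof.
move=> [[MS Mi Ml] Md] i1 j0.
have rj : rev_ord j = i by apply: val_inj => /=; lia.
have := SO2l_isotropic j MS; rewrite (bigD1 j) //=; last by rewrite j0; lia.
move/eqP; rewrite addr_eq0 rj => /eqP e.
have -> : absp (M i j) = absp (M j j * M i j) by rewrite abspM (absp_unit1 (Md j)) mul1r.
rewrite e abspN; apply: absp_le_sum => [|k /andP[kl kj]].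
  by rewrite exprn_ge0 // ltW // qV_gt0.
have kj' : (k : nat) <> j by move=> h; rewrite (val_inj h) eqxx in kj.
rewrite abspM expr2 ler_pM ?absp_ge0 //; apply: absp_lt1V; apply: Ml => /=.
  by lia.
by have := ltn_ord k; lia.
Qed.

(** Conjugation by [g_chi] brings this entry below the diagonal. It is small because isotropy of its
    column leaves only products that contain an entry below the diagonal. *)
Lemma iwahori_middle M (i j : 'I_(2 * l)) : iwahori_plus M ->
  i = l.-1 :> nat -> j = l :> nat -> absp (M i j) < 1.
Proof.
move=> [[MS Mi Ml] Md] i1 j0.
have rj : rev_ord i = j by apply: val_inj => /=; lia.
have := SO2l_isotropic j MS; rewrite (bigD1 i) //=; last by rewrite i1; lia.
move/eqP; rewrite addr_eq0 rj => /eqP e.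
have -> : absp (M i j) = absp (M i j * M j j) by rewrite abspM (absp_unit1 (Md j)) mulr1.
rewrite e abspN; apply: absp_lt_sum => // k /andP[kl kj].
have kj' : (k : nat) <> i by move=> h; rewrite (val_inj h) eqxx in kj.
have h : absp (M (rev_ord k) j) < 1 by apply: Ml => /=; have := ltn_ord k; lia.
by rewrite abspM (le_lt_trans _ h) // ler_piMl ?absp_ge0.
Qed.

(** Conjugation permutes the positions and rescales the first and last rows and columns. The corner
    and the middle entry need the orthogonality relations; elsewhere a factor q falls only on
    entries that come from below the diagonal. *)
Lemma g_chi_normalizes M : SO2l g -> iwahori_plus M -> iwahori_plus (g *m M *m g).
Proof.
move=> gS MI; have corner := iwahori_corner MI; have middle := iwahori_middle MI.
case: (MI) => [[MS Mi Ml] Md].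
have q0 := q_gt0 F; have qn0 := q_neq0 F; have q1 := qV_lt1; have q2 := qV_gt0.
have sm (x : F) : absp x < 1 -> q * absp x <= 1.
  by move=> /absp_lt1V h; rewrite -ler_pdivlMl // mulr1.
have aE i j : absp ((g *m M *m g) i j) =
    absp (gcoef i) * absp (M (gperm i) (gperm j)) / absp (gcoef j).
  by rewrite g_chi_conjE abspf abspM.
have diag i : (g *m M *m g) i i = M (gperm i) (gperm i).
  rewrite g_chi_conjE mulrAC mulfV ?mul1r //.
  by apply: contra_eq_neq (gcoef_gperm i) => ->; rewrite mul0r eq_sym oner_eq0.
split; last by move=> i; rewrite diag.
have lower i j : (j < i)%N -> absp ((g *m M *m g) i j) < 1.
  move=> ji; rewrite aE !absp_gcoef; have := ltn_ord i; have := ltn_ord j => hj hi.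
  move: (Ml (gperm i) (gperm j)) (Mi (gperm i) (gperm j)) (middle (gperm i) (gperm j)).
  move: (absp (M _ _)) (absp_ge0 (M (gperm i) (gperm j))) => x x0 hl1 hx hm.
  have [i0|i0] := eqVneq (nat_of_ord i) 0%N; first by rewrite i0 in ji.
  have [j1|j1] := eqVneq (nat_of_ord j) N.-1; first by exfalso; clear -ji hi j1 hl; lia.
  have [i1|i1] := eqVneq (nat_of_ord i) N.-1; have [j0|j0] := eqVneq (nat_of_ord j) 0%N.
  - apply: le_lt_trans q1; rewrite ler_pdivrMr // mulVf //.
    exact: (mulr_ile1 (ltW q2) x0 (ltW qV_lt1) hx).
  - by rewrite divr1 (le_lt_trans _ q1) // ler_piMr // ltW.
  - by rewrite mul1r (le_lt_trans _ q1) // ler_pdivrMr // mulVf.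
  rewrite mul1r divr1.
  have [e|e] := pselect (gperm i = l.-1 :> nat /\ gperm j = l :> nat); first by apply: hm; case: e.
  exact: hl1 (gperm_lt ji i0 i1 j0 j1 e).
split=> //; first exact: SO_mul (SO_mul gS MS) gS.
move=> i j; have [ji|ij|/val_inj e] := ltngtP j i; first exact/ltW/lower; last first.
  by rewrite e diag Mi.
rewrite aE !absp_gcoef; have := ltn_ord i; have := ltn_ord j => hj hi.
move: (Ml (gperm i) (gperm j)) (Mi (gperm i) (gperm j)) (corner (gperm i) (gperm j)).
move: (sm (M (gperm i) (gperm j))).
move: (absp (M _ _)) (absp_ge0 (M (gperm i) (gperm j))) => x x0 smx hl1 hx hc.
have [i1|i1] := eqVneq (nat_of_ord i) N.-1; first by exfalso; clear -ij hj i1 hl; lia.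
have [j0|j0] := eqVneq (nat_of_ord j) 0%N; first by exfalso; clear -ij j0; lia.
have [i0|i0] := eqVneq (nat_of_ord i) 0%N; have [j1|j1] := eqVneq (nat_of_ord j) N.-1.
- rewrite invrK -ler_pdivlMr // mul1r -ler_pdivlMl // -expr2.
  exact: hc (gperm_first i0) (gperm_last j1).
- by rewrite divr1; apply: smx; apply: hl1; apply: gperm_lt_first.
- by rewrite invrK mul1r mulrC; apply: smx; apply: hl1; apply: gperm_lt_last.
by rewrite mul1r divr1.
Qed.

Lemma det_g4 : \det g4 = 1.
Proof.
rewrite (expand_det_row _ ord0) !big_ord_recl big_ord0 /cofactor !mxE /=.
do 3![rewrite ?(mul0r, add0r, addr0) (expand_det_row _ ord0) !big_ord_recl big_ord0 /cofactor !mxE /=].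
rewrite ?(mul0r, add0r, addr0) det_mx00 /bump /=.
rewrite !(add0n, addn0, add1n) !exprS !expr0; field.
by rewrite alpha0 varpi0.
Qed.

Lemma g4_form : g4^T *m J4 F *m g4 = J4 F.
Proof.
by apply: matrix4P; split; rewrite mulmx4E !mulmx_J4 !mxE /=; field; rewrite ?varpi0 ?alpha0.
Qed.

Lemma g_chi_SO2l : SO2l g.
Proof. by rewrite g_chi_embmx; apply: SO2l_embmx det_g4 g4_form; [exact: pos_inj|exact: rev_pos]. Qed.

(* A unipotent element linking the coordinates 1, l, l + 1 and 2l. *)
Definition link4 : 'M[F]_4 := mx_rows 4 [:: [:: 1; 1; 1; -1];
  [:: 0; 1; 0; -1]; [:: 0; 0; 1; -1]; [:: 0; 0; 0; 1]].

Lemma link_SO2l : SO2l (embmx pos link4).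
Proof.
apply: SO2l_embmx; [exact: pos_inj|exact: rev_pos|..].
  rewrite -det_tr det_trig.
    by rewrite !big_ord_recl big_ord0 !mxE /= !mulr1.
  by apply/is_trig_mxP; case=> [[|[|[|[|?]]]] ?] // [[|[|[|[|?]]]] ?] //; rewrite !mxE.
by apply: matrix4P; split; rewrite mulmx4E !mulmx_J4 !mxE /=; ring.
Qed.

(** The entries of [d] have pairwise different absolute values, so whatever commutes with this
    diagonal element is diagonal. *)
Lemma center2l_diag M i j : center2l M -> i != j -> M i j = 0.
Proof.
move=> [MS Mc] nij.
pose d i : F := if (i < l)%N then varpi ^+ (l - i) else varpi ^- (l - rev_ord i).
have d0 k : d k != 0 by rewrite /d; case: ifP => _; rewrite ?invr_eq0 expf_neq0.
have dr k : d (rev_ord k) = (d k)^-1.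
  rewrite /d rev_ordK; have := ltn_ord k => hk /=.
  by case: (ltnP k l) => h; [rewrite ifF|rewrite ifT ?invrK] => //; lia.
have da k : absp (d k) = q ^ (if (k < l)%N then - (l - k)%N%:Z else (l - rev_ord k)%N%:Z).
  rewrite /d; case: ifP => _; first by rewrite exprnP absp_unif.
  by rewrite abspV exprnP absp_unif // invr_expz opprK.
have := Mc _ (diag_SO2l hl d0 dr); move/matrixP/(_ i j).
rewrite mulmx_monomial // monomial_mulmx mulrC => /eqP.
rewrite -subr_eq0 -mulrBl mulf_eq0 subr_eq0 => /orP[/eqP e|/eqP//].
exfalso; have := congr1 (@absp R F) e; rewrite !da => /qz_inj.
move: nij; rewrite -val_eqE /=; have := ltn_ord i; have := ltn_ord j.
by case: ifP; case: ifP; lia.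
Qed.

Lemma center2l_wl1 M i : center2l M -> M (wl1_fun hl i) (wl1_fun hl i) = M i i.
Proof.
move=> [MS Mc]; have := Mc _ (wl1_SO2l F hl) => /matrixP/(_ i (wl1_fun hl i)).
rewrite (wl1_monomial F hl) monomial_mulmx mul1r => <-.
rewrite mxE (bigD1 i) //= !mxE eqxx !mulr1 big1 ?addr0 // => k ki.
by rewrite !mxE (inj_eq (@wl1_fun_inj l hl)) eq_sym (negPf ki) mul0r mulr0.
Qed.

(** The first row of [link4] has no zero entry, so commuting with it equates all four diagonal
    entries with the first. *)
Lemma center2l_pos M a b : center2l M -> M (pos a) (pos a) = M (pos b) (pos b).
Proof.
move=> Mc; have [MS Mcc] := Mc.
have h c : M (pos c) (pos c) = M (pos 0) (pos 0); last by rewrite !h.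
have := Mcc _ link_SO2l => /matrixP/(_ (pos 0) (pos c)).
rewrite mxE (bigD1 (pos 0)) //= big1 ?addr0; last first.
  by move=> k k0; rewrite (center2l_diag Mc) ?mul0r // eq_sym.
rewrite [in X in _ = X]mxE (bigD1 (pos c)) //= big1 ?addr0; last first.
  by move=> k k0; rewrite (center2l_diag Mc k0) mulr0.
rewrite (embmx_in (@pos_inj _ hl)) !mxE.
by case: c => [[|[|[|[|?]]]] ?] //=; rewrite ?mulr1 ?mul1r ?mulrN1 ?mulN1r // => /oppr_inj.
Qed.

Lemma wl1_fun_small i : (0 < i <= l - 2)%N -> wl1_fun hl i = i.-1 :> nat.
Proof. by move=> h; rewrite /wl1_fun /=; case_ifs; lia. Qed.

(** [link4] equates the diagonal entries at [pos], and [wl1] propagates the first of them step by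
    step to the other coordinates and their mirror images. *)
Lemma center2l_scalar M : center2l M -> exists2 c : F, c ^+ 2 = 1 & M = c%:M.
Proof.
move=> Mc; have [MS Mcc] := Mc; pose c := M (pos 0) (pos 0).
have small i : (i <= l - 2)%N -> M i i = c /\ M (rev_ord i) (rev_ord i) = c.
  case: i => n; elim: n => [|n IH] hn /= hn2.
    have e0 : Ordinal hn = pos 0 by apply: val_inj.
    split; first by rewrite e0.
    rewrite (_ : rev_ord _ = pos 3%:R) ?(center2l_pos 3%:R 0) //.
    by apply: val_inj => /=; lia.
  have hn' : (n < 2 * l)%N by lia.
  have e : wl1_fun hl (Ordinal hn) = Ordinal hn'.
    by apply: val_inj; apply: wl1_fun_small => /=; lia.
  have [] := IH hn' _; first by rewrite /=; lia.
  rewrite -e -wl1_fun_rev !(center2l_wl1 _ Mc).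
  by [].
have all i : M i i = c.
  have [h|h] := leqP i (l - 2); first by have [] := small i h.
  have [h'|h'] := leqP (rev_ord i) (l - 2).
    by have [] := small _ h'; rewrite rev_ordK.
  have [e|e] : i = pos 1 \/ i = pos 2%:R.
    have := ltn_ord i; move: h h' => /=.
    have [h1|h1] := eqVneq (nat_of_ord i) l.-1; first by left; apply: val_inj.
    by right; apply: val_inj => /=; lia.
  - by rewrite e (center2l_pos _ 0).
  - by rewrite e (center2l_pos _ 0).
exists c.
  have := SO2l_col (pos 0) (pos 3%:R) MS.
  rewrite (_ : (pos 3%:R == rev_ord (pos 0)) = true); last by rewrite rev_pos; apply/eqP; congr pos; apply: val_inj.
  rewrite (bigD1 (pos 0)) //= big1 ?addr0; last first.
    by move=> k k0; rewrite (center2l_diag Mc) ?mul0r.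
  rewrite (_ : rev_ord (pos 0) = pos 3%:R); last by rewrite rev_pos; congr pos; apply: val_inj.
  by rewrite !all -expr2.
apply/matrixP => i j; rewrite !mxE; case: eqP => [->|/eqP ne]; first by rewrite all.
by rewrite (center2l_diag Mc).
Qed.

Lemma scalar_center (c : F) : c ^+ 2 = 1 -> center2l (c%:M : 'M[F]_(2 * l)).
Proof.
move=> c2; split; last by move=> M _; rewrite scalar_mxC.
by rewrite -scalemx1; apply: SO2l_scaledP c2 _; exact: SO1.
Qed.

Definition gpow (b : bool) : 'M[F]_(2 * l) := if b then g else 1%:M.

Lemma gpowM b b' : gpow b *m gpow b' = gpow (b (+) b').
Proof. by case: b b' => [] [] /=; rewrite ?g_chi_sq ?mulmx1 ?mul1mx. Qed.

Lemma gpow_SO2l b : SO2l (gpow b).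
Proof. by case: b; [exact: g_chi_SO2l|exact: SO1]. Qed.

Lemma gpow_normalizes b M : iwahori_plus M -> iwahori_plus (gpow b *m M *m gpow b).
Proof.
case: b => h /=; last by rewrite mul1mx mulmx1.
exact: g_chi_normalizes g_chi_SO2l h.
Qed.

(** The centre consists of scalars and [g_chi] is an involution, so a sign, a bit and an element of
    I^+ describe each element. *)
Lemma inducing_groupP M : H M <-> exists (c : F) b h,
  [/\ c ^+ 2 = 1, iwahori_plus h & M = c *: (gpow b *m h)].
Proof.
have gX (k : nat) : g ^+ k = gpow (odd k).
  elim: k => [|k IH] //=; rewrite exprS IH.
  by rewrite -[X in X * _]/(gpow true) -[_ * _]/(_ *m _) gpowM.
split=> [[z [k [h [/center2l_scalar[c c2 ->] hI ->]]]]|[c [b [h [c2 hI ->]]]]].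
  by exists c, (odd k), h; rewrite gX mul_scalar_mx scalemxAl.
exists c%:M, b, h; split => //; first exact: scalar_center.
by rewrite gX mul_scalar_mx scalemxAl; case: b.
Qed.

Lemma inducing_SO2l M : H M -> SO2l M.
Proof.
move=> /inducing_groupP[c [b [h [c2 [[hS _ _] _] ->]]]].
apply: SO2l_scaledP => //; exact: SO_mul (gpow_SO2l b) hS.
Qed.

Lemma inducing_unit M : H M -> M \in unitmx.
Proof. by move=> /inducing_SO2l; apply: SO_unitmx. Qed.

Lemma inducing1 : H 1%:M.
Proof.
apply/inducing_groupP; exists 1, false, 1%:M; split; rewrite ?expr1n //.
  exact: iwahori_plus1.
by rewrite scale1r /= mulmx1.
Qed.

Lemma inducing_iwahori M : iwahori_plus M -> H M.
Proof.
move=> h; apply/inducing_groupP; exists 1, false, M; split; rewrite ?expr1n //.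
by rewrite scale1r /= mul1mx.
Qed.

Lemma inducing_g : H g.
Proof.
apply/inducing_groupP; exists 1, true, 1%:M; split; rewrite ?expr1n //.
  exact: iwahori_plus1.
by rewrite scale1r /= mulmx1.
Qed.

Lemma inducingM M M' : H M -> H M' -> H (M *m M').
Proof.
move=> /inducing_groupP[c [b [h [c2 hI ->]]]] /inducing_groupP[c' [b' [h' [c2' hI' ->]]]].
apply/inducing_groupP; exists (c * c'), (b (+) b'), ((gpow b' *m h *m gpow b') *m h').
split; first by rewrite exprMn c2 c2' mulr1.
  exact: iwahori_plusM (gpow_normalizes b' hI) hI'.
rewrite -scalemxAl -scalemxAr scalerA; congr (_ *: _).
rewrite -gpowM !mulmxA -(mulmxA (gpow b) (gpow b') (gpow b')) gpowM addbb /=.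
by rewrite mulmx1.
Qed.

Lemma inducingV M : H M -> H (invmx M).
Proof.
move=> HM; have Mu := inducing_unit HM.
move: HM => /inducing_groupP[c [b [h [c2 hI ME]]]].
have hu := iwahori_plus_unit hI.
have MX : M *m (c *: (gpow b *m (gpow b *m invmx h *m gpow b))) = 1%:M.
  rewrite !mulmxA gpowM addbb /= mul1mx ME -scalemxAl -scalemxAr scalerA -expr2 c2 scale1r.
  by rewrite -!mulmxA (mulmxA h) mulmxV // mul1mx gpowM addbb.
rewrite -[invmx M]mulmx1 -MX (mulKmx Mu).
apply/inducing_groupP; exists c, b, (gpow b *m invmx h *m gpow b); split => //.
exact: gpow_normalizes (iwahori_plusV hI).
Qed.

Lemma inducing_mull M M' : H M -> H (M *m M') <-> H M'.
Proof.
move=> HM; split; last exact: inducingM.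
by move=> h; rewrite -(mulKmx (inducing_unit HM) M'); apply: inducingM => //; apply: inducingV.
Qed.

Lemma inducing_mulr M M' : H M' -> H (M *m M') <-> H M.
Proof.
move=> HM'; split; last by move=> h; apply: inducingM.
by move=> h; rewrite -(mulmxK (inducing_unit HM') M); apply: inducingM => //; apply: inducingV.
Qed.

End InducingGroup.

(** * The Whittaker functional *)

(** A sum over a set is 0 by convention when its support is infinite, so linearity needs finite
    supports. All sums are compared over the union of the two. *)
Lemma fsum_linear (T : choiceType) (K : idomainType) (S : set T) (f g : T -> K) (c : K) :
  finite_set (S `&` [set x | f x != 0]) -> finite_set (S `&` [set x | g x != 0]) ->
  \sum_(x \in S) (c * f x + g x) = c * \sum_(x \in S) f x + \sum_(x \in S) g x.
Proof.
move=> ff fg; pose P := (S `&` [set x | f x != 0]) `|` (S `&` [set x | g x != 0]).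
have Pfin : finite_set P by rewrite finite_setU.
have PS : P `<=` S by move=> x [] [].
have out x : (S `\` P) x -> f x = 0 /\ g x = 0.
  move=> [Sx nP]; split; apply/eqP/negPn/negP => h; apply: nP; [by left|by right].
rewrite -(@fsbig_widen _ _ _ _ P) //; last first.
  by move=> x /out[fx gx] /=; rewrite fx gx mulr0 addr0.
rewrite -[X in c * X + _](@fsbig_widen _ _ _ _ P) //; last by move=> x /out[].
rewrite -[X in _ + X](@fsbig_widen _ _ _ _ P) //; last by move=> x /out[].
by rewrite fsbig_split // mulr_fsumr.
Qed.

(** * Continuity of matrix products *)

Section MxConj.
Context (R : realType) (F : padicField R).

Lemma mx_mul2_near n (A B M : 'M[F]_n) (e : R) : 0 < e ->
  exists2 d : R, 0 < d &
    forall k : 'M[F]_n, mxnear M k d -> mxnear (A *m M *m B) (A *m k *m B) e.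
Proof.
move=> e0.
have [c c1 hc] : exists2 c : R, 0 < c & forall i j a b, absp (A i a) * absp (B b j) <= c.
  (* A crude bound for all the products at once: their sum, increased by 1 to be positive. *)
  exists (1 + \sum_i \sum_a \sum_b \sum_j absp (A i a) * absp (B b j)).
    rewrite ltr_wpDr // sumr_ge0 // => i _; rewrite sumr_ge0 // => a _.
    by rewrite sumr_ge0 // => b _; rewrite sumr_ge0 // => j _; rewrite mulr_ge0 ?absp_ge0.
  move=> i j a b; rewrite ler_wpDl //.
  have p x y z w : 0 <= absp (A x y) * absp (B z w) by rewrite mulr_ge0 ?absp_ge0.
  rewrite (bigD1 i) //= ler_wpDr ?sumr_ge0 // => [x _|].
    by rewrite sumr_ge0 // => y _; rewrite sumr_ge0 // => z _; rewrite sumr_ge0.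
  rewrite (bigD1 a) //= ler_wpDr ?sumr_ge0 // => [x _|].
    by rewrite sumr_ge0 // => y _; rewrite sumr_ge0.
  rewrite (bigD1 b) //= ler_wpDr ?sumr_ge0 // => [x _|]; first by rewrite sumr_ge0.
  by rewrite (bigD1 j) //= ler_wpDr ?sumr_ge0.
exists (e / c); first by rewrite divr_gt0.
move=> k kn i j.
have -> : (A *m k *m B) i j - (A *m M *m B) i j = (A *m (k - M) *m B) i j.
  by rewrite mulmxBr mulmxBl !mxE.
rewrite mxE; apply: absp_lt_sum => // b _; rewrite mxE big_distrl /=.
apply: absp_lt_sum => // a _; rewrite !abspM mulrAC.
have /le_lt_trans : absp (A i a) * absp (B b j) * absp ((k - M) a b) <=
    c * absp ((k - M) a b) by rewrite ler_wpM2r ?absp_ge0.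
apply; rewrite mulrC -ltr_pdivlMr //; have := kn a b.
by rewrite !mxE.
Qed.

Lemma mx_conj_near n (A B : 'M[F]_n) (e : R) : A *m B = 1%:M -> 0 < e ->
  exists2 d : R, 0 < d &
    forall k : 'M[F]_n, mxnear 1%:M k d -> mxnear 1%:M (A *m k *m B) e.
Proof. by move=> AB /(mx_mul2_near A B 1%:M); rewrite mulmx1 AB. Qed.

Lemma mx_mulr_near n (M B : 'M[F]_n) (e : R) : 0 < e ->
  exists2 d : R, 0 < d & forall k : 'M[F]_n, mxnear M k d -> mxnear (M *m B) (k *m B) e.
Proof.
move=> /(mx_mul2_near 1%:M B M)[d d0 hd]; exists d => // k /hd.
by rewrite !mul1mx.
Qed.

End MxConj.

(** * The upper triangular unipotent subgroup *)

Section Unipotent.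
Context (R : realType) (F : padicField R) (l : nat).
Local Notation U := (@U2l R F l).
Implicit Types (i j k : 'I_(2 * l)) (u v w : 'M[F]_(2 * l)).

Lemma U2lM u v : U u -> U v -> U (u *m v).
Proof.
move=> [uS uE] [vS vE]; split; first exact: SO_mul uS vS.
move=> i j ji; rewrite mxE.
have [e|ne] := eqVneq i j.
  subst j; rewrite (bigD1 i) //= uE // vE // eqxx mulr1 big1 ?addr0 // => k ki.
  have [ki'|ik|/val_inj e] := ltngtP k i; last by rewrite e eqxx in ki.
  - by rewrite uE ?(ltnW ki') // eq_sym (negPf ki) mul0r.
  - by rewrite vE ?(ltnW ik) // (negPf ki) mulr0.
apply: big1 => k _.
have [ki|ik] := ltnP k i; first by rewrite uE ?(ltnW ki) // -val_eqE /= gtn_eqF ?mul0r.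
rewrite vE ?(leq_trans ji) // -val_eqE /= gtn_eqF ?mulr0 //.
by apply: leq_trans ik; rewrite ltn_neqAle ji andbT eq_sym.
Qed.

Lemma U2lV u : U u -> U (invmx u).
Proof.
move=> [uS uE]; split; first exact: SO_inv uS.
move=> i j ji; rewrite SO2l_invE // uE.
  by rewrite (inj_eq rev_ord_inj) eq_sym.
by rewrite /=; have := ltn_ord i; have := ltn_ord j; lia.
Qed.

Lemma U2l_unit u : U u -> u \in unitmx.
Proof. by move=> [/SO_unitmx]. Qed.

Hypothesis hl : (2 < l)%N.

(** This position belongs to no root of SO_2l: in the isotropy relation of its column all other
    terms vanish. *)
Lemma U2l_mid w (i j : 'I_(2 * l)) : U w -> i = l.-1 :> nat -> j = l :> nat -> w i j = 0.
Proof.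
move=> [wS wE] hi hj; have := SO2l_isotropic hl j wS.
rewrite (bigD1 i) //=; last by rewrite hi; lia.
rewrite (_ : rev_ord i = j); last by apply: val_inj => /=; lia.
rewrite (wE j j) // eqxx mulr1 big1 ?addr0 // => k /andP[kl ki].
have hk : (k < l.-1)%N.
  have : (k : nat) != i by [].
  by rewrite hi; lia.
have jk : (j < rev_ord k)%N by rewrite /=; lia.
by rewrite [w (rev_ord k) j]wE ?(ltnW jk) // -val_eqE (gtn_eqF jk) mulr0.
Qed.

Lemma U2l_simpleM u v (i j : 'I_(2 * l)) : U u -> U v ->
  ((i.+1 = j) \/ (i = (l - 2)%N :> nat /\ j = l :> nat)) ->
  (u *m v) i j = u i j + v i j.
Proof.
move=> Uu Uv h; have uE := Uu.2; have vE := Uv.2.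
have ij : i != j by apply/eqP => e; move: h; rewrite e => -[]; lia.
rewrite mxE (bigD1 i) //= (bigD1 j) /=; last by rewrite eq_sym.
rewrite (uE i i) // eqxx mul1r (vE j j) // eqxx mulr1 [X in _ + (_ + X)]big1 ?addr0; first by rewrite addrC.
move=> k /andP[ki kj].
have [k1|k1|/val_inj e] := ltngtP k i; last by rewrite e eqxx in ki.
  by rewrite uE ?(ltnW k1) // eq_sym (negPf ki) mul0r.
have [k2|k2|/val_inj e] := ltngtP j k; last by rewrite e eqxx in kj.
  by rewrite vE ?(ltnW k2) // (negPf kj) mulr0.
case: h => [h|[hi hj]]; first by exfalso; lia.
by rewrite (U2l_mid Uv (i := k) (j := j)) ?mulr0 //; lia.
Qed.

End Unipotent.

(** * The compact induction and its Whittaker functional *)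

Section InducedRep.
Context (R : realType) (F : padicField R) (l : nat).
Hypothesis hl : (2 < l)%N.
Local Notation C := R[i].
Local Notation N := (2 * l)%N.
Local Notation q := ((resq F)%:R : R).
Implicit Types (i j k : 'I_(2 * l)) (M : 'M[F]_(2 * l)).
Local Notation pos := (pos hl).

Variables (varpi alpha : F) (psi : F -> C).
Hypothesis hvarpi : uniformizer varpi.
Hypothesis halpha : absp alpha = 1.
Hypothesis hpsi : additive_character_level1 psi.

Local Notation H := (inducing_group (l := l) varpi alpha).
Local Notation g := (g_chi l varpi alpha).

Lemma psiD x y : psi (x + y) = psi x * psi y.
Proof. by case: hpsi. Qed.

Lemma psi_small x : absp x < 1 -> psi x = 1.
Proof. by case: hpsi => _ h _; apply: h. Qed.

Lemma psi0 : psi 0 = 1.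
Proof. by rewrite psi_small // absp0. Qed.

Lemma psi_neq0 x : psi x != 0.
Proof.
apply/eqP => h; have := psiD x (- x); rewrite h mul0r subrr psi0.
by move/eqP; rewrite oner_eq0.
Qed.

Lemma psiN x : psi (- x) = (psi x)^-1.
Proof. by apply: (mulfI (psi_neq0 x)); rewrite -psiD subrr psi0 mulfV ?psi_neq0. Qed.

(* Positions of the simple affine roots, 0-indexed. *)
Definition simple_entry (i j : nat) : Prop :=
  [\/ j = i.+1 /\ (i.+1 < l)%N, i = (l - 2)%N /\ j = l | i = (2 * l - 2)%N /\ j = 0%N].

Definition affine_arg M : F :=
  \sum_(1 <= i < l) ent M i i.+1 + alpha * ent M l.-1 l.+1 + varpi^-1 * ent M N.-1 1.

Lemma affine_argE M : affine_character psi varpi alpha M = psi (affine_arg M).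
Proof. by []. Qed.

Lemma ent_lt (M : 'M[F]_(2 * l)) (i j : nat) (hi : (i.-1 < 2 * l)%N) (hj : (j.-1 < 2 * l)%N) :
  ent M i j = M (Ordinal hi) (Ordinal hj).
Proof. exact: ent_ord. Qed.

(** The bound is 1/q rather than 1 for the sake of the entry that the character multiplies by the
    inverse of the uniformizer. *)
Lemma affine_small M :
  (forall i j, simple_entry i j -> absp (M i j) < q^-1) ->
  affine_character psi varpi alpha M = 1.
Proof.
move=> h; rewrite affine_argE; apply: psi_small; rewrite /affine_arg.
have q1 := qV_lt1 F.
have hN : ((N.-1).-1 < 2 * l)%N by lia.
have h0 : (1.-1 < 2 * l)%N by lia.
have h1 : ((l.-1).-1 < 2 * l)%N by lia.
have h2 : ((l.+1).-1 < 2 * l)%N by lia.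
apply: absp_lt_add; first apply: absp_lt_add.
- rewrite big_nat; apply: absp_lt_sum => // k /andP[k1 k2].
  have hk : (k.-1 < 2 * l)%N by lia.
  have hk' : ((k.+1).-1 < 2 * l)%N by lia.
  rewrite (ent_lt _ hk hk'); apply: lt_trans q1; apply: h.
  by constructor 1 => /=; lia.
- rewrite abspM halpha mul1r (ent_lt _ h1 h2); apply: lt_trans q1; apply: h.
  by constructor 2 => /=; lia.
- rewrite abspM abspV hvarpi invrK (ent_lt _ hN h0) -ltr_pdivlMl ?q_gt0 // mulr1.
  by apply: h; constructor 3 => /=; lia.
Qed.

Lemma affine_zero M : (forall i j, simple_entry i j -> M i j = 0) ->
  affine_character psi varpi alpha M = 1.
Proof. by move=> h; apply: affine_small => i j /h ->; rewrite absp0 qV_gt0. Qed.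

Variables (eps : C) (omega chi : 'M[F]_(2 * l) -> C).
Hypothesis hchi : extended_character psi varpi alpha eps omega chi.

Lemma chiM x y : H x -> H y -> chi (x *m y) = chi x * chi y.
Proof. by case: hchi => h _ _ _; apply: h. Qed.

Lemma chi_iwahori h : iwahori_plus h -> chi h = affine_character psi varpi alpha h.
Proof. by case: hchi => _ hh _ _; apply: hh. Qed.

Lemma chi_g : chi g = eps.
Proof. by case: hchi. Qed.

Local Notation V := (compact_induction H chi).

Definition phi0 M : C := if `[< H M >] then chi M else 0.

Lemma phi0_in M : H M -> phi0 M = chi M.
Proof. by move=> h; rewrite /phi0 asboolT. Qed.

Lemma phi0_out M : ~ H M -> phi0 M = 0.
Proof. by move=> h; rewrite /phi0 asboolF. Qed.

Lemma phi0_mull h M : H h -> phi0 (h *m M) = chi h * phi0 M.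
Proof.
move=> Hh; have [HM|nM] := pselect (H M).
  by rewrite !phi0_in ?chiM //; apply/(inducing_mull hl hvarpi halpha _ Hh).
rewrite !phi0_out ?mulr0 // => /(inducing_mull hl hvarpi halpha _ Hh).
exact: nM.
Qed.

Lemma chi_ker_near : exists2 e : R, 0 < e &
  forall k : 'M[F]_(2 * l), SO2l k -> mxnear 1%:M k e -> H k /\ chi k = 1.
Proof.
have [e e0 he] := iwahori_plus_near F l.
exists (Num.min e q^-1); first by rewrite lt_min e0 qV_gt0.
move=> k kS kn.
have kI : iwahori_plus k.
  by apply: he => //; apply: mxnear_le kn; rewrite ge_min lexx.
split; first exact: inducing_iwahori.
rewrite chi_iwahori //; apply: affine_small => i j sij.
have := kn i j; rewrite mxE (_ : (i == j) = false) ?subr0.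
  by move/lt_le_trans; apply; rewrite ge_min lexx orbT.
apply/eqP => e1; move: sij; rewrite e1 => -[] [] *; have := ltn_ord j; lia.
Qed.

Definition phi_tr (g1 : 'M[F]_(2 * l)) M := phi0 (M *m g1).

(** Smoothness holds because [chi] is trivial near 1 and conjugation by [g1] is continuous. Modulo
    the inducing group the support is the single point [invmx g1]. *)
Lemma phi_tr_in g1 : SO2l g1 -> V (phi_tr g1).
Proof.
move=> g1S; have g1u := SO_unitmx g1S; have g1VS := SO_inv g1S.
split.
- move=> M nM; apply: phi0_out => /(inducing_SO2l hl hvarpi halpha) h; apply: nM.
  exact: SO_mulr g1S h.
- by move=> h M Hh MS; rewrite /phi_tr -mulmxA phi0_mull.
- apply/nbhs_mxP; have [e e0 he] := chi_ker_near.
  have [d d0 hd] := mx_conj_near (mulVmx g1u) e0.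
  exists d => // k kn kS M MS; rewrite /phi_tr.
  have [HK chiK] : H (invmx g1 *m k *m g1) /\ chi (invmx g1 *m k *m g1) = 1.
    by apply: he; [apply: SO_mul (SO_mul g1VS kS) g1S|exact: hd].
  have -> : M *m k *m g1 = (M *m g1) *m (invmx g1 *m k *m g1).
    by rewrite !mulmxA mulmxK.
  have [HM|nM] := pselect (H (M *m g1)).
    by rewrite !phi0_in ?(chiM HM HK) ?chiK ?mulr1 //; apply: inducingM HM HK.
  by rewrite !phi0_out // => /(inducing_mulr hl hvarpi halpha _ HK).
exists [set invmx g1]; split; [exact: compact_set1|by move=> _ ->|].
move=> M; have [HM|nM] := pselect (H (M *m g1)); last first.
  by rewrite /phi_tr phi0_out // eqxx.
by exists (M *m g1), (invmx g1); rewrite mulmxK.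
Qed.

Variable gam : F.
Hypothesis hgam : gam = - 4%:R * alpha.

Local Notation U := (@U2l R F l).
Local Notation t := (tmx F l).
Local Notation tconj := (@tconj R F l).

Definition psiU_arg (u : 'M[F]_(2 * l)) : F :=
  \sum_(1 <= i < l.-1) ent u i i.+1 + 4%:R^-1 * ent u l.-1 l - gam * ent u l.-1 l.+1.

Lemma psi_UE u : psi_U psi gam u = psi (psiU_arg u).
Proof. by []. Qed.

Lemma psi_UM u v : U u -> U v -> psi_U psi gam (u *m v) = psi_U psi gam u * psi_U psi gam v.
Proof.
move=> Uu Uv; rewrite !psi_UE -psiD; congr psi; rewrite /psiU_arg.
have h0 : ((l.-1).-1 < 2 * l)%N by lia.
have h1 : (l.-1 < 2 * l)%N by lia.
have h2 : ((l.+1).-1 < 2 * l)%N by lia.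
rewrite !(ent_lt _ h0 h1) !(ent_lt _ h0 h2).
rewrite !(U2l_simpleM hl Uu Uv); [|by right => /=; lia|by left => /=; lia].
have -> : \sum_(1 <= i < l.-1) ent (u *m v) i i.+1 =
    \sum_(1 <= i < l.-1) ent u i i.+1 + \sum_(1 <= i < l.-1) ent v i i.+1.
  rewrite -big_split /= [LHS]big_nat [RHS]big_nat; apply: eq_bigr => i /andP[i1 i2].
  have hi : (i.-1 < 2 * l)%N by lia.
  have hi' : ((i.+1).-1 < 2 * l)%N by lia.
  by rewrite !(ent_lt _ hi hi') (U2l_simpleM hl Uu Uv) //; left => /=; lia.
by ring.
Qed.

Lemma psi_U_neq0 (u : 'M[F]_(2 * l)) : psi_U psi gam u != 0.
Proof. exact: psi_neq0. Qed.

(** The compatibility that makes the Whittaker sum well defined. A conjugate of a unipotent element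
    that lies in the inducing group must lie in I^+, and there the entries of [tmx] match the two
    characters term by term. *)
Lemma tconj_inducing v : U v -> H (tconj v) -> chi (tconj v) = (psi_U psi gam v)^-1.
Proof.
move=> Uv Hv; have vE := Uv.2.
have tii (i : 'I_(2 * l)) : tconj v i i = 1.
  by rewrite (tconjE hl) vE // eqxx mulr1 mulfV ?tfun_neq0.
have vI : iwahori_plus (tconj v).
  move: (Hv) => /(inducing_groupP hl hvarpi halpha)[c [b [h [c2 hI E]]]].
  have hN : (N.-1 < 2 * l)%N by lia.
  pose o := Ordinal hN.
  move: (E) => /matrixP/(_ o o); rewrite tii [in X in _ = X -> _]mxE.
  (* On the component of [g_chi] the last diagonal entry is divisible by the uniformizer, whereas
     that of [tconj v] is 1. *)
  case: b E => E; rewrite /gpow.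
    rewrite (g_chi_mul hl) mulrA => /(congr1 (@absp R F)); rewrite !abspM absp1.
    rewrite (absp_gcoef hvarpi halpha) /= ifF; last by lia.
    rewrite eqxx => e; exfalso.
    have c1 : absp c = 1 by apply/eqP; rewrite -sqrp_eq1 ?absp_ge0 // -abspX c2 absp1.
    have hle : absp (h (gperm hl o) o) <= 1 by case: hI => [[_ hh _] _].
    have := qV_lt1 F; rewrite ltNge => /negP; apply.
    by rewrite {1}e c1 mul1r ler_piMr // ltW ?qV_gt0.
  (* The sign [c] is congruent to 1. In residue characteristic 2 this allows c = -1, which is then
     absorbed in I^+. *)
  rewrite mul1mx => e.
  have hd : absp (h o o - 1) < 1 by case: hI.
  have c1 : absp (c - 1) < 1.
    have h0 : h o o != 0 by rewrite -absp_gt0 (absp_unit1 hd).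
    by rewrite (_ : c = (h o o)^-1); [exact: absp_unit1V|apply: (mulIf h0); rewrite -e mulVf].
  have cc : absp c = 1 by apply: absp_unit1.
  rewrite E mul1mx; case: hI => [[hS hi hlo] hdi]; split; first split.
  - exact: SO2l_scaledP.
  - by move=> i j; rewrite mxE abspM cc mul1r.
  - by move=> i j ji; rewrite mxE abspM cc mul1r; apply: hlo.
  - by move=> i; rewrite mxE; apply: absp_unit1M.
rewrite chi_iwahori // affine_argE psi_UE -psiN; congr psi; rewrite /affine_arg /psiU_arg.
have h0 : ((l.-1).-1 < 2 * l)%N by lia.
have h1 : (l.-1 < 2 * l)%N by lia.
have h2 : ((l.+1).-1 < 2 * l)%N by lia.
have hN : ((N.-1).-1 < 2 * l)%N by lia.
have h00 : (1.-1 < 2 * l)%N by lia.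
rewrite (ent_lt _ hN h00) (tconjE hl) (vE (Ordinal hN) (Ordinal h00)); last by [].
rewrite (_ : (Ordinal hN == Ordinal h00) = false); last by apply/eqP => /(congr1 val) /=; lia.
rewrite mulr0 mul0r mulr0 addr0.
have gen n (f : nat -> F) : (1 < n)%N ->
    \sum_(1 <= i < n) f i = \sum_(1 <= i < n.-1) f i + f n.-1.
  by case: n => [|[|n]] // _; rewrite big_nat_recr.
rewrite gen ?prednK; [|lia..].
have -> : \sum_(1 <= i < l.-1) ent (tconj v) i i.+1 = - \sum_(1 <= i < l.-1) ent v i i.+1.
  rewrite -sumrN [LHS]big_nat [RHS]big_nat; apply: eq_bigr => i /andP[i1 i2].
  have hi : (i.-1 < 2 * l)%N by lia.
  have hi' : ((i.+1).-1 < 2 * l)%N by lia.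
  rewrite !(ent_lt _ hi hi') (tconjE hl) mulrAC.
  by rewrite tfun_ratio ?mulN1r //=; lia.
rewrite !(ent_lt _ h0 h1) !(ent_lt _ h0 h2) !(tconjE hl).
have t0 : tfun F (Ordinal h0) = -1 by apply: tfun_before => //=; lia.
have t1 : tfun F (Ordinal h1) = 4%:R by apply: tfun_mid1.
have t2 : tfun F (Ordinal h2) = 4%:R^-1 by apply: tfun_mid2.
rewrite t0 t1 t2 invrK.
rewrite hgam; have := four_neq0 F; move: (4%:R : F) => f f0.
by field.
Qed.

Definition coset_rel (u v : 'M[F]_(2 * l)) : Prop := H (tconj (v *m invmx u)).

Lemma tconj_unit M : M \in unitmx -> tconj (invmx M) = invmx (tconj M).
Proof.
move=> Mu; have e : tconj M *m tconj (invmx M) = 1%:M.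
  by rewrite -(tconjM hl) mulmxV // /tconj mulmx1 mulmxV ?(tmx_unit F hl).
have [tu _] := mulmx1_unit e.
by rewrite -[LHS](mulKmx tu) e mulmx1.
Qed.

Lemma coset_rel_refl u : U u -> coset_rel u u.
Proof.
move=> Uu; rewrite /coset_rel mulmxV ?(U2l_unit Uu) // /tconj mulmx1 mulmxV.
  exact: inducing1.
exact: tmx_unit.
Qed.

Lemma coset_rel_sym u v : U u -> U v -> coset_rel u v -> coset_rel v u.
Proof.
move=> Uu Uv; rewrite /coset_rel => h.
have -> : u *m invmx v = invmx (v *m invmx u).
  have uu := U2l_unit Uu; have vu := U2l_unit Uv.
  have e : (v *m invmx u) *m (u *m invmx v) = 1%:M by rewrite mulmxA mulmxKV // mulmxV.
  have [xu _] := mulmx1_unit e.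
  by rewrite -[LHS](mulKmx xu) e mulmx1.
rewrite tconj_unit; first exact: inducingV.
by apply: U2l_unit; apply: U2lM Uv (U2lV Uu).
Qed.

Lemma coset_rel_trans u v w : U u -> U v -> coset_rel u v -> coset_rel v w -> coset_rel u w.
Proof.
move=> Uu Uv; rewrite /coset_rel => h h'.
have -> : w *m invmx u = (w *m invmx v) *m (v *m invmx u).
  by rewrite mulmxA mulmxKV ?(U2l_unit Uv).
by rewrite (tconjM hl); apply: inducingM.
Qed.

(* A canonical representative of the coset of u modulo U cap t^-1 H t. *)
Definition coset_rep (u : 'M[F]_(2 * l)) : 'M[F]_(2 * l) :=
  xget 1%:M [set v | U v /\ coset_rel u v].

Lemma coset_repP u : U u -> U (coset_rep u) /\ coset_rel u (coset_rep u).
Proof.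
move=> Uu; apply: (@xgetPex _ _ [set v | U v /\ coset_rel u v]).
by exists u; split=> //; exact: coset_rel_refl.
Qed.

Lemma coset_rep_eq u v : U u -> U v -> coset_rel u v -> coset_rep u = coset_rep v.
Proof.
move=> Uu Uv uv; rewrite /coset_rep; congr xget; apply/seteqP; split => w [Uw h]; split => //.
  exact: coset_rel_trans (coset_rel_sym Uu Uv uv) h.
exact: coset_rel_trans uv h.
Qed.

Definition coset_reps : set 'M[F]_(2 * l) := [set u | U u /\ coset_rep u = u].

Lemma coset_rep_in u : U u -> coset_reps (coset_rep u).
Proof.
move=> Uu; have [Ur ur] := coset_repP Uu; split => //.
by apply/esym; apply: coset_rep_eq.
Qed.

Definition whit_term (phi : 'M[F]_(2 * l) -> C) (u : 'M[F]_(2 * l)) : C :=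
  phi (t *m u) * psi_U psi gam u.

Lemma tSO M : SO2l M -> SO2l (t *m M).
Proof. by apply: SO_mul; exact: tmx_SO2l. Qed.

Lemma whit_term_coset phi u v : V phi -> U u -> U v -> coset_rel u v ->
  whit_term phi u = whit_term phi v.
Proof.
move=> [_ ph _ _] Uu Uv uv; have uu := U2l_unit Uu.
have Uw : U (v *m invmx u) := U2lM Uv (U2lV Uu).
have vE : v = (v *m invmx u) *m u by rewrite mulmxKV.
have tvE : t *m v = tconj (v *m invmx u) *m (t *m u).
  by rewrite /tconj -!mulmxA (mulKmx (tmx_unit F hl)) (mulVmx uu) mulmx1.
rewrite /whit_term tvE (ph _ _ uv (tSO Uu.1)).
rewrite [in psi_U psi gam v]vE (psi_UM Uw Uu) tconj_inducing //.
by rewrite mulrACA mulVf ?psi_U_neq0 // mul1r.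
Qed.

(** Stands for the integral over U of phi(t u) psi_U(u). The integrand is constant on the cosets of
    the intersection of U with t^-1 H t, so a sum over these cosets replaces the integral. *)
Definition whit_functional (phi : 'M[F]_(2 * l) -> C) : C :=
  \sum_(u \in coset_reps) whit_term phi u.

(** Modulo the inducing group the support of [phi] is covered by finitely many sets I^+ x, and the
    elements u with t u in H x form at most one coset. *)
Lemma whit_finite phi : V phi ->
  finite_set (coset_reps `&` [set u | whit_term phi u != 0]).
Proof.
move=> [p0 ph psm [K [cK KS phK]]].
have [|s [sK scov]] := compact_mx_cover (V := fun k k' : 'M[F]_(2 * l) => SO2l k' -> iwahori_plus (k' *m invmx k)) cK.
    move=> k Kk; have kS := KS k Kk; have ku := SO_unitmx kS.
    have [e e0 he] := iwahori_plus_near F l.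
    have [d d0 hd] := mx_mulr_near k (invmx k) e0.
    exists d => // k' kn k'S; apply: he; first exact: SO_mul k'S (SO_inv kS).
    by rewrite -(mulmxV ku); apply: hd.
pose f y := xget 1%:M [set u | coset_reps u /\ H (t *m u *m invmx y)].
apply: (@sub_finite_set _ _ (f @` [set` s])); last exact/finite_image/finite_seq.
move=> u [[Uu ru]]; rewrite /= /whit_term => nz.
have /phK[h [k [Hh Kk E]]] : phi (t *m u) != 0 by apply: contra nz => /eqP ->; rewrite mul0r.
have [x xs hx] := scov k Kk.
have xS := KS x (sK x xs); have xu := SO_unitmx xS.
have Hu : H (t *m u *m invmx x).
  rewrite E -mulmxA; apply: (inducingM hl hvarpi halpha Hh).
  by apply: inducing_iwahori => //; apply: hx; apply: KS.
exists x => //; apply: xget_unique => [|v [[Uv rv] Hv]]; first by split.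
rewrite -ru -rv; apply: coset_rep_eq => //; rewrite /coset_rel.
have uu := U2l_unit Uu; have Tu := tmx_unit F hl.
have -> : tconj (u *m invmx v) = (t *m u *m invmx x) *m invmx (t *m v *m invmx x).
  have vxu : t *m v *m invmx x \in unitmx.
    by apply: SO_unitmx; apply: inducing_SO2l Hv.
  apply: (can_inj (mulmxK vxu)); rewrite mulmxKV //.
  by rewrite /tconj !mulmxA mulmxKV // mulmxKV ?(U2l_unit Uv).
by apply: inducingM => //; apply: inducingV.
Qed.

Lemma whit_functionalP : whittaker_functional psi gam V whit_functional.
Proof.
split=> [c phi phi' Vphi Vphi'|u phi Uu Vphi].
  rewrite /whit_functional -fsum_linear; [|exact: whit_finite..].
  by apply: eq_fsbigr => x _; rewrite /whit_term mulrDl mulrA.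
have psu := psi_U_neq0 u.
have iuU := U2lV Uu; have uu := U2l_unit Uu.
rewrite /whit_functional mulr_fsumr.
(* Right multiplication by [u] permutes the cosets but not the chosen representatives, hence the
   renormalisation by [coset_rep]. *)
rewrite [RHS](@reindex_fsbig _ _ _ _ _ (fun v => coset_rep (v *m u)) coset_reps coset_reps).
  apply: eq_fsbigr => v; rewrite inE => -[Uv rv].
  have Uvu := U2lM Uv Uu; have [Ur ur] := coset_repP Uvu.
  rewrite -(whit_term_coset Vphi Uvu Ur ur) /whit_term /right_translate.
  by rewrite (psi_UM Uv Uu) -mulmxA; field.
split.
- by move=> v [Uv rv]; apply: coset_rep_in; apply: U2lM.
- move=> v v'; rewrite !inE => -[Uv rv] [Uv' rv'] e.
  have Uvu := U2lM Uv Uu; have Uvu' := U2lM Uv' Uu.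
  have [Ur ur] := coset_repP Uvu; have [Ur' ur'] := coset_repP Uvu'.
  rewrite -rv -rv'; apply: coset_rep_eq => //.
  have : coset_rel (v *m u) (v' *m u).
    apply: (coset_rel_trans Uvu Ur ur); rewrite e.
    exact: coset_rel_sym.
  rewrite /coset_rel (_ : invmx (v *m u) = invmx u *m invmx v); last first.
    have vu := U2l_unit Uv; have vuu := U2l_unit Uvu.
    rewrite -[RHS](mulKmx vuu) -mulmxA (mulmxA u) mulmxV // mul1mx mulmxV // mulmx1.
    by [].
  by rewrite mulmxA mulmxK.
move=> v [Uv rv]; have Uw := U2lM Uv iuU; have [Ur ur] := coset_repP Uw.
exists (coset_rep (v *m invmx u)); first exact: coset_rep_in.
rewrite -[RHS]rv; apply: coset_rep_eq => //; first exact: U2lM.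
apply: coset_rel_sym => //; first exact: U2lM.
move: ur; rewrite /coset_rel (_ : invmx (v *m invmx u) = u *m invmx v).
  by rewrite mulmxA.
have wu := U2l_unit Uw; rewrite -[RHS](mulKmx wu) -mulmxA (mulmxA (invmx u)) mulVmx //.
by rewrite mul1mx mulmxV ?(U2l_unit Uv) // mulmx1.
Qed.

(** The translated vector is supported on one coset of the inducing group, so only the coset of [u]
    contributes to the sum. *)
Lemma whit_phi_tr g1 u M : SO2l g1 -> SO2l M -> U u -> H (t *m u *m M *m g1) ->
  whit_functional (right_translate M (phi_tr g1)) =
  chi (t *m u *m M *m g1) * psi_U psi gam u.
Proof.
move=> g1S MS Uu Hu.
have -> : right_translate M (phi_tr g1) = phi_tr (M *m g1).
  by apply/funext => x; rewrite /right_translate /phi_tr mulmxA.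
have VM : V (phi_tr (M *m g1)) by apply: phi_tr_in; apply: SO_mul.
have [Ur ur] := coset_repP Uu.
have uin := coset_rep_in Uu.
have tE v : U v -> t *m v *m M *m g1 = tconj (v *m invmx u) *m (t *m u *m M *m g1).
  move=> Uv; rewrite /tconj !mulmxA mulmxKV ?(tmx_unit F hl) // mulmxKV //.
  exact: U2l_unit Uu.
rewrite /whit_functional -(@fsbig_widen _ _ _ _ [set coset_rep u]).
- rewrite fsbig_set1 -(whit_term_coset VM Uu Ur ur) /whit_term /phi_tr phi0_in !mulmxA //.
- by move=> _ ->.
move=> v [[Uv rv] vne] /=.
rewrite /whit_term /phi_tr phi0_out ?mul0r // !mulmxA (tE v Uv).
move=> /(inducing_mulr hl hvarpi halpha _ Hu) h; apply: vne.
by rewrite /= -rv; apply: coset_rep_eq => //; apply: coset_rel_sym.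
Qed.

Lemma whit_phi_tr0 g1 M : (forall u, U u -> ~ H (t *m u *m M *m g1)) ->
  whit_functional (right_translate M (phi_tr g1)) = 0.
Proof.
move=> h; apply: fsbig1 => u [Uu _].
rewrite /whit_term /right_translate /phi_tr phi0_out ?mul0r //.
by apply: h.
Qed.

End InducedRep.

(** * The group SO_3 *)

Section ThreeDim.
Context (R : realType) (F : padicField R) (gam : F).
Hypothesis gam0 : gam != 0.
Implicit Types (h u n : 'M[F]_3) (x y z m : F).

Let two0 : 2%:R != 0 :> F := two_neq0 F.
Let four0 : 4%:R != 0 :> F := four_neq0 F.

Definition J3inv : 'M[F]_3 :=
  mx_rows 3 [:: [:: 0; 0; 1]; [:: 0; 2%:R / gam; 0]; [:: 1; 0; 0]].

Lemma J3_mul_inv : J3 gam *m J3inv = 1%:M.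
Proof.
apply: matrix3P; split; rewrite !mulmx3E !mxE /= ?(mulr0, mul0r, addr0, add0r, mulr1) //.
by field; rewrite gam0 two0.
Qed.

Lemma J3_unit : J3 gam \in unitmx.
Proof. by have [] := mulmx1_unit J3_mul_inv. Qed.

Lemma invmx_J3 : invmx (J3 gam) = J3inv.
Proof. by rewrite -[RHS](mulKmx J3_unit) J3_mul_inv mulmx1. Qed.

Lemma SO3_row_pair h (i j : 'I_3) : SO3 gam h ->
  h i 0 * h j 2%:R + h i 2%:R * h j 0 + 2%:R / gam * (h i 1 * h j 1) = J3inv i j.
Proof.
move=> /(SO_rows J3_unit); rewrite invmx_J3 => /matrixP/(_ i j) <-.
rewrite mulmx3E !mulmx3E !mxE /=; ring.
Qed.

Lemma SO3_col_pair h (i j : 'I_3) : SO3 gam h ->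
  h 0 i * h 2%:R j + h 2%:R i * h 0 j + gam / 2%:R * (h 1 i * h 1 j) = J3 gam i j.
Proof.
move=> [_ /matrixP/(_ i j) <-].
rewrite mulmx3E !mulmx3E !mxE /=; ring.
Qed.

Lemma SO3_row_iso h (i : 'I_3) : SO3 gam h -> i != 1 ->
  h i 1 ^+ 2 = - gam * h i 0 * h i 2%:R.
Proof.
move=> hS i1; have := SO3_row_pair i i hS.
have -> : J3inv i i = 0 by rewrite mxE; case: i i1 => [[|[|[|?]]] ?].
move=> e; have : 2%:R / gam * (h i 1 ^+ 2 + gam * h i 0 * h i 2%:R) = 0.
  by rewrite -[RHS]e; field.
move/eqP; rewrite mulf_eq0 mulf_eq0 invr_eq0 (negPf two0) (negPf gam0) /= addr_eq0 => /eqP ->.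
by ring.
Qed.

Lemma SO3_col_iso h (j : 'I_3) : SO3 gam h -> j != 1 ->
  h 1 j ^+ 2 = - (4%:R / gam) * h 0 j * h 2%:R j.
Proof.
move=> hS i1; have := SO3_col_pair j j hS.
have -> : J3 gam j j = 0 by rewrite mxE; case: j i1 => [[|[|[|?]]] ?].
move=> e; have : gam / 2%:R * (h 1 j ^+ 2 + 4%:R / gam * h 0 j * h 2%:R j) = 0.
  by rewrite -[RHS]e; field; rewrite two0 gam0.
move/eqP; rewrite mulf_eq0 mulf_eq0 invr_eq0 (negPf two0) (negPf gam0) /= addr_eq0 => /eqP ->.
by ring.
Qed.

Lemma SO3_pair h : SO3 gam h ->
  h 0 0 * h 2%:R 2%:R + h 0 2%:R * h 2%:R 0 + 2%:R / gam * (h 0 1 * h 2%:R 1) = 1.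
Proof. by move=> hS; rewrite (SO3_row_pair 0 2%:R hS) mxE. Qed.

Definition umx y : 'M[F]_3 :=
  mx_rows 3 [:: [:: 1; y; - y ^+ 2 / gam]; [:: 0; 1; - 2%:R * y / gam]; [:: 0; 0; 1]].

Lemma det3E h : \det h =
  h 0 0 * (h 1 1 * h 2%:R 2%:R - h 1 2%:R * h 2%:R 1)
  - h 0 1 * (h 1 0 * h 2%:R 2%:R - h 1 2%:R * h 2%:R 0)
  + h 0 2%:R * (h 1 0 * h 2%:R 1 - h 1 1 * h 2%:R 0).
Proof.
rewrite (expand_det_row _ ord0) !big_ord_recl big_ord0 /cofactor.
do ![rewrite (expand_det_row _ ord0) !big_ord_recl big_ord0 /cofactor].
rewrite !det_mx00 !mxE.
pose g (i j : nat) := h (inord i) (inord j).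
have e i j : h i j = g i j by rewrite /g !inord_val.
rewrite !e /= /bump /= !(addn0, add0n, addn1, add1n); ring.
Qed.

Lemma umx_SO3 y : SO3 gam (umx y).
Proof.
split.
  rewrite -det_tr det_trig; first by rewrite !big_ord_recl big_ord0 !mxE /= !mulr1.
  by apply/is_trig_mxP; case=> [[|[|[|?]]] ?] // [[|[|[|?]]] ?] //; rewrite !mxE.
apply: matrix3P; split; rewrite !mulmx3E !mxE /=; field; rewrite ?gam0 ?two0 //.
Qed.

Lemma umx_U3 y : U3 gam (umx y).
Proof.
split; first exact: umx_SO3.
by case=> [[|[|[|?]]] ?] // [[|[|[|?]]] ?] //; rewrite !mxE.
Qed.

Lemma U3_umx u : U3 gam u -> u = umx (u 0 1).
Proof.
move=> [uS uE]; have e2 := SO3_row_iso (i := 0) uS isT.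
have e12 := SO3_row_pair 0 1 uS.
have e00 : u 0 0 = 1 by rewrite uE.
have e10 : u 1 0 = 0 by rewrite uE.
have e11 : u 1 1 = 1 by rewrite uE.
have e20 : u 2%:R 0 = 0 by rewrite uE.
have e21 : u 2%:R 1 = 0 by rewrite uE.
have e22 : u 2%:R 2%:R = 1 by rewrite uE.
move: e12; rewrite e00 e10 e11 [J3inv _ _]mxE /= => e12.
rewrite e00 in e2.
apply: matrix3P; split; rewrite ?[umx _ _ _]mxE /= ?e00 ?e10 ?e11 ?e20 ?e21 ?e22 //=.
  by rewrite e2; field.
have : u 1 2%:R + 2%:R / gam * u 0 1 = 0 by rewrite -[RHS]e12; ring.
by move/eqP; rewrite addr_eq0 => /eqP ->; ring.
Qed.

Lemma umxD y z : umx y *m umx z = umx (y + z).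
Proof. by apply: matrix3P; split; rewrite !mulmx3E !mxE /=; field. Qed.

Lemma umx0 : umx 0 = 1%:M.
Proof. by apply: matrix3P; split; rewrite !mxE /=; field. Qed.

Lemma umx_mulmx y h j : (umx y *m h) 0 j = h 0 j + y * h 1 j - y ^+ 2 / gam * h 2%:R j.
Proof. by rewrite mulmx3E !mxE /=; ring. Qed.

Lemma umx_mulmx_last y h j : (umx y *m h) 2%:R j = h 2%:R j.
Proof. by rewrite mulmx3E !mxE /=; ring. Qed.

(** As a polynomial in y the entry has discriminant 0, because the column is isotropic; it is
    therefore a constant times a square. This is why the supports met later are balls around the
    double root, or their complements. *)
Lemma umx_mulmx_root y h j : SO3 gam h -> j != 1 -> h 2%:R j != 0 ->
  (umx y *m h) 0 j = - h 2%:R j / gam * (y - gam * h 1 j / (2%:R * h 2%:R j)) ^+ 2.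
Proof.
move=> hS j1 h0; rewrite umx_mulmx.
have e := SO3_col_iso hS j1.
have -> : h 0 j = - gam / (4%:R * h 2%:R j) * h 1 j ^+ 2.
  by rewrite e; field; rewrite gam0 four0 h0.
by field; rewrite gam0 two0 h0.
Qed.

Lemma w1_SO3 : SO3 gam (w1 F).
Proof.
split; last by apply: matrix3P; split; rewrite !mulmx3E !mxE /=; ring.
by rewrite det3E !mxE /=; ring.
Qed.

Lemma w1_sq : w1 F *m w1 F = 1%:M.
Proof. by apply: matrix3P; split; rewrite !mulmx3E !mxE /=; ring. Qed.

Lemma mulmx_w1 h : h *m w1 F =
  mx_rows 3 [:: [:: h 0 2%:R; - h 0 1; h 0 0]; [:: h 1 2%:R; - h 1 1; h 1 0];
                [:: h 2%:R 2%:R; - h 2%:R 1; h 2%:R 0]].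
Proof. by apply: matrix3P; split; rewrite !mulmx3E !mxE /=; ring. Qed.

Lemma torus3_SO3 m : m != 0 -> SO3 gam (torus3 m).
Proof.
move=> m0; split; first by rewrite det3E !mxE /=; field.
by apply: matrix3P; split; rewrite !mulmx3E !mxE /=; field; rewrite ?m0.
Qed.

(** The representative of a coset of U_3 with last row ending in b, c, for invertible c. The next
    definition is its analogue when the first entry of the row is invertible. *)
Definition lower_mx (b c : F) : 'M[F]_3 :=
  mx_rows 3 [:: [:: c^-1; 0; 0]; [:: - 2%:R * b / (gam * c); 1; 0];
                [:: - b ^+ 2 / (gam * c); b; c]].

Definition antilower_mx (a b : F) : 'M[F]_3 :=
  mx_rows 3 [:: [:: 0; 0; a^-1]; [:: 0; -1; 2%:R * b / (gam * a)];
                [:: a; b; - b ^+ 2 / (gam * a)]].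

Lemma SO3_last_iso h : SO3 gam h ->
  h 2%:R 1 ^+ 2 = - gam * h 2%:R 0 * h 2%:R 2%:R.
Proof. by move=> hS; apply: SO3_row_iso. Qed.

(* The first row of [umx y *m h] is made isotropic to the last standard vector
   by completing the square in its last entry. *)
Lemma SO3_lower h : SO3 gam h -> h 2%:R 2%:R != 0 ->
  exists y, umx y *m h = lower_mx (h 2%:R 1) (h 2%:R 2%:R).
Proof.
move=> hS c0; set y := gam * h 1 2%:R / (2%:R * h 2%:R 2%:R).
exists y; set n := umx y *m h.
have nS : SO3 gam n by apply: SO_mul => //; exact: umx_SO3.
have n2 j : n 2%:R j = h 2%:R j by rewrite /n umx_mulmx_last.
have n02 : n 0 2%:R = 0.
  by rewrite /n umx_mulmx_root // subrr expr0n mulr0.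
have n01 : n 0 1 = 0.
  by apply/eqP; rewrite -sqrf_eq0 (SO3_row_iso nS) // n02 mulr0.
have n12 : n 1 2%:R = 0.
  by apply/eqP; rewrite -sqrf_eq0 (SO3_col_iso nS) // n02 mulr0 mul0r.
have n00 : n 0 0 = (h 2%:R 2%:R)^-1.
  have := SO3_pair nS; rewrite n02 n01 !mul0r mulr0 !addr0 n2 => e.
  by apply: (mulIf c0); rewrite e mulVf.
have n11 : n 1 1 = 1.
  have [d _] := nS; move: d; rewrite det3E n01 n02 n12 n00 !n2 => d.
  by rewrite -[RHS]d; field.
have n20 : h 2%:R 0 = - h 2%:R 1 ^+ 2 / (gam * h 2%:R 2%:R).
  by rewrite SO3_last_iso //; field; rewrite gam0 c0.
have n10 : n 1 0 = - 2%:R * h 2%:R 1 / (gam * h 2%:R 2%:R).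
  have := SO3_row_pair 1 2%:R nS; rewrite n12 n11 !n2 [J3inv _ _]mxE /= => e.
  have -> : n 1 0 = (n 1 0 * h 2%:R 2%:R + 0 * h 2%:R 0 + 2%:R / gam * (1 * h 2%:R 1)
     - 2%:R / gam * h 2%:R 1) / h 2%:R 2%:R by field; rewrite gam0 c0.
  by rewrite e; field; rewrite gam0 c0.
by apply: matrix3P; split; rewrite [RHS]mxE /= ?n00 ?n01 ?n02 ?n10 ?n11 ?n12 ?n2.
Qed.

(** Right multiplication by [w1] exchanges the ends of the last row and reduces to the lower
    triangular case. *)
Lemma SO3_antilower h : SO3 gam h -> h 2%:R 0 != 0 ->
  exists y, umx y *m h = antilower_mx (h 2%:R 0) (h 2%:R 1).
Proof.
move=> hS a0; pose h' := h *m w1 F.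
have h'S : SO3 gam h' by apply: SO_mul => //; exact: w1_SO3.
have [|y e] := SO3_lower h'S; first by rewrite /h' mulmx_w1 mxE.
exists y; move: e; rewrite /h' mulmxA => /(congr1 (mulmxr (w1 F))) /=.
rewrite -mulmxA w1_sq mulmx1 => ->.
rewrite mulmx_w1 mulmx_w1 !mxE /=.
by apply: matrix3P; split; rewrite !mxE /=; field; rewrite ?gam0 ?a0.
Qed.

End ThreeDim.

(** * The embedding of SO_3 in the four-dimensional block *)

Section EmbeddedThree.
Context (R : realType) (F : padicField R) (gam : F).
Hypothesis gam0 : gam != 0.
Implicit Types (h u n : 'M[F]_3).

Let two0 : 2%:R != 0 :> F := two_neq0 F.
Let four0 : 4%:R != 0 :> F := four_neq0 F.

Definition skip1 (a : 'I_3) : 'I_4 := lift 1 a.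

Lemma skip1_inj : injective skip1.
Proof. exact: lift_inj. Qed.

Lemma sharp_embmx h : sharp h = embmx skip1 h.
Proof.
have e i j (a b : 'I_3) : i.-1 = a -> j.-1 = b -> ent h i j = h a b by apply: ent_ord.
have s0 : skip1 0 = 0 by apply: val_inj.
have s1 : skip1 1 = 2%:R by apply: val_inj.
have s2 : skip1 2%:R = 3%:R by apply: val_inj.
have n1 a : (1 : 'I_4) != skip1 a by rewrite /skip1 neq_lift.
apply: matrix4P; split; rewrite mxE /= ?(embmx_outl _ _ n1) ?(embmx_outr _ _ n1) //.
all: rewrite -?s0 -?s1 -?s2 embmx_in //; try exact: skip1_inj.
all: exact: e.
Qed.

Definition embA_inv : 'M[F]_4 :=
  mx_rows 4 [:: [:: 1; 0; 0; 0]; [:: 0; 2%:R; - (2%:R * gam)^-1; 0];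
                [:: 0; 2%:R; (2%:R * gam)^-1; 0]; [:: 0; 0; 0; 1]].

Lemma embA_mul_inv : embA gam *m embA_inv = 1%:M.
Proof.
by apply: matrix4P; split; rewrite !mulmx4E !mxE /=; field; rewrite ?gam0 ?two0 ?four0.
Qed.

Lemma embA_unit : embA gam \in unitmx.
Proof. by have [] := mulmx1_unit embA_mul_inv. Qed.

Definition emb4 h : 'M[F]_4 := embA gam *m sharp h *m invmx (embA gam).

Lemma emb4M h u : emb4 (h *m u) = emb4 h *m emb4 u.
Proof.
rewrite /emb4 !sharp_embmx -(embmxM skip1_inj) !mulmxA.
by rewrite mulmxKV ?embA_unit // -!mulmxA.
Qed.

Lemma det_emb4 h : \det (emb4 h) = \det h.
Proof.
rewrite /emb4 !det_mulmx det_inv mulrAC mulfV ?mul1r ?sharp_embmx ?det_embmx //.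
  exact: skip1_inj.
by have := embA_unit; rewrite unitmxE unitfE.
Qed.

Let K4 : 'M[F]_4 := mx_rows 4 [:: [:: 0; 0; 0; 1]; [:: 0; - gam / 2%:R; 0; 0];
  [:: 0; 0; gam / 2%:R; 0]; [:: 1; 0; 0; 0]].

(** The columns of [embA] split the middle hyperbolic plane into orthogonal lines of norms -gam/2
    and gam/2. SO_3 fixes the first line and acts on the sum of the second with the outer plane. *)
Lemma embA_form : (embA gam)^T *m J4 F *m embA gam = K4.
Proof. by apply: matrix4P; split; rewrite mulmx4E !mulmx_J4 !mxE /=; field; rewrite ?four0 ?two0. Qed.

Lemma emb4_form h : SO3 gam h -> (emb4 h)^T *m J4 F *m emb4 h = J4 F.
Proof.
move=> [_ hJ].
have sJ : (sharp h)^T *m K4 *m sharp h = K4.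
  rewrite sharp_embmx; apply: (embmx_form skip1_inj _ _ _ hJ).
  - by apply: matrix4P; split; rewrite !mxE.
  - by apply: matrix3P; split; rewrite !mxE.
  have s0 : skip1 0 = 0 by apply: val_inj.
  have s1 : skip1 1 = 2%:R by apply: val_inj.
  have s2 : skip1 2%:R = 3%:R by apply: val_inj.
  apply/matrixP => i j; rewrite !mxE !big_ord_recl !big_ord0 !mxE -!val_eqE /=.
  by case: i => [[|[|[|[|?]]]] ?]; case: j => [[|[|[|?]]] ?] //=;
    rewrite !(mulr0, mul0r, mulr1, mul1r, addr0, add0r).
have -> : J4 F = (invmx (embA gam))^T *m K4 *m invmx (embA gam).
  rewrite -embA_form trmx_inv !mulmxA mulVmx ?unitmx_tr ?embA_unit // mul1mx.
  by rewrite mulmxK ?embA_unit.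
rewrite -[RHS in _ = RHS]/(_ *m K4 *m _) -{2}sJ /emb4 !trmx_mul !mulmxA.
have -> : (invmx (embA gam))^T *m (sharp h)^T *m (embA gam)^T *m (invmx (embA gam))^T =
          (invmx (embA gam))^T *m (sharp h)^T.
  by rewrite -mulmxA trmx_inv mulmxV ?unitmx_tr ?embA_unit // mulmx1.
congr (_ *m _); rewrite -!mulmxA; do 3!congr (_ *m _).
by rewrite !mulmxA mulVmx ?embA_unit // mul1mx.
Qed.

Lemma emb4E h : emb4 h = mx_rows 4
 [:: [:: h 0 0; 2%:R * h 0 1; h 0 1 / (2%:R * gam); h 0 2%:R];
     [:: h 1 0 / 4%:R; (1 + h 1 1) / 2%:R; (h 1 1 - 1) / (8%:R * gam); h 1 2%:R / 4%:R];
     [:: gam * h 1 0; 2%:R * gam * (h 1 1 - 1); (h 1 1 + 1) / 2%:R; gam * h 1 2%:R];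
     [:: h 2%:R 0; 2%:R * h 2%:R 1; h 2%:R 1 / (2%:R * gam); h 2%:R 2%:R]].
Proof.
have e i j (a b : 'I_3) : i.-1 = a -> j.-1 = b -> ent h i j = h a b by apply: ent_ord.
have sE : sharp h = mx_rows 4 [:: [:: h 0 0; 0; h 0 1; h 0 2%:R]; [:: 0; 1; 0; 0];
    [:: h 1 0; 0; h 1 1; h 1 2%:R]; [:: h 2%:R 0; 0; h 2%:R 1; h 2%:R 2%:R]].
  by apply: matrix4P; split; rewrite !mxE /= //; apply: e.
rewrite /emb4 sE; set Y := mx_rows 4 _; set X := mx_rows 4 _.
(* Comparing the products with [embA] avoids computing with its inverse. *)
have YA : embA gam *m Y = X *m embA gam.
  have eight0 : 8%:R != 0 :> F by rewrite (natrM _ 2 4) mulf_neq0.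
  rewrite /embA /Y /X !mulmx_rows4.
  by congr (mx_rows 4 [:: [:: _; _; _; _]; [:: _; _; _; _]; [:: _; _; _; _]; [:: _; _; _; _]]);
    rewrite ?(mulr0, mul0r, addr0, add0r, mulr1, mul1r);
    first [by [] | ring | by field; rewrite ?gam0 ?two0 ?four0 ?eight0].
by rewrite YA mulmxK ?embA_unit.
Qed.

End EmbeddedThree.

(** * The support of the test Whittaker function *)

Section RootSubgroup.
Context (R : realType) (F : padicField R) (l : nat).
Hypothesis hl : (2 < l)%N.
Local Notation N := (2 * l)%N.
Implicit Types (i j k : 'I_(2 * l)) (r s : 'M[F]_(2 * l)).
Local Notation pos := (pos hl).

Definition root_entry i j : bool :=
  (j == 0 :> nat) && (0 < i <= l - 2)%N || (i == N.-1 :> nat) && (l < j < N.-1)%N.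

Lemma Rl1P r : Rl1 r <->
  SO2l r /\ forall i j, ~~ root_entry i j -> r i j = (i == j)%:R.
Proof.
split=> -[rS h]; split => // i j.
  move=> nR; have hi := ltn_ord i; have hj := ltn_ord j.
  rewrite -(@ent_ord _ _ _ r i.+1 j.+1 i j erefl erefl) h -?val_eqE ?eqSS //.
  apply: contra nR; rewrite /root_entry; lia.
move=> hi hj nR; have hi' : (i.-1 < N)%N by lia.
have hj' : (j.-1 < N)%N by lia.
rewrite (ent_lt r hi' hj') h -?val_eqE /=; first by congr ((_ : bool)%:R); lia.
by apply: contra nR; rewrite /root_entry /=; lia.
Qed.

Definition root_supported r := forall i j, ~~ root_entry i j -> r i j = 0.

(** No position of the support ends where another begins. Hence R^{l,1} is commutative, with product
    r + s - 1 and inverse 2 - r. *)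
Lemma root_supported_mul r s : root_supported r -> root_supported s -> r *m s = 0.
Proof.
move=> rR sR; apply/matrixP => i j; rewrite !mxE big1 // => k _.
have [hr|hr] := boolP (root_entry i k); last by rewrite rR ?mul0r.
rewrite sR ?mulr0 //; move: hr; rewrite /root_entry; lia.
Qed.

Lemma Rl1_supported r : Rl1 r -> root_supported (r - 1%:M).
Proof. by move=> /Rl1P[_ h] i j nR; rewrite !mxE h // subrr. Qed.

Lemma Rl1_mul r s : Rl1 r -> Rl1 s -> r *m s = r + s - 1%:M.
Proof.
move=> rR sR; have e := root_supported_mul (Rl1_supported rR) (Rl1_supported sR).
move: e; rewrite mulmxBr !mulmxBl !mul1mx mulmx1; move: (r *m s) => rs /matrixP e.
apply/matrixP => i j; move: (e i j); rewrite !mxE => e1.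
by rewrite -[LHS]subr0 -e1; ring.
Qed.

Lemma Rl1V_E r : Rl1 r -> invmx r = 2%:R *: 1%:M - r.
Proof.
move=> rR; have ru : r \in unitmx by case: rR => /SO_unitmx.
apply: (can_inj (mulKmx ru)); rewrite mulmxV // mulmxBr -scalemxAr mulmx1 Rl1_mul //.
by apply/matrixP => i j; rewrite !mxE; ring.
Qed.

Lemma Rl1_1 : Rl1 (1%:M : 'M[F]_(2 * l)).
Proof. by apply/Rl1P; split; [exact: SO1|move=> i j _; rewrite mxE]. Qed.

Lemma Rl1M r s : Rl1 r -> Rl1 s -> Rl1 (r *m s).
Proof.
move=> rR sR; rewrite Rl1_mul //; have := rR; have := sR => /Rl1P[sS sE] /Rl1P[rS rE].
apply/Rl1P; split; first by rewrite -Rl1_mul //; exact: SO_mul.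
by move=> i j nR; rewrite !mxE rE ?sE //; ring.
Qed.

Lemma Rl1V r : Rl1 r -> Rl1 (invmx r).
Proof.
move=> rR; have := rR => /Rl1P[rS rE]; apply/Rl1P; split; first exact: SO_inv.
by move=> i j nR; rewrite Rl1V_E // !mxE rE //; ring.
Qed.

Lemma Rl1_rev r i j : Rl1 r -> r (rev_ord j) (rev_ord i) = 2%:R * (i == j)%:R - r i j.
Proof. by move=> rR; rewrite -SO2l_invE ?Rl1V_E ?mxE //; case: rR. Qed.

Lemma root_entry_pos a i : ~~ root_entry (pos a) i \/ a = 3%:R.
Proof.
case: a => [[|[|[|[|?]]]] ?] //; [left|left|left|right; exact: val_inj];
  rewrite /root_entry /=; lia.
Qed.

Lemma root_entry_pos_pos a b : ~~ root_entry (pos a) (pos b).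
Proof.
have [//|->] := root_entry_pos a (pos b).
by case: b => [[|[|[|[|?]]]] ?] //; rewrite /root_entry /=; lia.
Qed.

End RootSubgroup.

Section Cells.
Context (R : realType) (F : padicField R) (varpi : F).
Local Notation q := ((resq F)%:R : R).
(* The cells of SO_3 on which the test Whittaker function is supported. *)
Definition cell0 (h : 'M[F]_3) : Prop := absp (h 2%:R 2%:R - 1) < 1 /\ absp (h 2%:R 0) < 1.
Definition cell1 (h : 'M[F]_3) : Prop :=
  absp (h 2%:R 0 + varpi) < q^-1 /\ absp (h 2%:R 2%:R) < 1.
End Cells.

Section Embedding.
Context (R : realType) (F : padicField R) (l : nat).
Hypothesis hl : (2 < l)%N.
Local Notation N := (2 * l)%N.
Implicit Types (i j k : 'I_(2 * l)) (M u r : 'M[F]_(2 * l)) (h n : 'M[F]_3).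
Local Notation pos := (pos hl).
Lemma lt_pos a b : (pos a < pos b)%N = (a < b)%N.
Proof.
by case: a => [[|[|[|[|?]]]] ?]; case: b => [[|[|[|[|?]]]] ?] //=; lia.
Qed.

Lemma embmx_pos_iwahori (Y : 'M[F]_4) : SO2l (embmx pos Y) ->
  (forall a b, absp (Y a b) <= 1) -> (forall a b : 'I_4, (b < a)%N -> absp (Y a b) < 1) ->
  (forall a, absp (Y a a - 1) < 1) -> iwahori_plus (embmx pos Y).
Proof.
move=> YS Y1 Yl Yd; split; first split => //.
- move=> i j; have [[a ->]|ni] := pos_cases hl i; last first.
    by rewrite embmx_outl //; case: eqP => _; rewrite ?absp1 ?absp0.
  have [[b ->]|nj] := pos_cases hl j; first by rewrite embmx_in //; exact: pos_inj.
  by rewrite embmx_outr //; case: eqP => _; rewrite ?absp1 ?absp0.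
- move=> i j ji; have ij : (i == j) = false by apply/eqP => e; rewrite e ltnn in ji.
  have [[a ia]|ni] := pos_cases hl i; last by rewrite embmx_outl // ij absp0.
  have [[b jb]|nj] := pos_cases hl j; last by rewrite embmx_outr // ij absp0.
  by rewrite ia jb embmx_in ?Yl -?lt_pos -?ia -?jb //; exact: pos_inj.
move=> i; have [[a ->]|ni] := pos_cases hl i; first by rewrite embmx_in //; exact: pos_inj.
by rewrite embmx_outl // eqxx subrr absp0.
Qed.

Variables (gam : F).
Hypothesis gam0 : gam != 0.

Definition embpos h : 'M[F]_(2 * l) := embmx pos (emb4 gam h).

Lemma embpos_SO2l h : SO3 gam h -> SO2l (embpos h).
Proof.
move=> hS; apply: SO2l_embmx; [exact: pos_inj|exact: rev_pos|..].
  by rewrite det_emb4 //; case: hS.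
exact: emb4_form.
Qed.

Lemma embposM h n : embpos (h *m n) = embpos h *m embpos n.
Proof. by rewrite /embpos emb4M // embmxM //; exact: pos_inj. Qed.

End Embedding.

(** * Values of the test Whittaker function on the two cells *)

Section WhittakerSupport.
Context (R : realType) (F : padicField R) (l : nat).
Hypothesis hl : (2 < l)%N.
Local Notation N := (2 * l)%N.
Local Notation q := ((resq F)%:R : R).
Implicit Types (i j k : 'I_(2 * l)) (M u r : 'M[F]_(2 * l)) (h n : 'M[F]_3).
Local Notation pos := (pos hl).
Variables (varpi alpha gam : F).
Hypothesis hvarpi : uniformizer varpi.
Hypothesis halpha : absp alpha = 1.
Hypothesis hgam : gam = - 4%:R * alpha.
Local Notation H := (inducing_group (l := l) varpi alpha).
Local Notation U := (@U2l R F l).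
Local Notation embpos := (embpos hl gam).
Local Notation tfun := (@tfun R F l).

Lemma gam_neq0 : gam != 0.
Proof.
by rewrite hgam mulf_neq0 ?oppr_eq0 ?four_neq0 // -absp_gt0 halpha.
Qed.
Let gam0 := gam_neq0.

Lemma absp_tfun i : i <> l.-1 :> nat -> i <> l :> nat -> absp (tfun i) = 1.
Proof.
have e m : absp ((-1) ^+ m : F) = 1 by rewrite abspX abspN absp1 expr1n.
by rewrite /tfun; case: ifP => _ //; case: eqP => // _; case: eqP.
Qed.

Lemma tfun_ends : tfun (pos 3%:R) = tfun (pos 0).
Proof.
have -> : pos 3%:R = rev_ord (pos 0) by rewrite rev_pos; congr pos; apply: val_inj.
rewrite tfun_rev // /tfun ifT ?invr_sign //=; lia.
Qed.

Fact last2_subproof : (N - 2 < N)%N. Proof. lia. Qed.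
Let m2 : 'I_(2 * l) := Ordinal last2_subproof.

Lemma conj_row_last u r h a : U u -> Rl1 r ->
  (u *m (r *m embpos h)) (pos 3%:R) (pos a) = emb4 gam h 3%:R a.
Proof.
move=> [uS uE] rR; have := rR => /(Rl1P hl)[rS rE].
rewrite mxE (bigD1 (pos 3%:R)) //= uE // eqxx mul1r big1 ?addr0; last first.
  by move=> k nk; rewrite uE 1?eq_sym ?(negPf nk) ?mul0r //=; have := ltn_ord k; lia.
rewrite mxE (bigD1 (pos 3%:R)) //= rE ?root_entry_pos_pos // eqxx mul1r.
rewrite (embmx_in (@pos_inj _ hl)) big1 ?addr0 // => k nk.
have [[b kb]|nb] := pos_cases hl k; last first.
  by rewrite [X in _ * X]embmx_outl // (_ : k == pos a = false) ?mulr0 //; apply/eqP => e; move: (nb a); rewrite e eqxx.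
by rewrite kb rE ?root_entry_pos_pos // -kb eq_sym (negPf nk) mul0r.
Qed.

Lemma conj_row_last_out u r h j : U u -> Rl1 r -> (forall a, j != pos a) ->
  (u *m (r *m embpos h)) (pos 3%:R) j = r (pos 3%:R) j.
Proof.
move=> [uS uE] rR nj.
rewrite mxE (bigD1 (pos 3%:R)) //= uE // eqxx mul1r big1 ?addr0; last first.
  by move=> k nk; rewrite uE 1?eq_sym ?(negPf nk) ?mul0r //=; have := ltn_ord k; lia.
rewrite mxE (bigD1 j) //= embmx_outr // eqxx mulr1 big1 ?addr0 // => k nk.
by rewrite embmx_outr // (negPf nk) mulr0.
Qed.

(** The row above the last one is a standard vector plus a multiple of the last row. Its diagonal
    entry will control the central sign. *)
Lemma conj_row_last2 u r h j : U u -> Rl1 r ->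
  (u *m (r *m embpos h)) m2 j =
  (m2 == j)%:R + u m2 (pos 3%:R) * (u *m (r *m embpos h)) (pos 3%:R) j.
Proof.
move=> [uS uE] rR; have := rR => /(Rl1P hl)[rS rE].
have m2pos a : m2 != pos a by rewrite -val_eqE /=; case: a => [[|[|[|[|?]]]] ?] //=; lia.
have -> : (u *m (r *m embpos h)) (pos 3%:R) j = (r *m embpos h) (pos 3%:R) j.
  rewrite mxE (bigD1 (pos 3%:R)) //= uE // eqxx mul1r big1 ?addr0 // => k nk.
  by rewrite uE 1?eq_sym ?(negPf nk) ?mul0r //=; have := ltn_ord k; lia.
rewrite mxE (bigD1 m2) //= (bigD1 (pos 3%:R)) /=; last by rewrite eq_sym m2pos.
rewrite big1 ?addr0 => [|k /andP[k1 k2]]; last first.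
  rewrite uE 1?eq_sym ?(negPf k1) ?mul0r //=.
  by move: k1 k2; rewrite -!val_eqE /=; have := ltn_ord k; lia.
congr (_ + _); rewrite uE // eqxx mul1r mxE (bigD1 m2) //= rE; last by rewrite /root_entry /=; lia.
rewrite eqxx mul1r embmx_outl // big1 ?addr0 // => k nk.
by rewrite rE 1?eq_sym ?(negPf nk) ?mul0r //; rewrite /root_entry /=; lia.
Qed.

(** By orthogonality the first column of [r] is determined by its last row. *)
Lemma Rl1_near r : Rl1 r ->
  (forall j, (forall a, j != pos a) -> absp (r (pos 3%:R) j) < 1) -> mxnear 1%:M r 1.
Proof.
move=> rR h i j; have := rR => /(Rl1P hl)[rS rE]; rewrite mxE.
have [ij|nij] := boolP (root_entry i j); last by rewrite rE // subrr absp0.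
have np k : (0 < k)%N -> (k < l.-1)%N \/ (l < k < N.-1)%N -> forall a, k != pos a.
  by move=> k0 hk a; rewrite -val_eqE /=; case: a => [[|[|[|[|?]]]] ?] //=; lia.
have nij : (i == j) = false.
  by apply/eqP => e; move: ij; rewrite e /root_entry; lia.
rewrite nij subr0; move: ij; rewrite /root_entry => /orP[/andP[/eqP j0 hi]|/andP[/eqP i0 hj]]; last first.
  have -> : i = pos 3%:R by apply: val_inj => /=; lia.
  by apply: h; apply: np; lia.
have := Rl1_rev hl i j rR; rewrite nij mulr0 sub0r => e; rewrite -[r i j]opprK -e.
have -> : rev_ord j = pos 3%:R by apply: val_inj => /=; lia.
by rewrite abspN; apply: h; apply: np => /=; lia.
Qed.

(** The last row is untouched by [u] and shows the last rows of [r] and [h]; it is compared with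
    that of [c] times a power of [g_chi] times [h'], with [h'] in I^+. The sign [c] is found to be
    congruent to 1 from the row above: its coefficient [x] is an integer, so its diagonal entry is
    congruent to 1. *)
Lemma whit_support u r h : U u -> Rl1 r -> SO3 gam h -> H (tconj (u *m (r *m embpos h))) ->
  mxnear 1%:M r 1 /\ (cell0 h \/ cell1 varpi h).
Proof.
move=> Uu rR hS /(inducing_groupP hl hvarpi halpha)[c [b [h' [c2 [[h'S h'i h'l] h'd] e]]]].
have c1 : absp c = 1.
  by apply/eqP; rewrite -sqrp_eq1 ?absp_ge0 // -abspX c2 absp1.
set T := tconj _ in e; set x := u m2 (pos 3%:R).
have t3 : absp (tfun (pos 3%:R)) = 1 by apply: absp_tfun => /=; lia.
have t0 : absp (tfun (pos 0)) = 1 by rewrite -tfun_ends.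
have tm : absp (tfun m2) = 1 by apply: absp_tfun => /=; lia.
have np_t j : (forall a, j != pos a) -> absp (tfun j) = 1.
  by move=> nj; apply: absp_tfun => hj; [have := nj 1|have := nj 2%:R]; rewrite -val_eqE /= hj eqxx.
have m2pos a : m2 != pos a by rewrite -val_eqE /=; case: a => [[|[|[|[|?]]]] ?] //=; lia.
have T33 : T (pos 3%:R) (pos 3%:R) = h 2%:R 2%:R.
  by rewrite /T tconjE // conj_row_last // emb4E // mxE /= mulrAC mulfV ?mul1r ?tfun_neq0.
have T30 : T (pos 3%:R) (pos 0) = h 2%:R 0.
  by rewrite /T tconjE // conj_row_last // emb4E // mxE /= tfun_ends mulrAC mulfV ?mul1r ?tfun_neq0.
have T3j j : (forall a, j != pos a) -> absp (T (pos 3%:R) j) = absp (r (pos 3%:R) j).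
  by move=> nj; rewrite /T tconjE // conj_row_last_out // !abspM abspV (np_t j nj) t3 invr1 mulr1 mul1r.
have Tm3 : absp (T m2 (pos 3%:R)) = absp (x * h 2%:R 2%:R).
  rewrite /T tconjE // conj_row_last2 // conj_row_last // emb4E // (negPf (m2pos _)) add0r mxE /=.
  by rewrite !abspM abspV t3 tm invr1 mulr1 mul1r.
have Tm0 : absp (T m2 (pos 0)) = absp (x * h 2%:R 0).
  rewrite /T tconjE // conj_row_last2 // conj_row_last // emb4E // (negPf (m2pos _)) add0r mxE /=.
  by rewrite !abspM abspV t0 tm invr1 mulr1 mul1r.
have Tmm : T m2 m2 = 1 + x * r (pos 3%:R) m2.
  by rewrite /T tconjE // conj_row_last2 // conj_row_last_out // eqxx mulrAC mulfV ?mul1r ?tfun_neq0.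
have close y : absp (c - 1) < 1 -> absp (y - 1) < 1 -> absp (c * y - 1) < 1 by exact: absp_unit1M.
have cnear y : absp (y - 1) < 1 -> absp x <= 1 -> absp (r (pos 3%:R) m2) < 1 ->
    T m2 m2 = c * y -> absp (c - 1) < 1.
  move=> y1 x1 r1 ey; have -> : c - 1 = - (c * (y - 1)) + x * r (pos 3%:R) m2.
    by rewrite mulrBr mulr1 -ey Tmm; ring.
  apply: absp_lt_add; first by rewrite abspN abspM c1 mul1r.
  by rewrite abspM (le_lt_trans _ r1) // ler_piMl ?absp_ge0.
(* The component of [g_chi] leads to the second cell, I^+ itself to the first. *)
case: b e => e.
  have eT i j : T i j = c * (gcoef varpi alpha i * h' (gperm hl i) j).
    by rewrite e mxE (g_chi_mul hl).
  have eT3 j : T (pos 3%:R) j = - (c * varpi * h' (pos 0) j).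
    have g3 : gperm hl (pos 3%:R) = 0%N :> nat by apply: (gperm_last hl varpi alpha).
    rewrite eT (_ : gperm hl (pos 3%:R) = pos 0); last exact: val_inj.
    by rewrite /gcoef ifF ?eqxx //=; [ring | lia].
  have eTm j : T m2 j = c * h' m2 j.
    have [g1 g2] : gcoef varpi alpha m2 = 1 /\ gperm hl m2 = m2 :> nat.
      by case: (gpermP hl varpi alpha m2) => /=; move=> *; try (exfalso; lia).
    by rewrite eT g1 mul1r (val_inj g2).
  have r1 j : (forall a, j != pos a) -> absp (r (pos 3%:R) j) < 1.
    move=> nj; rewrite -T3j // eT3 abspN !abspM c1 mul1r hvarpi.
    by apply: (@le_lt_trans _ _ q^-1); [rewrite ler_piMr // ltW ?qV_gt0|exact: qV_lt1].
  split; first exact: Rl1_near.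
  right; have h30 : absp (h 2%:R 0) = q^-1.
    by rewrite -T30 eT3 abspN !abspM c1 mul1r hvarpi (absp_unit1 (h'd _)) mulr1.
  have x1 : absp x <= 1.
    have : absp (T m2 (pos 0)) < 1 by rewrite eTm abspM c1 mul1r h'l //=; lia.
    rewrite Tm0 => /absp_lt1V; rewrite abspM h30 => hx.
    by rewrite -(ler_pM2r (qV_gt0 F)) mul1r (hx _ hvarpi).
  have cc := cnear _ (h'd m2) x1 (r1 _ m2pos) (eTm m2).
  split; last first.
    by rewrite -T33 eT3 abspN !abspM c1 mul1r hvarpi (le_lt_trans _ (qV_lt1 F)) // ler_piMr // ltW ?qV_gt0.
  rewrite -T30 eT3 (_ : _ + _ = - varpi * (c * h' (pos 0) (pos 0) - 1)); last by ring.
  by rewrite abspM abspN hvarpi -[X in _ < X]mulr1 ltr_pM2l ?qV_gt0 // close.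
have eT i j : T i j = c * h' i j by rewrite e /= mul1mx mxE.
have r1 j : (forall a, j != pos a) -> absp (r (pos 3%:R) j) < 1.
  move=> nj; rewrite -T3j // eT abspM c1 mul1r h'l //.
  by have := nj 3%:R; rewrite -val_eqE /=; have := ltn_ord j; lia.
split; first exact: Rl1_near.
left; have h33 : absp (h 2%:R 2%:R) = 1.
  by rewrite -T33 eT abspM c1 (absp_unit1 (h'd _)) mulr1.
have x1 : absp x <= 1.
  by have := h'i m2 (pos 3%:R); rewrite -[X in X <= _]mul1r -c1 -abspM -eT Tm3 abspM h33 mulr1.
have cc := cnear _ (h'd m2) x1 (r1 _ m2pos) (eT m2 m2).
split; first by rewrite -T33 eT close.
by rewrite -T30 eT abspM c1 mul1r h'l //=; lia.
Qed.

Lemma mul_selmx m (f : 'I_4 -> 'I_(2 * l)) (M : 'M[F]_(m, 2 * l)) (i : 'I_m) a :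
  (M *m selmx F f) i a = M i (f a).
Proof.
rewrite mxE (bigD1 (f a)) //= mxE eqxx mulr1 big1 ?addr0 // => k nk.
by rewrite mxE (negPf nk) mulr0.
Qed.

Lemma selmxT_mulmx m (f : 'I_4 -> 'I_(2 * l)) (M : 'M[F]_(2 * l, m)) a (j : 'I_m) :
  ((selmx F f)^T *m M) a j = M (f a) j.
Proof.
rewrite mxE (bigD1 (f a)) //= !mxE eqxx mul1r big1 ?addr0 // => k nk.
by rewrite !mxE (negPf nk) mul0r.
Qed.

Lemma root_conjE r y i j : Rl1 r -> let v := invmx r in
  (r *m embpos (umx gam y) *m v) i j = (i == j)%:R +
    (r i (pos 0) * (2%:R * y * v (pos 1) j + y / (2%:R * gam) * v (pos 2%:R) j
                    - y ^+ 2 / gam * v (pos 3%:R) j)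
     - y / (2%:R * gam) * r i (pos 1) * v (pos 3%:R) j
     - 2%:R * y * r i (pos 2%:R) * v (pos 3%:R) j).
Proof.
move=> rR v; have ru : r \in unitmx by case: rR => /SO_unitmx.
have two0 := two_neq0 F; have four0 := four_neq0 F.
rewrite /embpos /embmx mulmxDr mulmx1 mulmxDl mulmxV // mxE [in X in X + _]mxE; congr (_ + _).
set Z := emb4 _ _ - _.
have -> : r *m (selmx F pos *m Z *m (selmx F pos)^T) *m v =
  (r *m selmx F pos) *m (Z *m ((selmx F pos)^T *m v)) by rewrite !mulmxA.
have mul4 m p (A : 'M[F]_(m, 4)) (B : 'M[F]_(4, p)) a b : (A *m B) a b =
    A a 0 * B 0 b + (A a 1 * B 1 b + (A a 2%:R * B 2%:R b + A a 3%:R * B 3%:R b)).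
  rewrite mxE !big_ord_recl big_ord0 addr0.
  by congr (_ + (_ + (_ + _))); congr (_ * _); congr fun_of_matrix; apply: val_inj.
have eight0 : 8%:R != 0 :> F by rewrite (natrM _ 2 4) mulf_neq0.
have ZE : Z = mx_rows 4 [:: [:: 0; 2%:R * y; y / (2%:R * gam); - y ^+ 2 / gam];
    [:: 0; 0; 0; - y / (2%:R * gam)]; [:: 0; 0; 0; - 2%:R * y]; [:: 0; 0; 0; 0]].
  rewrite /Z emb4E //.
  by apply: matrix4P; split; rewrite !mxE /=; field; rewrite ?gam0 ?two0 ?four0 ?eight0.
rewrite mul4 !mul4 !mul_selmx !selmxT_mulmx ZE !mxE /=.
by field; rewrite ?gam0 ?two0.
Qed.

(** Allows an element of U_3 to the left of [h] to be moved past [r] and absorbed in U. *)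
Lemma root_conj_U r y : Rl1 r -> U (r *m embpos (umx gam y) *m invmx r).
Proof.
move=> rR; have VR := Rl1V hl rR; have := rR => /(Rl1P hl)[rS rE]; have := VR => /(Rl1P hl)[VS VE].
split; first by apply: SO_mul VS; apply: SO_mul rS _; apply: embpos_SO2l; [exact: gam0|exact: umx_SO3].
move=> i j ji; rewrite root_conjE //; rewrite -[RHS]addr0; congr (_ + _).
have eqF (k k' : 'I_(2 * l)) : nat_of_ord k <> k' -> (k == k')%:R = 0 :> F.
  by move=> ne; case: eqP => // e; case: ne; rewrite e.
have r0 : (l.-1 <= i)%N -> r i (pos 0) = 0.
  move=> hi; rewrite rE; last by rewrite /root_entry /=; lia.
  by apply: eqF => /=; lia.
have [lj|jl] := ltnP l j.
  rewrite r0; last by lia.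
  rewrite !rE; try by rewrite /root_entry /=; have := ltn_ord i; lia.
  rewrite (eqF i (pos 1)) ?(eqF i (pos 2%:R)) /=; try lia.
  by rewrite !(mulr0, mul0r, subr0).
have -> : invmx r (pos 3%:R) j = 0.
  rewrite VE; last by rewrite /root_entry /=; lia.
  by apply: eqF => /=; lia.
rewrite !mulr0 !subr0.
have [hj|hj] := leqP l.-1 j; first by rewrite r0 ?mul0r //; lia.
rewrite !VE; try by rewrite /root_entry /=; lia.
rewrite (eqF (pos 1)) ?(eqF (pos 2%:R)) /=; try lia.
by rewrite !(mulr0, addr0).
Qed.

Variable psi : F -> R[i].
Hypothesis hpsi : additive_character_level1 psi.

(** The two middle entries are 2y and y/(2 gam) times the same entry of [r], and the weights 1/4 and
    -gam of [psi_U] make them cancel. *)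
Lemma root_conj_psi r y : Rl1 r -> psi_U psi gam (r *m embpos (umx gam y) *m invmx r) = 1.
Proof.
move=> rR; have VR := Rl1V hl rR; have := VR => /(Rl1P hl)[VS VE].
have two0 := two_neq0 F; have four0 := four_neq0 F.
have eqF (k k' : 'I_(2 * l)) : nat_of_ord k <> k' -> (k == k')%:R = 0 :> F.
  by move=> ne; case: eqP => // e; case: ne; rewrite e.
have eqT (k k' : 'I_(2 * l)) : nat_of_ord k = k' -> (k == k')%:R = 1 :> F.
  by move=> e; rewrite (val_inj e) eqxx.
have v3 j : (j <= l)%N -> invmx r (pos 3%:R) j = 0.
  move=> hj; rewrite VE; last by rewrite /root_entry /=; lia.
  by apply: eqF => /=; lia.
have nR (a : 'I_4) j : a != 3%:R -> ~~ root_entry (pos a) j.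
  by have [//|->] := root_entry_pos hl a j.
rewrite psi_UE /psiU_arg big_nat big1 => [|i /andP[i1 i2]]; last first.
  have h1 : (i.-1 < N)%N by lia.
  have h2 : (i.+1.-1 < N)%N by lia.
  rewrite (ent_lt _ h1 h2) root_conjE // (v3 (Ordinal h2)) /=; last by lia.
  rewrite !VE ?nR // (eqF (pos 1)) ?(eqF (pos 2%:R)) ?eqF /=; try lia.
  by rewrite !(mulr0, addr0, subr0).
have h0 : (l.-1.-1 < N)%N by lia.
have h1 : (l.-1 < N)%N by lia.
have h2 : (l.+1.-1 < N)%N by lia.
rewrite (ent_lt _ h0 h1) (ent_lt _ h0 h2) !root_conjE // !v3 //=; last by lia.
rewrite !VE ?nR // (eqF (Ordinal h0) (Ordinal h1)) /=; last by lia.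
rewrite (eqF (Ordinal h0) (Ordinal h2)) /=; last by lia.
rewrite (eqT (pos 1) (Ordinal h1)) // (eqF (pos 1) (Ordinal h2)) /=; last by lia.
rewrite (eqT (pos 2%:R) (Ordinal h2)) // (eqF (pos 2%:R) (Ordinal h1)) /=; last by lia.
rewrite (_ : _ - _ = 0); first exact: psi0 hpsi.
by rewrite /=; field; rewrite gam0 four0 two0.
Qed.

(** For l > 2 no simple affine position has both coordinates among 1, l, l + 1, 2l, so the affine
    character does not see the block containing SO_3. *)
Lemma embmx_pos_affine (Y : 'M[F]_4) : affine_character psi varpi alpha (embmx pos Y) = 1.
Proof.
apply: (affine_zero hl hvarpi halpha hpsi) => i j hij.
have np k : (0 < k)%N -> (k < l.-1)%N \/ (l < k < N.-1)%N -> forall a, k != pos a.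
  by move=> k0 hk a; rewrite -val_eqE /=; case: a => [[|[|[|[|?]]]] ?] //=; lia.
have ij : (i == j) = false by rewrite -val_eqE /=; case: hij => -[]; lia.
case: hij => -[h1 h2].
- have [i0|i0] := posnP i; last by rewrite embmx_outl ?ij //; apply: np => //; lia.
  by rewrite embmx_outr ?ij //; apply: np; lia.
- by rewrite embmx_outl ?ij //; apply: np; lia.
by rewrite embmx_outl ?ij //; apply: np; lia.
Qed.

Let sg : F := tfun (pos 0).

Let sg2 : sg * sg = 1.
Proof.
have e : tfun (pos 3%:R) = (tfun (pos 0))^-1.
  by rewrite -tfun_rev // rev_pos; congr (tfun (pos _)); apply: val_inj.
by rewrite /sg -{1}tfun_ends e mulVf // tfun_neq0.
Qed.

Lemma tconj_embpos n : tconj (embpos n) = embmx pos (mx_rows 4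
  [:: [:: n 0 0; sg * n 0 1 / 2%:R; - sg * n 0 1 / (2%:R * alpha); n 0 2%:R];
      [:: sg * n 1 0; (1 + n 1 1) / 2%:R; (1 - n 1 1) / (2%:R * alpha); sg * n 1 2%:R];
      [:: - alpha * sg * n 1 0; alpha * (1 - n 1 1) / 2%:R; (1 + n 1 1) / 2%:R; - alpha * sg * n 1 2%:R];
      [:: n 2%:R 0; sg * n 2%:R 1 / 2%:R; - sg * n 2%:R 1 / (2%:R * alpha); n 2%:R 2%:R]]).
Proof.
have two0 := two_neq0 F; have four0 := four_neq0 F.
have al0 : alpha != 0 by rewrite -absp_gt0 halpha.
have sg0 : sg != 0 by exact: tfun_neq0.
have eight0 : 8%:R != 0 :> F by rewrite (natrM _ 2 4) mulf_neq0.
have sgV : sg^-1 = sg by apply: (mulfI sg0); rewrite mulfV // sg2.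
set Y := mx_rows 4 _.
have YE a b : tfun (pos a) * emb4 gam n a b / tfun (pos b) = Y a b.
  have t0 : tfun (pos 0) = sg by [].
  have t1 : tfun (pos 1) = 4%:R by apply: tfun_mid1.
  have t2 : tfun (pos 2%:R) = 4%:R^-1 by apply: tfun_mid2.
  have t3 : tfun (pos 3%:R) = sg by exact: tfun_ends.
  suff : \matrix_(a, b) (tfun (pos a) * emb4 gam n a b / tfun (pos b)) = Y.
    by move=> /matrixP/(_ a b); rewrite mxE.
  rewrite emb4E //; apply: matrix4P; split; rewrite !mxE /= ?t0 ?t1 ?t2 ?t3 ?sgV ?hgam.
  1,4,13,16: by rewrite mulrAC sg2 mul1r.
  1-12: by rewrite ?invrK; field; rewrite ?oppr_eq0 ?al0 ?four0 ?two0 ?eight0.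
apply/matrixP => i j; rewrite tconjE //.
have [[a ->]|ni] := pos_cases hl i; last first.
  rewrite /embpos !embmx_outl //; case: eqP => [->|_]; last by rewrite mulr0 mul0r.
  by rewrite mulr1 mulfV ?tfun_neq0.
have [[b ->]|nj] := pos_cases hl j; last first.
  rewrite /embpos !embmx_outr //; case: eqP => [->|_]; last by rewrite mulr0 mul0r.
  by rewrite mulr1 mulfV ?tfun_neq0.
by rewrite /embpos !embmx_in ?YE //; exact: pos_inj.
Qed.

Lemma tconj_Rl1_iwahori r : Rl1 r -> mxnear 1%:M r 1 -> iwahori_plus (tconj r).
Proof.
move=> rR near; have := rR => /(Rl1P hl)[rS rE].
have tE i j : tconj r i j = tfun i * r i j / tfun j by rewrite tconjE.
have big i j : root_entry i j -> (j < i)%N /\ absp (tconj r i j) < 1.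
  move=> ij; have := ij; rewrite /root_entry => hij; split; first by have := ltn_ord j; lia.
  have nij : (i == j) = false by apply/eqP => e; move: hij; rewrite e; lia.
  rewrite tE !abspM abspV !absp_tfun ?invr1 ?mul1r ?mulr1; try by have := ltn_ord j; lia.
  by have := near i j; rewrite mxE nij subr0.
have small i j : ~~ root_entry i j -> tconj r i j = (i == j)%:R.
  move=> ij; rewrite tE rE //; case: eqP => [->|_]; last by rewrite mulr0 mul0r.
  by rewrite mulr1 mulfV ?tfun_neq0.
split; first split; first exact: tconj_SO2l.
- move=> i j; have [/big[_ /ltW] //|/small ->] := boolP (root_entry i j).
  by case: eqP; rewrite ?absp1 ?absp0.
- move=> i j ji; have [/big[] //|/small ->] := boolP (root_entry i j).
  by case: eqP => [e|]; rewrite ?absp0 //; rewrite e ltnn in ji.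
move=> i; have [/big[]|/small ->] := boolP (root_entry i i); first by rewrite ltnn.
by rewrite eqxx subrr absp0.
Qed.

Lemma tconj_Rl1_affine r : Rl1 r -> affine_character psi varpi alpha (tconj r) = 1.
Proof.
move=> /(Rl1P hl)[rS rE]; apply: (affine_zero hl hvarpi halpha hpsi) => i j hij.
have ij : (i == j) = false by rewrite -val_eqE /=; case: hij => -[]; lia.
rewrite tconjE // rE ?ij ?mulr0 ?mul0r //.
by rewrite /root_entry; case: hij => -[]; lia.
Qed.

Variables (eps : R[i]) (omega chi : 'M[F]_(2 * l) -> R[i]).
Hypothesis hchi : extended_character psi varpi alpha eps omega chi.

(** Chosen so that [wl1] cancels and [tmx] acts by conjugation in the terms of the Whittaker sum, as
    [whit_arg] shows. *)
Definition whit_shift : 'M[F]_(2 * l) := invmx (wl1 F l) *m invmx (tmx F l).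

Lemma whit_shift_SO2l : SO2l whit_shift.
Proof. by apply: SO_mul; apply: SO_inv; [exact: wl1_SO2l|exact: tmx_SO2l]. Qed.

Definition test_whittaker M : R[i] :=
  whit_functional varpi alpha psi gam (right_translate M (phi_tr varpi alpha chi whit_shift)).

Lemma test_whittaker_in : whittaker_model psi gam (compact_induction H chi) test_whittaker.
Proof.
exists (whit_functional varpi alpha psi gam), (phi_tr varpi alpha chi whit_shift).
split => //; first exact: (whit_functionalP hl hvarpi halpha hpsi hchi hgam).
apply: (phi_tr_in hl hvarpi halpha hpsi hchi); exact: whit_shift_SO2l.
Qed.

Lemma whit_arg u r h : tmx F l *m u *m (r *m wl1 F l *m emb l gam h) *m whit_shift =
  tconj (u *m (r *m embpos h)).
Proof.
rewrite (emb_embmx hl) -[r *m _ *m _]mulmxA (wl1_emb hl) /whit_shift /tconj.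
have wu : wl1 F l \in unitmx by exact: SO_unitmx (wl1_SO2l F hl).
by rewrite !mulmxA mulmxK.
Qed.

Lemma test_whittaker0 r h : Rl1 r -> SO3 gam h ->
  ~ (mxnear 1%:M r 1 /\ (cell0 h \/ cell1 varpi h)) ->
  test_whittaker (r *m wl1 F l *m emb l gam h) = 0.
Proof.
move=> rR hS nh; apply: whit_phi_tr0 => u Uu; rewrite whit_arg => Hu; apply: nh.
exact: whit_support Uu rR hS Hu.
Qed.

(** [h] may be replaced by any representative of its U_3-coset: [psi_U] is trivial on the element of
    U that compensates, and the affine character is trivial on [tconj r]. *)
Lemma test_whittaker_val r h y : Rl1 r -> SO3 gam h -> mxnear 1%:M r 1 ->
  H (tconj (embpos (umx gam y *m h))) ->
  test_whittaker (r *m wl1 F l *m emb l gam h) = chi (tconj (embpos (umx gam y *m h))).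
Proof.
move=> rR hS near Hn; set u := r *m embpos (umx gam y) *m invmx r.
have Uu : U u by exact: root_conj_U.
have ru : r \in unitmx by case: rR => /SO_unitmx.
have e : tconj (u *m (r *m embpos h)) = tconj r *m tconj (embpos (umx gam y *m h)).
  by rewrite -tconjM // /u embposM ?gam0 // !mulmxA mulmxKV.
have rI := tconj_Rl1_iwahori rR near.
have Hr : H (tconj r) by exact: (inducing_iwahori hl hvarpi halpha).
rewrite /test_whittaker (whit_phi_tr hl hvarpi halpha hpsi hchi hgam whit_shift_SO2l _ Uu).
- rewrite root_conj_psi // mulr1 whit_arg e (chiM hchi Hr Hn) (chi_iwahori hchi rI).
  by rewrite tconj_Rl1_affine // mul1r.
- apply: SO_mul; first by apply: SO_mul; [case: rR|exact: wl1_SO2l].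
  rewrite (emb_embmx hl); apply: SO2l_embmx; [exact: pos0_inj|exact: rev_pos0|..].
    by have := det_emb4 gam0 h; rewrite /emb4 => ->; case: hS.
  exact: (emb4_form gam0 hS).
by rewrite whit_arg e; apply: (inducingM hl hvarpi halpha).
Qed.

Lemma absp_half (x : F) : absp x ^+ 2 < absp gam -> absp (x / 2%:R) < 1.
Proof.
have two0 : 0 < absp (2%:R : F) by rewrite absp_gt0 two_neq0.
rewrite (absp_two_square halpha hgam) abspM abspV ltr_pdivrMr // mul1r.
by rewrite ltr_sqr ?nnegrE ?absp_ge0.
Qed.

Lemma absp_sg : absp sg = 1.
Proof. by apply/eqP; rewrite -sqrp_eq1 ?absp_ge0 // expr2 -abspM sg2 absp1. Qed.

Lemma absp_over_alpha (x : F) : absp (sg * x / 2%:R) = absp (x / 2%:R) /\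
  absp (- sg * x / (2%:R * alpha)) = absp (x / 2%:R).
Proof. by rewrite !abspM !abspV !abspM ?abspN absp_sg halpha !mul1r mulr1. Qed.

(** The common shape of the representatives for the two cells: lower triangular for the first, upper
    triangular for the second once [g_chi] is split off. *)
Definition unit_rows4 (a b1 b2 b3 e1 k1 e2 k2 d e3 e4 c : F) : 'M[F]_4 := mx_rows 4
  [:: [:: a; b1; b2; b3]; [:: e1; 1; 0; k1]; [:: e2; 0; 1; k2]; [:: d; e3; e4; c]].

Lemma unit_rows4_iwahori (a b1 b2 b3 e1 k1 e2 k2 d e3 e4 c : F) :
  SO2l (embmx pos (unit_rows4 a b1 b2 b3 e1 k1 e2 k2 d e3 e4 c)) ->
  absp (a - 1) < 1 -> absp (c - 1) < 1 ->
  absp b1 <= 1 -> absp b2 <= 1 -> absp b3 <= 1 -> absp k1 <= 1 -> absp k2 <= 1 ->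
  absp e1 < 1 -> absp e2 < 1 -> absp e3 < 1 -> absp e4 < 1 -> absp d < 1 ->
  iwahori_plus (embmx pos (unit_rows4 a b1 b2 b3 e1 k1 e2 k2 d e3 e4 c)).
Proof.
move=> YS ha hc hb1 hb2 hb3 hk1 hk2 he1 he2 he3 he4 hd.
have a1 := absp_unit1 ha; have c1 := absp_unit1 hc.
apply: embmx_pos_iwahori => //.
- move=> [[|[|[|[|?]]]] ?] // [[|[|[|[|?]]]] ?] //; rewrite !mxE /= ?absp0 ?absp1 ?a1 ?c1 //; exact: ltW.
- by move=> [[|[|[|[|?]]]] ?] // [[|[|[|[|?]]]] ?] //; rewrite !mxE /= ?absp0.
by move=> [[|[|[|[|?]]]] ?] //; rewrite !mxE /= ?subrr ?absp0.
Qed.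

Lemma test_whittaker_cell0 r h : Rl1 r -> SO3 gam h -> mxnear 1%:M r 1 -> cell0 h ->
  test_whittaker (r *m wl1 F l *m emb l gam h) = 1.
Proof.
move=> rR hS near [c1 a1].
have c0 : h 2%:R 2%:R != 0 by rewrite -absp_gt0 (absp_unit1 c1).
have [y ny] := SO3_lower gam0 hS c0.
have nS : SO3 gam (umx gam y *m h) by apply: SO_mul hS; exact: umx_SO3.
have n20 : - h 2%:R 1 ^+ 2 / (gam * h 2%:R 2%:R) = h 2%:R 0.
  by rewrite (SO3_last_iso gam0 hS); field; rewrite gam0 c0.
(* From b^2 = -gam a c with |c| = 1 and |a| < 1. *)
have b1 : absp (h 2%:R 1 / 2%:R) < 1.
  apply: absp_half; rewrite -abspX (SO3_last_iso gam0 hS) !abspM abspN (absp_unit1 c1) mulr1.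
  by rewrite gtr_pMr // absp_gt0.
have n10 : absp (- 2%:R * h 2%:R 1 / (gam * h 2%:R 2%:R)) = absp (h 2%:R 1 / 2%:R).
  rewrite !abspM !abspV !abspM (absp_unit1 c1) mulr1 abspN (absp_two_square halpha hgam).
  by field; rewrite absp_eq0 two_neq0.
have two0 := two_neq0 F.
have [b2 b3] := absp_over_alpha (h 2%:R 1).
have YI : iwahori_plus (tconj (embpos (umx gam y *m h))).
  have := tconj_SO2l hl (embpos_SO2l hl gam0 nS); rewrite tconj_embpos ny => YS.
  set Y' := mx_rows 4 _ in YS *; have Y'E : Y' = unit_rows4 (h 2%:R 2%:R)^-1 0 0 0
     (sg * (- 2%:R * h 2%:R 1 / (gam * h 2%:R 2%:R))) 0
     (- alpha * sg * (- 2%:R * h 2%:R 1 / (gam * h 2%:R 2%:R))) 0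
     (h 2%:R 0) (sg * h 2%:R 1 / 2%:R) (- sg * h 2%:R 1 / (2%:R * alpha)) (h 2%:R 2%:R).
    by rewrite /Y' /unit_rows4; congr (mx_rows 4 [:: [:: _; _; _; _]; [:: _; _; _; _]; [:: _; _; _; _]; [:: _; _; _; _]]);
      rewrite ?mxE /= ?n20 // ?(mulr0, mul0r, subrr) // -[1 + 1]/(2%:R) mulfV.
  rewrite Y'E in YS *; apply: unit_rows4_iwahori => //; rewrite ?absp0 //; first exact: absp_unit1V.
  - by rewrite abspM absp_sg mul1r n10.
  - by rewrite abspM [absp (_ * sg)]abspM abspN halpha absp_sg !mul1r n10.
  - by rewrite b2.
  - by rewrite b3.
rewrite (test_whittaker_val rR hS near (inducing_iwahori hl hvarpi halpha YI)).
by rewrite (chi_iwahori hchi YI) tconj_embpos embmx_pos_affine.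
Qed.

Lemma test_whittaker_cell1 r h : Rl1 r -> SO3 gam h -> mxnear 1%:M r 1 -> cell1 varpi h ->
  test_whittaker (r *m wl1 F l *m emb l gam h) = eps.
Proof.
move=> rR hS near [a1 c1].
have va0 : varpi != 0 by exact: uniformizer_neq0 hvarpi.
have al0 : alpha != 0 by rewrite -absp_gt0 halpha.
have va : absp (h 2%:R 0) = q^-1.
  by rewrite -hvarpi -[absp varpi]abspN; apply: absp_sub_eq; rewrite opprK abspN hvarpi.
have a0 : h 2%:R 0 != 0 by rewrite -absp_gt0 va qV_gt0.
have [y ny] := SO3_antilower gam0 hS a0.
have nS : SO3 gam (umx gam y *m h) by apply: SO_mul hS; exact: umx_SO3.
have n22 : - h 2%:R 1 ^+ 2 / (gam * h 2%:R 0) = h 2%:R 2%:R.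
  by rewrite (SO3_last_iso gam0 hS); field; rewrite gam0 a0.
(* Here |b/2|^2 = |a c| with |a| = 1/q, and |c| < 1 means |c| <= 1/q. *)
have b1 : absp (h 2%:R 1 / 2%:R / varpi) <= 1.
  have : absp (h 2%:R 1 / 2%:R / varpi) ^+ 2 <= 1; last by rewrite expr_le1 ?absp_ge0.
  rewrite !abspM !abspV !exprMn -abspX (SO3_last_iso gam0 hS) !abspM abspN va.
  rewrite (absp_two_square halpha hgam) hvarpi.
  have t0 : absp (2%:R : F) ^+ 2 != 0 by rewrite expf_neq0 // absp_eq0 two_neq0.
  have q0 := q_neq0 F.
  rewrite [X in X <= _](_ : _ = absp (h 2%:R 2%:R) * q); last first.
    by rewrite invrK; field; rewrite q0 absp_eq0 two_neq0.
  by rewrite -ler_pdivlMr ?q_gt0 // mul1r (absp_lt1V hvarpi c1).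
have two0 := two_neq0 F.
set n := umx gam y *m h in ny nS *.
(* The representative with the factor [g_chi] split off on the left. *)
pose Y := unit_rows4 (- h 2%:R 0 / varpi) (- sg * (h 2%:R 1 / 2%:R / varpi))
   (sg / alpha * (h 2%:R 1 / 2%:R / varpi)) (- h 2%:R 2%:R / varpi)
   0 (- sg * (2%:R * h 2%:R 1 / (gam * h 2%:R 0))) 0 (alpha * sg * (2%:R * h 2%:R 1 / (gam * h 2%:R 0)))
   0 0 0 (- varpi / h 2%:R 0).
have gY : tconj (embpos n) = g_chi l varpi alpha *m embmx pos Y.
  rewrite (g_chi_embmx hl) // embmxM; last exact: pos_inj.
  rewrite tconj_embpos; congr embmx; rewrite ny /Y.
  rewrite /g4 /unit_rows4 mulmx_rows4.
  by congr (mx_rows 4 [:: [:: _; _; _; _]; [:: _; _; _; _]; [:: _; _; _; _]; [:: _; _; _; _]]);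
    rewrite ?mxE /= -?n22; field; rewrite ?va0 ?al0 ?a0 ?gam0 ?two0.
have YS : SO2l (embmx pos Y).
  apply: (SO_mull (g_chi_SO2l hl hvarpi halpha)); rewrite -gY.
  by apply: tconj_SO2l => //; exact: embpos_SO2l.
have k1 : absp (2%:R * h 2%:R 1 / (gam * h 2%:R 0)) <= 1.
  apply: le_trans b1; rewrite !abspM !abspV !abspM va hvarpi (absp_two_square halpha hgam).
  rewrite le_eqVlt; apply/orP; left; apply/eqP; field.
  by rewrite absp_eq0 two_neq0 q_neq0.
have YI : iwahori_plus (embmx pos Y).
  apply: unit_rows4_iwahori => //; rewrite ?absp0 //.
  - rewrite (_ : _ - 1 = - (h 2%:R 0 + varpi) / varpi); last by field.
    by rewrite abspM abspN abspV hvarpi invrK -ltr_pdivlMr ?q_gt0 // div1r.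
  - rewrite (_ : _ - 1 = - (h 2%:R 0 + varpi) / h 2%:R 0); last by field.
    by rewrite abspM abspN abspV va invrK -ltr_pdivlMr ?q_gt0 // div1r.
  - by rewrite abspM abspN absp_sg mul1r.
  - by rewrite abspM [absp (sg / _)]abspM abspV halpha absp_sg invr1 !mul1r.
  - by rewrite abspM abspN abspV hvarpi invrK -ler_pdivlMr ?q_gt0 // mul1r (absp_lt1V hvarpi c1).
  - by rewrite abspM abspN absp_sg mul1r.
  - by rewrite abspM [absp (_ * sg)]abspM halpha absp_sg !mul1r.
have Hn : H (tconj (embpos n)).
  by rewrite gY; apply: (inducingM hl hvarpi halpha); [exact: inducing_g|exact: (inducing_iwahori hl hvarpi halpha)].
rewrite (test_whittaker_val rR hS near Hn) -/n gY (chiM hchi); first last.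
- exact: (inducing_iwahori hl hvarpi halpha).
- exact: inducing_g.
by rewrite (chi_g hchi) (chi_iwahori hchi YI) embmx_pos_affine mulr1.
Qed.

End WhittakerSupport.

(** * Complex integrals *)

Section ComplexIntegrals.
Context (R : realType) (d : measure_display) (T : measurableType d).
Variable mu : {measure set T -> \bar R}.
Local Notation C := R[i].
Implicit Types (D A : set T) (f g : T -> C).

Definition has_cintegral D f (v : C) : Prop := cintegrable mu D f /\ cintegral mu D f = v.

Lemma has_cintegral_eq D f g v : measurable D -> (forall x, D x -> f x = g x) ->
  has_cintegral D g v -> has_cintegral D f v.
Proof.
move=> mD fg [[g1 g2] <-]; split; first split.
- by apply: eq_integrable g1 => // x /set_mem Dx /=; rewrite fg.
- by apply: eq_integrable g2 => // x /set_mem Dx /=; rewrite fg.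
by apply: complex_eqP => /=; apply: eq_Rintegral => x /set_mem Dx; rewrite fg.
Qed.

Lemma has_cintegralD D f g v w : measurable D ->
  has_cintegral D f v -> has_cintegral D g w -> has_cintegral D (fun x => f x + g x) (v + w).
Proof.
move=> mD [[f1 f2] <-] [[g1 g2] <-].
have eRe x : complex.Re (f x + g x) = complex.Re (f x) + complex.Re (g x).
  by case: (f x) (g x) => [? ?] [? ?].
have eIm x : complex.Im (f x + g x) = complex.Im (f x) + complex.Im (g x).
  by case: (f x) (g x) => [? ?] [? ?].
split; first split.
- apply: eq_integrable (integrableD mD f1 g1) => // x _ /=.
  by rewrite eRe.
- apply: eq_integrable (integrableD mD f2 g2) => // x _ /=.
  by rewrite eIm.
rewrite /cintegral; apply: complex_eqP; rewrite /=.
  by rewrite -RintegralD //; apply: eq_Rintegral => x _; rewrite eRe.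
by rewrite -RintegralD //; apply: eq_Rintegral => x _; rewrite eIm.
Qed.

Lemma has_cintegral_step D A f (w : C) : measurable D -> measurable A -> A `<=` D ->
  (mu A < +oo)%E -> (forall x, A x -> f x = w) -> (forall x, D x -> ~ A x -> f x = 0) ->
  has_cintegral D f (w * (fine (mu A))%:C%C).
Proof.
move=> mD mA AD Afin fA f0.
(* [p] is the real or the imaginary part. *)
have key (p : C -> R) : p 0 = 0 -> mu.-integrable D (fun x => (p (f x))%:E) /\
    \int[mu]_(x in D) p (f x) = p w * fine (mu A).
  move=> p0; have e x : D x -> (p (f x))%:E = ((cst (p w)%:E) \_ A) x.
    move=> Dx; rewrite /patch; case: ifPn => [/set_mem Ax|/negP nA]; first by rewrite /= fA.
    by rewrite f0 ?p0 // => Ax; apply: nA; apply: mem_set.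
  have DA : D `&` A = A by apply/setIidPr.
  split.
    have iA : mu.-integrable A (cst (p w)%:E).
      apply/integrableP; split; first exact: measurable_cst.
      rewrite (_ : (fun x => _) = cst `|p w|%:E); last by apply/funext.
      by rewrite integral_cst // lte_mul_pinfty.
    have /(integrable_mkcond _ mA) iT := iA.
    apply: (@eq_integrable _ _ _ mu D mD ((cst (p w)%:E) \_ A)).
      by move=> x /set_mem Dx; rewrite e.
    by apply: integrableS iT => //; exact: measurableT.
  have -> : \int[mu]_(x in D) p (f x) = \int[mu]_(x in D `&` A) p w.
    rewrite /Rintegral integral_mkcondr; congr fine; apply: eq_integral => x /set_mem Dx.
    by rewrite e.
  by rewrite DA Rintegral_cst.
have [i1 e1] := key (@complex.Re R) erefl; have [i2 e2] := key (@complex.Im R) erefl.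
split; first by split.
rewrite /cintegral e1 e2; case: w {fA key e1 e2} => a b.
by apply: complex_eqP; rewrite /= !mulr0 ?subr0 ?add0r ?addr0.
Qed.

End ComplexIntegrals.

(** * Integrals summed as geometric series *)

Section GeometricSeries.
Context (R : realType).
Local Notation C := R[i].

Lemma normc_ReIm (z : C) : (`|complex.Re z| <= Normc.normc z) /\ (`|complex.Im z| <= Normc.normc z).
Proof.
case: z => x y /=; split; rewrite -sqrtr_sqr ler_wsqrtr //.
  by rewrite lerDl sqr_ge0.
by rewrite lerDr sqr_ge0.
Qed.

Lemma geometric_sum (a z : C) n : z != 1 ->
  \sum_(0 <= k < n) a * z ^+ k = a / (1 - z) - a / (1 - z) * z ^+ n.
Proof.
move=> z1; have z1' : 1 - z != 0 by rewrite subr_eq0 eq_sym.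
elim: n => [|n IH]; first by rewrite big_nil expr0 mulr1 subrr.
by rewrite big_nat_recr //= IH exprS; field.
Qed.

Lemma geometric_cvg (a z : C) (p : C -> R) : Normc.normc z < 1 ->
  (forall x y, p (x - y) = p x - p y) -> (forall x, `|p x| <= Normc.normc x) ->
  (fun n => p (\sum_(0 <= k < n) a * z ^+ k)) @ \oo --> p (a / (1 - z)).
Proof.
move=> z1 pB pN.
have z1' : z != 1 by apply/eqP => e; move: z1; rewrite e /= expr1n expr0n addr0 sqrtr1 ltxx.
have nz (w : C) : 0 <= Normc.normc w by case: w => ? ? /=; exact: sqrtr_ge0.
have nX n : Normc.normc (z ^+ n) = Normc.normc z ^+ n.
  elim: n => [|n IH]; first by rewrite !expr0 /= expr1n expr0n addr0 sqrtr1.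
  by rewrite !exprS Normc.normcM IH.
have c0 : (fun n => p (a / (1 - z) * z ^+ n)) @ \oo --> (0 : R).
  apply/norm_cvg0P.
  apply: (@squeeze_cvgr _ _ _ _ (cst 0) (geometric (Normc.normc (a / (1 - z))) (Normc.normc z))).
  - near=> n; rewrite normr_ge0 /=; apply: le_trans (pN _) _.
    by rewrite Normc.normcM nX.
  - exact: cvg_cst.
  - by apply: cvg_geometric; rewrite ger0_norm.
rewrite -[X in _ --> X]subr0.
under eq_fun do rewrite geometric_sum // pB.
by apply: cvgB => //; exact: cvg_cst.
Unshelve. all: by end_near. Qed.

End GeometricSeries.

Section Shells.
Context (R : realType) (d : measure_display) (T : measurableType d).
Variable mu : {measure set T -> \bar R}.
Local Notation C := R[i].
Implicit Types (D A : set T) (f g : T -> C).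

(** The shells contribute the terms of a geometric series. Its absolute convergence gives
    integrability, after which the integral is countably additive. *)
Lemma has_cintegral_shells D (S : nat -> set T) (m : nat -> R) (w : nat -> C) f (a z : C) :
  measurable D -> (forall k, measurable (S k)) -> (forall k, S k `<=` D) ->
  trivIset setT S -> (forall k, mu (S k) = (m k)%:E) ->
  (forall k x, S k x -> f x = w k) -> (forall x, D x -> (forall k, ~ S k x) -> f x = 0) ->
  (forall k, w k * (m k)%:C%C = a * z ^+ k) -> Normc.normc z < 1 ->
  has_cintegral mu D f (a / (1 - z)).
Proof.
move=> mD mS SD tS muS fS f0 wm z1.
have m0 k : 0 <= m k by rewrite -lee_fin -muS.
have nz (x : C) : 0 <= Normc.normc x by case: x => ? ? /=; exact: sqrtr_ge0.
have nX (x : C) n : Normc.normc (x ^+ n) = Normc.normc x ^+ n.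
  elim: n => [|n IH]; first by rewrite !expr0 /= expr1n expr0n addr0 sqrtr1.
  by rewrite !exprS Normc.normcM IH.
have key (p : C -> R) : p 0 = 0 -> (forall x y, p (x - y) = p x - p y) ->
    (forall x y, p (x + y) = p x + p y) ->
    (forall x, `|p x| <= Normc.normc x) -> (forall x (r : R), p (x * r%:C%C) = p x * r) ->
    mu.-integrable D (fun x => (p (f x))%:E) /\
    \int[mu]_(x in D) p (f x) = p (a / (1 - z)).
  move=> p0 pB pD pN pM.
  have bigD : \bigcup_k S k `<=` D by move=> x [k _ /SD].
  have mb : measurable (\bigcup_k S k) by exact: bigcupT_measurable.
  have e x : D x -> (p (f x))%:E = ((fun x => (p (f x))%:E) \_ (\bigcup_k S k)) x.
    move=> Dx; rewrite /patch; case: ifPn => // /negP nA.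
    rewrite f0 ?p0 // => k Sk; apply: nA; apply: mem_set; by exists k.
  have mfS k : measurable_fun (S k) (EFin \o (p \o f)).
    have h : measurable_fun (S k) (cst (p (w k))%:E) by exact: measurable_cst.
    by apply: eq_measurable_fun h => x /set_mem Sk /=; rewrite (fS k).
  have iS : mu.-integrable (\bigcup_k S k) (fun x => (p (f x))%:E).
    apply/integrableP; split.
      by apply/measurable_fun_bigcup.
    rewrite ge0_integral_bigcup //; last 1 first.
      by apply: measurableT_comp => //; apply/measurable_fun_bigcup.
    have eS k : (\int[mu]_(x in S k) `|(p (f x))%:E| = (`|p (w k)| * m k)%:E)%E.
      rewrite (eq_integral (cst `|p (w k)|%:E)); first by rewrite integral_cst // muS -EFinM.
      by move=> x /set_mem Sk /=; rewrite (fS k).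
    apply: (@le_lt_trans _ _ (Normc.normc a / (1 - Normc.normc z))%:E); last exact: ltry.
    apply: lime_le; first by apply: is_cvg_nneseries => k _ _; rewrite eS lee_fin mulr_ge0.
    near=> n; rewrite (eq_bigr (fun k => (`|p (w k)| * m k)%:E)); last by move=> k _; exact: eS.
    rewrite sumEFin lee_fin.
    apply: (@le_trans _ _ (\sum_(0 <= k < n) Normc.normc a * Normc.normc z ^+ k)).
      apply: ler_sum => k _; rewrite -nX -Normc.normcM -wm.
      by rewrite -[X in _ * X](ger0_norm (m0 k)) -normrM -pM; exact: pN.
    have zz : (Normc.normc z == 1) = false by apply: lt_eqF.
    have -> : \sum_(0 <= k < n) Normc.normc a * Normc.normc z ^+ k =
        series (geometric (Normc.normc a) (Normc.normc z)) n by [].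
    rewrite geometric_seriesE ?zz // ler_pM2r ?invr_gt0 ?subr_gt0 //.
    by rewrite ler_piMr // lerBlDr lerDl exprn_ge0.
  split.
    have /(integrable_mkcond _ mb) iT := iS.
    apply: (@eq_integrable _ _ _ mu D mD ((fun x => (p (f x))%:E) \_ (\bigcup_k S k))).
      by move=> x /set_mem Dx; rewrite e.
    by apply: integrableS iT => //; exact: measurableT.
  have -> : \int[mu]_(x in D) p (f x) = fine (\int[mu]_(x in D `&` \bigcup_k S k) (p (f x))%:E).
    rewrite /Rintegral integral_mkcondr; congr fine; apply: eq_integral => x /set_mem Dx.
    by rewrite e.
  rewrite (_ : D `&` _ = \bigcup_k S k); last exact/setIidPr.
  rewrite integral_bigcup //.
  rewrite (_ : (\sum_(i <oo) _)%E = (p (a / (1 - z)))%:E) //.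
  apply: cvg_lim => //.
  have pS n : p (\sum_(0 <= k < n) a * z ^+ k) = \sum_(0 <= k < n) p (w k) * m k.
    elim: n => [|n IH]; first by rewrite !big_nil.
    by rewrite !big_nat_recr //= pD IH -pM wm.
  have iSk k : (\int[mu]_(x in S k) (p (f x))%:E = (p (w k) * m k)%:E)%E.
    rewrite (eq_integral (cst (p (w k))%:E)); first by rewrite integral_cst // muS -EFinM.
    by move=> x /set_mem Sk /=; rewrite (fS k).
  have := @geometric_cvg _ a z p z1 pB pN.
  rewrite (_ : (fun n => (\sum_(0 <= i < n) _)%E) = EFin \o (fun n => p (\sum_(0 <= k < n) a * z ^+ k))).
    by move=> h; apply: cvg_EFin => //; exact: nearW.
  by apply/funext => n /=; rewrite pS -sumEFin; apply: eq_bigr.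
have [nR nI] : (forall x : C, `|complex.Re x| <= Normc.normc x) /\ (forall x : C, `|complex.Im x| <= Normc.normc x).
  by split => x; have [] := normc_ReIm x.
have [||||i1 e1] := key (@complex.Re R) erefl => //; try by move=> [? ?] [? ?].
  by move=> [x y] r /=; rewrite mulr0 subr0.
have [||||i2 e2] := key (@complex.Im R) erefl => //; try by move=> [? ?] [? ?].
  by move=> [x y] r /=; rewrite mulr0 add0r.
by split; [split|rewrite /cintegral e1 e2; case: (a / _)].
Unshelve. all: by end_near. Qed.

End Shells.

(** * Scaling and measure-preserving maps *)

Section ChangeOfVariable.
Context (R : realType) (d : measure_display) (T : measurableType d).
Variable mu : {measure set T -> \bar R}.
Local Notation C := R[i].
Implicit Types (D A : set T) (f g : T -> C).

Lemma has_cintegralZ D f (c v : C) : measurable D ->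
  has_cintegral mu D f v -> has_cintegral mu D (fun x => c * f x) (c * v).
Proof.
move=> mD [[f1 f2] <-]; case: c => a b.
have eRe x : complex.Re ((a +i* b)%C * f x) = a * complex.Re (f x) - b * complex.Im (f x).
  by case: (f x).
have eIm x : complex.Im ((a +i* b)%C * f x) = a * complex.Im (f x) + b * complex.Re (f x).
  by case: (f x).
have i1 (r : R) : mu.-integrable D (EFin \o (fun x => r * complex.Re (f x))).
  apply: eq_integrable (integrableZl mD r f1) => // x _ /=.
have i2 (r : R) : mu.-integrable D (EFin \o (fun x => r * complex.Im (f x))).
  by apply: eq_integrable (integrableZl mD r f2).
split; first split.
- apply: eq_integrable (integrableB mD (i1 a) (i2 b)) => // x _ /=.
  by rewrite eRe.
- apply: eq_integrable (integrableD mD (i2 a) (i1 b)) => // x _ /=.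
  by rewrite eIm.
apply: complex_eqP; rewrite /=.
  rewrite -!RintegralZl // -RintegralB //; apply: eq_Rintegral => x _; exact: eRe.
rewrite -!RintegralZl // -RintegralD //; apply: eq_Rintegral => x _; exact: eIm.
Qed.

(** On subsets of [D] the push-forward of [mu] along [phi] is [mu] itself. *)
Lemma cintegral_invariant D (phi : T -> T) f : measurable D ->
  measurable_fun setT phi -> phi @^-1` D = D ->
  (forall A, measurable A -> A `<=` D -> mu (phi @^-1` A) = mu A) ->
  measurable_fun setT (fun x => complex.Re (f x)) ->
  measurable_fun setT (fun x => complex.Im (f x)) ->
  cintegrable mu D (f \o phi) -> cintegral mu D (f \o phi) = cintegral mu D f.
Proof.
move=> mD mphi phiD inv m1 m2 [f1 f2].
have key (g : T -> R) : measurable_fun setT g -> mu.-integrable D (EFin \o (g \o phi)) ->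
    \int[mu]_(x in D) g (phi x) = \int[mu]_(x in D) g x.
  move=> mg ig; rewrite /Rintegral; congr fine.
  transitivity (\int[pushforward mu phi]_(x in D) (g x)%:E)%E.
    by rewrite (integral_pushforward mphi) ?phiD //; exact/measurable_EFinP.
  by apply: eq_measure_integral => A mA AD; exact: inv.
by apply: complex_eqP; [exact: key|exact: key].
Qed.

End ChangeOfVariable.

(** * Haar measure on the unipotent subgroup *)

Section CountableCovers.
Context (R : realType) (d : measure_display) (T : measurableType d).
Variable mu : {measure set T -> \bar R}.

Lemma measure0_cover (A : set T) (S : nat -> set T) : measurable A ->
  (forall k, measurable (S k)) -> A `<=` \bigcup_k S k -> (forall k, mu (S k) = 0%E) -> mu A = 0%E.
Proof.
move=> mA mS AS S0; apply/eqP; rewrite eq_le measure_ge0 andbT.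
apply: le_trans (measure_sigma_subadditive mu mS mA AS) _.
by rewrite eseries0 // => k _ _; rewrite S0.
Qed.

End CountableCovers.

Section UnipotentMeasure.
Context (R : realType) (F : padicField R) (gam : F).
Hypothesis gam0 : gam != 0.
Local Notation q := ((resq F)%:R : R).
Local Notation U := (U3 gam).
Implicit Types (u : 'M[F]_3) (y z : F) (Y : set F).

Lemma absp_arch0 (x : F) : (forall e : R, 0 < e -> absp x < e) -> x = 0.
Proof.
by move=> h; apply/eqP; apply: contraT; rewrite -absp_gt0 => /h; rewrite ltxx.
Qed.

Lemma umx_near y (e : R) : 0 < e -> exists2 d : R, 0 < d &
  forall z, absp (z - y) < d -> mxnear (umx gam y) (umx gam z) e.
Proof.
move=> e0; pose K := 1 + absp (2%:R / gam) + (1 + absp (2%:R * y)) / absp gam.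
have g0 : 0 < absp gam by rewrite absp_gt0.
have K1 : 1 <= K.
  by rewrite /K -addrA lerDl addr_ge0 ?absp_ge0 // divr_ge0 ?addr_ge0 ?absp_ge0.
have K0 : 0 < K by apply: lt_le_trans K1.
exists (Num.min 1 (e / K)); first by rewrite lt_min ltr01 divr_gt0.
move=> z; rewrite lt_min => /andP[z1 zK] i j.
have zK' : absp (z - y) * K < e by rewrite -ltr_pdivlMr.
have h (x : F) : absp x <= K -> absp ((z - y) * x) < e.
  by move=> hx; rewrite abspM; apply: le_lt_trans zK'; rewrite ler_wpM2l ?absp_ge0.
have h1 : absp (1 : F) <= K by rewrite absp1.
have h2 : absp (- (2%:R / gam)) <= K.
  by rewrite abspN /K [1 + absp _]addrC -addrA lerDl addr_ge0 // divr_ge0 ?addr_ge0 ?absp_ge0.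
have h3 : absp (- ((z - y) + 2%:R * y) / gam) <= K.
  rewrite abspM abspN abspV (@le_trans _ _ ((1 + absp (2%:R * y)) / absp gam)) //.
    rewrite ler_pM2r ?invr_gt0 //; apply: le_trans (absp_ultra _ _) _.
    by rewrite ge_max; apply/andP; split; [apply: le_trans (ltW z1) _; rewrite lerDl absp_ge0|rewrite lerDr ler01].
  by rewrite /K lerDr addr_ge0 ?absp_ge0.
case: i => [[|[|[|?]]] ?] //; case: j => [[|[|[|?]]] ?] //; rewrite !mxE /= ?subrr ?absp0 //.
- by rewrite -[_ - _]mulr1 h.
- have -> : - z ^+ 2 / gam - - y ^+ 2 / gam = (z - y) * (- ((z - y) + 2%:R * y) / gam) by field.
  exact: h.
- have -> : - 2%:R * z / gam - - 2%:R * y / gam = (z - y) * - (2%:R / gam) by field.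
  exact: h.
Qed.

(** U_3 is the image of the continuous map [umx], which inverts the coordinate (1,2); a limit of
    elements of U_3 is the image of its own coordinate. *)
Lemma closed_U3 : closed U.
Proof.
apply: closed_mx => M hM; have -> : M = umx gam (M 0 1); last exact: umx_U3.
apply/matrixP => i j; apply/eqP; rewrite -subr_eq0; apply/eqP; apply: absp_arch0 => e e0.
have [d d0 hd] := umx_near (M 0 1) e0.
have [|M' [UM' near]] := hM (Num.min d e); first by rewrite lt_min d0.
have := near 0 1; rewrite lt_min => /andP[/hd near' _].
have := near' i j; rewrite -(U3_umx gam0 UM') => h.
rewrite (_ : _ - _ = - (M' i j - M i j) + (M' i j - umx gam (M 0 1) i j)); last by ring.
by apply: absp_lt_add => //; rewrite abspN; have := near i j; rewrite lt_min => /andP[].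
Qed.

Definition open_field Y := forall y, Y y -> exists2 e : R, 0 < e & forall z, absp (z - y) < e -> Y z.

Definition rowset Y : set (borel F 3) := [set u | U u /\ Y ((u : 'M[F]_3) 0 1)].

Lemma U3_measurable : measurable (U : set (borel F 3)).
Proof. exact: borel_closed closed_U3. Qed.

Lemma preimage_measurable Y : open_field Y ->
  measurable ([set u | Y ((u : 'M[F]_3) 0 1)] : set (borel F 3)).
Proof.
move=> oY; apply: borel_open; apply/open_mxP => M /= /oY[e e0 he]; exists e => // M' near.
exact: he (near 0 1).
Qed.

Lemma rowset_measurable Y : open_field Y -> measurable (rowset Y).
Proof.
move=> oY; have -> : rowset Y = U `&` [set u | Y ((u : 'M[F]_3) 0 1)] by [].
apply: measurableI; [exact: U3_measurable|exact: preimage_measurable].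
Qed.

Lemma umx_entry y : umx gam y 0 1 = y.
Proof. by rewrite mxE. Qed.

Lemma rowset_translate Y z :
  [set umx gam z *m a | a in rowset Y] = rowset [set y | Y (y - z)].
Proof.
apply/seteqP; split => [_ [u [Uu Yu] <-]|u [Uu Yu]].
  have := U3_umx gam0 Uu; set y := u 0 1 in Yu * => ->.
  by split; rewrite umxD //; [exact: umx_U3|rewrite /= umx_entry addrAC subrr add0r].
exists (umx gam (u 0 1 - z)); first by split; [exact: umx_U3|rewrite umx_entry].
by rewrite umxD // addrC subrK -(U3_umx gam0 Uu).
Qed.

Definition ballF y (k : int) : set F := [set z | absp (z - y) <= q ^ k].

Lemma ballF_open y k : open_field (ballF y k).
Proof.
move=> z hz; exists (q ^ k); first exact: qz_gt0.
by move=> w hw; rewrite /ballF /= -(subrK z w) -addrA absp_le_add // ltW.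
Qed.

Definition shellF y (k : int) : set F := [set z | absp (z - y) = q ^ k].

Lemma shellF_open y k : open_field (shellF y k).
Proof.
move=> z hz; exists (q ^ k); first exact: qz_gt0.
move=> w hw; rewrite /shellF /= -hz; apply: absp_sub_eq.
by rewrite (_ : _ - (z - y) = w - z) ?hz //; ring.
Qed.

Variable mu : {measure set (borel F 3) -> \bar R}.
Hypothesis mu_haar : is_haar U mu.

Lemma rowset_shift Y z : open_field Y -> mu (rowset [set y | Y (y - z)]) = mu (rowset Y).
Proof.
move=> oY; have [inv _ _] := mu_haar; rewrite -rowset_translate; apply: inv.
- exact: umx_U3.
- exact: rowset_measurable.
by move=> u [].
Qed.

Lemma ball_fin y k : (mu (rowset (ballF y k)) < +oo)%E.
Proof.
have [_ fin _] := mu_haar; apply: fin; last by move=> u [].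
pose B := Num.max 1 (Num.max (absp y) (q ^ k)).
have [n hn] := q_large F (Num.max B (Num.max (B ^+ 2 / absp gam) (B * absp (2%:R / gam)))).
move: hn; rewrite !ge_max => /andP[/andP[n1 /andP[ny nk]] /andP[n2 n3]].
apply: (subclosed_compact _ (@compact_mx_bounded R F 3 n)) => [|u [Uu hu]].
- apply: closed_mx => M hM; split.
    have := closed_U3 => /(_ M); apply => V /nbhs_mxP[e e0 hV].
    by have [M' [[UM' _] near]] := hM _ e0; exists M'; split => //; exact: hV.
  have [M' [[_ hM'] near]] := hM _ (qz_gt0 F k).
  rewrite /ballF /= -(subrK (M' 0 1) (M 0 1)) -addrA absp_le_add // -abspN opprB ltW //.
rewrite /=.
have uB : absp ((u : 'M[F]_3) 0 1) <= B.
  rewrite -(subrK y ((u : 'M[F]_3) 0 1)); apply: absp_le_add; last by rewrite /B !le_max lexx orbT.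
  by apply: le_trans hu _; rewrite /B !le_max lexx !orbT.
have B0 : 0 <= B by rewrite /B le_max ler01.
move=> i j; rewrite (U3_umx gam0 Uu); move: ((u : 'M[F]_3) 0 1) uB => x xB.
case: i => [[|[|[|?]]] ?] //; case: j => [[|[|[|?]]] ?] //; rewrite !mxE /= ?absp0 ?absp1 ?exprn_ge0 //.
- by apply: le_trans xB _; rewrite /B !ge_max n1 ny nk.
- apply: le_trans n2; rewrite abspM abspN abspV abspX ler_pM2r ?invr_gt0 ?absp_gt0 //.
  by rewrite ler_sqr ?nnegrE ?absp_ge0.
apply: le_trans n3; rewrite (_ : - 2%:R * x / gam = x * - (2%:R / gam)); last by field.
by rewrite abspM abspN ler_wpM2r ?absp_ge0.
Qed.

Definition ball_vol : R := fine (mu (rowset (ballF 0 0))).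
Local Notation c := ball_vol.

Lemma ball_translate y k : mu (rowset (ballF y k)) = mu (rowset (ballF 0 k)).
Proof.
rewrite -(rowset_shift y (@ballF_open 0 k)); congr (mu (rowset _)).
by apply/seteqP; split => x; rewrite /ballF /= subr0.
Qed.

(** Residue classes cut the larger ball into q disjoint translates of the smaller one. *)
Lemma ball_succ k : mu (rowset (ballF 0 (k + 1))) = (q%:E * mu (rowset (ballF 0%R k)))%E.
Proof.
have [w hw] := uniformizer_exists F; have w0 := uniformizer_neq0 hw.
have [rep [rep1 repI repS]] := residue_rep F.
have aw (n : int) : absp (w ^ n) = q ^ (- n) by exact: absp_unif.
have q0 : (0 < resq F)%N by rewrite (leq_trans _ (resq_gt1 F)).
pose rp (i : nat) : F := rep (insubd (Ordinal q0) i).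
pose S (i : nat) := rowset (ballF (rp i * w ^ (- (k + 1))) k).
have e : rowset (ballF 0 (k + 1)) = \bigcup_(i in `I_(resq F)) S i.
  apply/seteqP; split => [u [Uu hu]|u [i _ [Uu hu]]]; last first.
    split => //; move: hu; rewrite /ballF /= subr0 => hu.
    rewrite -(subrK (rp i * w ^ (- (k + 1))) (_ 0 1)); apply: absp_le_add.
      by apply: le_trans hu _; rewrite ler_qz lerDl.
    by rewrite abspM aw opprK ler_piMl ?rep1 // ltW ?qz_gt0.
  move: hu; rewrite /ballF /= subr0 => hu.
  have [|i hi] := repS ((u : 'M[F]_3) 0 1 * w ^ (k + 1)).
    by rewrite abspM aw -invr_expz ler_pdivrMr ?qz_gt0 // mul1r.
  exists i; first exact: (ltn_ord i).
  split => //; rewrite /ballF /= /rp valKd.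
  have wk0 : w ^ (k + 1) != 0 by rewrite expfz_neq0.
  rewrite (_ : _ - _ = ((u : 'M[F]_3) 0 1 * w ^ (k + 1) - rep i) * w ^ (- (k + 1))); last first.
    by rewrite mulrBl -invr_expz mulfK.
  rewrite abspM aw opprK (_ : q ^ k = q^-1 * q ^ (k + 1)); last first.
    by rewrite exprzDr ?unitfE ?q_neq0 // expr1z mulrCA mulVf ?mulr1 ?q_neq0.
  by rewrite ler_pM2r ?qz_gt0 // (absp_lt1V hw).
rewrite e measure_fin_bigcup //; last 2 first.
- move=> i j /= iq jq [u [[_ hi] [_ hj]]].
  suff /(congr1 val) : insubd (Ordinal q0) i = insubd (Ordinal q0) j.
    by rewrite !val_insubd iq jq.
  apply: repI; rewrite -/(rp i) -/(rp j).
  have w0' : w ^ (- (k + 1)) != 0 by rewrite expfz_neq0.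
  rewrite (_ : rp i - rp j = (rp i * w ^ (- (k + 1)) - rp j * w ^ (- (k + 1))) / w ^ (- (k + 1))).
    rewrite abspM abspV aw opprK ltr_pdivrMr ?qz_gt0 // mul1r.
    apply: (@le_lt_trans _ _ (q ^ k)); last by rewrite ltr_qz ltrDl.
    rewrite (_ : _ - _ = ((u : 'M[F]_3) 0 1 - rp j * w ^ (- (k + 1))) - ((u : 'M[F]_3) 0 1 - rp i * w ^ (- (k + 1)))); last by ring.
    exact: absp_le_sub.
  by rewrite -mulrBl mulfK.
- by move=> i _; apply: rowset_measurable; exact: ballF_open.
rewrite (eq_fsbigr (fun=> mu (rowset (ballF 0 k)))); last by move=> i _; exact: ball_translate.
rewrite -fsbig_ord -(@fineK _ (mu (rowset (ballF 0 k)))); last by rewrite ge0_fin_numE ?ball_fin.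
by rewrite sumEFin sumr_const card_ord -EFinM mulr_natl.
Qed.

Lemma ball_mu0 k : mu (rowset (ballF 0 k)) = (c * q ^ k)%:E.
Proof.
have fink n : mu (rowset (ballF 0 n)) = (fine (mu (rowset (ballF 0 n))))%:E.
  by rewrite fineK // ge0_fin_numE ?ball_fin.
have fs n : fine (mu (rowset (ballF 0 (n + 1)))) = q * fine (mu (rowset (ballF 0 n))).
  by rewrite ball_succ fink.
rewrite fink; congr EFin; elim/int_ind: k => [|n IH|n IH]; first by rewrite expr0z mulr1.
  rewrite (_ : n.+1%:Z = n%:Z + 1); last by rewrite -PoszD addn1.
  by rewrite fs IH exprzDr ?unitfE ?q_neq0 // expr1z; ring.
apply: (mulfI (q_neq0 F)); rewrite -fs.
rewrite (_ : - n.+1%:Z + 1 = - n%:Z); last by rewrite -addn1 PoszD opprD subrK.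
rewrite IH mulrCA -{2}(expr1z q) -exprzDr ?unitfE ?q_neq0 //.
by rewrite -addn1 PoszD opprD addrC subrK.
Qed.

Lemma ball_mu y k : mu (rowset (ballF y k)) = (c * q ^ k)%:E.
Proof. by rewrite ball_translate ball_mu0. Qed.

(** Otherwise all the balls, which exhaust U_3, would be null sets. *)
Lemma ball_vol_gt0 : 0 < c.
Proof.
rewrite lt_def fine_ge0 ?measure_ge0 // andbT; apply/eqP => c0.
have [_ _] := mu_haar; apply.
apply: (measure0_cover U3_measurable (S := fun k => rowset (ballF 0 k%:Z))).
- by move=> k; apply: rowset_measurable; exact: ballF_open.
- move=> u Uu; have [k hk] := q_large F (absp ((u : 'M[F]_3) 0 1)).
  by exists k => //; split => //; rewrite /ballF /= subr0.
- by move=> k; rewrite ball_mu c0 mul0r.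
Qed.

Lemma shell_mu y k : mu (rowset (shellF y k)) = (c * q ^ k * (1 - q^-1))%:E.
Proof.
have e : rowset (shellF y k) = rowset (ballF y k) `\` rowset (ballF y (k - 1)).
  apply/seteqP; split => [u [Uu hu]|u [[Uu hu] nu]].
    split; first by split => //; rewrite /ballF /= hu.
    by move=> [_]; rewrite /ballF /= hu ler_qz; clear; lia.
  split => //; rewrite /shellF /=; apply/eqP; rewrite eq_le hu /= leNgt; apply/negP => lt.
  apply: nu; split => //; rewrite /ballF /=.
  have [->|ne] := eqVneq ((u : 'M[F]_3) 0 1 - y) 0; first by rewrite absp0 ltW ?qz_gt0.
  by move: lt; rewrite absp_lgp // ltr_qz ler_qz; clear; lia.
rewrite e measureD ?ball_fin //; try (apply: rowset_measurable; exact: ballF_open).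
rewrite (_ : _ `&` _ = rowset (ballF y (k - 1))); last first.
  apply/setIidPr => u [Uu hu]; split => //; apply: le_trans hu _.
  by rewrite ler_qz gerDl.
transitivity ((c * q ^ k)%:E - (c * q ^ (k - 1))%:E)%E.
  by congr (_ - _)%E; exact: ball_mu.
rewrite -EFinB; congr EFin.
by rewrite exprzDr ?unitfE ?q_neq0 // exprN1; ring.
Qed.

End UnipotentMeasure.

(** * Test sections and intertwining *)

Section TameQuadratic.
Context (R : realType) (F : padicField R) (tau : F -> R[i]).
Hypothesis htau : mul_character tau.
Hypothesis htau2 : quadratic tau.
Hypothesis htame : tamely_ramified tau.

Lemma tauM x y : x != 0 -> y != 0 -> tau (x * y) = tau x * tau y.
Proof. by case: htau => _; apply. Qed.

Lemma tau_neq0 x : x != 0 -> tau x != 0.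
Proof. by case: htau => h _; apply: h. Qed.

Lemma tau1 : tau 1 = 1.
Proof. by apply: htame; rewrite subrr absp0 ltr01. Qed.

Lemma tau_sq x : x != 0 -> tau x * tau x = 1.
Proof. by move=> x0; rewrite -expr2 htau2. Qed.

Lemma tauV x : x != 0 -> tau x^-1 = tau x.
Proof.
move=> x0; apply: (mulfI (tau_neq0 x0)).
by rewrite -tauM ?invr_neq0 // mulfV // tau1 tau_sq.
Qed.

Lemma tau_near x y : absp (y - x) < absp x -> tau y = tau x.
Proof.
have [->|x0] := eqVneq x 0; first by rewrite absp0 ltNge absp_ge0.
move=> h; have h1 : absp (y / x - 1) < 1.
  rewrite (_ : _ - 1 = (y - x) / x); last by field.
  by rewrite abspM abspV ltr_pdivrMr ?absp_gt0 // mul1r.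
have yx0 : y / x != 0 by rewrite -absp_gt0 (absp_unit1 h1).
by rewrite -[y in LHS](mulfVK x0) tauM // (htame h1) mul1r.
Qed.

Lemma tau_sqM x y : x != 0 -> y != 0 -> tau (x * y ^+ 2) = tau x.
Proof. by move=> x0 y0; rewrite tauM ?sqrf_eq0 ?expf_neq0 // expr2 tauM // tau_sq // mulr1. Qed.

End TameQuadratic.

(** * The test sections and their images under M(tau, s) *)

Section Sections.
Context (R : realType) (F : padicField R) (alpha gam : F).
Hypothesis halpha : absp alpha = 1.
Hypothesis hgam : gam = - 4%:R * alpha.
Local Notation q := ((resq F)%:R : R).
Local Notation C := R[i].
Implicit Types (h k g : 'M[F]_3) (i j : 'I_3) (s : C).

Let gam0 : gam != 0 := gam_neq0 halpha hgam.

(* The two isotropic columns, in either order. *)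
Definition ends i j : bool := (i == 0) && (j == 2%:R) || (i == 2%:R) && (j == 0).

Lemma ends_neq1 i j : ends i j -> i != 1 /\ j != 1.
Proof. by case/orP => /andP[/eqP -> /eqP ->]. Qed.

Lemma ends_form i j h k : ends i j -> forall m, (h *m k) 2%:R m =
  h 2%:R i * k i m + h 2%:R j * k j m + h 2%:R 1 * k 1 m.
Proof. by case/orP => /andP[/eqP -> /eqP ->] m; rewrite mulmx3E; ring. Qed.

Lemma ends_iso i j h : ends i j -> SO3 gam h ->
  h 2%:R 1 ^+ 2 = - gam * h 2%:R i * h 2%:R j.
Proof. by case/orP => /andP[/eqP -> /eqP ->] /(SO3_last_iso gam0) ->; ring. Qed.

Lemma absp_gam_le1 : absp gam <= 1.
Proof. by rewrite (absp_two_square halpha hgam) exprn_ile1 ?absp_ge0 ?absp_nat. Qed.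

Lemma last_mid_lt i j h : ends i j -> SO3 gam h -> absp (h 2%:R i) < absp (h 2%:R j) ->
  absp (h 2%:R 1) < absp (h 2%:R j).
Proof.
move=> ij hS lt; rewrite -ltr_sqr ?nnegrE ?absp_ge0 // -abspX (ends_iso ij hS) !abspM abspN.
have b0 : 0 < absp (h 2%:R j) by apply: le_lt_trans lt; exact: absp_ge0.
rewrite expr2 ltr_pM2r //; apply: le_lt_trans lt.
by rewrite ler_piMl ?absp_ge0 ?absp_gam_le1.
Qed.

Lemma last_mid_le i j h : ends i j -> SO3 gam h -> absp (h 2%:R j) <= absp (h 2%:R i) ->
  absp (h 2%:R 1) <= absp (h 2%:R i).
Proof.
move=> ij hS le; rewrite -ler_sqr ?nnegrE ?absp_ge0 // -abspX (ends_iso ij hS) !abspM abspN.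
rewrite -mulrA expr2; apply: (@le_trans _ _ (absp (h 2%:R i) * absp (h 2%:R j))).
  by rewrite ler_piMl ?mulr_ge0 ?absp_ge0 ?absp_gam_le1.
by rewrite ler_wpM2l ?absp_ge0.
Qed.

Lemma near1_diag h i : mxnear 1%:M h 1 -> absp (h i i - 1) < 1.
Proof. by move=> /(_ i i); rewrite mxE eqxx. Qed.

Lemma near1_off h i j : mxnear 1%:M h 1 -> i != j -> absp (h i j) < 1.
Proof. by move=> near /negPf ne; have := near i j; rewrite mxE ne subr0. Qed.

Lemma absp_mul_lt (x y : F) (e : R) : absp x <= e -> 0 < e -> absp y < 1 -> absp (x * y) < e.
Proof.
move=> xe e0 y1; rewrite abspM; apply: (@le_lt_trans _ _ (e * absp y)).
  by rewrite ler_wpM2r ?absp_ge0.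
by rewrite gtr_pMr.
Qed.

(** By isotropy the middle entry is smaller than the larger end, so right multiplication by [k]
    moves that end by less than its own size. *)
Lemma last_row_stable i j h k : ends i j -> SO3 gam h -> mxnear 1%:M k 1 ->
  absp (h 2%:R i) < absp (h 2%:R j) ->
  absp ((h *m k) 2%:R j - h 2%:R j) < absp (h 2%:R j) /\
  absp ((h *m k) 2%:R i) < absp ((h *m k) 2%:R j).
Proof.
move=> ij hS near lt; have [i1 j1] := ends_neq1 ij.
have b0 : 0 < absp (h 2%:R j) by apply: le_lt_trans lt; exact: absp_ge0.
have m_lt := last_mid_lt ij hS lt.
have nij : i != j by case/orP: ij => /andP[/eqP -> /eqP ->].
have e1 : absp ((h *m k) 2%:R j - h 2%:R j) < absp (h 2%:R j).
  rewrite (ends_form _ _ ij).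
  rewrite (_ : _ - _ = h 2%:R i * k i j + h 2%:R j * (k j j - 1) + h 2%:R 1 * k 1 j); last by ring.
  apply: absp_lt_add; first apply: absp_lt_add.
  - by apply: absp_mul_lt (near1_off near nij) => //; exact: ltW.
  - by apply: absp_mul_lt (near1_diag j near).
  - by apply: absp_mul_lt (near1_off near _) => //; [exact: ltW|rewrite eq_sym].
split=> //; rewrite (absp_sub_eq e1) (ends_form _ _ ij).
apply: absp_lt_add; first apply: absp_lt_add.
- by rewrite abspM (absp_unit1 (near1_diag i near)) mulr1.
- by apply: absp_mul_lt (near1_off near _) => //; rewrite eq_sym.
- by apply: absp_mul_lt (near1_off near _) => //; [exact: ltW|rewrite eq_sym].
Qed.

Lemma last_row_stable_le i j h k : ends i j -> SO3 gam h -> mxnear 1%:M k 1 ->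
  absp (h 2%:R j) <= absp (h 2%:R i) ->
  absp ((h *m k) 2%:R j) <= absp ((h *m k) 2%:R i).
Proof.
move=> ij hS near le; have [i1 j1] := ends_neq1 ij.
have m_le := last_mid_le ij hS le.
have nij : i != j by case/orP: ij => /andP[/eqP -> /eqP ->].
have [a0|a0] := eqVneq (h 2%:R i) 0.
  move: le m_le; rewrite a0 absp0 => le m_le.
  have b0 : h 2%:R j = 0 by apply/eqP; rewrite -absp_eq0 eq_le le absp_ge0.
  have m0 : h 2%:R 1 = 0 by apply/eqP; rewrite -absp_eq0 eq_le m_le absp_ge0.
  by rewrite !(ends_form _ _ ij) a0 b0 m0 !mul0r !addr0.
have a0' : 0 < absp (h 2%:R i) by rewrite absp_gt0.
have e1 : absp ((h *m k) 2%:R i - h 2%:R i) < absp (h 2%:R i).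
  rewrite (ends_form _ _ ij).
  rewrite (_ : _ - _ = h 2%:R i * (k i i - 1) + h 2%:R j * k j i + h 2%:R 1 * k 1 i); last by ring.
  apply: absp_lt_add; first apply: absp_lt_add.
  - exact: absp_mul_lt (near1_diag i near).
  - by apply: absp_mul_lt (near1_off near _) => //; rewrite eq_sym.
  - by apply: absp_mul_lt (near1_off near _) => //; rewrite eq_sym.
rewrite (absp_sub_eq e1) (ends_form _ _ ij).
apply: absp_le_add; first apply: absp_le_add.
- by apply: ltW; apply: absp_mul_lt (near1_off near nij).
- by rewrite abspM (absp_unit1 (near1_diag j near)) mulr1.
- by apply: ltW; apply: absp_mul_lt (near1_off near _) => //; rewrite eq_sym.
Qed.

Variable tau : F -> C.
Hypothesis htau : mul_character tau.
Hypothesis htau2 : quadratic tau.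
Hypothesis htame : tamely_ramified tau.

(* The test section is [sec 0 2], supported on the [h] whose last row has its
   last entry larger than its first one; [sec 2 0] is its translate by [w1]. *)
Definition sec_phi i j h : C := if absp (h 2%:R i) < absp (h 2%:R j) then tau (h 2%:R j) else 0.

Definition sec i j s h (a : F) : C :=
  tau a * (sec_phi i j h * (cpow (absp (h 2%:R j)) s)^-1).

Lemma sec_phi_stable i j h k : ends i j -> SO3 gam h -> mxnear 1%:M k 1 ->
  sec_phi i j (h *m k) = sec_phi i j h.
Proof.
move=> ij hS near; rewrite /sec_phi; have [lt|ge] := ltP (absp (h 2%:R i)).
  by have [e1 ->] := last_row_stable ij hS near lt; exact: (tau_near htau htame e1).
by rewrite ltNge (last_row_stable_le ij hS near ge).
Qed.

Lemma sec_stable i j s h k a : ends i j -> SO3 gam h -> mxnear 1%:M k 1 ->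
  sec i j s (h *m k) a = sec i j s h a.
Proof.
move=> ij hS near; rewrite /sec sec_phi_stable //; congr (_ * _).
rewrite /sec_phi; have [lt|ge] := ltP (absp (h 2%:R i)); last by rewrite !mul0r.
by have [/absp_sub_eq -> _] := last_row_stable ij hS near lt.
Qed.

Lemma sec_in_V i j s : ends i j -> in_V gam tau s (sec i j s).
Proof.
move=> ij; split.
  move=> m a u g m0 a0 [uS uE] gS.
  have row (k : 'I_3) : (torus3 m *m u *m g) 2%:R k = m^-1 * g 2%:R k.
    have t20 : torus3 m 2%:R 0 = 0 by rewrite mxE.
    have t21 : torus3 m 2%:R 1 = 0 by rewrite mxE.
    have t22 : torus3 m 2%:R 2%:R = m^-1 by rewrite mxE.
    rewrite -mulmxA mulmx3E t20 t21 t22 !mul0r !add0r mulmx3E.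
    by rewrite (uE 2%:R 0) // (uE 2%:R 1) // (uE 2%:R 2%:R) //= !mul0r mul1r !add0r.
  rewrite /sec /sec_phi !row !abspM ltr_pM2l ?absp_gt0 ?invr_neq0 //.
  case: ifP => [lt|_]; last by rewrite !mul0r !mulr0.
  have b0 : g 2%:R j != 0 by rewrite -absp_gt0 (le_lt_trans _ lt) ?absp_ge0.
  rewrite (tauM htau (invr_neq0 m0) b0) (tauV htau htau2 htame m0) (tauM htau a0 m0).
  by rewrite abspV cpowM ?cpowV ?invr_gt0 ?absp_gt0 // (tau1 htame) mul1r invfM invrK; ring.
move=> a a0; rewrite /smooth_on; apply/nbhs_mxP; exists 1 => // k near _ g gS.
exact: sec_stable.
Qed.

(** The pairing of the first and last rows is 1 and each of its terms is bounded by the larger end.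
    The middle term carries the factor 2/gam, which isotropy compensates by making both its other
    factors divisible by 2. Hence the restriction of the section to SO_3(o) does not involve s. *)
Lemma SO3_o_last i j h : ends i j -> SO3_o gam h -> absp (h 2%:R i) < absp (h 2%:R j) ->
  absp (h 2%:R j) = 1.
Proof.
move=> ij [hS hi] lt; apply/eqP; rewrite eq_le hi /=.
have two0 := two_neq0 F; have two1 : absp (2%:R : F) <= 1 by exact: absp_nat.
have b0 : 0 <= absp (h 2%:R j) by exact: absp_ge0.
have g2 := absp_two_square halpha hgam.
have pair : h 0 i * h 2%:R j + h 0 j * h 2%:R i + 2%:R / gam * (h 0 1 * h 2%:R 1) = 1.
  case/orP: ij => /andP[/eqP -> /eqP ->]; rewrite -[RHS](SO3_pair gam0 hS); ring.
have t1 : absp (h 0 1) <= absp (2%:R : F).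
  rewrite -ler_sqr ?nnegrE ?absp_ge0 // -abspX (SO3_row_iso gam0 hS) // !abspM abspN g2.
  by rewrite -mulrA ler_piMr ?exprn_ge0 ?absp_ge0 // mulr_ile1 ?absp_ge0.
have m1 : absp (h 2%:R 1) <= absp (2%:R : F) * absp (h 2%:R j).
  rewrite -ler_sqr ?nnegrE ?mulr_ge0 ?absp_ge0 // -abspX (ends_iso ij hS) !abspM abspN g2.
  by rewrite exprMn -mulrA ler_wpM2l ?exprn_ge0 ?absp_ge0 // expr2 ler_wpM2r // ltW.
have t0 : 0 < absp (2%:R : F) by rewrite absp_gt0.
rewrite -(absp1 F) -pair; apply: absp_le_add; first apply: absp_le_add.
- by rewrite abspM ler_piMl.
- by rewrite abspM (@le_trans _ _ (absp (h 2%:R i))) ?ler_piMl ?absp_ge0 // ltW.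
rewrite !abspM abspV g2; apply: (@le_trans _ _ (absp (2%:R : F) / absp (2%:R : F) ^+ 2 *
    (absp (2%:R : F) * (absp (2%:R : F) * absp (h 2%:R j))))).
  by apply: ler_wpM2l; [rewrite divr_ge0 ?exprn_ge0 ?absp_ge0|apply: ler_pM; rewrite ?absp_ge0].
rewrite (_ : _ * _ = absp (2%:R : F) * absp (h 2%:R j)); first by rewrite ler_piMl.
by field; rewrite gt_eqF.
Qed.

Lemma sec_holomorphic i j : ends i j -> holomorphic_section gam tau (sec i j).
Proof.
move=> ij; split; first by move=> s; exact: sec_in_V.
exists 1%N, 0%N, (fun=> 1), (fun=> sec_phi i j); split=> [_|s k kO].
  rewrite /smooth_on; apply/nbhs_mxP; exists 1 => // k near _ g [gS _].
  exact: sec_phi_stable.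
rewrite big_ord1 expr0 invr1 mulr1 hornerC mul1r /sec (tau1 htame) mul1r.
rewrite /sec_phi; case: ifP => [lt|_]; last by rewrite mul0r.
by rewrite (SO3_o_last ij kO lt) cpow_1l invr1 mulr1.
Qed.

(** [z] is the middle term of the pairing of the first and last rows. Isotropy of both rows makes
    its square 4 times the product of the two other terms, so it never exceeds the larger of
    them. *)
Lemma first_row_pair i j h y : ends i j -> SO3 gam h -> let n := umx gam y *m h in
  exists z, n 0 i * h 2%:R j + n 0 j * h 2%:R i + z = 1 /\
    absp z ^+ 2 <= absp (n 0 i * h 2%:R j) * absp (n 0 j * h 2%:R i).
Proof.
move=> ij hS n; have nS : SO3 gam n by apply: SO_mul hS; exact: umx_SO3.
have n2 (k' : 'I_3) : n 2%:R k' = h 2%:R k' by rewrite /n umx_mulmx_last.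
exists (2%:R / gam * (n 0 1 * n 2%:R 1)); split.
  rewrite -!n2; case/orP: ij => /andP[/eqP -> /eqP ->]; rewrite -[RHS](SO3_pair gam0 nS); ring.
have n01 : n 0 1 ^+ 2 = - gam * n 0 i * n 0 j.
  by rewrite (SO3_row_iso gam0 nS) //; case/orP: ij => /andP[/eqP -> /eqP ->]; ring.
have e : (2%:R / gam * (n 0 1 * n 2%:R 1)) ^+ 2 = 4%:R * ((n 0 i * h 2%:R j) * (n 0 j * h 2%:R i)).
  rewrite !exprMn n01 (ends_iso ij nS) !n2 (natrM _ 2 2) exprVn; field; exact: gam0.
by rewrite -abspX e -abspM [absp (4%:R * _)]abspM ler_piMl ?absp_ge0 ?absp_nat.
Qed.

(** If the first row is largest at j as well, all three terms of the pairing are smaller than n_0j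
    h_2j, which therefore exceeds their sum 1. Otherwise n_0i h_2j strictly dominates the pairing,
    so it has absolute value 1 and bounds n_0j h_2j. *)
Lemma first_row_ltP i j h y : ends i j -> SO3 gam h ->
  absp (h 2%:R i) < absp (h 2%:R j) -> let n := umx gam y *m h in
  (absp (n 0 i) < absp (n 0 j)) = (1 < absp (n 0 j * h 2%:R j)).
Proof.
move=> ij hS lt n; have [z [e1 e2]] := first_row_pair y ij hS.
have b0 : 0 < absp (h 2%:R j) by apply: le_lt_trans lt; exact: absp_ge0.
rewrite -/n in e1 e2; move: e1 e2; move: (n 0 i) (n 0 j) => A B e1 e2.
apply/idP/idP => hAB.
  have B0 : 0 < absp B by apply: le_lt_trans hAB; exact: absp_ge0.
  have h1 : absp (A * h 2%:R j) < absp (B * h 2%:R j) by rewrite !abspM ltr_pM2r.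
  have h2 : absp (B * h 2%:R i) < absp (B * h 2%:R j) by rewrite !abspM ltr_pM2l.
  rewrite -(absp1 F) -e1; apply: absp_lt_add; first exact: absp_lt_add.
  rewrite -ltr_sqr ?nnegrE ?absp_ge0 //; apply: le_lt_trans e2 _.
  rewrite expr2; apply: (@le_lt_trans _ _ (absp (B * h 2%:R j) * absp (B * h 2%:R i))).
    by rewrite ler_wpM2r ?absp_ge0 // ltW.
  by rewrite ltr_pM2l // abspM mulr_gt0.
rewrite ltNge; apply/negP => BA.
have P0 : 0 < absp (B * h 2%:R j) by apply: lt_trans hAB.
have B0 : 0 < absp B by move: P0; rewrite abspM; case: (ltgtP 0 (absp B)) (absp_ge0 B) => // <-; rewrite mul0r ltxx.
have h1 : absp (B * h 2%:R j) <= absp (A * h 2%:R j) by rewrite !abspM ler_pM2r.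
have h2 : absp (B * h 2%:R i) < absp (A * h 2%:R j).
  by apply: lt_le_trans h1; rewrite !abspM ltr_pM2l.
have A0 : 0 < absp (A * h 2%:R j) by apply: le_lt_trans h2; exact: absp_ge0.
have h3 : absp z < absp (A * h 2%:R j).
  rewrite -ltr_sqr ?nnegrE ?absp_ge0 //; apply: le_lt_trans e2 _.
  by rewrite expr2 ltr_pM2l.
have : absp (1 : F) = absp (A * h 2%:R j).
  rewrite -e1 -addrA absp_addl //; exact: absp_lt_add.
by rewrite absp1 => e; move: h1; rewrite -e leNgt hAB.
Qed.

Lemma last_end_neq0 i j h : ends i j -> SO3 gam h ->
  absp (h 2%:R j) <= absp (h 2%:R i) -> h 2%:R i != 0.
Proof.
move=> ij hS le; apply/eqP => a0.
have b0 : h 2%:R j = 0 by apply/eqP; rewrite -absp_eq0 eq_le absp_ge0 andbT -(absp0 F) -a0.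
have m0 : h 2%:R 1 = 0 by apply/eqP; rewrite -sqrf_eq0 (ends_iso ij hS) a0 mulr0 mul0r.
have := SO3_pair gam0 hS; case/orP: ij a0 b0 => /andP[/eqP -> /eqP ->] -> ->;
  rewrite m0 !mulr0 !addr0 => /eqP; by rewrite eq_sym oner_eq0.
Qed.

(** If the first row is largest at j, the term n_0j h_2i dominates the pairing and is congruent to
    its sum 1. This also determines the value of the section on its support. *)
Lemma first_row_leP i j h y : ends i j -> SO3 gam h ->
  absp (h 2%:R j) <= absp (h 2%:R i) -> let n := umx gam y *m h in
  (absp (n 0 i) < absp (n 0 j)) = (absp (n 0 i * h 2%:R i) < 1) /\
  (absp (n 0 i) < absp (n 0 j) -> absp (n 0 j * h 2%:R i - 1) < 1).
Proof.
move=> ij hS le n; have [z [e1 e2]] := first_row_pair y ij hS.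
rewrite -/n in e1 e2; move: e1 e2; move: (n 0 i) (n 0 j) => A B e1 e2.
have a0 : 0 < absp (h 2%:R i).
  by rewrite absp_gt0 (last_end_neq0 ij).
have main : absp A < absp B -> absp (B * h 2%:R i - 1) < 1 /\ absp (A * h 2%:R i) < 1.
  move=> hAB; have B0 : 0 < absp B by apply: le_lt_trans hAB; exact: absp_ge0.
  have Ba0 : 0 < absp (B * h 2%:R i) by rewrite abspM mulr_gt0.
  have h1 : absp (A * h 2%:R j) < absp (B * h 2%:R i).
    rewrite !abspM; apply: (@le_lt_trans _ _ (absp A * absp (h 2%:R i))).
      by rewrite ler_wpM2l ?absp_ge0.
    by rewrite ltr_pM2r.
  have h3 : absp z < absp (B * h 2%:R i).
    rewrite -ltr_sqr ?nnegrE ?absp_ge0 //; apply: le_lt_trans e2 _.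
    by rewrite expr2 ltr_pM2r.
  have B1 : absp (B * h 2%:R i) = 1.
    by rewrite -(absp1 F) -e1 addrAC absp_addr //; exact: absp_lt_add.
  split; last by rewrite -B1 !abspM ltr_pM2r.
  rewrite (_ : _ - 1 = - (A * h 2%:R j + z)); last by rewrite -e1; ring.
  by rewrite abspN -B1; apply: absp_lt_add.
split; last by move=> /main[].
apply/idP/idP => [/main[] //|Q1].
rewrite ltNge; apply/negP => BA.
have h1 : absp (B * h 2%:R i) < 1.
  by apply: le_lt_trans Q1; rewrite !abspM ler_pM2r.
have h2 : absp (A * h 2%:R j) < 1.
  by apply: le_lt_trans Q1; rewrite !abspM ler_wpM2l ?absp_ge0.
have h3 : absp z < 1.
  rewrite -ltr_sqr ?nnegrE ?absp_ge0 // expr1n; apply: le_lt_trans e2 _.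
  by rewrite mulr_ilt1 ?absp_ge0.
suff : absp (1 : F) < 1 by rewrite absp1 ltxx.
by rewrite -[X in absp X]e1; apply: absp_lt_add => //; exact: absp_lt_add.
Qed.

Variable mu : {measure set (borel F 3) -> \bar R}.
Hypothesis mu_haar : is_haar (U3 gam) mu.
Local Notation c := (ball_vol gam mu).
Local Notation l2 := (lgp (2%:R : F)).

Definition rX : ratfun R := tofrac 'X.
Definition rC (z : C) : ratfun R := tofrac z%:P.

Definition unram_factor : ratfun R := (1 - rC (q%:C)%C * rX ^+ 2)^-1.

(* The image of [sec i j] under M(tau, s): the integrand is supported on the
   complement of a ball in the first case, on a ball in the second one. *)
Definition Mfun i j h (a : F) : ratfun R :=
  if absp (h 2%:R i) < absp (h 2%:R j) then
    rC (tau (- a^-1) * tau (- h 2%:R j / gam) * (c * q ^ (l2 - lgp (h 2%:R j) + 1) * (1 - q^-1))%:C%C)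
      * rX ^ (2 - lgp (h 2%:R j)) * unram_factor
  else rC (tau (- a^-1) * tau (h 2%:R i) * (c * q ^ (l2 - lgp (h 2%:R i) - 1))%:C%C)
      * rX ^ (- lgp (h 2%:R i)).

Definition Mval i j (X : C) h (a : F) : C :=
  if absp (h 2%:R i) < absp (h 2%:R j) then
    tau (- a^-1) * tau (- h 2%:R j / gam) * (c * q ^ (l2 - lgp (h 2%:R j) + 1) * (1 - q^-1))%:C%C
      * X ^ (2 - lgp (h 2%:R j)) * (1 - (q%:C)%C * X ^+ 2)^-1
  else tau (- a^-1) * tau (h 2%:R i) * (c * q ^ (l2 - lgp (h 2%:R i) - 1))%:C%C
      * X ^ (- lgp (h 2%:R i)).

Lemma ratval_unram X : 1 - (q%:C)%C * X ^+ 2 != 0 ->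
  ratval unram_factor X (1 - (q%:C)%C * X ^+ 2)^-1.
Proof.
move=> h; apply: ratvalV => //; apply: ratvalD.
  by have := ratvalC 1 X; rewrite /rC polyC1 tofrac1.
apply: ratvalN; apply: ratvalM; first exact: ratvalC.
by rewrite /rX -tofracXn; have := ratval_poly ('X^2) X; rewrite hornerXn.
Qed.

Lemma Mfun_val i j X h a : X != 0 -> 1 - (q%:C)%C * X ^+ 2 != 0 ->
  ratval (Mfun i j h a) X (Mval i j X h a).
Proof.
move=> X0 D0; rewrite /Mfun /Mval; case: ifP => _.
  apply: ratvalM (ratval_unram D0); apply: ratvalM; first exact: ratvalC.
  by apply: ratval_exp => //; exact: ratvalX.
apply: ratvalM; first exact: ratvalC.
by apply: ratval_exp => //; exact: ratvalX.
Qed.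

Lemma w1_row (h : 'M[F]_3) (k' : 'I_3) : (w1 F *m h) 2%:R k' = h 0 k'.
Proof. by rewrite mulmx3E !mxE /=; ring. Qed.

Lemma normc_qs_lt s : 2^-1 < complex.Re s -> Normc.normc ((q%:C)%C * qs F s ^+ 2) < 1.
Proof.
move=> hs; rewrite Normc.normcM expr2 Normc.normcM normc_qs.
have -> : Normc.normc (q%:C)%C = expR (ln q).
  by rewrite lnK ?posrE ?q_gt0 // /= expr0n addr0 sqrtr_sqr ger0_norm // ltW ?q_gt0.
rewrite -!expRD -[X in _ < X]expR0 ltr_expR [X in X < _](_ : _ = (1 - 2%:R * complex.Re s) * ln q); last by ring.
rewrite nmulr_rlt0 ?ln_gt0 ?q_gt1 // subr_lt0 mulrC -ltr_pdivrMr // div1r.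
exact: hs.
Qed.

Lemma lt_ballP (y : F) (n : int) : (absp y < q ^ n) = (absp y <= q ^ (n - 1)).
Proof.
have [->|y0] := eqVneq y 0; first by rewrite absp0 ltW ?qz_gt0.
by rewrite absp_lgp // ltr_qz ler_qz; clear; lia.
Qed.

Lemma root_scale (a d : F) : absp (- a / gam * d ^+ 2 * a) = (absp (a * d) / absp (2%:R : F)) ^+ 2.
Proof.
rewrite !abspM abspV abspN (absp_two_square halpha hgam).
by field; rewrite absp_eq0 two_neq0.
Qed.

(** At [w1 *m u *m h] the last row is the first row of u h, one end of which is a constant times the
    squared distance of y to a root. The support is thus a ball, on which the integrand is constant
    by [first_row_leP], or the outside of a ball, over whose shells it forms a geometric series
    because tau ignores squares. *)
Lemma intertwine_integral i j s h a : ends i j -> SO3 gam h -> a != 0 ->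
  Normc.normc ((q%:C)%C * qs F s ^+ 2) < 1 ->
  has_cintegral mu (U3 gam) (fun u => sec i j s (w1 F *m u *m h) (- a^-1))
    (Mval i j (qs F s) h a).
Proof.
move=> ij hS a0 X1; have [i1 j1] := ends_neq1 ij.
have mU := U3_measurable gam0.
have two0 := two_neq0 F; have g2 := absp_two_square halpha hgam.
have tm0 : - a^-1 != 0 by rewrite oppr_eq0 invr_eq0.
have row u (k' : 'I_3) : U3 gam u -> (w1 F *m u *m h) 2%:R k' = (umx gam (u 0 1) *m h) 0 k'.
  by move=> Uu; rewrite -mulmxA w1_row {1}(U3_umx gam0 Uu).
rewrite /Mval; have [lt|ge] := ltP (absp (h 2%:R i)); last first.
  pose y1 := gam * h 1 i / (2%:R * h 2%:R i).
  have a0' : h 2%:R i != 0 by exact: last_end_neq0 ij hS ge.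
  (* The condition is |h_2i (y - y1)| < |2|; the final -1 turns the strict inequality into a closed
     ball. *)
  pose A := rowset gam (ballF y1 (l2 - lgp (h 2%:R i) - 1)).
  have lowA u : U3 gam u -> (absp ((umx gam (u 0 1) *m h) 0 i) < absp ((umx gam (u 0 1) *m h) 0 j)) <-> A u.
    move=> Uu; have [-> _] := first_row_leP (u 0 1) ij hS ge.
    rewrite (umx_mulmx_root gam0 _ hS i1 a0') root_scale expr_lt1 ?divr_ge0 ?absp_ge0 //.
    rewrite ltr_pdivrMr ?absp_gt0 // mul1r abspM mulrC -ltr_pdivlMr ?absp_gt0 //.
    rewrite [absp 2%:R]absp_lgp // [absp (h _ _)]absp_lgp // invr_expz -exprzDr ?unitfE ?q_neq0 //.
    by rewrite lt_ballP; split => [hb|[]].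
  rewrite (_ : _ * _ * _%:C%C * _ = tau (- a^-1) * tau (h 2%:R i) * qs F s ^ (- lgp (h 2%:R i)) * (fine (mu A))%:C%C); last first.
    by rewrite [RHS]mulrAC /A ball_mu.
  apply: has_cintegral_step => //.
  - by apply: rowset_measurable => //; exact: ballF_open.
  - by move=> u [].
  - by rewrite /A ball_mu // ltry.
  - move=> u Au; have Uu := Au.1; have := Au => /(lowA _ Uu) lt.
    have [_ /(_ lt) e1] := first_row_leP (u 0 1) ij hS ge.
    rewrite /sec /sec_phi !row // lt; move: ((umx gam (u 0 1) *m h) 0 j) e1 => B e1.
    have B0 : B != 0 by apply/eqP => B0; move: e1; rewrite B0 mul0r sub0r abspN absp1 ltxx.
    have -> : tau B = tau (h 2%:R i).
      by apply: (mulIf (tau_neq0 htau a0')); rewrite -tauM // (htame e1) tau_sq.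
    have lB : lgp B = - lgp (h 2%:R i).
      apply: lgp_eq; rewrite -invr_expz -absp_lgp //; apply: (mulIf (_ : absp (h 2%:R i) != 0)).
        by rewrite absp_eq0.
      by rewrite -abspM (absp_unit1 e1) mulVf ?absp_eq0.
    by rewrite cpow_absp // lB opprK invr_expz mulrA.
  move=> u Uu nA; rewrite /sec /sec_phi !row // ifF ?mul0r ?mulr0 //.
  by apply/negP => /(lowA _ Uu).
pose y0 := gam * h 1 j / (2%:R * h 2%:R j); set lb := lgp (h 2%:R j).
have b0 : h 2%:R j != 0 by rewrite -absp_gt0 (le_lt_trans _ lt) ?absp_ge0.
have BE y : (umx gam y *m h) 0 j = - h 2%:R j / gam * (y - y0) ^+ 2 by exact: umx_mulmx_root.
(* The support is |h_2j (y - y0)| > |2|, so the first shell has exponent l2 - lb + 1. *)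
pose S (k : nat) := rowset gam (shellF y0 (l2 - lb + 1 + k%:Z)).
have Babs y (n : int) : absp (y - y0) = q ^ n ->
    absp ((umx gam y *m h) 0 j) = q ^ (lb - 2 * l2 + 2 * n) /\
    absp ((umx gam y *m h) 0 j * h 2%:R j) = q ^ (2 * (n - (l2 - lb))).
  move=> hn; have q0 := q_neq0 F.
  have B2 : absp ((umx gam y *m h) 0 j * h 2%:R j) = q ^ (2 * (n - (l2 - lb))).
    rewrite BE root_scale abspM hn (absp_lgp b0) (absp_lgp two0) -/lb.
    rewrite (_ : q ^ lb * q ^ n / q ^ l2 = q ^ (n - (l2 - lb))).
      by rewrite exprnP exprz_exp mulrC.
    by rewrite invr_expz -!exprzDr ?unitfE //; congr (_ ^ _); clear; lia.
  split=> //; apply: (mulIf (_ : absp (h 2%:R j) != 0)); first by rewrite absp_eq0.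
  rewrite -abspM B2 (absp_lgp b0) -/lb -exprzDr ?unitfE //; congr (_ ^ _); clear; lia.
apply: (has_cintegral_shells (S := S) (m := fun k : nat => c * q ^ (l2 - lb + 1 + k%:Z) * (1 - q^-1))
  (w := fun k : nat => tau (- a^-1) * (tau (- h 2%:R j / gam) * qs F s ^ (2 - lb + 2 * k%:Z)))
  (z := (q%:C)%C * qs F s ^+ 2)) => //.
- by move=> k; apply: rowset_measurable => //; exact: shellF_open.
- by move=> k u [].
- move=> k k' _ _ [u [[_ h1] [_ h2]]]; move: h1; rewrite /shellF /= h2 => /qz_inj; clear; lia.
- by move=> k; rewrite shell_mu.
- move=> k u [Uu hu]; have [B1 B2] := Babs _ _ hu.
  rewrite /sec /sec_phi !row // (first_row_ltP _ ij hS lt) B2.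
  rewrite (_ : 1 = q ^ (0 : int)) // ltr_qz ifT; last by clear; lia.
  have B0 : (umx gam (u 0 1) *m h) 0 j != 0 by rewrite -absp_gt0 B1 qz_gt0.
  congr (_ * (_ * _)).
    rewrite BE tau_sqM //; first by rewrite mulf_neq0 ?oppr_eq0 ?invr_eq0 ?b0.
    by rewrite -absp_gt0 hu qz_gt0.
  rewrite cpow_absp // (lgp_eq B1) invr_expz opprK; congr (_ ^ _).
  by clear; lia.
- move=> u Uu nS; rewrite /sec /sec_phi !row // (first_row_ltP _ ij hS lt) ifF ?mul0r ?mulr0 //.
  apply/negP => h1; have d0 : (u : 'M[F]_3) 0 1 - y0 != 0.
    by apply/eqP => d0; move: h1; rewrite BE d0 expr0n mulr0 mul0r absp0 ltr10.
  have [n hn] := padic_value_group d0; have [_ B2] := Babs _ _ hn.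
  move: h1; rewrite B2 (_ : 1 = q ^ (0 : int)) // ltr_qz => h1.
  apply: (nS (absz (n - (l2 - lb + 1))%R)); split => //.
  rewrite /shellF /= [absp _]hn; congr (_ ^ _); move: h1; clear; lia.
move=> k; have q0 := q_neq0 F; have X0 := qs_neq0 F s.
have -> : qs F s ^ (2 - lb + 2 * k%:Z) = qs F s ^ (2 - lb) * (qs F s ^+ 2) ^+ k.
  by rewrite exprzDr ?unitfE // -PoszM -exprM.
have -> : q ^ (l2 - lb + 1 + k%:Z) = q ^ (l2 - lb + 1) * q ^+ k by rewrite exprzDr ?unitfE.
move: (q ^ (l2 - lb + 1)) (qs F s ^ (2 - lb)) (qs F s ^+ 2) (tau _) (tau _) => Q Y Z t t'.
have -> : (c * (Q * q ^+ k) * (1 - q^-1))%:C%C = (c * Q * (1 - q^-1))%:C%C * (q%:C)%C ^+ k.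
  have eM (x y : R) : (x * y)%:C%C = x%:C%C * y%:C%C by rewrite rmorphM.
  have <- : (q ^+ k)%:C%C = (q%:C)%C ^+ k by rewrite rmorphXn.
  by rewrite -eM mulrA mulrAC.
by rewrite exprMn; move: (_%:C%C) (_ ^+ k) (_ ^+ k) => A B D; ring.
Qed.

Lemma sec_intertwined i j : ends i j -> intertwined gam mu (sec i j) (Mfun i j).
Proof.
move=> ij h a hS a0; exists 2^-1 => s hs.
have X1 := normc_qs_lt hs; have [h1 h2] := intertwine_integral ij hS a0 X1.
split=> //; rewrite h2; apply: Mfun_val; first exact: qs_neq0.
by apply/eqP => e; move: X1; rewrite (_ : _ * _ = 1) ?Normc.normc1 ?ltxx //; apply/esym/eqP; rewrite -subr_eq0 e.
Qed.

End Sections.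

(** * The C-factor *)

Section BoundedMultiplier.
Context (R : realType) (d : measure_display) (T : measurableType d).
Variable mu : {measure set T -> \bar R}.
Local Notation C := R[i].

(** Serves to insert the oscillating factor psi^-1, which has absolute value 1. *)
Lemma cintegrable_mul (D : set T) (f u : T -> C) : measurable D -> cintegrable mu D f ->
  measurable_fun D (fun x => complex.Re (u x * f x)) ->
  measurable_fun D (fun x => complex.Im (u x * f x)) ->
  (forall x, D x -> Normc.normc (u x) <= 1) -> cintegrable mu D (fun x => u x * f x).
Proof.
move=> mD [f1 f2] m1 m2 u1.
have iabs : mu.-integrable D (EFin \o (fun x => `|complex.Re (f x)| + `|complex.Im (f x)|)).
  apply: eq_integrable (integrableD mD (integrable_abse f1) (integrable_abse f2)) => // x _ /=.
split; apply: le_integrable iabs => //.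
- exact/measurable_EFinP.
- move=> x Dx; rewrite /= lee_fin [X in _ <= X]ger0_norm ?addr_ge0 //.
  have [ua ub] := normc_ReIm (u x); have le1 := u1 x Dx.
  case: (u x) (f x) ua ub le1 => [a b] [v w] /= ua ub le1.
  apply: le_trans (ler_normB _ _) _; rewrite !normrM; apply: lerD.
    by rewrite ler_piMl // (le_trans ua).
  by rewrite ler_piMl // (le_trans ub).
- exact/measurable_EFinP.
- move=> x Dx; rewrite /= lee_fin [X in _ <= X]ger0_norm ?addr_ge0 //.
  have [ua ub] := normc_ReIm (u x); have le1 := u1 x Dx.
  case: (u x) (f x) ua ub le1 => [a b] [v w] /= ua ub le1.
  apply: le_trans (ler_normD _ _) _; rewrite !normrM addrC; apply: lerD.
    by rewrite ler_piMl // (le_trans ub).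
  by rewrite ler_piMl // (le_trans ua).
Qed.

End BoundedMultiplier.

Section MatrixMeasurability.
Context (R : realType) (F : padicField R) (n : nat).

Lemma measurable_mulmx (A B : 'M[F]_n) :
  measurable_fun setT (fun M : borel F n => (A *m (M : 'M[F]_n) *m B : borel F n)).
Proof.
apply: (measurability (@open 'M[F]_n : set (set (borel F n)))) => //.
move=> _ [V oV <-]; rewrite setTI; apply: borel_open; apply/open_mxP => M VM.
have [e e0 he] := (open_mxP V).2 oV _ VM.
have [d d0 hd] := mx_mul2_near A B M e0.
by exists d => // M' /hd /he.
Qed.

End MatrixMeasurability.

Section CFactor.
Context (R : realType) (F : padicField R) (alpha gam : F) (psi tau : F -> R[i]).
Hypothesis halpha : absp alpha = 1.
Hypothesis hgam : gam = - 4%:R * alpha.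
Hypothesis hpsi : additive_character_level1 psi.
Hypothesis htau : mul_character tau.
Hypothesis htau2 : quadratic tau.
Hypothesis htame : tamely_ramified tau.
Local Notation q := ((resq F)%:R : R).
Local Notation C := R[i].
Variable mu : {measure set (borel F 3) -> \bar R}.
Hypothesis mu_haar : is_haar (U3 gam) mu.
Local Notation c := (ball_vol gam mu).
Local Notation l2 := (lgp (2%:R : F)).
Implicit Types (y z : F) (s X : C).

Let gam0 : gam != 0 := gam_neq0 halpha hgam.
Let mU := U3_measurable gam0.
Let two0 := two_neq0 F.
Let q0 := q_neq0 F.

(* For n as in [natr_lt1], a power of n kills y, so psi y is a root of unity. *)
Lemma psi_norm y : Normc.normc (psi y) = 1.
Proof.
have nz (w : C) : 0 <= Normc.normc w by case: w => ? ? /=; exact: sqrtr_ge0.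
have nX (w : C) n : Normc.normc (w ^+ n) = Normc.normc w ^+ n.
  elim: n => [|n IH]; first by rewrite !expr0 /= expr1n expr0n addr0 sqrtr1.
  by rewrite !exprS Normc.normcM IH.
have pX n : psi (n%:R * y) = psi y ^+ n.
  elim: n => [|n IH]; first by rewrite mul0r (psi0 hpsi) expr0.
  by rewrite -natr1 mulrDl mul1r (psiD hpsi) IH exprSr.
have [n [n0 n1]] := natr_lt1 F.
have [k hk] : exists k, absp (n%:R : F) ^+ k * absp y < 1.
  have [w hw] := uniformizer_exists F.
  have n1' : absp (n%:R : F) <= q^-1 by exact: (absp_lt1V hw n1).
  have [|k hk] := @qV_small R F (absp y + 1)^-1; first by rewrite invr_gt0 ltr_wpDl ?absp_ge0.
  exists k; apply: (@le_lt_trans _ _ (q ^- k * absp y)).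
    by rewrite ler_wpM2r ?absp_ge0 // -exprVn lerXn2r ?nnegrE ?absp_ge0 ?invr_ge0 ?ler0n.
  apply: (@le_lt_trans _ _ (q ^- k * (absp y + 1))).
    by rewrite ler_wpM2l ?lerDl // invr_ge0 exprn_ge0 // ler0n.
  by rewrite -ltr_pdivlMr ?ltr_wpDl ?absp_ge0 // div1r.
have e : psi y ^+ (n ^ k) = 1.
  by rewrite -pX (psi_small hpsi) // abspM natrX abspX.
have : Normc.normc (psi y) ^+ (n ^ k) = 1.
  by rewrite -nX e /= expr1n expr0n addr0 sqrtr1.
by move/eqP; rewrite pexpr_eq1 ?expn_gt0 ?n0 // => /eqP.
Qed.

Definition onU (phi : F -> C) : borel F 3 -> C := fun u => phi ((u : 'M[F]_3) 0 1).

Lemma has_cintegral_ball (phi : F -> C) (w : C) (k : int) :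
  (forall y, absp y <= q ^ k -> phi y = w) -> (forall y, q ^ k < absp y -> phi y = 0) ->
  has_cintegral mu (U3 gam) (onU phi) (w * (c * q ^ k)%:C%C).
Proof.
move=> h1 h2; have e : c * q ^ k = fine (mu (rowset gam (ballF 0 k))) by rewrite ball_mu.
rewrite e; apply: has_cintegral_step => //.
- by apply: rowset_measurable => //; exact: ballF_open.
- by move=> u [].
- by rewrite ball_mu // ltry.
- by move=> u [_]; rewrite /ballF /= subr0 => /h1.
move=> u Uu nB; apply: h2; rewrite ltNge; apply/negP => h; apply: nB.
by split => //; rewrite /ballF /= subr0.
Qed.

Lemma has_cintegral_tail (phi : F -> C) (w : int -> C) (n0 : int) (a z : C) :
  (forall y n, absp y = q ^ n -> n0 <= n -> phi y = w n) -> (forall y, absp y < q ^ n0 -> phi y = 0) ->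
  (forall k : nat, w (n0 + k%:Z) * (c * q ^ (n0 + k%:Z) * (1 - q^-1))%:C%C = a * z ^+ k) ->
  Normc.normc z < 1 ->
  has_cintegral mu (U3 gam) (onU phi) (a / (1 - z)).
Proof.
move=> h1 h2 h3 z1.
pose S (k : nat) := rowset gam (shellF (0 : F) (n0 + k%:Z)).
apply: (has_cintegral_shells (S := S) (m := fun k : nat => c * q ^ (n0 + k%:Z) * (1 - q^-1))
  (w := fun k : nat => w (n0 + k%:Z)) (z := z)) => //.
- by move=> k; apply: rowset_measurable => //; exact: shellF_open.
- by move=> k u [].
- move=> k k' _ _ [u [[_ e1] [_ e2]]]; move: e1; rewrite /shellF /= e2 => /qz_inj; clear; lia.
- by move=> k; rewrite shell_mu.
- move=> k u [Uu]; rewrite /shellF /= subr0 => hu.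
  by apply: h1 hu _; rewrite lerDl.
move=> u Uu nS; apply: h2; rewrite ltNge; apply/negP => h.
have u0 : (u : 'M[F]_3) 0 1 != 0 by rewrite -absp_gt0 (lt_le_trans _ h) ?qz_gt0.
have [n hn] := padic_value_group u0; move: h; rewrite [absp _]hn ler_qz => h.
apply: (nS (absz (n - n0)%R)); split => //.
by rewrite /shellF /= subr0 [absp _]hn; congr (_ ^ _); move: h; clear; lia.
Qed.

Section Values.
Variable X : C.
Hypothesis X0 : X != 0.
Local Notation Q := ((q%:C)%C : C).
Local Notation Y := (Q * X ^+ 2).
Hypothesis Y1 : Normc.normc Y^-1 < 1.

Let kap : C := tau gam * (c * q ^ (l2 - 1))%:C%C.

(** Together these describe the image under M(tau, s) of the translated section [sec tau 2 0] at
    [w1 *m u], as a function of y = u_12: [Gcenter] for |y| < |2| and [Gshell n] on the shells |y| =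
    q^n outside; see [Mval_Gfun]. *)
Definition Gshell (n : int) : C := kap * (Q ^+ 2 * X ^+ 2) ^ (l2 - n).
Definition Gcenter : C := kap * (Q ^+ 2 * (1 - Q^-1)) * X ^+ 2 / (1 - Y).
Definition Gfun y : C := if absp y < absp (2%:R : F) then Gcenter else Gshell (lgp y).

Let Q0 : Q != 0.
Proof. by apply/eqP => -[] /eqP; rewrite (negPf q0). Qed.

Let D0 : 1 - Y != 0.
Proof.
apply/eqP => /eqP; rewrite subr_eq0 => /eqP e; move: Y1.
by rewrite -e invr1 /= expr1n expr0n addr0 sqrtr1 ltxx.
Qed.

Lemma absp_two : absp (2%:R : F) = q ^ l2.
Proof. by rewrite absp_lgp. Qed.

Lemma lgp1 : lgp (1 : F) = 0.
Proof. by apply: lgp_eq; rewrite absp1. Qed.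

Lemma tau_pm : tau (- 1^-1) * tau (- 1 / gam) = tau gam.
Proof.
have n10 : (- 1 : F) != 0 by rewrite oppr_eq0 oner_eq0.
rewrite invr1 (tauM htau n10) ?invr_neq0 // (tauV htau htau2 htame) // mulrA.
by rewrite (tau_sq htau2) // mul1r.
Qed.

Lemma umx_last_lt y : (absp (umx gam y 0 2%:R) < absp (umx gam y 0 0)) = (absp y < absp (2%:R : F)).
Proof.
have t0 : 0 < absp (2%:R : F) by rewrite absp_gt0.
rewrite !mxE /= absp1 abspM abspN abspV (absp_two_square halpha hgam) abspX.
by rewrite ltr_pdivrMr ?exprn_gt0 // mul1r ltr_sqr ?nnegrE ?absp_ge0.
Qed.

Lemma Mval_Gfun (u : 'M[F]_3) : U3 gam u -> Mval gam tau mu 2%:R 0 X (w1 F *m u) 1 = Gfun (u 0 1).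
Proof.
move=> Uu; rewrite /Mval /Gfun !w1_row (U3_umx gam0 Uu); move: (u 0 1) => y.
rewrite !mxE /= absp1.
have g2 := absp_two_square halpha hgam.
have t0 : 0 < absp (2%:R : F) by rewrite absp_gt0.
have := umx_last_lt y; rewrite !mxE /= absp1 => ->.
case: ltP => hy.
  rewrite lgp1 !subr0 tau_pm /Gcenter /kap; congr (_ / _); congr (_ * _).
  have -> : q ^ (l2 + 1) = q ^ (l2 - 1) * q ^+ 2.
    by rewrite -[q ^+ 2]/(q ^ (2 : int)) -exprzDr ?unitfE //; congr (_ ^ _); clear; lia.
  have <- : (1 - q^-1)%:C%C = 1 - Q^-1 by rewrite rmorphB /= rmorph1 fmorphV.
  have <- : (q ^+ 2)%:C%C = Q ^+ 2 by rewrite rmorphXn.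
  rewrite -[RHS]mulrA; congr (_ * _); rewrite -!rmorphM; congr (_%:C)%C.
  by rewrite -!mulrA.
have y0 : y != 0 by rewrite -absp_gt0 (lt_le_trans t0).
have -> : lgp (- y ^+ 2 / gam) = 2 * (lgp y - l2).
  apply: lgp_eq; rewrite abspM abspN abspV g2 abspX absp_two (absp_lgp y0).
  have e2 (z : int) : (q ^ z) ^+ 2 = q ^ (2 * z).
    by rewrite -[LHS]/((q ^ z) ^ (2 : int)) exprz_exp mulrC.
  rewrite !e2 invr_expz -exprzDr ?unitfE //; congr (_ ^ _); clear; lia.
have -> : tau (- y ^+ 2 / gam) = tau (- 1 / gam).
  rewrite (_ : - y ^+ 2 / gam = - 1 / gam * y ^+ 2); last by field.
  by rewrite (tau_sqM htau htau2) // mulf_neq0 ?oppr_eq0 ?oner_eq0 ?invr_eq0.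
rewrite tau_pm /Gshell /kap -!mulrA; congr (_ * _).
have -> : q ^ (l2 - 2 * (lgp y - l2) - 1) = q ^ (l2 - 1) * q ^ (2 * (l2 - lgp y)).
  by rewrite -exprzDr ?unitfE //; congr (_ ^ _); clear; lia.
have -> : (c * (q ^ (l2 - 1) * q ^ (2 * (l2 - lgp y))))%:C%C = (c * q ^ (l2 - 1))%:C%C * (q ^ (2 * (l2 - lgp y)))%:C%C.
  by rewrite -rmorphM mulrA.
rewrite -mulrA; congr (_ * _).
rewrite (_ : - (2 * (lgp y - l2)) = 2 * (l2 - lgp y)); last by clear; lia.
have -> : (q ^ (2 * (l2 - lgp y)))%:C%C = Q ^ (2 * (l2 - lgp y)) by rewrite fmorphXz.
rewrite -exprzMl ?unitfE //.
have -> : Q * Y = (Q * X) ^+ 2 by rewrite mulrA -expr2 exprMn.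
by rewrite -[(Q * X) ^+ 2]/((Q * X) ^ (2 : int)) [RHS]exprz_exp.
Qed.

(* The Jacquet integrand decomposes pointwise as
   [Gfun / psi = Fa + Fb - (Fc + Fd) + (Fc + Fd) / psi].  The integrals of [Fa]
   and [Fb] cancel, and that of the last term vanishes because [Fc + Fd] is
   invariant under translation by integers. *)
Definition Fa y : C := if absp y < absp (2%:R : F) then Gcenter else 0.
Definition Fb y : C := if absp y < absp (2%:R : F) then 0 else Gshell (lgp y).
Definition Fc y : C := if absp y < 1 then 0 else Gshell (lgp y).
Definition Fd y : C := if absp y < 1 then Gshell 0 else 0.

Lemma Fa_integral : has_cintegral mu (U3 gam) (onU Fa) (Gcenter * (c * q ^ (l2 - 1))%:C%C).
Proof.
apply: has_cintegral_ball => y; rewrite /Fa absp_two lt_ballP; first by move=> ->.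
by move=> h; rewrite leNgt h.
Qed.

Lemma Fd_integral : has_cintegral mu (U3 gam) (onU Fd) (Gshell 0 * (c * q ^ (-1))%:C%C).
Proof.
apply: has_cintegral_ball => y; rewrite /Fd (_ : 1 = q ^ (0 : int)) // lt_ballP sub0r; first by move=> ->.
by move=> h; rewrite leNgt h.
Qed.

(** From one shell to the next the function is divided by Q^2 X^2 and the volume multiplied by Q.
    The ratio is the inverse of Q X^2, so these integrals converge on a left half plane. *)
Lemma tail_term (n0 : int) (k : nat) :
  Gshell (n0 + k%:Z) * (c * q ^ (n0 + k%:Z) * (1 - q^-1))%:C%C =
  (Gshell n0 * (c * q ^ n0 * (1 - q^-1))%:C%C) * Y^-1 ^+ k.
Proof.
rewrite /Gshell; set A := Q ^+ 2 * X ^+ 2.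
have A0 : A != 0 by rewrite mulf_neq0 ?expf_neq0.
have -> : A ^ (l2 - (n0 + k%:Z)) = A ^ (l2 - n0) * A^-1 ^+ k.
  have -> : A^-1 ^+ k = A ^ (- k%:Z) by rewrite exprVn -invr_expz.
  rewrite -exprzDr ?unitfE //; congr (_ ^ _); clear; lia.
have -> : (c * q ^ (n0 + k%:Z) * (1 - q^-1))%:C%C = (c * q ^ n0 * (1 - q^-1))%:C%C * Q ^+ k.
  have <- : (q ^+ k)%:C%C = Q ^+ k by rewrite rmorphXn.
  rewrite -rmorphM; congr (_%:C)%C.
  by rewrite exprzDr ?unitfE // -!mulrA; congr (_ * (_ * _)); rewrite mulrC.
have -> : Y^-1 = A^-1 * Q.
  by rewrite /A; move: Q0 X0; generalize Q => w w0 x0; field; rewrite w0 x0.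
have gen (x a b d e : C) : x * (a * b) * (e * d) = x * a * e * (b * d) by ring.
by rewrite exprMn; exact: gen.
Qed.

Lemma Fb_integral : has_cintegral mu (U3 gam) (onU Fb)
  (Gshell l2 * (c * q ^ l2 * (1 - q^-1))%:C%C / (1 - Y^-1)).
Proof.
apply: (has_cintegral_tail (w := Gshell) (n0 := l2)) => //.
- by move=> y n hn le; rewrite /Fb (lgp_eq hn) hn absp_two ltr_qz ltNge le.
- by move=> y; rewrite /Fb absp_two => ->.
- exact: tail_term.
Qed.

Lemma Fc_integral : has_cintegral mu (U3 gam) (onU Fc)
  (Gshell 0 * (c * q ^ (0 : int) * (1 - q^-1))%:C%C / (1 - Y^-1)).
Proof.
apply: (has_cintegral_tail (w := Gshell) (n0 := 0)) => //.
- by move=> y n hn le; rewrite /Fc (lgp_eq hn) hn (_ : 1 = q ^ (0 : int)) // ltr_qz ltNge le.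
- by move=> y; rewrite /Fc => ->.
- exact: tail_term.
Qed.

Definition Fe y : C := Fc y + Fd y.

(** [Fd] continues the value of [Fc] on the unit shell to the ball inside it. So [Fe] is constant on
    the integers, and beyond them depends only on the absolute value. *)
Lemma Fe_shift y z : absp z <= 1 -> Fe (y + z) = Fe y.
Proof.
move=> hz; have small w : absp w <= 1 -> Fe w = Gshell 0.
  move=> hw; rewrite /Fe /Fc /Fd; case: ltP => h; first by rewrite add0r.
  by rewrite addr0 (@lgp_eq _ _ _ 0) //; apply/eqP; rewrite expr0z eq_le hw.
have [le|lt] := leP (absp y) 1; first by rewrite !small // absp_le_add.
have e : absp (y + z) = absp y by rewrite absp_addl // (le_lt_trans hz).
by rewrite /Fe /Fc /Fd /lgp e.
Qed.

Definition Ff y : C := (psi y)^-1 * Fe y.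

Lemma Ff_shift y z : absp z <= 1 -> Ff (y + z) = (psi z)^-1 * Ff y.
Proof. by move=> hz; rewrite /Ff Fe_shift // (psiD hpsi) invfM mulrA [_^-1 * _^-1]mulrC. Qed.

Lemma Ff_near y z : absp (z - y) < 1 -> Ff z = Ff y.
Proof.
move=> hz; rewrite -(subrK y z) addrC Ff_shift ?ltW //.
by rewrite (psi_small hpsi) // invr1 mul1r.
Qed.

Lemma Ff_measurable (p : C -> R) : measurable_fun setT (fun u => p (onU Ff u)).
Proof.
move=> _ B mB; rewrite setTI.
apply: (preimage_measurable (Y := [set y | B (p (Ff y))])) => y hy; exists 1 => // z hz.
by rewrite /= (Ff_near hz).
Qed.

(** Translation by an integer z with psi(z) <> 1 preserves the Haar measure and multiplies the
    integral by psi(z)^-1. *)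
Lemma Ff_integral : has_cintegral mu (U3 gam) (onU Ff) 0.
Proof.
have iFe := has_cintegralD mU Fc_integral Fd_integral.
have iFf : cintegrable mu (U3 gam) (onU Ff).
  apply: (cintegrable_mul (f := onU Fe) (u := onU (fun y => (psi y)^-1)) mU).
  - exact: iFe.1.
  - by apply: measurable_funTS; exact: Ff_measurable.
  - by apply: measurable_funTS; exact: Ff_measurable.
  move=> u _; rewrite /onU -(psiN hpsi) psi_norm //.
split => //.
have [_ _ [z [hz pz]]] := hpsi.
pose phi (u : borel F 3) : borel F 3 := umx gam z *m (u : 'M[F]_3) *m 1%:M.
have phiE (u : 'M[F]_3) : phi u = umx gam z *m u by rewrite /phi mulmx1.
have phiU u : U3 gam u -> phi u = umx gam (u 0 1 + z).
  by move=> Uu; rewrite phiE {1}(U3_umx gam0 Uu) (umxD gam0) addrC.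
have phiN (u v : 'M[F]_3) : phi u = v -> u = umx gam (- z) *m v.
  by move=> <-; rewrite phiE mulmxA (umxD gam0) addNr (umx0 gam0) mul1mx.
have zp : has_cintegral mu (U3 gam) (onU Ff \o phi) ((psi z)^-1 * cintegral mu (U3 gam) (onU Ff)).
  apply: (has_cintegral_eq (g := fun u => (psi z)^-1 * onU Ff u)) => //.
    by move=> u Uu; rewrite /= phiU // /onU umx_entry Ff_shift.
  exact: has_cintegralZ.
have inv : cintegral mu (U3 gam) (onU Ff \o phi) = cintegral mu (U3 gam) (onU Ff).
  apply: cintegral_invariant => //.
  - exact: measurable_mulmx.
  - apply/seteqP; split => u; last by move=> /phiU e; rewrite /preimage /= e; exact: (umx_U3 gam0).
    rewrite /preimage /= => h; rewrite (phiN _ _ (erefl (phi u))) (U3_umx gam0 h) (umxD gam0).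
    exact: (umx_U3 gam0).
  - move=> A mA AU; have [inv _ _] := mu_haar.
    rewrite -(inv (umx gam (- z)) A) //; last exact: (umx_U3 gam0).
    congr (mu _); apply/seteqP; split => u.
      by move=> h; exists (phi u) => //; rewrite -(phiN u _ erefl).
    by move=> [v Av <-]; rewrite /preimage /= phiE mulmxA (umxD gam0) subrr (umx0 gam0) mul1mx.
  - exact: Ff_measurable.
  - exact: Ff_measurable.
  exact: zp.1.
have e : cintegral mu (U3 gam) (onU Ff) = (psi z)^-1 * cintegral mu (U3 gam) (onU Ff).
  by rewrite -{1}inv zp.2.
apply/eqP; have : (1 - (psi z)^-1) * cintegral mu (U3 gam) (onU Ff) = 0.
  by rewrite mulrBl mul1r -e subrr.
move/eqP; rewrite mulf_eq0 => /orP[|//].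
by rewrite subr_eq0 eq_sym invr_eq1 => /eqP.
Qed.

Definition Bval : C := kap * c%:C%C * (Q ^+ 2 * X ^+ 2) ^ l2 * (Y - Q^-1) / (1 - Y).

Lemma G_integral : has_cintegral mu (U3 gam) (onU (fun y => Gfun y * (psi y)^-1)) Bval.
Proof.
have two1 := absp_nat F 2.
have := has_cintegralD mU (has_cintegralD mU (has_cintegralD mU Fa_integral Fb_integral)
  (has_cintegralZ (-1) mU (has_cintegralD mU Fc_integral Fd_integral))) Ff_integral.
set v := (X in has_cintegral _ _ _ X) => h.
have -> : Bval = v.
  rewrite /v /Bval /Gcenter.
  have -> : Gshell l2 = kap by rewrite /Gshell subrr expr0z mulr1.
  have -> : Gshell 0 = kap * (Q ^+ 2 * X ^+ 2) ^ l2 by rewrite /Gshell subr0.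
  have eM (x y : R) : (x * y)%:C%C = x%:C%C * y%:C%C by rewrite rmorphM.
  have e1 : (1 - q^-1)%:C%C = 1 - Q^-1 by rewrite rmorphB /= rmorph1 fmorphV.
  have e2 : (q ^ (-1))%:C%C = Q^-1 by rewrite exprN1 fmorphV.
  have e3 : (q ^ (l2 - 1))%:C%C = (q ^ l2)%:C%C * Q^-1 by rewrite -e2 -eM -exprzDr ?unitfE.
  rewrite !eM e1 e2 e3 expr0z rmorph1 /=.
  have gen (k d T w x P : C) : w != 0 -> x != 0 -> 1 - w * x ^+ 2 != 0 ->
      k * d * T * (w * x ^+ 2 - w^-1) / (1 - w * x ^+ 2) =
      k * (w ^+ 2 * (1 - w^-1)) * x ^+ 2 / (1 - w * x ^+ 2) * (d * (P * w^-1)) +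
      k * (d * P * (1 - w^-1)) / (1 - (w * x ^+ 2)^-1) +
      -1 * (k * T * (d * 1 * (1 - w^-1)) / (1 - (w * x ^+ 2)^-1) + k * T * (d * w^-1)) + 0.
    by move=> w0 x0 d0; field; rewrite w0 x0 -opprB oppr_eq0 d0.
  exact: gen.
apply: has_cintegral_eq h => // u _; rewrite /onU; move: ((u : 'M[F]_3) 0 1) => y.
have GE : Gfun y = Fa y + Fb y by rewrite /Gfun /Fa /Fb; case: ifP; rewrite ?addr0 ?add0r.
(* For |y| < 1, psi is trivial and the last two terms cancel. For |y| >= 1 >= |2|, [Fa] and [Fd]
   vanish and [Fb] equals [Fc]. *)
rewrite GE /Ff /Fe; have [lt|ge] := ltP (absp y) 1.
  by rewrite (psi_small hpsi) // !invr1 /Fc lt; ring.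
have -> : Fa y = 0 by rewrite /Fa ltNge (le_trans two1 ge).
have -> : Fb y = Fc y by rewrite /Fb /Fc !ltNge ge (le_trans two1 ge).
by rewrite /Fd ltNge ge /=; ring.
Qed.

End Values.

(** The substitution of 1 - s for s inverts q X^2. *)
Lemma normc_qs_gt s : complex.Re s < 2^-1 -> Normc.normc ((q%:C)%C * qs F s ^+ 2)^-1 < 1.
Proof.
move=> hs; have h : 2^-1 < complex.Re (1 - s).
  by move: hs; case: s => [a b] /= ha; lra.
have := @normc_qs_lt _ F _ h; congr (Normc.normc _ < 1).
have e : qs F (1 - s) = (q%:C)%C^-1 * (qs F s)^-1.
  by rewrite !qsE cpowD cpowN invfM cpow_r1 ?q_gt0.
have Q0 : (q%:C)%C != 0 :> C by apply/eqP => -[] /eqP; rewrite (negPf q0).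
rewrite e; move: (qs_neq0 F s) Q0; move: (qs F s) (q%:C)%C => x w x0 w0.
by field; rewrite x0 w0.
Qed.

Definition Cval X : C := (1 - (q%:C)%C * X ^+ 2) /
  (tau gam * c%:C%C * ((q%:C)%C ^+ 2 * X ^+ 2) ^ l2 * ((q%:C)%C * X ^+ 2 - (q%:C)%C^-1)).

(** At [w1 *m u] the section [sec tau 2 0] is supported on |y| < |2|, inside p, so its Jacquet
    integral is the constant [rA]. That of its image is [Bval], and the C-factor is the quotient. *)
Lemma C_factor_val cst : is_C_factor psi gam mu tau cst ->
  forall X, X != 0 -> 1 - (q%:C)%C * X ^+ 2 != 0 -> (q%:C)%C * X ^+ 2 - (q%:C)%C^-1 != 0 ->
  ratval cst X (Cval X).
Proof.
move=> hcst.
have Q0 : (q%:C)%C != 0 :> C by apply/eqP => -[] /eqP; rewrite (negPf q0).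
have rY X : ratval (rC (q%:C)%C * rX R ^+ 2) X ((q%:C)%C * X ^+ 2).
  by apply: ratvalM; [exact: ratvalC|rewrite !expr2; apply: ratvalM; exact: ratvalX].
pose kap : C := tau gam * (c * q ^ (l2 - 1))%:C%C.
pose rA : ratfun R := rC (c * q ^ (l2 - 1))%:C%C.
pose rB : ratfun R := rC (kap * c%:C%C) * (rC (q%:C)%C * (rC (q%:C)%C * rX R ^+ 2)) ^ l2 *
  (rC (q%:C)%C * rX R ^+ 2 - rC (q%:C)%C^-1) * unram_factor F.
have B_val X : X != 0 -> 1 - (q%:C)%C * X ^+ 2 != 0 -> ratval rB X (Bval X).
  move=> X0 D0; rewrite /Bval -/kap (_ : (q%:C)%C ^+ 2 * X ^+ 2 = (q%:C)%C * ((q%:C)%C * X ^+ 2)); last by rewrite mulrA -expr2.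
  apply: ratvalM (ratval_unram D0); apply: ratvalM.
    apply: ratvalM; first exact: ratvalC.
    apply: ratval_exp; first by apply: ratvalM; [exact: ratvalC|exact: rY].
    by rewrite !mulf_neq0 // expf_neq0.
  by apply: ratvalD; [exact: rY|apply: ratvalN; exact: ratvalC].
have c0 := ball_vol_gt0 gam0 mu_haar.
have A0 : (c * q ^ (l2 - 1))%:C%C != 0 :> C.
  apply/eqP => -[] /eqP; rewrite gt_eqF // mulr_gt0 // qz_gt0 //.
have e20 : ends 2%:R 0 by rewrite /ends eqxx orbT.
have AB : rA = cst * rB.
  apply: (hcst (sec tau 2%:R 0) (Mfun gam tau mu 2%:R 0)).
  - exact: (sec_holomorphic halpha hgam htau htau2 htame e20).
  - exact: (sec_intertwined halpha hgam htau htau2 htame mu_haar e20).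
  - exists 0 => s _.
    have [h1 h2] : has_cintegral mu (U3 gam) (jacquet_integrand psi (sec tau 2%:R 0 s)) (1 * (c * q ^ (l2 - 1))%:C%C).
      apply: (has_cintegral_eq (g := onU (fun y => if absp y < absp (2%:R : F) then 1 else 0))) => //.
        move=> u Uu; rewrite /jacquet_integrand /sec /sec_phi !w1_row (@ent_ord _ _ _ _ 1 2 0 1) // /onU.
        rewrite (U3_umx gam0 Uu) umx_last_lt umx_entry; move: (u 0 1) => y.
        have -> : umx gam y 0 0 = 1 by rewrite !mxE.
        rewrite absp1 cpow_1l !(tau1 htame) invr1 mulr1 mul1r.
        case: ifP => h; last by rewrite mul0r.
        by rewrite (psi_small hpsi) ?invr1 ?mulr1 // (lt_le_trans h) // absp_nat.
      apply: has_cintegral_ball => y; rewrite absp_two lt_ballP; first by move=> ->.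
      by move=> h; rewrite leNgt h.
    split => //; rewrite h2 mul1r; exact: ratvalC.
  exists 2^-1 => s /normc_qs_gt hs.
  have D0 : 1 - (q%:C)%C * qs F s ^+ 2 != 0.
    by apply/eqP => /eqP; rewrite subr_eq0 => /eqP e; move: hs; rewrite -e invr1 Normc.normc1 ltxx.
  have [h1 h2] : has_cintegral mu (U3 gam) (jacquet_integrand psi (section_eval (Mfun gam tau mu 2%:R 0) s)) (Bval (qs F s)).
    apply: (has_cintegral_eq _ _ (G_integral (qs_neq0 F s) hs)) => // u Uu.
    rewrite /jacquet_integrand /section_eval (rateval_ratval (Mfun_val gam tau mu 2%:R 0 (w1 F *m u) 1 (qs_neq0 F s) D0)).
    have -> : ent (u : 'M[F]_3) 1 2 = (u : 'M[F]_3) 0 1 by apply: ent_ord.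
    by rewrite Mval_Gfun ?qs_neq0.
  split => //; rewrite h2; exact: B_val (qs_neq0 F s) D0.
move=> X X0 D0 E0.
have rA0 : rA != 0 by rewrite tofrac_eq0 polyC_eq0.
have rB0 : rB != 0 by apply: contra rA0 => /eqP e; rewrite AB e mulr0.
have -> : cst = rA / rB by rewrite AB mulfK.
have kap0 : kap != 0 by rewrite mulf_neq0 // (tau_neq0 htau).
have C0 : c%:C%C != 0 :> C by apply/eqP => -[] /eqP; rewrite gt_eqF.
have P0 : ((q%:C)%C ^+ 2 * X ^+ 2) ^ l2 != 0 by rewrite expfz_neq0 // mulf_neq0 // expf_neq0.
have -> : Cval X = (c * q ^ (l2 - 1))%:C%C * (Bval X)^-1.
  rewrite /Cval /Bval; move: (tau_neq0 htau gam0) A0 C0 P0 E0 D0 Q0.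
  have gen (t a d P Y w : C) : t != 0 -> a != 0 -> d != 0 -> P != 0 -> Y - w^-1 != 0 -> 1 - Y != 0 ->
     w != 0 -> (1 - Y) / (t * d * P * (Y - w^-1)) = a * (t * a * d * P * (Y - w^-1) / (1 - Y))^-1.
    move=> t0 a0 d0 P0 E0 D0 w0; move: E0; rewrite -[Y - w^-1]/(Y - w^-1); set e := Y - w^-1 => e0.
    by field; rewrite t0 a0 d0 P0 e0 D0.
  exact: gen.
apply: ratvalM; first exact: ratvalC.
apply: ratvalV; first exact: B_val.
rewrite /Bval -/kap; do 4?[apply: mulf_neq0]; rewrite ?invr_neq0 //.
Qed.

End CFactor.

(** * The zeta integrals *)

Section RootMeasure.
Context (R : realType) (F : padicField R) (l : nat).
Hypothesis hl : (2 < l)%N.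
Local Notation Rl1 := (@Rl1 R F l).
Implicit Types (i j : 'I_(2 * l)) (M r : 'M[F]_(2 * l)).

(** Since M - 1 has square 0, the quadratic condition of orthogonality becomes linear. In this form
    closedness is immediate. *)
Lemma Rl1_charP M : Rl1 M <-> (forall i j, ~~ root_entry i j -> M i j = (i == j)%:R) /\
  forall i j, M (rev_ord j) (rev_ord i) = 2%:R * (i == j)%:R - M i j.
Proof.
split=> [MR|[h1 h2]]; first by split; [case/(Rl1P hl): MR|move=> i j; exact: Rl1_rev].
apply/(Rl1P hl); split => //.
have N0 : root_supported (M - 1%:M) by move=> i j /h1 e; rewrite !mxE e subrr.
have N2 := root_supported_mul hl N0 N0.
have JM : @J_anti R F l *m M^T *m @J_anti R F l = 2%:R *: 1%:M - M.
  by apply/matrixP => i j; rewrite mulmx_anti anti_mulmx !mxE h2.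
split; last first.
  have MM : M *m M = M + M - 1%:M.
    apply/eqP; rewrite -subr_eq0; apply/eqP; rewrite -N2 mulmxBl !mulmxBr !mulmx1 !mul1mx.
    by rewrite !opprB opprD !addrA; congr (_ + _); rewrite addrAC.
  have : @J_anti R F l *m (M^T *m @J_anti R F l *m M) = 1%:M.
    rewrite !mulmxA JM mulmxBl -scalemxAl mul1mx MM scaler_nat mulr2n opprB addrC subrK.
    by [].
  move/(congr1 (mulmx (@J_anti R F l))); rewrite mulmxA J_anti_sq mul1mx => ->.
  by rewrite mulmx1.
rewrite det_trig; first by rewrite big1 // => i _; rewrite h1 ?eqxx // /root_entry; move: (ltn_ord i); lia.
apply/is_trig_mxP => i j ij; rewrite h1; first by rewrite -val_eqE /= ltn_eqF.
rewrite /root_entry; move: (ltn_ord i) (ltn_ord j) ij; lia.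
Qed.

Lemma closed_Rl1 : closed Rl1.
Proof.
apply: closed_mx => M hM; apply/Rl1_charP; split => [i j nR|i j];
  apply/eqP; rewrite -subr_eq0; apply/eqP; apply: absp_arch0 => e /hM[M' [/Rl1_charP[h1 h2] near]].
  by rewrite -(h1 i j nR) -abspN opprB.
rewrite (_ : _ - _ = - ((M' (rev_ord j) (rev_ord i) - M (rev_ord j) (rev_ord i)) + (M' i j - M i j))).
  by rewrite abspN; apply: absp_lt_add.
by rewrite h2; ring.
Qed.

Definition Rl1_ball r : set (borel F (2 * l)) := [set r' | Rl1 r' /\ mxnear r r' 1].

Lemma Rl1_measurable : measurable (Rl1 : set (borel F (2 * l))).
Proof. exact: borel_closed closed_Rl1. Qed.

Lemma Rl1_ball_measurable r : measurable (Rl1_ball r).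
Proof.
have -> : Rl1_ball r = (Rl1 : set (borel F (2 * l))) `&` [set r' | mxnear r r' 1] by [].
apply: measurableI; [exact: Rl1_measurable|apply: borel_open; apply/open_mxP => M rM].
by exists 1 => // M' h; exact: mxnear_trans rM h.
Qed.

Lemma Rl1_ball_translate r : Rl1 r -> [set r *m r' | r' in Rl1_ball 1%:M] = Rl1_ball r.
Proof.
move=> rR; apply/seteqP; split => [_ [r' [r'R near] <-]|r' [r'R near]].
  split; [exact: Rl1M|rewrite Rl1_mul // => i j].
  by have := near i j; rewrite !mxE; congr (absp _ < 1); ring.
exists (invmx r *m r'); last by rewrite mulmxA mulmxV ?mul1mx // (SO_unitmx rR.1).
split; [by apply: Rl1M => //; exact: Rl1V|rewrite Rl1_mul ?Rl1V_E //; last first].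
  by rewrite -Rl1V_E //; exact: Rl1V.
by move=> i j; have := near i j; rewrite !mxE; congr (absp _ < 1); ring.
Qed.

Variable mu : {measure set (borel F (2 * l)) -> \bar R}.
Hypothesis mu_haar : is_haar Rl1 mu.

Lemma Rl1_ball_fin : (mu (Rl1_ball 1%:M) < +oo)%E.
Proof.
have [_ fin _] := mu_haar.
pose K : set (borel F (2 * l)) := Rl1 `&` [set M : 'M[F]_(2 * l) | forall i j, absp (M i j) <= (resq F)%:R ^+ 0].
have cK : compact (K : set 'M[F]_(2 * l)).
  by rewrite /K setIC; apply: compact_closedI; [exact: compact_mx_bounded|exact: closed_Rl1].
apply: le_lt_trans (fin _ cK _); last by move=> ? [].
apply: le_measure; rewrite ?inE.
- exact: Rl1_ball_measurable.
- rewrite /K; apply: measurableI; first exact: Rl1_measurable.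
  apply: borel_open; apply/open_mxP => M hM; exists 1 => // M' near i j.
  by rewrite -(subrK (M i j) (M' i j)); apply: absp_le_add; [rewrite expr0 ltW|].
move=> r [rR near]; split => // i j; rewrite expr0.
rewrite -(subrK ((1%:M : 'M[F]_(2 * l)) i j) (r i j)); apply: absp_le_add; first by rewrite ltW.
by rewrite mxE absp_nat.
Qed.

(** Countably many translates of the ball cover the group, which is not a null set. *)
Lemma Rl1_ball_neq0 : mu (Rl1_ball 1%:M) <> 0%E.
Proof.
move=> mu0; have [inv _] := mu_haar; apply.
have [||r [rR rS]] := @mx_countable_cover _ F _ Rl1 (fun r r' => Rl1_ball r r').
- by exists 1%:M; exact: Rl1_1.
- by move=> h hR; exists 1 => // r rR near; split => //; exact: mxnear_sym.
apply: (measure0_cover Rl1_measurable (S := fun k => Rl1_ball (r k))).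
- by move=> k; exact: Rl1_ball_measurable.
- by move=> h /rS[k hk]; exists k.
move=> k; rewrite -Rl1_ball_translate // inv ?mu0 //; first exact: Rl1_ball_measurable.
by move=> h [].
Qed.

End RootMeasure.

(** * The volumes of the two cells in U_3\SO_3 *)

Section QuotientMeasure.
Context (R : realType) (F : padicField R) (varpi alpha gam : F).
Hypothesis hvarpi : uniformizer varpi.
Hypothesis halpha : absp alpha = 1.
Hypothesis hgam : gam = - 4%:R * alpha.
Local Notation q := ((resq F)%:R : R).
Local Notation SO3 := (SO3 gam).
Local Notation U3 := (U3 gam).
Local Notation QB := (quotient_borel U3 SO3).
Implicit Types (g h k : 'M[F]_3).

Let gam0 : gam != 0 := gam_neq0 halpha hgam.

Lemma U3_last u h : U3 u -> forall j, (u *m h) 2%:R j = h 2%:R j.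
Proof. by move=> /(U3_umx gam0) -> j; rewrite umx_mulmx_last. Qed.

Lemma U3_SO3M u h : U3 u -> SO3 h -> SO3 (u *m h).
Proof. by move=> [uS _] hS; exact: SO_mul. Qed.

Lemma SO3_invmx22 k : SO3 k -> (invmx k) 2%:R 2%:R = k 0 0.
Proof.
move=> kS; rewrite (SO_invE _ kS) ?J3_unit // invmx_J3 // !mulmx3E !mxE /=.
by ring.
Qed.

Lemma SO3_invmx20 k : SO3 k -> (invmx k) 2%:R 0 = k 2%:R 0.
Proof.
move=> kS; rewrite (SO_invE _ kS) ?J3_unit // invmx_J3 // !mulmx3E !mxE /=.
by ring.
Qed.

(** Left multiplication by U_3 does not change the last row, so an open condition on its ends is
    open modulo U_3. *)
Lemma last_open_measurable (P : F -> F -> Prop) :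
  (forall a c, P a c -> exists2 e : R, 0 < e &
     forall a' c', absp (a' - a) < e -> absp (c' - c) < e -> P a' c') ->
  measurable ([set h | SO3 h /\ P (h 2%:R 0) (h 2%:R 2%:R)] : set QB).
Proof.
move=> Pn; apply: sub_sigma_algebra; split.
  exists [set h : 'M[F]_3 | P (h 2%:R 0) (h 2%:R 2%:R)]; last by rewrite setIC.
  apply/open_mxP => M /= /Pn[e e0 he]; exists e => // M' near; exact: he.
by move=> u h Uu [hS hP]; split; [exact: U3_SO3M|rewrite !U3_last].
Qed.

Definition Cell0 : set QB := [set h | SO3 h /\ cell0 h].
Definition Cell1 : set QB := [set h | SO3 h /\ cell1 varpi h].

Lemma Cell0_measurable : measurable Cell0.
Proof.
apply: (last_open_measurable (P := fun a c => absp (c - 1) < 1 /\ absp a < 1)) => a c [hc ha].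
exists 1 => // a' c' ha' hc'; split; last by rewrite -(subrK a a') absp_lt_add.
by rewrite -(subrK c c') -addrA absp_lt_add.
Qed.

Lemma Cell1_measurable : measurable Cell1.
Proof.
apply: (last_open_measurable (P := fun a c => absp (a + varpi) < q^-1 /\ absp c < 1)) => a c [ha hc].
exists q^-1; first exact: qV_gt0.
move=> a' c' ha' hc'; split; first by rewrite -(subrK a a') -addrA absp_lt_add.
by rewrite -(subrK c c') absp_lt_add // (lt_trans hc') // qV_lt1.
Qed.

Lemma SO3_quotient_measurable : measurable (SO3 : set QB).
Proof.
apply: sub_sigma_algebra; split; last by move=> u a; exact: U3_SO3M.
by exists setT; [exact: openT|rewrite setTI].
Qed.

Lemma cell0_half h : SO3 h -> cell0 h -> absp (h 2%:R 0) = absp (h 2%:R 1 / 2%:R) ^+ 2.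
Proof.
move=> hS [hc ha]; have := congr1 (@absp R F) (SO3_last_iso gam0 hS).
rewrite abspX !abspM abspN (absp_two_square halpha hgam) (absp_unit1 hc) mulr1 => e.
rewrite abspV expr_div_n e mulrC mulKf //.
by rewrite expf_neq0 // absp_eq0 two_neq0.
Qed.

(** The first entry has the absolute value of a square, so being less than 1 it is at most q^-2.
    This spare power of q is what lets [cell_flip] carry the first cell into the second. *)
Lemma cell0_lt h : SO3 h -> cell0 h -> absp (h 2%:R 0) < q^-1 /\ absp (h 2%:R 1 / 2%:R) < 1.
Proof.
move=> hS hc; have e := cell0_half hS hc; have b1 : absp (h 2%:R 1 / 2%:R) < 1.
  by have [_] := hc; rewrite e expr_lt1 ?absp_ge0.
split => //; rewrite e expr2.
have b2 := absp_lt1V hvarpi b1.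
apply: (@le_lt_trans _ _ (q^-1 * absp (h 2%:R 1 / 2%:R))); first by rewrite ler_wpM2r ?absp_ge0.
by rewrite gtr_pMr ?qV_gt0.
Qed.

(** Embedded by [embpos] and conjugated by [tmx], this element becomes [g_chi]. *)
Definition cell_flip : 'M[F]_3 := torus3 (- varpi^-1) *m w1 F.

Let varpi0 : varpi != 0 := uniformizer_neq0 hvarpi.

Lemma cell_flip_SO3 : SO3 cell_flip.
Proof.
apply: SO_mul; last exact: w1_SO3.
by apply: torus3_SO3; rewrite oppr_eq0 invr_eq0.
Qed.

Lemma cell_flipE : cell_flip = mx_rows 3 [:: [:: 0; 0; - varpi^-1]; [:: 0; -1; 0]; [:: - varpi; 0; 0]].
Proof. by rewrite /cell_flip mulmx_w1; apply: matrix3P; split; rewrite !mxE /= ?oppr0 // invrN invrK. Qed.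

Lemma cell_flip_sq : cell_flip *m cell_flip = 1%:M.
Proof. by rewrite cell_flipE; apply: matrix3P; split; rewrite !mulmx3E !mxE /=; field. Qed.

Lemma cell_flip_last h : (h *m cell_flip) 2%:R 0 = - varpi * h 2%:R 2%:R /\
  (h *m cell_flip) 2%:R 2%:R = - varpi^-1 * h 2%:R 0.
Proof. by rewrite cell_flipE; split; rewrite !mulmx3E !mxE /=; ring. Qed.

Lemma Cell1_flip : Cell1 = [set h *m cell_flip | h in Cell0].
Proof.
apply/seteqP; split => [h [hS [ha hc]]|_ [h [hS hcell] <-]].
  exists (h *m cell_flip); last by rewrite -mulmxA cell_flip_sq mulmx1.
  split; first by apply: SO_mul => //; exact: cell_flip_SO3.
  have [e1 e2] := cell_flip_last h; split; rewrite ?e1 ?e2.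
    rewrite (_ : _ - 1 = - varpi^-1 * (h 2%:R 0 + varpi)); last by field.
    by rewrite abspM abspN abspV hvarpi invrK -ltr_pdivlMl ?q_gt0 // mulr1.
  by rewrite abspM abspN hvarpi mulr_ilt1 ?absp_ge0 ?invr_ge0 ?ler0n // qV_lt1.
split; first by apply: SO_mul => //; exact: cell_flip_SO3.
have [a1 _] := cell0_lt hS hcell; have [hc _] := hcell.
have [e1 e2] := cell_flip_last h; split; rewrite ?e1 ?e2.
  rewrite (_ : _ + varpi = - varpi * (h 2%:R 2%:R - 1)); last by ring.
  by rewrite abspM abspN hvarpi gtr_pMr ?qV_gt0.
by rewrite abspM abspN abspV hvarpi invrK -ltr_pdivlMl ?q_gt0 // mulr1.
Qed.

Variable mu : {measure set QB -> \bar R}.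
Hypothesis hmu : is_quotient_measure mu.

Lemma Cell1_mu : mu Cell1 = mu Cell0.
Proof.
have [inv _ _] := hmu; rewrite Cell1_flip inv //.
- exact: cell_flip_SO3.
- exact: Cell0_measurable.
by move=> h [].
Qed.

(** Each coset in the cell has its lower triangular representative, and the entries of this matrix
    are integers. *)
Lemma Cell0_fin : (mu Cell0 < +oo)%E.
Proof.
have [_ fin _] := hmu; apply: le_lt_trans (fin 1).
apply: le_measure; rewrite ?inE.
- exact: Cell0_measurable.
- apply: sub_sigma_algebra; split.
    exists [set M : 'M[F]_3 | exists2 u, U3 u & forall i j, absp ((u *m M) i j) <= 1].
      apply/open_mxP => M [u Uu hM].
      have [d d0 hd] := mx_mul2_near u 1%:M M (@ltr01 R).
      exists d => // M' /hd near; exists u => // i j; have := near i j; rewrite !mulmx1 => nij.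
      by rewrite -(subrK ((u *m M) i j) ((u *m M') i j)) absp_le_add // ltW.
    apply/seteqP; split => [_ [u Uu [h [hS hb] <-]]|h [[u Uu hb] hS]].
      split; last exact: U3_SO3M.
      exists (umx gam (- (u 0 1))); first exact: umx_U3.
      by move=> i j; rewrite {2}(U3_umx gam0 Uu) mulmxA (umxD gam0) addNr (umx0 gam0) mul1mx.
    exists (umx gam (- (u 0 1))); first exact: umx_U3.
    exists (u *m h); first by split => //; exact: U3_SO3M.
    by rewrite {2}(U3_umx gam0 Uu) mulmxA (umxD gam0) addNr (umx0 gam0) mul1mx.
  move=> v _ Uv [u Uu [h hh <-]]; exists (v *m u); last by exists h => //; rewrite mulmxA.
  by rewrite (U3_umx gam0 Uu) (U3_umx gam0 Uv) (umxD gam0); exact: umx_U3.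
move=> h [hS hcell]; have [hc ha] := hcell; have c1 := absp_unit1 hc.
have c0 : h 2%:R 2%:R != 0 by rewrite -absp_gt0 c1.
have [y ey] := SO3_lower gam0 hS c0.
exists (umx gam (- y)); first exact: umx_U3.
exists (umx gam y *m h); last by rewrite mulmxA (umxD gam0) addNr (umx0 gam0) mul1mx.
split; first by apply: U3_SO3M => //; exact: umx_U3.
have [_ b1] := cell0_lt hS hcell.
have t0 : 0 < absp (2%:R : F) by rewrite absp_gt0 two_neq0.
have b2 : absp (h 2%:R 1) = absp (h 2%:R 1 / 2%:R) * absp (2%:R : F).
  by rewrite abspM abspV mulfVK // gt_eqF.
have b3 : absp (h 2%:R 1) <= 1.
  by rewrite b2 mulr_ile1 ?absp_ge0 ?absp_nat // ltW.
have g2 := absp_two_square halpha hgam.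
rewrite ey => i j; rewrite mxE.
case: i => [[|[|[|?]]] ?] //; case: j => [[|[|[|?]]] ?] //=; rewrite ?absp0 ?absp1 ?c1 ?ler01 //.
- by rewrite abspV c1 invr1.
- rewrite !(abspM, abspN, abspV) g2 c1 mulr1 b2 expr2 invfM.
  rewrite (_ : _ * _ = absp (h 2%:R 1 / 2%:R)); first by rewrite ltW.
  by field; rewrite gt_eqF.
rewrite abspM abspN abspV abspX abspM g2 c1 mulr1 b2 exprMn mulfK ?expf_neq0 ?gt_eqF //.
by rewrite exprn_ile1 ?absp_ge0 // ltW.
Qed.

(** The cell contains a neighbourhood of 1, so countably many right translates of it cover SO_3, and
    all have the same measure. The entries of the inverse of k that enter the definition of the cell
    are themselves entries of k. *)
Lemma Cell0_neq0 : mu Cell0 <> 0%E.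
Proof.
move=> mu0; have [inv _] := hmu; apply.
have [||g [gS gC]] := @mx_countable_cover _ F _ SO3 (fun g h => Cell0 (h *m invmx g)).
- by exists 1%:M; exact: SO1.
- move=> h hS; have [d d0 hd] := mx_mulr_near h (invmx h) (@ltr01 R).
  exists d => // g gS /hd; rewrite mulmxV ?(SO_unitmx hS) // => near.
  set k := g *m invmx h in near.
  have kS : SO3 k by apply: SO_mul => //; apply: SO_inv.
  have -> : h *m invmx g = invmx k.
    have gu := SO_unitmx gS; have hu := SO_unitmx hS; have ku := SO_unitmx kS.
    apply: (can_inj (mulKmx ku)).
    by rewrite mulmxV // /k -!mulmxA (mulmxA (invmx h)) mulVmx // mul1mx mulmxV.
  split; first exact: SO_inv.
  by split; rewrite ?SO3_invmx22 ?SO3_invmx20 //; [exact: near1_diag|exact: near1_off].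
have inv' (k : nat) A : measurable A -> A `<=` (SO3 : set QB) -> mu [set (a : 'M[F]_3) *m g k | a in A] = mu A.
  by move=> mA AS; apply: inv.
pose S (k : nat) : set QB := [set a *m g k | a in Cell0].
apply: (measure0_cover SO3_quotient_measurable (S := S)).
- move=> k; have gk := gS k; have gu := SO_unitmx gk; have SE : S k = [set h | SO3 h /\ cell0 (h *m invmx (g k))].
    apply/seteqP; split => [_ [h [hS hc] <-]|h [hS hc]].
      split; first by apply: SO_mul => //; exact: gS.
      by rewrite -mulmxA mulmxV ?mulmx1.
    exists (h *m invmx (g k)); last by rewrite -mulmxA mulVmx ?mulmx1.
    split; last by [].
    by apply: SO_mul => //; apply: SO_inv.
  rewrite SE; apply: sub_sigma_algebra; split.
    exists [set M : 'M[F]_3 | cell0 (M *m invmx (g k))]; last by rewrite setIC.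
    apply/open_mxP => M [hc ha].
    have [d d0 hd] := mx_mulr_near M (invmx (g k)) (@ltr01 R).
    exists d => // M' /hd near; split.
      rewrite -(subrK ((M *m invmx (g k)) 2%:R 2%:R) ((M' *m invmx (g k)) 2%:R 2%:R)) -addrA.
      exact: absp_lt_add.
    by rewrite -(subrK ((M *m invmx (g k)) 2%:R 0) ((M' *m invmx (g k)) 2%:R 0)) absp_lt_add.
  move=> u h Uu [hS [hc ha]]; split; first exact: U3_SO3M.
  by split; rewrite -mulmxA U3_last.
- move=> h /gC[k hk]; exists k => //; exists (h *m invmx (g k)) => //.
  by rewrite -mulmxA mulVmx ?mulmx1 // (SO_unitmx (gS k)).
move=> k; rewrite /S inv' ?mu0 //; first exact: Cell0_measurable.
by move=> h [].
Qed.

End QuotientMeasure.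

(** * Zeta integrals of the test Whittaker function *)

Section TestZeta.
Context (R : realType) (F : padicField R) (l : nat).
Hypothesis hl : (2 < l)%N.
Variables (varpi alpha gam : F).
Hypothesis hvarpi : uniformizer varpi.
Hypothesis halpha : absp alpha = 1.
Hypothesis hgam : gam = - 4%:R * alpha.
Variable psi : F -> R[i].
Hypothesis hpsi : additive_character_level1 psi.
Variables (eps : R[i]) (omega chi : 'M[F]_(2 * l) -> R[i]).
Hypothesis hchi : extended_character psi varpi alpha eps omega chi.
Variables (muR : {measure set (borel F (2 * l)) -> \bar R})
          (muQ : {measure set (quotient_borel (U3 gam) (SO3 gam)) -> \bar R}).
Hypothesis hmuR : is_haar (@Rl1 R F l) muR.
Hypothesis hmuQ : is_quotient_measure muQ.
Local Notation W := (test_whittaker varpi alpha gam psi chi).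
Local Notation C := R[i].

Definition test_volume : R := fine (muR (Rl1_ball 1%:M)) * fine (muQ (@Cell0 R F gam)).

Lemma test_volume_neq0 : test_volume != 0.
Proof.
have f1 := Rl1_ball_fin hl hmuR; have f2 := Cell0_fin hvarpi halpha hgam hmuQ.
have n1 := Rl1_ball_neq0 hl hmuR; have n2 := Cell0_neq0 halpha hgam hmuQ.
rewrite /test_volume mulf_neq0 // fine_eq0 ?ge0_fin_numE //; exact/eqP.
Qed.

Lemma cell01F h : cell0 h -> cell1 varpi h -> False.
Proof. by move=> [/absp_unit1 c1 _] [_]; rewrite c1 ltxx. Qed.

(* The integrand over the root subgroup is [w] times the indicator function of
   the unit ball, where [w] depends only on the cell of [h]. *)
Lemma test_inner (phi : 'M[F]_3 -> F -> C) h : SO3 gam h -> exists w : C,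
  [/\ has_cintegral muR (@Rl1 R F l) (zeta_integrand gam W phi h)
        (w * (fine (muR (Rl1_ball 1%:M)))%:C%C),
      cell0 h -> w = phi h 1, cell1 varpi h -> w = eps * phi h 1 &
      ~ cell0 h -> ~ cell1 varpi h -> w = 0].
Proof.
move=> hS.
have step (w : C) : (forall r, Rl1 r -> mxnear 1%:M r 1 -> W (r *m wl1 F l *m emb l gam h) * phi h 1 = w) ->
    has_cintegral muR (@Rl1 R F l) (zeta_integrand gam W phi h) (w * (fine (muR (Rl1_ball 1%:M)))%:C%C).
  move=> hw; apply: has_cintegral_step.
  - exact: Rl1_measurable.
  - exact: Rl1_ball_measurable.
  - by move=> r [].
  - exact: Rl1_ball_fin.
  - by move=> r [rR near]; exact: hw.
  move=> r rR nr; rewrite /zeta_integrand (test_whittaker0 hl hvarpi halpha hgam) ?mul0r //.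
  by move=> [near _]; apply: nr.
have [h0|n0] := pselect (cell0 h).
  exists (phi h 1); split=> // [|h1]; last by case: (cell01F h0 h1).
  by apply: step => r rR near; rewrite (test_whittaker_cell0 hl hvarpi halpha hgam hpsi hchi) ?mul1r.
have [h1|n1] := pselect (cell1 varpi h).
  exists (eps * phi h 1); split=> //.
  by apply: step => r rR near; rewrite (test_whittaker_cell1 hl hvarpi halpha hgam hpsi hchi).
exists 0; split=> //; apply: step => r rR near.
by rewrite (test_whittaker0 hl hvarpi halpha hgam) ?mul0r // => -[_ []].
Qed.

(** Only the values of [phi] on the two cells matter, and the cells have equal volume. One
    computation serves both f_s and its image under M^*. *)
Lemma test_zeta (phi : 'M[F]_3 -> F -> C) (w0 w1 : C) :
  (forall h, SO3 gam h -> cell0 h -> phi h 1 = w0) ->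
  (forall h, SO3 gam h -> cell1 varpi h -> phi h 1 = w1) ->
  zeta_converges muR muQ W phi /\
  zeta_integral muR muQ W phi = (w0 + eps * w1) * test_volume%:C%C.
Proof.
move=> h0 h1; pose vR := fine (muR (Rl1_ball 1%:M)).
have mS := @SO3_quotient_measurable R F gam.
have m0 := Cell0_measurable halpha hgam; have m1 := Cell1_measurable varpi halpha hgam.
have f0 := Cell0_fin hvarpi halpha hgam hmuQ; have e1 := Cell1_mu hvarpi halpha hgam hmuQ.
pose f0' (h : 'M[F]_3) : C := if `[< cell0 h >] then w0 * vR%:C%C else 0.
pose f1' (h : 'M[F]_3) : C := if `[< cell1 varpi h >] then eps * w1 * vR%:C%C else 0.
have s0 : has_cintegral muQ (SO3 gam) f0' (w0 * vR%:C%C * (fine (muQ (@Cell0 R F gam)))%:C%C).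
  apply: has_cintegral_step => //; first by move=> h [].
    by move=> h [_ hc]; rewrite /f0' asboolT.
  by move=> h hS nh; rewrite /f0' asboolF // => hc; apply: nh.
have s1 : has_cintegral muQ (SO3 gam) f1' (eps * w1 * vR%:C%C * (fine (muQ (@Cell0 R F gam)))%:C%C).
  rewrite -e1; apply: has_cintegral_step => //; first by move=> h [].
  - by rewrite e1.
  - by move=> h [_ hc]; rewrite /f1' asboolT.
  by move=> h hS nh; rewrite /f1' asboolF // => hc; apply: nh.
have [z1 z2] : has_cintegral muQ (SO3 gam) (zeta_inner gam muR W phi)
    ((w0 + eps * w1) * test_volume%:C%C).
  have -> : (w0 + eps * w1) * test_volume%:C%C = w0 * vR%:C%C * (fine (muQ (@Cell0 R F gam)))%:C%C +
      eps * w1 * vR%:C%C * (fine (muQ (@Cell0 R F gam)))%:C%C.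
    rewrite /test_volume -/vR.
    have -> : (vR * fine (muQ (@Cell0 R F gam)))%:C%C = vR%:C%C * (fine (muQ (@Cell0 R F gam)))%:C%C by rewrite rmorphM.
    by rewrite !mulrDl !mulrA.
  apply: has_cintegral_eq (has_cintegralD mS s0 s1) => // h hS.
  have [w [[_ iw] k0 k1 k2]] := test_inner phi hS.
  rewrite /zeta_inner iw /f0' /f1'.
  case: asboolP => c0; case: asboolP => c1.
  - by case: (cell01F c0 c1).
  - by rewrite k0 // h0 // addr0.
  - by rewrite k1 // h1 // add0r.
  - by rewrite k2 // mul0r addr0.
split => //; split => // h hS; have [w [[]]] := test_inner phi hS.
by [].
Qed.

End TestZeta.

(** * The gamma factor *)

Section RankTwo.
Context (R : realType) (F : padicField R).
Variables (varpi alpha : F) (psi : F -> R[i]).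
Hypothesis hvarpi : uniformizer varpi.
Hypothesis halpha : absp alpha = 1.
Hypothesis hpsi : additive_character_level1 psi.

Definition upper4 (x : F) : 'M[F]_(2 * 2) :=
  mx_rows 4 [:: [:: 1; x; 0; 0]; [:: 0; 1; 0; 0]; [:: 0; 0; 1; - x]; [:: 0; 0; 0; 1]].

Definition lower4 (z : F) : 'M[F]_(2 * 2) :=
  mx_rows 4 [:: [:: 1; 0; 0; 0]; [:: z; 1; 0; 0]; [:: 0; 0; 1; 0]; [:: 0; 0; - z; 1]].

Lemma upper4_SO x : SO2l (upper4 x).
Proof.
split.
  rewrite -det_tr det_trig; first by rewrite big1 // => -[[|[|[|[|?]]]] ?] _ //; rewrite !mxE.
  by apply/is_trig_mxP => -[[|[|[|[|?]]]] ?] [[|[|[|[|?]]]] ?] // _; rewrite !mxE.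
have -> : (upper4 x)^T *m J_anti F 2 = mx_rows 4 [:: [:: 0; 0; 0; 1]; [:: 0; 0; 1; x]; [:: 0; 1; 0; 0]; [:: 1; - x; 0; 0]].
  apply/matrixP => i j; rewrite mulmx_anti.
  by case: i => [[|[|[|[|?]]]] ?] //; case: j => [[|[|[|[|?]]]] ?] //; rewrite !mxE.
apply: matrix4P; split; rewrite !mulmx4E !mxE /=; ring.
Qed.

Lemma lower4_SO z : SO2l (lower4 z).
Proof.
split.
  rewrite det_trig; first by rewrite big1 // => -[[|[|[|[|?]]]] ?] _ //; rewrite !mxE.
  by apply/is_trig_mxP => -[[|[|[|[|?]]]] ?] [[|[|[|[|?]]]] ?] // _; rewrite !mxE.
have -> : (lower4 z)^T *m J_anti F 2 = mx_rows 4 [:: [:: 0; 0; z; 1]; [:: 0; 0; 1; 0]; [:: - z; 1; 0; 0]; [:: 1; 0; 0; 0]].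
  apply/matrixP => i j; rewrite mulmx_anti.
  by case: i => [[|[|[|[|?]]]] ?] //; case: j => [[|[|[|[|?]]]] ?] //; rewrite !mxE.
apply: matrix4P; split; rewrite !mulmx4E !mxE /=; ring.
Qed.

Lemma upper4_iwahori x : absp x <= 1 -> iwahori_plus (upper4 x).
Proof.
move=> hx; split; last by move=> [[|[|[|[|?]]]] ?] //; rewrite !mxE /= subrr absp0.
split; first exact: upper4_SO.
  by move=> [[|[|[|[|?]]]] ?] [[|[|[|[|?]]]] ?] //; rewrite !mxE /= ?absp0 ?absp1 ?abspN ?ler01.
by move=> [[|[|[|[|?]]]] ?] [[|[|[|[|?]]]] ?] // _; rewrite !mxE /= absp0.
Qed.

Lemma lower4_iwahori z : absp z < 1 -> iwahori_plus (lower4 z).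
Proof.
move=> hz; split; last by move=> [[|[|[|[|?]]]] ?] //; rewrite !mxE /= subrr absp0.
split; first exact: lower4_SO.
  by move=> [[|[|[|[|?]]]] ?] [[|[|[|[|?]]]] ?] //; rewrite !mxE /= ?absp0 ?absp1 ?abspN ?ler01 // ltW.
by move=> [[|[|[|[|?]]]] ?] [[|[|[|[|?]]]] ?] // _; rewrite !mxE /= ?abspN ?absp0.
Qed.

Lemma affine4E (h : 'M[F]_(2 * 2)) : affine_character psi varpi alpha h =
  psi ((h : 'M[F]_4) 0 1 + alpha * (h : 'M[F]_4) 0 2%:R + varpi^-1 * (h : 'M[F]_4) 2%:R 0).
Proof.
rewrite /affine_character big_nat1; congr (psi (_ + _ * _ + _ * _)); exact: ent_ord.
Qed.

(* The uniformizer-twisted involution sends the root group of a simple root onto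
   a negative root group on which the affine character is trivial. *)
Lemma no_extended_character_rank2 eps (omega chi : 'M[F]_(2 * 2) -> R[i]) :
  eps != 0 -> ~ extended_character psi varpi alpha eps omega chi.
Proof.
move=> eps0 [chiM chiI _ chig]; have [_ _ [x [hx px]]] := hpsi; apply: px.
have a0 : alpha != 0 by rewrite -absp_gt0 halpha.
have v0 : varpi != 0 := uniformizer_neq0 hvarpi.
(* The value for which conjugation by [g_chi] takes [lower4 z] to [upper4 x]. *)
pose z := varpi * x / alpha.
have hz : absp z < 1.
  rewrite abspM abspV halpha invr1 mulr1 abspM hvarpi.
  by rewrite (le_lt_trans _ (qV_lt1 F)) // ler_piMr // ltW // qV_gt0.
have c1 : center2l (1%:M : 'M[F]_(2 * 2)).
  by split => [|g _]; [exact: SO1|rewrite mul1mx mulmx1].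
have HI h : iwahori_plus h -> inducing_group (l := 2) varpi alpha h.
  by move=> hI; exists 1%:M, 0%N, h; split; rewrite // -[X in _ = X]/(1%:M *m 1%:M *m h) !mul1mx.
have Hg : inducing_group varpi alpha (g_chi 2 varpi alpha).
  exists 1%:M, 1%N, 1%:M; split=> //; [exact: iwahori_plus1|by rewrite mul1mx mulmx1].
have Iu := upper4_iwahori hx; have Il := lower4_iwahori hz.
have e : g_chi 2 varpi alpha *m lower4 z = upper4 x *m g_chi 2 varpi alpha.
  by apply: matrix4P; split; rewrite !mulmx4E !mxE /= /z; field; rewrite ?a0 ?v0.
have := congr1 chi e; rewrite !chiM ?chig ?(chiI _ Iu) ?(chiI _ Il) //; [|exact: HI|exact: HI].
rewrite !affine4E !mxE /= !mulr0 !addr0 (psi0 hpsi) mulr1 => h.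
by apply: (mulIf eps0); rewrite -h mul1r.
Qed.

End RankTwo.

(** * Evaluation of the functional equation *)

Section GammaFactor.
Context (R : realType) (F : padicField R) (l : nat).
Hypothesis hl : (2 < l)%N.
Variables (varpi alpha gam : F).
Hypothesis hvarpi : uniformizer varpi.
Hypothesis halpha : absp alpha = 1.
Hypothesis hgam : gam = - 4%:R * alpha.
Variable psi : F -> R[i].
Hypothesis hpsi : additive_character_level1 psi.
Variables (eps : R[i]) (omega chi : 'M[F]_(2 * l) -> R[i]).
Hypothesis hchi : extended_character psi varpi alpha eps omega chi.
Variable tau : F -> R[i].
Hypothesis htau : mul_character tau.
Hypothesis htau2 : quadratic tau.
Hypothesis htame : tamely_ramified tau.
Variables (muU : {measure set (borel F 3) -> \bar R})
          (muR : {measure set (borel F (2 * l)) -> \bar R})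
          (muQ : {measure set (quotient_borel (U3 gam) (SO3 gam)) -> \bar R}).
Hypothesis hmuU : is_haar (U3 gam) muU.
Hypothesis hmuR : is_haar (@Rl1 R F l) muR.
Hypothesis hmuQ : is_quotient_measure muQ.
Local Notation C := R[i].
Local Notation q := ((resq F)%:R : R).
Local Notation Q := ((q%:C)%C : C).
Local Notation c := (ball_vol gam muU).
Local Notation l2 := (lgp (2%:R : F)).
Local Notation a := (eps * tau varpi * tau gam).
Implicit Types (s X : C) (h : 'M[F]_3).

Let gam0 : gam != 0 := gam_neq0 halpha hgam.
Let varpi0 : varpi != 0 := uniformizer_neq0 hvarpi.
Let q0 := q_neq0 F.
Let Q0 : Q != 0. Proof. by apply/eqP => -[] /eqP; rewrite (negPf q0). Qed.

Lemma Mval_cell0 X h : cell0 h -> Mval gam tau muU 0 2%:R X h 1 =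
  tau gam * (c * q ^ (l2 + 1) * (1 - q^-1))%:C%C * X ^+ 2 * (1 - Q * X ^+ 2)^-1.
Proof.
move=> [hc ha]; have c1 := absp_unit1 hc.
have lc : lgp (h 2%:R 2%:R) = 0 by apply: lgp_eq; rewrite c1 expr0z.
rewrite /Mval c1 ha lc.
rewrite !subr0 -(tau_pm halpha hgam htau htau2 htame) (tau_near htau htame (x := - 1 / gam) (y := - h 2%:R 2%:R / gam)) //.
have -> : - h 2%:R 2%:R / gam - - 1 / gam = - (h 2%:R 2%:R - 1) * gam^-1 by ring.
by rewrite !abspM !abspN absp1 mul1r gtr_pMl // absp_gt0 invr_eq0.
Qed.

Lemma Mval_cell1 X h : cell1 varpi h -> Mval gam tau muU 0 2%:R X h 1 =
  tau varpi * (c * q ^ l2)%:C%C * X.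
Proof.
move=> [ha hc]; have n10 : (- 1 : F) != 0 by rewrite oppr_eq0 oner_eq0.
have near : absp (h 2%:R 0 - (- varpi)) < absp (- varpi) by rewrite opprK abspN hvarpi.
have a1 : absp (h 2%:R 0) = q^-1 by rewrite (absp_sub_eq near) abspN hvarpi.
have c1 := absp_lt1V hvarpi hc.
have la : lgp (h 2%:R 0) = -1 by apply: lgp_eq; rewrite a1 exprN1.
rewrite /Mval ltNge a1 c1 /= la.
rewrite (tau_near htau htame near) invr1 opprK (_ : l2 + 1 - 1 = l2); last by rewrite addrK.
rewrite expr1z -[- varpi]mulN1r (tauM htau n10 varpi0) mulrA.
by rewrite (tau_sq htau2 n10) mul1r.
Qed.

(** As |gam| = |2|^2, the product is |2|^(1 - 2s). It will cancel the powers of |2| in the C-factor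
    and in the values of M(tau, s). *)
Lemma gamma_prefactor s : cpow (absp (2%:R : F)) (2%:R * s - 1) * cpow (absp gam) (- 2%:R * s + 1) =
  (q ^ l2)%:C%C * (qs F s ^ l2 * qs F s ^ l2).
Proof.
have t0 : 0 < absp (2%:R : F) by rewrite absp_gt0 two_neq0.
rewrite (absp_two_square halpha hgam) expr2 cpowM //.
rewrite (_ : - 2%:R * s + 1 = 1 + (- s + - s)); last by ring.
rewrite (_ : 2%:R * s - 1 = - (1 + (- s + - s))); last by ring.
rewrite cpowN mulrA mulVf ?cpow_neq0 // mul1r !cpowD cpow_r1 // absp_two; congr (_ * (_ * _));
  by rewrite -absp_two cpowN cpow_absp ?two_neq0 // invr_expz opprK.
Qed.

Variables (cst g : ratfun R).
Hypothesis hcst : is_C_factor psi gam muU tau cst.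
Hypothesis hg : is_gamma_factor psi muU muR muQ tau
  (compact_induction (inducing_group varpi alpha) chi) (omega (- 1%:M)) cst g.

Lemma gamma_factor_val s gv : let X := qs F s in
  1 - Q * X ^+ 2 != 0 -> Q * X ^+ 2 - Q^-1 != 0 -> ratval g X gv ->
  gv = omega (- 1%:M) * tau (- 1) ^+ l * X * ((Q - 1) * X + a * (1 - Q * X ^+ 2)) / (Q * X ^+ 2 - Q^-1).
Proof.
move=> X D0 E0 gX; have X0 : X != 0 := qs_neq0 F s.
pose V : C := (test_volume muR muQ)%:C%C.
have V0 : V != 0.
  by apply/eqP => -[] /eqP; rewrite (negPf (test_volume_neq0 hl hvarpi halpha hgam hmuR hmuQ)).
pose k0 : C := tau gam * (c * q ^ (l2 + 1) * (1 - q^-1))%:C%C.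
pose k1 : C := tau varpi * (c * q ^ l2)%:C%C.
pose Ps : ratfun R := cst * (rC k0 * rX R ^ (2 : int) * unram_factor F + rC eps * (rC k1 * rX R)) * rC V.
pose psv (Z : C) := Cval gam tau muU Z * (k0 * Z ^+ 2 * (1 - Q * Z ^+ 2)^-1 + eps * (k1 * Z)) * V.
have cst_val := C_factor_val halpha hgam hpsi htau htau2 htame hmuU hcst.
have PsP Z : Z != 0 -> 1 - Q * Z ^+ 2 != 0 -> Q * Z ^+ 2 - Q^-1 != 0 -> ratval Ps Z (psv Z).
  move=> Z0 DZ EZ; apply: ratvalM; last exact: ratvalC.
  apply: ratvalM; first exact: cst_val.
  apply: ratvalD; last by apply: ratvalM; [exact: ratvalC|apply: ratvalM; [exact: ratvalC|exact: ratvalX]].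
  apply: ratvalM (ratval_unram DZ); apply: ratvalM; first exact: ratvalC.
  exact: (@ratval_exp _ _ _ _ 2 (ratvalX Z) Z0).
have e02 : ends 0 2%:R by rewrite /ends !eqxx.
pose W := test_whittaker varpi alpha gam psi chi.
have hP : continues_right F (fun t => zeta_converges muR muQ W (sec tau 0 2%:R t))
    (fun t => zeta_integral muR muQ W (sec tau 0 2%:R t)) (rC V).
  exists 0 => t _; have [||z1 z2] := @test_zeta _ _ _ hl _ _ _ hvarpi halpha hgam _ hpsi _ _ _ hchi _ _ hmuR hmuQ
    (sec tau 0 2%:R t) 1 0.
  + move=> h hS [hc ha]; have c1 := absp_unit1 hc.
    by rewrite /sec /sec_phi c1 ha cpow_1l invr1 mulr1 (tau1 htame) mul1r htame.
  + move=> h hS [ha hc]; rewrite /sec /sec_phi ltNge.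
    have near : absp (h 2%:R 0 - (- varpi)) < absp (- varpi) by rewrite opprK abspN hvarpi.
    by rewrite (absp_sub_eq near) abspN hvarpi (absp_lt1V hvarpi hc) /= mul0r mulr0.
  by split => //; rewrite z2 mulr0 addr0 mul1r; exact: ratvalC.
pose Msf := section_eval (fun h b => cst * Mfun gam tau muU 0 2%:R h b).
have hPs : continues_left F (fun t => zeta_converges muR muQ W (Msf t))
    (fun t => zeta_integral muR muQ W (Msf t)) Ps.
  (* For Re t < 1/2 one has |q Z^2| > 1, which excludes both exceptional values 1 and 1/q of q
     Z^2. *)
  exists 2^-1 => t /normc_qs_gt hs; move: (hs F) => {}hs; set Z := qs F t in hs *.
  have Z0 : Z != 0 := qs_neq0 F t.
  have DZ : 1 - Q * Z ^+ 2 != 0.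
    by apply/eqP => /eqP; rewrite subr_eq0 => /eqP e; move: hs; rewrite -e invr1 Normc.normc1 ltxx.
  have EZ : Q * Z ^+ 2 - Q^-1 != 0.
    apply/eqP => /eqP; rewrite subr_eq0 => /eqP e; move: hs; rewrite e invrK /= expr0n addr0 sqrtr_sqr.
    by rewrite ger0_norm ?ler0n // ltNge ltW ?q_gt1.
  pose phi := section_eval (fun h b => cst * Mfun gam tau muU 0 2%:R h b) t.
  have phiE h : phi h 1 = Cval gam tau muU Z * Mval gam tau muU 0 2%:R Z h 1.
    apply: rateval_ratval; apply: ratvalM; [exact: cst_val|exact: Mfun_val].
  have [||z1 z2] := @test_zeta _ _ _ hl _ _ _ hvarpi halpha hgam _ hpsi _ _ _ hchi _ _ hmuR hmuQ
    phi (Cval gam tau muU Z * (k0 * Z ^+ 2 * (1 - Q * Z ^+ 2)^-1)) (Cval gam tau muU Z * (k1 * Z)).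
  + by move=> h hS hc; rewrite phiE Mval_cell0.
  + by move=> h hS hc; rewrite phiE Mval_cell1.
  split => //; rewrite z2 [eps * (_ * _)]mulrCA -mulrDr; exact: PsP.
(* Convergence was established on half planes, but the equation of the continuations may be read at
   any s that is not exceptional. *)
have key := hg (test_whittaker_in hl hvarpi halpha hgam hpsi hchi)
  (sec_holomorphic halpha hgam htau htau2 htame e02)
  (sec_intertwined halpha hgam htau htau2 htame hmuU e02) hP hPs gX (ratvalC V X) (PsP X X0 D0 E0).
apply: (mulIf V0); rewrite key.
have n10 : (- 1 : F) != 0 by rewrite oppr_eq0 oner_eq0.
rewrite (htau2 (two_neq0 F)) mulr1 (htau2 gam0) invr1 mulr1.
rewrite -[_ * cpow _ _ * cpow _ _]mulrA gamma_prefactor /psv /Cval /k0 /k1 -/X.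
have eM (x y : R) : (x * y)%:C%C = x%:C%C * y%:C%C by rewrite rmorphM.
have e1 : (1 - q^-1)%:C%C = 1 - Q^-1 by rewrite rmorphB /= rmorph1 fmorphV.
have e2 : (q ^ (l2 + 1))%:C%C = (q ^ l2)%:C%C * Q by rewrite -eM exprzDr ?unitfE ?expr1z.
have e3 : (Q ^+ 2 * X ^+ 2) ^ l2 = ((q ^ l2)%:C%C * (q ^ l2)%:C%C) * (X ^ l2 * X ^ l2).
  have -> : (q ^ l2)%:C%C = Q ^ l2 by rewrite fmorphXz.
  have mz (x y : C) : x != 0 -> y != 0 -> (x * y) ^ l2 = x ^ l2 * y ^ l2.
    by move=> x0 y0; rewrite exprzMl ?unitfE.
  have sq (x : C) : x != 0 -> (x ^+ 2) ^ l2 = x ^ l2 * x ^ l2 by move=> x0; rewrite -mz.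
  by rewrite mz ?expf_neq0 // sq // sq.
rewrite !eM e1 e2 e3.
have tg : (tau gam)^-1 = tau gam.
  by apply: (mulfI (tau_neq0 htau gam0)); rewrite mulfV ?(tau_neq0 htau) // (tau_sq htau2 gam0).
(* [P] and [T] stand for |2| and X^l2; their powers cancel, so the result depends on |2| no more. *)
have gen (K P T D e t b w x k v e' z : C) : P != 0 -> T != 0 -> D != 0 -> e != 0 -> t != 0 -> b != 0 -> w != 0 ->
    K * (P * (T * T)) * (D / (t * b * ((P * P) * (T * T)) * e) *
      (t * (b * (P * w) * (1 - w^-1)) * x ^+ 2 * D^-1 + e' * (v * (b * P) * x)) * z) =
    K * x * ((w - 1) * x + e' * v * t^-1 * D) / e * z.
  by move=> P0 T0 D0' e0 t0 b0 w0; field; rewrite P0 T0 D0' e0 t0 b0 w0.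
have c0 : c%:C%C != 0 :> C by apply/eqP => -[] /eqP; rewrite gt_eqF // (ball_vol_gt0 gam0 hmuU).
have P0 : (q ^ l2)%:C%C != 0 :> C by apply/eqP => -[] /eqP; rewrite gt_eqF // qz_gt0.
by rewrite gen ?(tau_neq0 htau) ?expfz_neq0 // tg.
Qed.

End GammaFactor.

(** * The explicit rational function *)

Section FinalRatfun.
Context (R : realType) (F : padicField R).
Local Notation C := R[i].
Local Notation q := ((resq F)%:R : R).
Local Notation Q := ((q%:C)%C : C).

Let Q0 : Q != 0. Proof. by apply/eqP => -[] /eqP; rewrite (negPf (q_neq0 F)). Qed.

Definition gamma_fun (K a : C) : ratfun R := rC (K * a * Q) * rX R * (1 - rC a * rX R) / (rC (a * Q) * rX R - 1).

Lemma ratval1 (z : C) : ratval (1 : ratfun R) z 1.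
Proof. by have := ratvalC 1 z; rewrite /rC polyC1 tofrac1. Qed.

Lemma gamma_num_val (K a X : C) :
  ratval (rC (K * a * Q) * rX R * (1 - rC a * rX R)) X (K * a * Q * X * (1 - a * X)).
Proof.
apply: ratvalM; first by apply: ratvalM; [exact: ratvalC|exact: ratvalX].
apply: ratvalD; first exact: ratval1.
by apply: ratvalN; apply: ratvalM; [exact: ratvalC|exact: ratvalX].
Qed.

Lemma gamma_den_val (a X : C) : ratval (rC (a * Q) * rX R - 1) X (a * Q * X - 1).
Proof.
apply: ratvalD; first by apply: ratvalM; [exact: ratvalC|exact: ratvalX].
by apply: ratvalN; exact: ratval1.
Qed.

Lemma gamma_fun_val (K a X : C) : a * Q * X - 1 != 0 ->
  ratval (gamma_fun K a) X (K * a * Q * X * (1 - a * X) / (a * Q * X - 1)).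
Proof. by move=> h; apply: ratvalM (gamma_num_val K a X) (ratvalV (gamma_den_val a X) h). Qed.

(** Because a^2 = 1, numerator and denominator share the factor a Q X + 1, which removes the
    possible pole at X = -a/Q. *)
Lemma gamma_funE (K a X : C) : a * a = 1 -> Q * X ^+ 2 - Q^-1 != 0 ->
  a * Q * X - 1 != 0 /\ K * X * ((Q - 1) * X + a * (1 - Q * X ^+ 2)) / (Q * X ^+ 2 - Q^-1) =
  K * a * Q * X * (1 - a * X) / (a * Q * X - 1).
Proof.
move=> aa E0.
have f : Q * X ^+ 2 - Q^-1 = (a * Q * X - 1) * (a * Q * X + 1) / Q.
  rewrite -subr_sqr expr1n !exprMn (expr2 a) aa mul1r mulrBl expr2 -[Q * Q * _]mulrA.
  by rewrite mulrAC mulfV // !mul1r.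
move: E0; rewrite f !mulf_eq0 !negb_or => /andP[/andP[h1 h2] _]; split => //.
have -> : (Q - 1) * X + a * (1 - Q * X ^+ 2) = a * (1 - a * X) * (a * Q * X + 1).
  have -> : a * (1 - a * X) * (a * Q * X + 1) = (a * a) * Q * X + a - (a * a) * a * (Q * X ^+ 2) - (a * a) * X by ring.
  by rewrite aa; ring.
by move: Q0 h1 h2; generalize Q => w w0 h1 h2; field; rewrite w0 h1 h2.
Qed.

Lemma gamma_fun_regular (K a : C) : K != 0 -> a = 1 \/ a = -1 ->
  (regular_at (gamma_fun K a) (qs F 1) /\ rateval (gamma_fun K a) (qs F 1) <> 0) <-> a = -1.
Proof.
move=> K0 ha; have q1 := q_gt1 F.
have qsE1 : qs F 1 = Q^-1 by rewrite qs1 fmorphV.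
rewrite qsE1; have Qn1 : Q != 1 by apply/eqP => -[] /eqP; rewrite gt_eqF.
have Qm1 : Q != - 1.
  by apply/eqP => -[] /eqP; rewrite gt_eqF // (lt_trans _ q1) // ltrN10.
have two0 : (2%:R : C) != 0 by rewrite pnatr_eq0.
split=> [[[v hv] _]|->].
  case: ha => // a1; exfalso; subst a.
  (* A value at 1/Q, multiplied by the vanishing denominator, would give 0, but the numerator is
     nonzero there since Q <> 1. *)
  have h := ratvalM hv (gamma_den_val 1 Q^-1).
  have den0 : rC (1 * Q) * rX R - 1 != 0 :> ratfun R.
    apply/eqP => e; have := gamma_den_val 1 (0 : C); rewrite e mulr0 sub0r.
    have r0 : ratval (0 : ratfun R) (0 : C) 0 by have := ratvalC 0 (0 : C); rewrite polyC0 tofrac0.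
    by move=> /ratval_unique /(_ r0) /eqP; rewrite oppr_eq0 oner_eq0.
  move: h; rewrite /gamma_fun mulfVK // => /ratval_unique /(_ (gamma_num_val K 1 Q^-1)).
  rewrite !mul1r mulfV // subrr mulr0 => /esym /eqP.
  by rewrite !mulf_eq0 invr_eq0 subr_eq0 (negPf K0) (negPf Q0) oner_eq0 /= eq_sym invr_eq1 (negPf Qn1).
have d0 : -1 * Q * Q^-1 - 1 != 0 by rewrite mulN1r mulNr mulfV // -opprD oppr_eq0.
have h := gamma_fun_val K d0; split; first by eexists; exact: h.
rewrite (rateval_ratval h) => /eqP; rewrite !mulf_eq0 !invr_eq0 (negPf K0) (negPf Q0) (negPf d0).
rewrite oppr_eq0 oner_eq0 /= orbF mulN1r opprK => /eqP e; move/eqP: Qm1; apply.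
have /eqP : Q * (1 + Q^-1) = 0 by rewrite e mulr0.
by rewrite mulrDr mulr1 mulfV // addr_eq0 => /eqP.
Qed.

(** For s >= 2, q X^2 is a power of q with exponent at most -3, so it is neither 1 nor 1/q. At s = 1
    it would be 1/q. *)
Lemma qs_nonexceptional (n : nat) : let X := qs F n.+2%:R in
  1 - Q * X ^+ 2 != 0 /\ Q * X ^+ 2 - Q^-1 != 0.
Proof.
move=> X; have eX : X = Q ^- n.+2 by rewrite /X qs_nat fmorphV rmorphXn.
have q1 := q_gt1 F.
have XI (m : nat) : (0 < m)%N -> Q ^+ m != 1.
  move=> m0; apply/eqP; have <- : (q ^+ m)%:C%C = Q ^+ m by rewrite rmorphXn.
  by move=> -[] /eqP; rewrite gt_eqF // exprn_egt1 // -lt0n.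
have e1 : Q * X ^+ 2 = Q ^- (2 * n + 3).
  rewrite eX exprVn -exprM (_ : (n.+2 * 2 = (2 * n + 3).+1)%N); last by lia.
  by rewrite exprS invfM mulrA mulfV // mul1r.
rewrite e1; split; first by rewrite subr_eq0 eq_sym invr_eq1 XI // addn_gt0 orbT.
rewrite subr_eq0 (inj_eq invr_inj) (_ : (2 * n + 3 = (2 * n + 2).+1)%N) ?exprS; last by lia.
by rewrite -[X in _ == X]mulr1 (inj_eq (mulfI Q0)) XI // addn_gt0 orbT.
Qed.

End FinalRatfun.

Theorem theorem1p1 (R : realType) (F : padicField R) (l : nat)
  (psi : F -> R[i]) (varpi alpha gam : F) (eps : R[i])
  (omega chi : 'M[F]_(2 * l) -> R[i]) (tau : F -> R[i])
  (muU : {measure set (borel F 3) -> \bar R})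
  (muR : {measure set (borel F (2 * l)) -> \bar R})
  (muQ : {measure set (quotient_borel (U3 gam) (SO3 gam)) -> \bar R})
  (cst g : ratfun R)
  (hl : (2 <= l)%N)
  (hpsi : additive_character_level1 psi)
  (hvarpi : uniformizer varpi)
  (halpha : absp alpha = 1)
  (hgam : gam = - 4%:R * alpha)
  (heps : eps = 1 \/ eps = -1)
  (homega : compatible_central_character psi varpi alpha omega)
  (hchi : extended_character psi varpi alpha eps omega chi)
  (htau : mul_character tau)
  (htau2 : quadratic tau)
  (htau_tame : tamely_ramified tau)
  (hmuU : is_haar (U3 gam) muU)
  (hmuR : is_haar (@Rl1 R F l) muR)
  (hmuQ : is_quotient_measure muQ)
  (hcst : is_C_factor psi gam muU tau cst)
  (hg : is_gamma_factor psi muU muR muQ tau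
          (compact_induction (inducing_group varpi alpha) chi)
          (omega (- 1%:M)) cst g) :
  (regular_at g (qs F 1) /\ rateval g (qs F 1) <> 0) <->
  tau varpi = - chi (g_chi l varpi alpha) * tau gam.
Proof.
have eps0 : eps != 0 by case: heps => ->; rewrite ?oppr_eq0 oner_eq0.
have [l2|l2] := eqVneq l 2%N.
  by subst l; case: (no_extended_character_rank2 hvarpi halpha hpsi eps0 hchi).
have hl3 : (2 < l)%N by rewrite ltn_neqAle eq_sym l2.
rewrite (chi_g hchi).
have gam0 := gam_neq0 halpha hgam; have v0 := uniformizer_neq0 hvarpi.
have n10 : (- 1 : F) != 0 by rewrite oppr_eq0 oner_eq0.
pose a : R[i] := eps * tau varpi * tau gam.
have ee : eps * eps = 1 by case: heps => ->; rewrite ?mulrNN mulr1.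
have tt := tau_sq htau2.
have aa : a * a = 1 by rewrite /a mulrACA [X in X * _]mulrACA ee !tt // !mulr1.
pose K : R[i] := omega (- 1%:M) * tau (- 1) ^+ l.
have K0 : K != 0.
  rewrite mulf_neq0 ?expf_neq0 ?(tau_neq0 htau) //; case: homega => h _ _; apply: h.
  have -> : - 1%:M = (- 1)%:M :> 'M[F]_(2 * l) by rewrite raddfN.
  by apply: scalar_center; rewrite sqrrN expr1n.
(* The values of [g] are known only at regular points that are not exceptional; the integers s >= 2
   provide infinitely many candidates. *)
have -> : g = gamma_fun F K a.
  apply: (@ratfun_eq_inf _ _ _ (fun n => qs F n.+2%:R)).
    by move=> m n /qs_nat_inj [].
  move=> n v v'; have [D0 E0] := qs_nonexceptional F n; have [D1 eK] := gamma_funE K aa E0.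
  move=> /(gamma_factor_val hl3 hvarpi halpha hgam hpsi hchi htau htau2 htau_tame hmuU hmuR hmuQ hcst hg D0 E0) ->.
  by move=> /ratval_unique /(_ (gamma_fun_val K D1)) ->.
have a1 : a = 1 \/ a = -1.
  by move/eqP: aa; rewrite -expr2 sqrf_eq1 => /orP[/eqP|/eqP]; [left|right].
rewrite (gamma_fun_regular F K0 a1) /a.
(* [eps] and [tau gam] are their own inverses, so a = -1 can be solved for [tau varpi]. *)
split=> [e|->].
  have := congr1 (fun z => eps * z * tau gam) e.
  by rewrite -!mulrA tt // mulr1 !mulrA ee mul1r mulrN1 => ->.
by rewrite !mulNr mulrN mulNr mulrA ee mul1r tt.
Qed.
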